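(* Let $u\in[-1,1]$ and let $\mathcal{P}(u)=\lim_{N\to\infty}F_N(u_N)$ be the limiting free energy. There exists a sequence $(u_N')$ such that $\lim_{N\to\infty}u_N'=u$ and such that $$\mathcal{P}(u)=\lim_{N\to\infty}\ \lim_{\delta\to0}\ \inf_{\Omega_\delta}\,G_N(u_N',\Omega_\delta),$$ where, for each $\delta>0$, the infimum is over all random overlap structures $\Omega_\delta$ with parameter $\delta$.
   Context: For $N\ge 1$ let $\Sigma_N=\{-1,+1\}^N$. For $\ell=1,2$ let $(a_p^\ell)_{p\ge 1}$ be real sequences with $\sum_{p\ge1}(a_p^\ell)^2<\infty$, and define Gaussian Hamiltonians on $\Sigma_N$ by $$H_N^\ell(\sigma)=N^{1/2}\sum_{p\ge1}\frac{a_p^\ell}{N^{p/2}}\sum_{1\le i_1,\dots,i_p\le N}g_{i_1,\dots,i_p}\,\sigma_{i_1}\cdots\sigma_{i_p},$$ where $(g_{i_1,\dots,i_p})$ are standard Gaussian random variables, independent for all $p\ge 1$ and all $(i_1,\dots,i_p)$ (the same $g$'s are used for $\ell=1$ and $\ell=2$). For $\ell,\ell'\in\{1,2\}$ define on $[-1,1]$ the functions $\xi_{\ell,\ell'}(x)=\sum_{p\ge1}a_p^\ell a_p^{\ell'}x^p$ and $\theta_{\ell,\ell'}(x)=x\xi_{\ell,\ell'}'(x)-\xi_{\ell,\ell'}(x)$. It is assumed that the sequences $(a_p^\ell)$ are such that the functions $\xi_{\ell,\ell'}$ are convex on $[-1,1]$. Let $R_{1,2}=R(\sigma^1,\sigma^2)=\frac1N\sum_{i\le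 N}\sigma_i^1\sigma_i^2$ be the overlap. External fields $h_1,h_2\in\mathbb{R}$ are given. Free energy. Let $(u_N)_{N\ge1}$ be such that for each $N$, $u_N=k/N$ for some integer $-N\le k\le N$ (this form is chosen so that the set $\{R_{1,2}=u_N\}$ is not empty), and $\lim_{N\to\infty}u_N=u$. Define $F_N(u_N)=\frac1N\mathbb{E}\log Z_N(u_N)$, where $$Z_N(u_N)=\sum_{R_{1,2}=u_N}\exp\Big(\sum_{\ell\le2}H_N^\ell(\sigma^\ell)+\sum_{\ell\le2}h_\ell\sum_{i\le N}\sigma_i^\ell\Big),$$ the sum being over $(\sigma^1,\sigma^2)\in\Sigma_N^2$ with $R_{1,2}=u_N$. The limit $\mathcal{P}(u)=\lim_{N\to\infty}F_N(u_N)$ exists and depends on $u$ but not on the sequence $(u_N)$. Random overlap structures. Given $\delta>0$, a random overlap structure $\Omega_\delta$ is a collection of: (1) a countable set $\mathcal{A}$; (2) numbers $q_{\alpha,\beta}^{\ell,\ell'}$, $\alpha,\beta\in\mathcal{A}$, $\ell,\ell'\in\{1,2\}$, with $|q_{\alpha,\beta}^{\ell,\ell'}|\le1$, $q_{\alpha,\alpha}^{\ell,\ell}=1$ and $|q_{\alpha,\alpha}^{1,2}-u|\le\delta$; (3) an arbitrary random sequence $(w_\alpha)_{\alpha\in\mathcal{A}}$ with $w_\alpha\ge0$ and $\sum_{\alpha\in\mathcal{A}}w_\alpha=1$ a.s.; (4) Gaussian sequences $(z^1(\alpha),z^2(\alpha))_{\alpha\in\mathcal{A}}$ and $(y^1(\alpha),y^2(\alpha))_{\alpha\in\mathcal{A}}$,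 independent of each other and of $(w_\alpha)$, with covariances $$\mathbb{E}z^\ell(\alpha)z^{\ell'}(\beta)=\xi_{\ell,\ell'}'(q_{\alpha,\beta}^{\ell,\ell'}),\qquad \mathbb{E}y^\ell(\alpha)y^{\ell'}(\beta)=\theta_{\ell,\ell'}(q_{\alpha,\beta}^{\ell,\ell'}).$$ Only structures for which such Gaussian sequences exist are considered. Let $(z_i^1(\alpha),z_i^2(\alpha))_{\alpha\in\mathcal{A}}$, $i\ge1$, be independent copies of $(z^1(\alpha),z^2(\alpha))_{\alpha\in\mathcal{A}}$; all random variables here are independent of the Hamiltonians $H_N^\ell$. Define $$G_N(u_N,\Omega_\delta)=\frac1N\mathbb{E}\log\sum_{\alpha\in\mathcal{A}}w_\alpha\sum_{R_{1,2}=u_N}\exp\sum_{\ell\le2}\sum_{i\le N}\sigma_i^\ell\big(z_i^\ell(\alpha)+h_\ell\big)-\frac1N\mathbb{E}\log\sum_{\alpha\in\mathcal{A}}w_\alpha\exp\Big(\sqrt N\sum_{\ell\le2}y^\ell(\alpha)\Big),$$ where the inner sum is over $(\sigma^1,\sigma^2)\in\Sigma_N^2$ with $R(\sigma^1,\sigma^2)=u_N$; $G_N(u_N',\Omega_\delta)$ is the same expression with $u_N'$ in place of $u_N$. *)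

(* Defs.v *)
(* The index l in {1, 2} is l : 'I_2, with ord0 standing for 1 and ord_max
   for 2. *)
From HB Require Import structures.
From mathcomp Require Import all_boot all_order all_algebra finmap.
From mathcomp Require Import all_classical all_reals all_analysis.

Set Implicit Arguments.
Unset Strict Implicit.
Unset Printing Implicit Defensive.

Import Order.TTheory GRing.Theory Num.Theory.
Import numFieldNormedType.Exports.

Local Open Scope classical_set_scope.
Local Open Scope ring_scope.

Section Probability.
Context d (T : measurableType d) (R : realType) (P : probability T R).

Definition mutually_independent (J : choiceType) (D : set J)
    (F : J -> set (set T)) : Prop :=
  forall (S : {fset J}) (E : J -> set T),
    [set` S] `<=` D -> (forall j, j \in S -> F j (E j)) ->
    P (\bigcap_(j in [set` S]) E j) = (\prod_(j <- S) P (E j))%E.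

Definition sigma_generated (I : Type) (X : I -> T -> R) : set (set T) :=
  <<s \bigcup_(i in [set: I]) preimage_set_system setT (X i) measurable >>.

(* The case s = 0 (the Dirac mass at 0) is separate because normal_prob m 0 is
   not a degenerate Gaussian law in the library. *)
Definition centered_gaussian (X : T -> R) : Prop :=
  exists2 s : R, 0 <= s & forall B : set R, measurable B ->
    P (X @^-1` B) = (if s == 0 then \d_(0 : R) B else normal_prob 0 s B).

Definition gaussian_family (I : Type) (X : I -> T -> R) : Prop :=
  forall (s : seq I) (c : I -> R),
    centered_gaussian (fun t => \sum_(i <- s) c i * X i t).

(* g [:: i_1; ...; i_p] is the variable g_{i_1,...,i_p}, with indices starting
   from 0; since p >= 1, the value at the empty sequence is irrelevant. *)
Definition gaussian_disorder (g : seq nat -> {RV P >-> R}) : Prop :=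
  (forall s, s != [::] -> forall B : set R, measurable B ->
     P (g s @^-1` B) = normal_prob 0 1 B) /\
  mutually_independent [set s | s != [::]]
    (fun s => sigma_generated (fun _ : unit => g s)).

End Probability.

Section Covariances.
Context (R : realType) (a : 'I_2 -> nat -> R).

Definition xi (l l' : 'I_2) (x : R) : R :=
  limn (fun n => \sum_(1 <= p < n) a l p * a l' p * x ^+ p).

(* The series defining xi need only converge on [-1, 1], so derivatives are
   taken relatively to [-1, 1]; they are one-sided at the end points. *)
Definition slope (f : R -> R) (x y : R) : R := (f y - f x) / (y - x).

Definition derivable_on_unit (f : R -> R) : Prop :=
  forall x : R, -1 <= x <= 1 ->
    cvg (slope f x y @[y --> within `[-1, 1]%classic x^']).

Definition unit_derive (f : R -> R) (x : R) : R :=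
  lim (slope f x y @[y --> within `[-1, 1]%classic x^']).

Definition xi' (l l' : 'I_2) (x : R) : R := unit_derive (xi l l') x.

Definition theta (l l' : 'I_2) (x : R) : R := x * xi' l l' x - xi l l' x.

End Covariances.

Section Model.
Context (R : realType).

(* A configuration stores b_i with sigma_i = (-1)^b_i. *)
Definition config (N : nat) := {ffun 'I_N -> bool}.

Definition spin (N : nat) (s : config N) (i : 'I_N) : R := (-1) ^+ s i.

Definition overlap (N : nat) (s : 'I_2 -> config N) : R :=
  N%:R^-1 * \sum_(i < N) spin (s ord0) i * spin (s ord_max) i.

(* The values k / N for which the constraint set {R_{1,2} = u_N} is nonempty;
   this amounts to k having the same parity as N. *)
Definition admissible (v : nat -> R) : Prop :=
  forall N : nat, (0 < N)%N ->
    (exists2 k : int, - (N%:Z) <= k <= N%:Z & v N = k%:~R / N%:R) /\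
    (exists s : {ffun 'I_2 -> config N}, overlap s = v N).

Section FreeEnergy.
Context d (T : measurableType d) (P : probability T R).
Context (g : seq nat -> {RV P >-> R}) (a : 'I_2 -> nat -> R) (h : 'I_2 -> R).

(* The series in p converges almost surely when \sum_p (a l p)^2 is finite. *)
Definition hamiltonian (N : nat) (l : 'I_2) (s : config N) (t : T) : R :=
  Num.sqrt N%:R *
  limn (fun n => \sum_(1 <= p < n) a l p / (N%:R `^ (p%:R / 2)) *
    \sum_(i : p.-tuple 'I_N)
      g (map (@nat_of_ord N) i) t * \prod_(j <- i) spin s j).

Definition partition_function (N : nat) (v : R) (t : T) : R :=
  \sum_(s : {ffun 'I_2 -> config N} | overlap s == v)
    expR (\sum_(l < 2) hamiltonian l (s l) t +
          \sum_(l < 2) h l * \sum_(i < N) spin (s l) i).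

Definition free_energy (N : nat) (v : R) : \bar R :=
  ((N%:R^-1)%:E * 'E_P[fun t => ln (partition_function N v t)])%E.

(* p is the value at u of the limiting free energy. *)
Definition is_limiting_free_energy (u p : R) : Prop :=
  forall v : nat -> R, admissible v -> v N @[N --> \oo] --> u ->
    free_energy N (v N) @[N --> \oo] --> p%:E.

End FreeEnergy.

(* os_z i, for i in nat, are the independent copies of the Gaussian sequence
   (z^1, z^2); the law of a centered Gaussian family is determined by its
   covariance, so that only the latter is prescribed. *)
Record overlap_structure (a : 'I_2 -> nat -> R) (u delta : R) :=
  OverlapStructure {
  os_disp : measure_display;
  os_T : measurableType os_disp;
  os_P : probability os_T R;
  os_A : countType;
  os_q : 'I_2 -> 'I_2 -> os_A -> os_A -> R;
  os_w : os_A -> {RV os_P >-> R};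
  os_z : nat -> 'I_2 -> os_A -> {RV os_P >-> R};
  os_y : 'I_2 -> os_A -> {RV os_P >-> R};
  os_q_le1 : forall l l' x y, `|os_q l l' x y| <= 1;
  os_q_diag : forall l x, os_q l l x x = 1;
  os_q_near : forall x, `|os_q ord0 ord_max x x - u| <= delta;
  os_w_proba : {ae os_P, forall t, (forall x, 0 <= os_w x t) /\
    (\esum_(x in [set: os_A]) (os_w x t)%:E = 1)%E};
  os_z_gaussian : forall i,
    gaussian_family os_P (fun lx : 'I_2 * os_A => os_z i lx.1 lx.2);
  os_z_cov : forall i l l' x y,
    ('E_os_P[fun t => (os_z i l x t * os_z i l' y t)%R]
      = (xi' a l l' (os_q l l' x y))%:E)%E;
  os_y_gaussian :
    gaussian_family os_P (fun lx : 'I_2 * os_A => os_y lx.1 lx.2);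
  os_y_cov : forall l l' x y,
    ('E_os_P[fun t => (os_y l x t * os_y l' y t)%R]
      = (theta a l l' (os_q l l' x y))%:E)%E;
  os_independent :
    mutually_independent os_P [set: option (option nat)] (fun j =>
      match j with
      | None => sigma_generated (fun x : os_A => os_w x)
      | Some None =>
          sigma_generated (fun lx : 'I_2 * os_A => os_y lx.1 lx.2)
      | Some (Some i) =>
          sigma_generated (fun lx : 'I_2 * os_A => os_z i lx.1 lx.2)
      end)
}.

Section Functional.
Context (a : 'I_2 -> nat -> R) (h : 'I_2 -> R).

Definition G (N : nat) (v u delta : R) (Om : overlap_structure a u delta) :
    \bar R :=
  ((N%:R^-1)%:E *
     \int[os_P Om]_t lne (\esum_(x in [set: os_A Om])
       (os_w x t * \sum_(s : {ffun 'I_2 -> config N} | overlap s == v)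
          expR (\sum_(l < 2) \sum_(i < N)
                  spin (s l) i * (os_z i l x t + h l)))%:E)
   - (N%:R^-1)%:E *
     \int[os_P Om]_t lne (\esum_(x in [set: os_A Om])
       (os_w x t *
          expR (Num.sqrt N%:R * \sum_(l < 2) os_y l x t))%:E))%E.

Definition inf_G (N : nat) (v u delta : R) : \bar R :=
  ereal_inf [set e | exists Om : overlap_structure a u delta, e = G N v Om].

End Functional.
End Model.

(* Main.v *)
(* Aizenman-Sims-Starr scheme. For every overlap structure, Gaussian interpolation
   between H + sqrt N y and the cavity fields z gives, by convexity of xi,
   F_N <= G_N up to an error controlled by the distance between u_N and the
   diagonal overlaps q^{1,2}.
   Conversely, the constrained Gibbs measure of a system of size M, with z and y
   built from independent copies of the disorder, is an overlap structure. Splitting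
   M + N sites into M and N shows that its G_N is at most (Psi_{M+N} - Psi_M) / N
   + o(1) as M grows, where Psi = E log Z. Along M = t N, keep the number of
   agreeing sites close to its target by adding at each step one of two
   admissible numbers of agreements among the N new sites; the increments average
   to P(u), so for one of the two, infinitely many of its increments are at most
   N (P(u) + O(1/N)), and this selects u'_N.
   All laws are handled through the integrals of cos (th + X), which determine the
   law of X and factor when X is a sum of independent Gaussian variables. *)

From HB Require Import structures.
Require Import Defs.
From mathcomp Require Import all_boot all_order all_algebra finmap.
From mathcomp Require Import all_classical all_reals all_analysis.
From mathcomp Require Import measurable_realfun simple_functions measurable_fun_approximation lebesgue_integral_under.
From mathcomp Require Import zify ring lra.

Set Implicit Arguments.
Unset Strict Implicit.
Unset Printing Implicit Defensive.

Import Order.TTheory GRing.Theory Num.Theory.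
Import numFieldNormedType.Exports HBSimple HBNNSimple.

Local Open Scope classical_set_scope.
Local Open Scope ring_scope.

(** Three obstacles shape the development. The index set of an overlap structure is countable, with
    arbitrary random weights, while interpolation differentiates a finite sum. The weights are
    therefore truncated, and the limit is taken under the logarithm with |ln x| <= x + 1/x, where
    1/x is controlled by the convexity of the inverse. Conditioning on the weights is expressed
    through events: a Gaussian identity is required on each event of a pi-system, and a variable
    independent of the pi-system is integrated out of a product law. Finally, [xi] is differentiable
    on [-1, 1], end points included, but no second derivative is available there. Differentiability
    at 1 makes the sum of p (a_p)^2 finite, which gives a first-order Taylor estimate, uniform on
    [-1, 1], with an error [eta] times the increment. The choice [eta = 1/N] makes the errors of the
    converse bound vanish in the limit. The overlap u'_N has to be fixed before delta, because the
    limit in delta is taken first; this is why a single step size must serve infinitely many sizes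
    M. *)

Definition rintegrable d (T : measurableType d) (R : realType)
    (P : {measure set T -> \bar R}) (f : T -> R) : Prop :=
  P.-integrable setT (EFin \o f).

Lemma measurable_norm d (T : measurableType d) (R : realType) (D : set T)
  (f : T -> R) : measurable_fun D f -> measurable_fun D (fun x => `|f x|).
Proof. by move=> mf; apply: (measurableT_comp (@normr_measurable R setT) mf). Qed.

Lemma measurable_cos d (T : measurableType d) (R : realType) (D : set T)
  (f : T -> R) : measurable_fun D f -> measurable_fun D (fun x => cos (f x)).
Proof. exact: (measurableT_comp (continuous_measurable_fun (@continuous_cos R))). Qed.

Lemma measurable_exp d (T : measurableType d) (R : realType) (D : set T)
  (f : T -> R) : measurable_fun D f -> measurable_fun D (fun x => expR (f x)).
Proof. exact: (measurableT_comp (@measurable_expR R)). Qed.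

Lemma measurable_log d (T : measurableType d) (R : realType) (D : set T)
  (f : T -> R) : measurable_fun D f -> measurable_fun D (fun x => ln (f x)).
Proof. exact: (measurableT_comp (@measurable_ln R)). Qed.

(** * Integrals of real functions *)

Section real_integration.
Context d (T : measurableType d) (R : realType) (P : probability T R).
Implicit Types (f g : T -> R).

Lemma rint_measurable f : rintegrable P f -> measurable_fun setT f.
Proof. by move/measurable_int/measurable_EFinP. Qed.

Lemma rint_cst (c : R) : rintegrable P (fun=> c).
Proof. exact: (finite_measure_integrable_cst P c measurableT). Qed.

Lemma rintD f g : rintegrable P f -> rintegrable P g ->
  rintegrable P (fun t => f t + g t).
Proof. by move=> hf hg; exact: (integrableD measurableT hf hg). Qed.

Lemma rintB f g : rintegrable P f -> rintegrable P g ->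
  rintegrable P (fun t => f t - g t).
Proof. by move=> hf hg; exact: (integrableB measurableT hf hg). Qed.

Lemma rintZ (c : R) f : rintegrable P f -> rintegrable P (fun t => c * f t).
Proof. by move=> hf; exact: (integrableZl measurableT c hf). Qed.

Lemma rint_sum (I : Type) (s : seq I) (p : pred I) (F : I -> T -> R) :
  (forall i, p i -> rintegrable P (F i)) ->
  rintegrable P (fun t => \sum_(i <- s | p i) F i t).
Proof.
move=> hF; elim: s => [|i s IH].
  by under eq_fun do rewrite big_nil; exact: rint_cst.
under eq_fun do rewrite big_cons.
by case pi: (p i) => //; apply: rintD => //; exact: hF.
Qed.

Lemma rint_le f g : measurable_fun setT f -> (forall t, `|f t| <= g t) ->
  rintegrable P g -> rintegrable P f.
Proof.
move=> mf fg ig; apply: (le_integrable measurableT _ _ ig).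
  exact/measurable_EFinP.
by move=> t _ /=; rewrite lee_fin (le_trans (fg t))// ler_norm.
Qed.

Lemma rint_bounded f (M : R) : measurable_fun setT f ->
  (forall t, `|f t| <= M) -> rintegrable P f.
Proof. by move=> mf fM; apply: rint_le mf fM (rint_cst M). Qed.

Lemma rint_norm f : rintegrable P f -> rintegrable P (fun t => `|f t|).
Proof. exact: integrable_norm. Qed.

Lemma rint_mul_bounded f g (M : R) : rintegrable P f -> measurable_fun setT g ->
  (forall t, `|g t| <= M) -> rintegrable P (fun t => f t * g t).
Proof.
move=> hf mg gM.
apply: (@rint_le _ (fun t => M * `|f t|)).
- by apply: measurable_funM => //; exact: rint_measurable.
- by move=> t; rewrite normrM mulrC ler_wpM2r.
- by apply: rintZ; exact: rint_norm.
Qed.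

Lemma RintD f g : rintegrable P f -> rintegrable P g ->
  \int[P]_t (f t + g t) = \int[P]_t f t + \int[P]_t g t.
Proof. exact: RintegralD. Qed.

Lemma RintB f g : rintegrable P f -> rintegrable P g ->
  \int[P]_t (f t - g t) = \int[P]_t f t - \int[P]_t g t.
Proof. exact: RintegralB. Qed.

Lemma RintZ (c : R) f : rintegrable P f ->
  \int[P]_t (c * f t) = c * \int[P]_t f t.
Proof. exact: RintegralZl. Qed.

Lemma Rint_cst (c : R) : \int[P]_t c = c.
Proof. by rewrite Rintegral_cst//= (@probability_setT _ _ _ P) mulr1. Qed.

Lemma Rint_sum (I : Type) (s : seq I) (p : pred I) (F : I -> T -> R) :
  (forall i, p i -> rintegrable P (F i)) ->
  \int[P]_t (\sum_(i <- s | p i) F i t) = \sum_(i <- s | p i) \int[P]_t F i t.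
Proof.
move=> hF; elim: s => [|i s IH].
  by under eq_Rintegral do rewrite big_nil; rewrite big_nil Rint_cst.
under eq_Rintegral do rewrite big_cons; rewrite big_cons.
by case pi: (p i) => //; rewrite RintD ?IH//; [exact: hF|exact: rint_sum].
Qed.

Lemma Rint_le f g : rintegrable P f -> rintegrable P g ->
  (forall t, f t <= g t) -> \int[P]_t f t <= \int[P]_t g t.
Proof. by move=> hf hg fg; apply: le_Rintegral. Qed.

Lemma EFin_Rint f : rintegrable P f ->
  (\int[P]_t f t)%:E = (\int[P]_t (f t)%:E)%E.
Proof. by move=> hf; rewrite fineK//; exact: integrable_fin_num. Qed.

Lemma Rint_dominated (F : nat -> T -> R) f g :
  (forall n, measurable_fun setT (F n)) -> measurable_fun setT f ->
  {ae P, forall t, F n t @[n --> \oo] --> f t} ->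
  (forall n t, `|F n t| <= g t) -> rintegrable P g ->
  rintegrable P f /\ \int[P]_t F n t @[n --> \oo] --> \int[P]_t f t.
Proof.
move=> mF mf Ff Fg ig.
have [] := @dominated_convergence _ _ _ P setT measurableT
  (fun n => EFin \o F n) (EFin \o f) (EFin \o g).
- by move=> n; exact/measurable_EFinP.
- exact/measurable_EFinP.
- apply: filterS Ff => t Ft _.
  by apply: cvg_comp; first exact: Ft.
- exact: ig.
- by apply/aeW => t n _; rewrite lee_fin.
move=> hf _ h; split => //.
apply: fine_cvg; rewrite fineK//; exact: integrable_fin_num.
Qed.

Lemma Rint_indic (A : set T) : measurable A -> \int[P]_t (\1_A t) = fine (P A).
Proof. by move=> mA; rewrite /Rintegral integral_indic// setIT. Qed.

Lemma indic_measurable (A : set T) : measurable A ->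
  measurable_fun setT (\1_A : T -> R).
Proof. exact: measurable_indic. Qed.

Lemma indic_norm_le1 (T' : Type) (A : set T') t : `|\1_A t : R| <= 1.
Proof. by rewrite indicE; case: (_ \in _); rewrite ?normr1 ?normr0. Qed.

Lemma indic_comp (T' : Type) (X : T -> T') (B : set T') t :
  \1_B (X t) = \1_(X @^-1` B) t :> R.
Proof. by rewrite !indicE; congr (nat_of_bool _)%:R; apply/idP/idP; rewrite !inE. Qed.

Lemma cos_norm_le1 (x : R) : `|cos x| <= 1.
Proof. by rewrite ler_norml cos_geN1 cos_le1. Qed.

Lemma sin_norm_le1 (x : R) : `|sin x| <= 1.
Proof. by rewrite ler_norml sin_geN1 sin_le1. Qed.

End real_integration.

Section extension.
Context d1 (T1 : measurableType d1) d2 (T2 : measurableType d2)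
  d (S : measurableType d) (R : realType)
  (P1 : probability T1 R) (P2 : probability T2 R).
Variables (X1 : T1 -> S) (X2 : T2 -> S) (f1 : T1 -> R) (f2 : T2 -> R).
Hypotheses (mX1 : measurable_fun setT X1) (mX2 : measurable_fun setT X2).
Hypotheses (if1 : rintegrable P1 f1) (if2 : rintegrable P2 f2).
Hypothesis eq12 : forall B, measurable B ->
  \int[P1]_t (f1 t * \1_B (X1 t)) = \int[P2]_t (f2 t * \1_B (X2 t)).

Let ext_nneg (phi : S -> R) (M : R) : measurable_fun setT phi ->
  (forall x, 0 <= phi x <= M) ->
  \int[P1]_t (f1 t * phi (X1 t)) = \int[P2]_t (f2 t * phi (X2 t)).
Proof.
move=> mphi phiM.
have mE : measurable_fun setT (EFin \o phi) by exact/measurable_EFinP.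
pose g := nnsfun_approx measurableT mE.
have phi0 x : [set: S] x -> (0 <= (EFin \o phi) x)%E.
  by move=> _; rewrite lee_fin; case/andP: (phiM x).
have gcvg x : g n x @[n --> \oo] --> phi x.
  have /fine_cvgP[_] := cvg_nnsfun_approx measurableT mE phi0 (I : [set: S] x).
  by [].
have g_le n x : g n x <= phi x.
  have nd : nondecreasing_seq (fun n => g n x).
    by move=> a b ab; have /lefP := nd_nnsfun_approx measurableT mE ab; exact.
  have := nondecreasing_cvgn_le nd (cvgP _ (gcvg x)) n.
  by rewrite (cvg_lim (@Rhausdorff R) (gcvg x)).
have gM n x : `|g n x| <= M.
  rewrite ger0_norm//; apply: le_trans (g_le n x) _.
  by case/andP: (phiM x).
have step n : \int[P1]_t (f1 t * g n (X1 t)) = \int[P2]_t (f2 t * g n (X2 t)).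
  pose s := fset_set (range (g n)).
  have gE x : g n x = \sum_(r <- s) r * \1_(g n @^-1` [set r]) x.
    by rewrite fimfunE fsbig_finite//=.
  have mI r : measurable (g n @^-1` [set r]) by [].
  have mi1 r : measurable_fun setT (fun t => \1_(g n @^-1` [set r]) (X1 t) : R).
    exact: (measurableT_comp (indic_measurable (mI r)) mX1).
  have mi2 r : measurable_fun setT (fun t => \1_(g n @^-1` [set r]) (X2 t) : R).
    exact: (measurableT_comp (indic_measurable (mI r)) mX2).
  have i1 r : rintegrable P1 (fun t => f1 t * \1_(g n @^-1` [set r]) (X1 t)).
    by apply: (rint_mul_bounded if1 (mi1 r)) => t; exact: indic_norm_le1.
  have i2 r : rintegrable P2 (fun t => f2 t * \1_(g n @^-1` [set r]) (X2 t)).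
    by apply: (rint_mul_bounded if2 (mi2 r)) => t; exact: indic_norm_le1.
  transitivity (\int[P1]_t (\sum_(r <- s)
      r * (f1 t * \1_(g n @^-1` [set r]) (X1 t)))).
    apply: eq_Rintegral => t _; rewrite gE mulr_sumr.
    by apply: eq_bigr => r _; rewrite mulrCA.
  rewrite Rint_sum; last by move=> r _; exact: rintZ.
  transitivity (\int[P2]_t (\sum_(r <- s)
      r * (f2 t * \1_(g n @^-1` [set r]) (X2 t)))); last first.
    apply: eq_Rintegral => t _; rewrite gE mulr_sumr.
    by apply: eq_bigr => r _; rewrite mulrCA.
  rewrite Rint_sum; last by move=> r _; exact: rintZ.
  by apply: eq_bigr => r _; rewrite !RintZ// eq12.
have cvgE d' (T : measurableType d') (P : probability T R) (X : T -> S) (f : T -> R) :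
    measurable_fun setT X -> rintegrable P f ->
    \int[P]_t (f t * g n (X t)) @[n --> \oo] --> \int[P]_t (f t * phi (X t)).
  move=> mX iF; have mF := rint_measurable iF.
  apply: (Rint_dominated (g := fun t => M * `|f t|) _ _ _ _ _).2.
  - by move=> n; apply: measurable_funM => //; apply: (measurableT_comp _ mX).
  - by apply: measurable_funM => //; apply: (measurableT_comp mphi mX).
  - by apply/aeW => t; apply: cvgMr; exact: gcvg.
  - by move=> n t; rewrite normrM mulrC ler_wpM2r.
  - by apply: rintZ; exact: rint_norm.
have l1 := cvgE _ _ P1 X1 f1 mX1 if1; have l2 := cvgE _ _ P2 X2 f2 mX2 if2.
apply: (cvg_unique (@Rhausdorff R) l1).
by rewrite (_ : (fun n => _) = (fun n => \int[P2]_t (f2 t * g n (X2 t))))//;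
  apply/funext => n; exact: step.
Qed.

(** Simple approximations and dominated convergence settle [0 <= phi <= M], and the shift [phi + M]
    reduces the signed case to that one. The weights [f1] and [f2] carry the factor or the event on
    which conditioning would take place. *)
Lemma weighted_law_ext (phi : S -> R) (M : R) : measurable_fun setT phi ->
  (forall x, `|phi x| <= M) ->
  \int[P1]_t (f1 t * phi (X1 t)) = \int[P2]_t (f2 t * phi (X2 t)).
Proof.
move=> mphi phiM.
have h := @ext_nneg (fun x => phi x + M) (M + M) _ _.
have i1 : rintegrable P1 (fun t => f1 t * (phi (X1 t) + M)).
  apply: (rint_mul_bounded (M := M + `|M|) if1).
    by apply: measurable_funD => //; exact: measurableT_comp.
  by move=> t; rewrite (le_trans (ler_normD _ _))// lerD2r.
have i2 : rintegrable P2 (fun t => f2 t * (phi (X2 t) + M)).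
  apply: (rint_mul_bounded (M := M + `|M|) if2).
    by apply: measurable_funD => //; exact: measurableT_comp.
  by move=> t; rewrite (le_trans (ler_normD _ _))// lerD2r.
transitivity (\int[P1]_t (f1 t * (phi (X1 t) + M) - M * f1 t)).
  by apply: eq_Rintegral => t _; ring.
transitivity (\int[P2]_t (f2 t * (phi (X2 t) + M) - M * f2 t)); last first.
  by apply: eq_Rintegral => t _; ring.
rewrite !RintB ?RintZ//; try exact: rintZ.
rewrite h; first congr (_ - _ * _).
- have := eq12 measurableT.
  under eq_Rintegral do rewrite indicE in_setT mulr1.
  by under [in RHS]eq_Rintegral do rewrite indicE in_setT mulr1.
- by apply: measurable_funD.
- by move=> x; have := phiM x; rewrite ler_norml => /andP[? ?]; apply/andP; split; lra.
Qed.

End extension.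

Lemma cvg_dist_le (R : realType) (u v : nat -> R) (l : R) :
  (forall n, `|u n - l| <= v n) -> v n @[n --> \oo] --> (0 : R) ->
  u n @[n --> \oo] --> l.
Proof.
move=> uv v0; apply/cvgrPdist_le => e e0.
move/cvgrPdist_le : v0 => /(_ e e0).
apply: filterS => n; rewrite sub0r normrN => vn.
by rewrite distrC (le_trans (uv n))// (le_trans (ler_norm _)).
Qed.

(** * Gaussian variables *)

Section normal_law.
Context (R : realType) (m s : R).
Hypothesis s0 : s != 0.
Local Notation mu := (@lebesgue_measure R).
Local Notation gam := (normal_prob m s).
Local Notation pdf := (normal_pdf m s).

Lemma pdfE x : pdf x = normal_peak s * expR (- (x - m) ^+ 2 / (s ^+ 2 *+ 2)).
Proof. by rewrite normal_pdfE. Qed.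

(** The Radon-Nikodym derivative of the normal law and the explicit density have the same integral
    over every measurable set, so they agree almost everywhere. *)
Lemma ge0_integral_normal (f : R -> R) : measurable_fun setT f ->
  (forall x, 0 <= f x) ->
  (\int[gam]_x (f x)%:E = \int[mu]_x (f x * pdf x)%:E)%E.
Proof.
move=> mf f0.
have dom : gam `<< mu := normal_prob_dominates m s.
have mE : measurable_fun setT (EFin \o f) by exact/measurable_EFinP.
rewrite -(Radon_Nikodym_SigmaFinite.change_of_variables dom)//.
apply: ae_eq_integral => //.
- apply: emeasurable_funM => //; apply: (measurable_int mu).
  exact: Radon_Nikodym_SigmaFinite.f_integrable.
- by apply/measurable_EFinP; apply: measurable_funM => //; exact: measurable_normal_pdf.
- suff : ae_eq mu setT (Radon_Nikodym_SigmaFinite.f gam mu) (EFin \o pdf).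
    by apply: filterS => x /= h _; rewrite h// EFinM.
  apply: integral_ae_eq => //=.
  + exact: Radon_Nikodym_SigmaFinite.f_integrable.
  + by apply/measurable_EFinP; exact: measurable_normal_pdf.
  + by move=> E _ mE'; rewrite -Radon_Nikodym_SigmaFinite.f_integral.
Qed.

Lemma rint_normalP (f : R -> R) : measurable_fun setT f ->
  rintegrable gam f <-> rintegrable mu (fun x => f x * pdf x).
Proof.
move=> mf.
have mn : measurable_fun setT (fun x => `|f x|) by exact: measurableT_comp.
have E : (\int[gam]_x (`|f x|)%:E = \int[mu]_x (`|f x * pdf x|)%:E)%E.
  rewrite ge0_integral_normal//; apply: eq_integral => x _.
  by rewrite normrM (ger0_norm (normal_pdf_ge0 m s x)).
split=> /integrableP[_ h]; apply/integrableP; split.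
- apply/measurable_EFinP; apply: measurable_funM => //.
  exact: measurable_normal_pdf.
- by move: h; rewrite [X in (X < _)%E -> _](_ : _ = (\int[gam]_x (`|f x|)%:E)%E)// E.
- exact/measurable_EFinP.
- by move: h; rewrite [X in (X < _)%E -> _](_ : _ = (\int[mu]_x (`|f x * pdf x|)%:E)%E)// -E.
Qed.

Lemma Rint_normal (f : R -> R) : rintegrable gam f ->
  \int[gam]_x f x = \int[mu]_x (f x * pdf x).
Proof.
move=> hf; have mf := rint_measurable hf.
have hg := (rint_normalP mf).1 hf.
have pn x : (f^\+ x * pdf x = (fun x => f x * pdf x)^\+ x)%R.
  by rewrite /funrpos/= maxr_pMl ?normal_pdf_ge0// mul0r.
have nn x : (f^\- x * pdf x = (fun x => f x * pdf x)^\- x)%R.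
  by rewrite /funrneg/= maxr_pMl ?normal_pdf_ge0// mul0r mulNr.
congr fine; rewrite [LHS]integralE [RHS]integralE.
rewrite (_ : (fun x => (f x)%:E) = EFin \o f)// funerpos funerneg.
rewrite (_ : (fun x => (f x * pdf x)%:E) = EFin \o (fun x => f x * pdf x))//.
rewrite funerpos funerneg; congr (_ - _)%E.
- rewrite ge0_integral_normal//; last by exact: measurable_funrpos.
  by apply: eq_integral => x _ /=; rewrite pn.
- rewrite ge0_integral_normal//; last by exact: measurable_funrneg.
  by apply: eq_integral => x _ /=; rewrite nn.
Qed.

End normal_law.

Section derive_helpers.
Context (R : realType).

Lemma is_derive1_continuous (f : R -> R) (x df : R) : is_derive x 1 f df ->
  {for x, continuous f}.
Proof. by move=> h; apply/differentiable_continuous/derivable1_diffP; case: h. Qed.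

Lemma is_derive1_LRcontinuous (f f' : R -> R) a b :
  (forall x, is_derive x (1 : R) f (f' x)) -> derivable_oo_LRcontinuous f a b.
Proof.
move=> h; have c x := is_derive1_continuous (h x); split.
- by move=> x _; case: (h x).
- exact/cvg_at_right_filter/c.
- exact/cvg_at_left_filter/c.
Qed.

Lemma is_derive1E (f : R -> R) (x df : R) : is_derive x 1 f df -> f^`()%classic x = df.
Proof. by move=> h; rewrite derive1E; exact: derive_val. Qed.

End derive_helpers.

Section normal_stein.
Context (R : realType) (m s : R).
Hypothesis s0 : s != 0.
Local Notation mu := (@lebesgue_measure R).
Local Notation gam := (normal_prob m s).
Local Notation pdf := (normal_pdf m s).

Lemma is_derive_pdf (x : R) : is_derive x 1 pdf (- (x - m) / s ^+ 2 * pdf x).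
Proof.
have s20 : s ^+ 2 != 0 by rewrite expf_neq0.
have d1 : is_derive x 1 (fun x : R => - (x - m) ^+ 2 / (s ^+ 2 *+ 2))
    (- (x - m) / s ^+ 2).
  apply: is_derive_eq; rewrite !scaler0 add0r /= /GRing.scale/=.
  by field; rewrite expf_eq0/= in s20 *.
have d2 := is_derive1_comp (is_derive_expR _) d1.
rewrite normal_pdfE//.
have -> : (fun x => normal_peak s * normal_fun m s x) =
  (fun x => normal_peak s *: (expR \o (fun x : R => - (x - m) ^+ 2 / (s ^+ 2 *+ 2))) x).
  by [].
by apply: is_derive_eq; rewrite /= /normal_fun /GRing.scale/=; ring.
Qed.

Lemma expR_id_le (x : R) : x <= expR x.
Proof. by rewrite (le_trans _ (expR_ge1Dx x))// lerDr. Qed.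

(** Completing the square turns the integrand times the density into a multiple of the normal
    density centered at [m + c * s ^+ 2]. *)
Lemma rint_exp_normal (c : R) : rintegrable gam (fun x => expR (c * (x - m))).
Proof.
have mf : measurable_fun setT (fun x : R => expR (c * (x - m))).
  by apply: measurableT_comp => //; apply: measurable_funM => //; exact: measurable_funB.
apply: (rint_normalP m s mf).2.
have E x : expR (c * (x - m)) * pdf x =
    expR (c ^+ 2 * s ^+ 2 / 2) * normal_pdf (m + c * s ^+ 2) s x.
  rewrite !pdfE// mulrCA -expRD mulrCA -expRD; congr (_ * expR _).
  by field.
under eq_fun do rewrite E.
exact: (integrableZl measurableT (expR (c ^+ 2 * s ^+ 2 / 2))
  (integrable_normal_pdf (m + c * s ^+ 2) s)).
Qed.

Lemma rint_growth_normal (f : R -> R) (C : R) : measurable_fun setT f ->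
  (forall x, `|f x| <= C * expR `|x - m|) -> rintegrable gam f.
Proof.
move=> mf fC.
have h : rintegrable gam (fun x => `|C| * (expR (1 * (x - m)) + expR (-1 * (x - m)))).
  by apply: rintZ; apply: rintD; exact: rint_exp_normal.
apply: rint_le h => // x; apply: le_trans (fC x) _.
apply: (@le_trans _ _ (`|C| * expR `|x - m|)); first by rewrite ler_wpM2r ?expR_ge0 ?ler_norm.
rewrite ler_wpM2l// mul1r mulN1r.
have [h0|h0] := leP 0 (x - m).
- by rewrite ger0_norm// lerDl expR_ge0.
- by rewrite ltr0_norm// lerDr expR_ge0.
Qed.

(** Stein's identity. The derivative of [phi * pdf] is (phi' - (x - m) phi / s^2) pdf, so its
    integral over a large interval around [m] is a difference of boundary values, which tends to
    0. *)
Lemma normal_stein (phi phi' : R -> R) (M : R) :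
  (forall x, is_derive x (1 : R) phi (phi' x)) -> continuous phi' ->
  (forall x, `|phi x| <= M * (1 + `|x - m|)) -> (forall x, `|phi' x| <= M) ->
  \int[gam]_x ((x - m) * phi x) = s ^+ 2 * \int[gam]_x (phi' x).
Proof.
move=> dphi cphi' phiM phi'M.
have s20 : s ^+ 2 != 0 by rewrite expf_neq0.
have cphi : continuous phi by move=> x; exact: is_derive1_continuous (dphi x).
have mphi : measurable_fun setT phi by exact: continuous_measurable_fun.
have mphi' : measurable_fun setT phi' by exact: continuous_measurable_fun.
have mx : measurable_fun setT (fun x : R => x - m) by apply: measurable_funB.
have M0 : 0 <= M by apply: le_trans (phi'M 0); exact: normr_ge0.
have i' : rintegrable gam phi' by apply: (@rint_bounded _ _ _ _ _ M).
have ix : rintegrable gam (fun x => (x - m) * phi x).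
  apply: (@rint_growth_normal _ (4 * M)); first exact: measurable_funM.
  move=> x; rewrite normrM.
  apply: (@le_trans _ _ (`|x - m| * (M * (1 + `|x - m|)))); first by rewrite ler_wpM2l.
  set y := `|x - m|; have y0 : 0 <= y := normr_ge0 _.
  have -> : y * (M * (1 + y)) = M * (y * (1 + y)) by ring.
  have -> : 4 * M * expR y = M * (4 * expR y) by ring.
  apply: ler_wpM2l => //.
  (* Squaring 1 + z <= exp z at z = y / 2 yields a quadratic lower bound for the exponential. *)
  have e1 := expR_ge1Dx (y / 2).
  have -> : expR y = expR (y / 2) ^+ 2 by rewrite expr2 -expRD; congr expR; field.
  have : (1 + y / 2) ^+ 2 <= expR (y / 2) ^+ 2.
    by rewrite ler_pXn2r// ?nnegrE ?expR_ge0//; lra.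
  by move: (expR (y/2) ^+ 2) => z; nra.
pose h x := phi' x - (x - m) / s ^+ 2 * phi x.
have ih : rintegrable gam h.
  have -> : h = (fun x => phi' x - (s ^+ 2)^-1 * ((x - m) * phi x)).
    by apply/funext => x; rewrite /h; ring.
  by apply: rintB => //; exact: rintZ.
suff h0 : \int[gam]_x h x = 0.
  have : \int[gam]_x (phi' x - (s ^+ 2)^-1 * ((x - m) * phi x)) = 0.
    by rewrite -h0; apply: eq_Rintegral => x _; rewrite /h; ring.
  rewrite RintB//; last exact: rintZ.
  by rewrite RintZ// => /subr0_eq ->; rewrite mulVKf.
have mh := rint_measurable ih.
pose A n : set R := `[m - n.+1%:R, m + n.+1%:R]%classic.
have mA n : measurable (A n) by exact: measurable_itv.
have AB n : m - n.+1%:R < m + n.+1%:R :> R.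
  have n0 : (0 : R) < n.+1%:R by rewrite ltr0n.
  by lra.
have := @Rint_dominated _ _ _ gam (fun n x => h x * \1_(A n) x) h (fun x => `|h x|).
case.
- by move=> n; apply: measurable_funM => //; exact: (indic_measurable (mA n)).
- by [].
- apply/aeW => x; apply: cvg_near_cst.
  exists (Num.truncn `|x - m|).+1 => // n /= hn.
  rewrite indicE mem_set ?mulr1// /A /= in_itv/=.
  have : `|x - m| <= n.+1%:R.
    apply: ltW; apply: lt_le_trans (truncnS_gt _) _.
    by rewrite ler_nat (leq_trans hn).
  by rewrite ler_norml => /andP[? ?]; apply/andP; split; lra.
- by move=> n x; rewrite normrM ler_piMr// indic_norm_le1.
- exact: rint_norm.
move=> _ cv.
have E n : \int[gam]_x (h x * \1_(A n) x) =
    phi (m + n.+1%:R) * pdf (m + n.+1%:R) - phi (m - n.+1%:R) * pdf (m - n.+1%:R).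
  have i1 : rintegrable gam (fun x => h x * \1_(A n) x).
    apply: (rint_mul_bounded (M := 1) ih); first exact: (indic_measurable (mA n)).
    by move=> x; exact: indic_norm_le1.
  rewrite Rint_normal//.
  pose F x := phi x * pdf x; pose f x := h x * pdf x.
  have dF x : is_derive x (1 : R) F (f x).
    have d1 := dphi x; have d2 := is_derive_pdf x.
    by apply: is_derive_eq; rewrite /f /h /GRing.scale/=; field.
  have cf : continuous f.
    move=> x; apply: cvgM; last exact: continuous_normal_pdf.
    apply: cvgB; first exact: cphi'.
    apply: cvgM; last exact: cphi.
    apply: cvgM; last exact: cvg_cst.
    by apply: cvgB; [exact: cvg_id|exact: cvg_cst].
  have := @continuous_FTC2 R f F _ _ (AB n) (continuous_subspaceT cf)
    (is_derive1_LRcontinuous _ _ dF) _.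
  move=> /(_ _)/(congr1 fine); rewrite -/(A n) /= => <-; last first.
    by move=> x _; exact: is_derive1E.
  rewrite -/(Rintegral mu (A n) f) Rintegral_mkcond.
  apply: eq_Rintegral => x _; rewrite patchE /f indicE.
  by case: ifP; rewrite ?mulr1// mulr0 mul0r.
(* The bound exp(-z) <= 1/z at z = (n + 1)^2 / (2 s^2) beats the linear growth of [phi]: each
   boundary term is O(1/n). *)
have B n : `|phi (m + n.+1%:R) * pdf (m + n.+1%:R) - phi (m - n.+1%:R) * pdf (m - n.+1%:R)|
    <= 8 * M * normal_peak s * s ^+ 2 * n.+1%:R^-1.
  have n0 : (1 : R) <= n.+1%:R by rewrite ler1n.
  have s2p : 0 < s ^+ 2 by rewrite exprn_even_gt0.
  have pk := normal_peak_gt0 s0.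
  have one (x : R) : `|x - m| = n.+1%:R ->
      `|phi x * pdf x| <= 4 * M * normal_peak s * s ^+ 2 * n.+1%:R^-1.
    move=> hx; rewrite normrM (ger0_norm (normal_pdf_ge0 m s x)) pdfE//.
    have E1 : expR (- (x - m) ^+ 2 / (s ^+ 2 *+ 2)) <= (s ^+ 2 *+ 2) / n.+1%:R ^+ 2.
      rewrite mulNr expRN -[(x-m)^+2]real_normK ?num_real// hx.
      rewrite -[leRHS]invf_div lef_pV2 ?posrE ?expR_gt0 ?divr_gt0 ?exprn_gt0 ?ltr0n ?pmulrn_lgt0//.
      exact: expR_id_le.
    have := phiM x; rewrite hx => hp.
    apply: (@le_trans _ _ ((M * (1 + n.+1%:R)) * (normal_peak s * ((s ^+ 2 *+ 2) / n.+1%:R ^+ 2)))).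
      apply: ler_pM => //; first by apply: mulr_ge0; [exact: ltW|exact: expR_ge0].
      by rewrite ler_wpM2l// ltW.
    have -> : 4 * M * normal_peak s * s ^+ 2 * n.+1%:R^-1 =
        (M * (2 * n.+1%:R)) * (normal_peak s * ((s ^+ 2 *+ 2) / n.+1%:R ^+ 2)).
      have N0 : n.+1%:R != 0 :> R by rewrite pnatr_eq0.
      by move: (n.+1%:R : R) N0 => N N0; rewrite -mulr_natr; field.
    apply: ler_wpM2r.
      apply: mulr_ge0; first exact: ltW.
      by apply: divr_ge0; [rewrite mulrn_wge0// ltW|exact: exprn_ge0].
    by rewrite ler_wpM2l//; lra.
  rewrite (le_trans (ler_normB _ _))//.
  have h1 : `|phi (m + n.+1%:R) * pdf (m + n.+1%:R)| <= 4 * M * normal_peak s * s ^+ 2 * n.+1%:R^-1.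
    by apply: one; rewrite addrAC subrr add0r ger0_norm.
  have h2 : `|phi (m - n.+1%:R) * pdf (m - n.+1%:R)| <= 4 * M * normal_peak s * s ^+ 2 * n.+1%:R^-1.
    by apply: one; rewrite addrAC subrr add0r normrN ger0_norm.
  apply: le_trans (lerD h1 h2) _.
  by rewrite le_eqVlt; apply/orP; left; apply/eqP; ring.
have z : \int[gam]_x (h x * \1_(A n) x) @[n --> \oo] --> (0 : R).
  apply: (@cvg_dist_le _ _ (fun n => 8 * M * normal_peak s * s ^+ 2 * n.+1%:R^-1)).
    by move=> n; rewrite subr0 E B.
  rewrite -[X in _ --> X](mulr0 (8 * M * normal_peak s * s ^+ 2)).
  by apply: cvgMr; exact: cvg_harmonic.
exact: cvg_unique cv z.
Qed.

End normal_stein.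

Section normal_transform.
Context (R : realType) (m s : R).
Hypothesis s0 : s != 0.
Local Notation gam := (normal_prob m s).

Let mx : measurable_fun setT (fun x : R => x - m).
Proof. exact: measurable_funB. Qed.

Lemma normal_variance :
  rintegrable gam (fun x => (x - m) ^+ 2) /\ \int[gam]_x ((x - m) ^+ 2) = s ^+ 2.
Proof.
split.
  apply: (@rint_growth_normal _ _ _ s0 _ 4); first exact: measurable_funX.
  move=> x; rewrite normrX; set y := `|x - m|; have y0 : 0 <= y := normr_ge0 _.
  have e1 := expR_ge1Dx (y / 2).
  have -> : expR y = expR (y / 2) ^+ 2 by rewrite expr2 -expRD; congr expR; field.
  have : (1 + y / 2) ^+ 2 <= expR (y / 2) ^+ 2.
    by rewrite ler_pXn2r// ?nnegrE ?expR_ge0//; lra.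
  by move: (expR (y/2) ^+ 2) => z; nra.
under eq_Rintegral do rewrite expr2.
have D (x : R) : is_derive x (1 : R) (fun x : R => x - m) (cst 1 x).
  by apply: is_derive_eq; rewrite subr0.
rewrite (normal_stein s0 (M := 1) D).
- by rewrite Rint_cst mulr1.
- exact: cst_continuous.
- by move=> x; rewrite mul1r lerDr.
- by move=> x; rewrite normr1.
Qed.

(** Chebyshev's inequality: the indicator is at most the squared deviation divided by e^2. *)
Lemma normal_tail (e : R) : 0 < e ->
  \int[gam]_x (\1_[set x | e <= `|x - m|] x) <= s ^+ 2 / e ^+ 2.
Proof.
move=> e0; have [iv <-] := normal_variance.
rewrite mulrC -RintZ//; apply: Rint_le.
- apply: (@rint_bounded _ _ _ _ _ 1); last by move=> x; exact: indic_norm_le1.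
  apply: measurable_indic; rewrite -[X in measurable X]setTI.
  rewrite (_ : [set x | _] = (fun x => `|x - m|) @^-1` `[e, +oo[); last first.
    by apply/seteqP; split => x /=; rewrite in_itv/= andbT.
  have mn : measurable_fun setT (fun x : R => `|x - m|) by exact: measurableT_comp.
  exact: mn.
- exact: rintZ.
- move=> x; rewrite indicE; case: (boolP (x \in _)) => [|_]; last first.
    by rewrite mulr_ge0 ?invr_ge0 ?sqr_ge0.
  rewrite inE /= => ex; rewrite mulrC ler_pdivlMr ?exprn_gt0// mul1r.
  by rewrite -[leRHS]real_normK ?num_real// ler_pXn2r// nnegrE ltW.
Qed.

(** As a function of [t] the integral solves g' = - s^2 t g, by differentiation under the integral
    and Stein's identity, so g(t) exp(s^2 t^2 / 2) is constant. The phase [th] lets one real formula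
    carry both the cosine and the sine transform. *)
Lemma normal_cos (th t : R) :
  \int[gam]_x cos (th + t * (x - m)) = cos th * expR (- (s ^+ 2 * t ^+ 2) / 2).
Proof.
pose g t := \int[gam]_x cos (th + t * (x - m)).
have mc (c : R) : measurable_fun setT (fun x : R => cos (th + c * (x - m))).
  apply: (measurableT_comp (continuous_measurable_fun (@continuous_cos R))).
  by apply: measurable_funD => //; exact: measurable_funM.
have ic (c : R) : rintegrable gam (fun x => cos (th + c * (x - m))).
  apply: (@rint_bounded _ _ _ _ _ 1); first exact: mc.
  by move=> x; exact: cos_norm_le1.
have dcos (c x : R) : is_derive c (1 : R) (fun c => cos (th + c * (x - m)))
    (- ((x - m) * sin (th + c * (x - m)))).
  have d1 : is_derive c (1 : R) (fun c : R => th + c * (x - m)) (x - m).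
    by apply: is_derive_eq; rewrite /GRing.scale/=; ring.
  have d2 := is_derive1_comp (is_derive_cos _) d1.
  by apply: (is_derive_eq d2); ring.
have iabs : rintegrable gam (fun x => `|x - m|).
  apply: (@rint_growth_normal _ _ _ s0 _ 1); first exact: measurableT_comp.
  by move=> x; rewrite normr_id mul1r; exact: expR_id_le.
have dg (c : R) : is_derive c (1 : R) g (- (s ^+ 2 * c) * g c).
  have Ia : (`]c - 1, c + 1[%classic : set R) c by rewrite /= in_itv/=; apply/andP; split; lra.
  pose f c x := cos (th + c * (x - m)).
  have h1 : forall x, (`]c - 1, c + 1[%classic : set R) x ->
      gam.-integrable setT (EFin \o f x) by move=> x _; exact: ic.
  have h2 : forall x y : R, (`]c - 1, c + 1[%classic : set R) x -> setT y ->
      derivable (f ^~ y) x 1 by move=> x y _ _; case: (dcos x y).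
  have p1 x y : partial1of2 f x y = - ((y - m) * sin (th + x * (y - m))).
    by rewrite /partial1of2; exact: is_derive1E.
  have h3 : forall x y : R, (`]c - 1, c + 1[%classic : set R) x -> setT y ->
      `|partial1of2 f x y| <= `|y - m|.
    by move=> x y _ _; rewrite p1 normrN normrM ler_piMr// sin_norm_le1.
  have D := derivable_under_integral measurableT Ia h1 h2
    (fun y => normr_ge0 (y - m)) iabs h3.
  have E := differentiation_under_integral measurableT Ia h1 h2
    (fun y => normr_ge0 (y - m)) iabs h3.
  apply: DeriveDef; first exact: D.
  rewrite -derive1E; rewrite E.
  under eq_Rintegral do rewrite p1 -mulrN.
  have S x : is_derive x (1 : R) (fun x => - sin (th + c * (x - m)))
      ((fun x => - (c * cos (th + c * (x - m)))) x).
    have d1 : is_derive x (1 : R) (fun x : R => th + c * (x - m)) c.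
      by apply: is_derive_eq; rewrite /GRing.scale/=; ring.
    have d2 := is_derive1_comp (is_derive_sin _) d1.
    rewrite (_ : (fun x => - _) = - (sin \o (fun x => th + c * (x - m))))//.
    by apply: is_derive_eq; rewrite /=; ring.
  rewrite (normal_stein s0 (M := 1 + `|c|) S).
  - rewrite (_ : (fun x => - (c * _)) = (fun x => (- c) * cos (th + c * (x - m)))).
      by rewrite RintZ// /g; ring.
    by apply/funext => x; rewrite mulNr.
  - move=> x; apply: cvgN; apply: cvgM; first exact: cvg_cst.
    apply: continuous_comp; last exact: continuous_cos.
    apply: cvgD; first exact: cvg_cst.
    apply: cvgM; first exact: cvg_cst.
    by apply: cvgB; [exact: cvg_id|exact: cvg_cst].
  - move=> x; rewrite normrN (le_trans (sin_norm_le1 _))//.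
    have a := normr_ge0 c; have b := normr_ge0 (x - m).
    by rewrite mulrDl !mul1r mulrDr mulr1; nra.
  - move=> x; rewrite normrN normrM; apply: (@le_trans _ _ (`|c| * 1)).
      by rewrite ler_wpM2l// cos_norm_le1.
    by rewrite mulr1 lerDr.
pose k c := g c * expR (s ^+ 2 * c ^+ 2 / 2).
have dk (c : R) : is_derive c (1 : R) k 0.
  have d1 : is_derive c (1 : R) (fun c : R => s ^+ 2 * c ^+ 2 / 2) (s ^+ 2 * c).
    rewrite (_ : (fun c => _) = (fun c : R => (s ^+ 2 / 2) *: (c ^+ 2))); last first.
      by apply/funext => x; rewrite /GRing.scale/=; ring.
    by apply: is_derive_eq; rewrite /GRing.scale/=; field.
  have d2 := is_derive1_comp (is_derive_expR _) d1.
  have d3 := dg c.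
  rewrite (_ : k = g * (expR \o (fun c => s ^+ 2 * c ^+ 2 / 2)))//.
  by apply: is_derive_eq; rewrite /= /GRing.scale/=; ring.
have : k t = k 0 by exact: is_derive_0_is_cst.
rewrite /k expr0n/= mulr0 mul0r expR0 mulr1 => E.
have g0 : g 0 = cos th.
  rewrite /g; under eq_Rintegral do rewrite mul0r addr0.
  exact: Rint_cst.
rewrite -g0 -E -/(g t) -[RHS]mulrA -expRD (_ : _ + _ = 0) ?expR0 ?mulr1//.
by ring.
Qed.

End normal_transform.

(** * Product measures and pi-systems *)

Section fubini_real.
Context d1 (T1 : measurableType d1) d2 (T2 : measurableType d2) (R : realType).
Variables (m1 : {sigma_finite_measure set T1 -> \bar R})
  (m2 : {sigma_finite_measure set T2 -> \bar R}).

Lemma Rint_fubini (h : T1 * T2 -> R) :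
  rintegrable (m1 \x m2)%E h ->
  (forall x, rintegrable m2 (fun y => h (x, y))) ->
  (forall y, rintegrable m1 (fun x => h (x, y))) ->
  \int[m1]_x \int[m2]_y h (x, y) = \int[m2]_y \int[m1]_x h (x, y).
Proof.
move=> ih i1 i2; congr fine.
transitivity (\int[m1]_x \int[m2]_y (h (x, y))%:E)%E.
  by apply: eq_integral => x _; rewrite fineK//; exact: (integrable_fin_num measurableT (i1 x)).
rewrite (Fubini ih).
by apply: eq_integral => x _; rewrite fineK//; exact: (integrable_fin_num measurableT (i2 x)).
Qed.

Lemma Rint_prod (h : T1 * T2 -> R) :
  rintegrable (m1 \x m2)%E h ->
  (forall x, rintegrable m2 (fun y => h (x, y))) ->
  \int[(m1 \x m2)%E]_z h z = \int[m1]_x \int[m2]_y h (x, y).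
Proof.
move=> ih i1; congr fine; rewrite -integral12_prod_meas1//.
by apply: eq_integral => x _; rewrite /fubini_F fineK//; exact: (integrable_fin_num measurableT (i1 x)).
Qed.

Lemma rint_prod (h : T1 * T2 -> R) (F : T1 -> R) :
  measurable_fun setT h -> rintegrable m1 F ->
  (forall x, (\int[m2]_y (`|h (x, y)|)%:E <= (`|F x|)%:E)%E) ->
  rintegrable (m1 \x m2)%E h.
Proof.
move=> mh iF hF; apply/integrable12ltyP; first exact/measurable_EFinP.
have /integrableP[mF] := iF; apply: le_lt_trans.
apply: ge0_le_integral => //.
- by move=> w _; apply: integral_ge0.
- have := @measurable_fun_fubini_tonelli_F _ _ T1 T2 R m2 (fun z => `|(h z)%:E|)%E.
  apply; last by move=> z; exact: abse_ge0.
  by apply: measurableT_comp => //; exact/measurable_EFinP.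
- exact: measurableT_comp.
- by move=> w _; exact: hF.
Qed.

End fubini_real.

Section pi_lambda.
Context d1 (T1 : measurableType d1) d2 (T2 : measurableType d2)
  d (S : measurableType d) (R : realType)
  (P1 : probability T1 R) (P2 : probability T2 R).
Variables (X1 : T1 -> S) (X2 : T2 -> S) (f1 : T1 -> R) (f2 : T2 -> R).
Hypotheses (mX1 : measurable_fun setT X1) (mX2 : measurable_fun setT X2).
Hypotheses (if1 : rintegrable P1 f1) (if2 : rintegrable P2 f2).

Let eqw B := \int[P1]_t (f1 t * \1_B (X1 t)) = \int[P2]_t (f2 t * \1_B (X2 t)).

(** The weights may be negative, so both sides are signed measures of [B]. Agreement still passes to
    complements by subtraction and to disjoint unions by dominated convergence, and this is all that
    Dynkin induction uses. *)
Lemma weighted_law_pi (G : set (set S)) :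
  @measurable _ S = <<s G >> -> setI_closed G -> eqw setT ->
  (forall B, G B -> eqw B) -> forall B, measurable B -> eqw B.
Proof.
move=> GE GI GT GB B; rewrite GE; apply: (dynkin_induction GE GI) => //.
- move=> A mA eA; rewrite /eqw.
  have E d' (T : measurableType d') (P : probability T R) (X : T -> S) (f : T -> R) :
      measurable_fun setT X -> rintegrable P f ->
      \int[P]_t (f t * \1_(~` A) (X t)) =
      \int[P]_t (f t * \1_setT (X t)) - \int[P]_t (f t * \1_A (X t)).
    move=> mX iF.
    rewrite -RintB.
    - apply: eq_Rintegral => t _; rewrite !indicE in_setT in_setC.
      by case: (_ \in _) => /=; ring.
    - apply: (rint_mul_bounded (M := 1) iF); last by move=> t; exact: indic_norm_le1.
      by apply: measurableT_comp => //; exact: indic_measurable.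
    - apply: (rint_mul_bounded (M := 1) iF); last by move=> t; exact: indic_norm_le1.
      by apply: measurableT_comp => //; exact: indic_measurable.
  by rewrite (E _ _ P1)// (E _ _ P2)// GT eA.
- move=> F mF tF eF; rewrite /eqw.
  have C d' (T : measurableType d') (P : probability T R) (X : T -> S) (f : T -> R) :
      measurable_fun setT X -> rintegrable P f ->
      \sum_(k < n) \int[P]_t (f t * \1_(F k) (X t)) @[n --> \oo] -->
      \int[P]_t (f t * \1_(\bigcup_k F k) (X t)).
    move=> mX iF.
    have mI k : measurable_fun setT (fun t => \1_(F k) (X t) : R).
      by apply: measurableT_comp => //; exact: indic_measurable.
    have iI k : rintegrable P (fun t => f t * \1_(F k) (X t)).
      by apply: (rint_mul_bounded (M := 1) iF) => // t; exact: indic_norm_le1.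
    have sE n t : \sum_(k < n) (\1_(F k) (X t) : R) = \1_(\big[setU/set0]_(k < n) F k) (X t).
      elim: n => [|n IH]; first by rewrite !big_ord0 indicE in_set0.
      rewrite !big_ord_recr/= IH !indicE in_setU.
      case: (boolP (X t \in F n)) => [h|_]; last by rewrite orbF addr0.
      rewrite orbT; suff -> : (X t \in \big[setU/set0]_(k < n) F k) = false by rewrite add0r.
      apply/negbTE/negP; rewrite inE -bigcup_mkord => -[k /= kn Fk].
      move: h; rewrite inE => h.
      have /trivIsetP tF' := tF.
      have kn' : k != n by rewrite neq_ltn kn.
      have /seteqP[h0 _] := tF' k n I I kn'.
      exact: (h0 (X t) (conj Fk h)).
    under eq_fun do rewrite -Rint_sum//.
    apply: (Rint_dominated (g := fun t => `|f t|) _ _ _ _ _).2.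
    - by move=> n; apply: measurable_sum => k; exact: (rint_measurable (iI k)).
    - apply: measurable_funM; first exact: (rint_measurable iF).
      apply: measurableT_comp => //; apply: indic_measurable.
      exact: bigcup_measurable.
    - apply/aeW => t; rewrite (_ : (fun n => _) =
          (fun n => f t * \1_(\big[setU/set0]_(k < n) F k) (X t))); last first.
        by apply/funext => n; rewrite -mulr_sumr sE.
      apply: cvgMr; have [[k _ Fk]|nF] := pselect ((\bigcup_k F k) (X t)).
        apply: cvg_near_cst; exists k.+1 => // n /= kn.
        rewrite !indicE !mem_set//; first by exists k.
        by rewrite -bigcup_mkord; exists k.
      apply: cvg_near_cst; apply: nearW => n.
      rewrite !indicE !memNset//.
      by rewrite -bigcup_mkord => -[k _ Fk]; apply: nF; exists k.
    - move=> n t; rewrite -mulr_sumr sE normrM ler_piMr//; exact: indic_norm_le1.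
    - exact: rint_norm.
  have c1 := C _ _ P1 X1 f1 mX1 if1; have c2 := C _ _ P2 X2 f2 mX2 if2.
  apply: (cvg_unique (@Rhausdorff R) c1).
  rewrite (_ : (fun n => _) = (fun n => \sum_(k < n) \int[P2]_t (f2 t * \1_(F k) (X2 t))))//.
  by apply/funext => n; apply: eq_bigr => k _; exact: eF.
Qed.

End pi_lambda.

Lemma measurable_ray_gen (R : realType) :
  @measurable _ R = <<s [set B : set R | exists b, B = `]-oo, b]%classic ] >>.
Proof.
rewrite [LHS](RGenOInfty.measurableE R); apply/seteqP; split.
- apply: smallest_sub; first exact: smallest_sigma_algebra.
  move=> _ [b ->].
  rewrite -setCitvl; apply: sigma_algebraC.
  by apply: sub_gen_smallest; exists b.
- apply: smallest_sub; first exact: smallest_sigma_algebra.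
  move=> _ [b ->].
  rewrite -setCitvr; apply: sigma_algebraC.
  by apply: sub_gen_smallest; exists b.
Qed.

Lemma ray_setI (R : realType) :
  setI_closed [set B : set R | exists b, B = `]-oo, b]%classic ].
Proof.
move=> _ _ [a ->] [b ->]; exists (Num.min a b).
by apply/seteqP; split => x /=; rewrite !in_itv/= le_min => /andP.
Qed.

(** * Uniqueness and independence through cosines *)

Section fourier_uniqueness.
Context (R : realType).

Lemma normal_pdf_cos (x e y : R) : 0 < e ->
  normal_pdf x e y =
  normal_peak e * \int[normal_prob 0 e^-1]_t cos (t * (y - x)).
Proof.
move=> e0; rewrite pdfE ?gt_eqF//; congr (_ * _).
have -> : \int[normal_prob 0 e^-1]_t cos (t * (y - x)) =
    \int[normal_prob 0 e^-1]_t cos (0 + (y - x) * (t - 0)).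
  by apply: eq_Rintegral => t _; rewrite add0r subr0 mulrC.
rewrite normal_cos ?invr_eq0 ?gt_eqF// cos0 mul1r; congr expR.
by field; rewrite gt_eqF.
Qed.

Let ray (b : R) : set R := `]-oo, b]%classic.

Let mray b : measurable (ray b). Proof. exact: measurable_itv. Qed.

Definition normal_ray (e b x : R) : R := \int[normal_prob x e]_y \1_(ray b) y.

Let mu := @lebesgue_measure R.

Lemma measurable_normal_pdf2 d (S : measurableType d) (A B : S -> R) (e : R) :
  0 < e -> measurable_fun setT A -> measurable_fun setT B ->
  measurable_fun setT (fun z => normal_pdf (A z) e (B z)).
Proof.
move=> e0 mA mB; rewrite (_ : (fun z => _) = (fun z =>
    normal_peak e * expR (- (B z - A z) ^+ 2 / (e ^+ 2 *+ 2)))); last first.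
  by apply/funext => z; rewrite pdfE// gt_eqF.
apply: measurable_funM => //; apply: measurableT_comp => //.
apply: measurable_funM => //; apply: measurableT_comp => //.
by apply: measurable_funX; apply: measurable_funB.
Qed.

Lemma normal_rayE (e b x : R) : 0 < e ->
  normal_ray e b x = \int[mu]_y (\1_(ray b) y * normal_pdf x e y).
Proof.
move=> e0; rewrite /normal_ray Rint_normal//.
apply: (@rint_bounded _ _ _ _ _ 1); first exact: (indic_measurable (mray b)).
by move=> y; exact: indic_norm_le1.
Qed.

Lemma normal_ray_bound (e b x : R) : 0 <= normal_ray e b x <= 1.
Proof.
rewrite /normal_ray Rint_indic; last exact: mray.
rewrite fine_ge0//= -lee_fin fineK.
  exact: (probability_le1 (normal_prob x e) (mray b)).
exact: (fin_num_measure (normal_prob x e) _ (mray b)).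
Qed.

(** At [x = b] smoothing alone would converge to 1/2. The ray is therefore enlarged by eta =
    1/(n+1), while the deviation eta^2 is smaller still: Chebyshev bounds the loss at [x <= b] by
    (eta^2 / eta)^2. *)
Lemma cvg_normal_ray (b x : R) :
  normal_ray (n.+1%:R^-1 ^+ 2) (b + n.+1%:R^-1) x @[n --> \oo] --> (\1_(ray b) x : R).
Proof.
pose eta n : R := n.+1%:R^-1.
have eta0 n : 0 < eta n by rewrite invr_gt0.
have etac : eta n @[n --> \oo] --> (0 : R) by exact: cvg_harmonic.
have e0 n : eta n ^+ 2 != 0 by rewrite expf_neq0// gt_eqF.
have mabs (c : R) : measurable [set y : R | c <= `|y - x|].
  rewrite (_ : [set y | _] = (fun y : R => `|y - x|) @^-1` `[c, +oo[); last first.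
    by apply/seteqP; split => y /=; rewrite in_itv/= andbT.
  rewrite -[X in measurable X]setTI.
  have mn : measurable_fun setT (fun y : R => `|y - x|).
    by apply: measurableT_comp => //; exact: measurable_funB.
  exact: mn.
have mi (e c : R) A : measurable A -> rintegrable (normal_prob x e) (\1_A : R -> R).
  move=> mA; apply: (@rint_bounded _ _ _ _ _ 1); first exact: (indic_measurable mA).
  by move=> y; exact: indic_norm_le1.
rewrite indicE; have [xb|bx] := boolP (x \in ray b).
- move: xb; rewrite inE /ray/= in_itv/= => xb.
  apply: (@cvg_dist_le _ _ (fun n => eta n * eta n)); last first.
    by rewrite -[X in _ --> X](mulr0 (0:R)); exact: cvgM.
  move=> n; have /andP[h0 h1] := normal_ray_bound (eta n ^+ 2) (b + eta n) x.
  rewrite distrC ger0_norm ?subr_ge0// lerBlDr -lerBlDl.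
  have h : 1 - \int[normal_prob x (eta n ^+ 2)]_y \1_[set y | eta n <= `|y - x|] y
      <= normal_ray (eta n ^+ 2) (b + eta n) x.
    rewrite /normal_ray -(Rint_cst (normal_prob x (eta n ^+ 2)) 1) -RintB; last 2 first.
    - exact: rint_cst.
    - by apply: mi => //; exact: mabs.
    apply: Rint_le.
    - by apply: rintB; [exact: rint_cst|apply: mi => //; exact: mabs].
    - by apply: mi => //; exact: mray.
    - move=> y; rewrite !indicE; case: (boolP (y \in [set y | _])) => [_|].
        by rewrite subrr; case: (_ \in _).
      rewrite notin_setE /= => /negP; rewrite -ltNge ltr_norml => /andP[_ h].
      by rewrite mem_set ?subr0// /ray/= in_itv/=; lra.
  apply: le_trans h; rewrite lerD2l lerN2.
  apply: le_trans (normal_tail x (e0 n) (eta0 n)) _.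
  by rewrite le_eqVlt; apply/orP; left; apply/eqP; field; rewrite gt_eqF.
- move: bx; rewrite notin_setE /ray/= in_itv/= => /negP; rewrite -ltNge => bx.
  pose c := (x - b) / 2; have c0 : 0 < c by rewrite divr_gt0// subr_gt0.
  apply/cvgrPdist_le => r r0.
  have cv : eta n ^+ 2 ^+ 2 / c ^+ 2 @[n --> \oo] --> (0 : R).
    rewrite (_ : 0 = (0 * 0 * (0 * 0)) / c ^+ 2 :> R); last by rewrite !mul0r.
    apply: cvgM; last exact: cvg_cst.
    rewrite (_ : (fun n => _) = (fun n => (eta n * eta n) * (eta n * eta n))); last first.
      by apply/funext => n; rewrite !expr2.
    by apply: cvgM; apply: cvgM.
  move/cvgrPdist_le : cv => /(_ r r0) cv; move/cvgrPdist_lt : etac => /(_ c c0) etac.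
  near=> n.
  have hn : eta n < c.
    have : `|0 - eta n| < c by near: n.
    by rewrite sub0r normrN gtr0_norm.
  have hr : eta n ^+ 2 ^+ 2 / c ^+ 2 <= r.
    have : `|0 - eta n ^+ 2 ^+ 2 / c ^+ 2| <= r by near: n.
    by rewrite sub0r normrN; apply: le_trans; rewrite ler_norm.
  have /andP[h0 h1] := normal_ray_bound (eta n ^+ 2) (b + eta n) x.
  rewrite sub0r normrN ger0_norm//; apply: le_trans hr.
  apply: le_trans (normal_tail x (e0 n) c0).
  apply: Rint_le.
  + by apply: mi => //; exact: mray.
  + by apply: mi => //; exact: mabs.
  + move=> y; rewrite !indicE; case: (boolP (y \in ray _)) => [|_]; last by case: (_ \in _).
    rewrite inE /ray/= in_itv/= => yb; rewrite mem_set//=.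
    rewrite distrC ler_normr; apply/orP; left.
    have {yb} : y <= b + eta n := yb.
    by move: hn; rewrite /c; move: (eta n) => E; lra.
Unshelve. all: by end_near. Qed.

Section one_space.
Context d (T : measurableType d) (P : probability T R).
Variables (X : T -> R) (f : T -> R).
Hypotheses (mX : measurable_fun setT X) (if_ : rintegrable P f).

Let mf := rint_measurable if_.

(** Fourier inversion in real form: the density of the weighted law of [X], smoothed at scale [e],
    is a Gaussian average of its cosine transform. The integrand is bounded by |f|, which justifies
    Fubini. *)
Lemma smooth_cosE (e y : R) : 0 < e ->
  \int[P]_w (f w * normal_pdf (X w) e y) =
  normal_peak e * \int[normal_prob 0 e^-1]_t \int[P]_w (f w * cos (t * y + (- t) * X w)).
Proof.
move=> e0; have einv : e^-1 != 0 by rewrite invr_eq0 gt_eqF.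
have mc : measurable_fun setT (fun z : T * R => f z.1 * cos (z.2 * (y - X z.1))).
  apply: measurable_funM; first exact: measurableT_comp.
  apply: (measurableT_comp (continuous_measurable_fun (@continuous_cos R))).
  apply: measurable_funM => //; apply: measurable_funB => //.
  exact: measurableT_comp.
have mcos t : measurable_fun setT (fun w => cos (t * (y - X w))).
  apply: (measurableT_comp (continuous_measurable_fun (@continuous_cos R))).
  by apply: measurable_funM => //; apply: measurable_funB.
have mcos' w : measurable_fun setT (fun t : R => cos (t * (y - X w))).
  apply: (measurableT_comp (continuous_measurable_fun (@continuous_cos R))).
  by apply: measurable_funM.
transitivity (normal_peak e * \int[P]_w \int[normal_prob 0 e^-1]_t (f w * cos (t * (y - X w)))).
  rewrite -RintZ.
    apply: eq_Rintegral => w _; rewrite normal_pdf_cos// RintZ; first by ring.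
    apply: (@rint_bounded _ _ _ _ _ 1); first exact: mcos'.
    by move=> t; exact: cos_norm_le1.
  have -> : (fun w => \int[normal_prob 0 e^-1]_t (f w * cos (t * (y - X w)))) =
      (fun w => f w * ((normal_peak e)^-1 * normal_pdf (X w) e y)).
    apply/funext => w; rewrite RintZ.
      by rewrite normal_pdf_cos// mulKf// gt_eqF// normal_peak_gt0// gt_eqF.
    apply: (@rint_bounded _ _ _ _ _ 1); first exact: mcos'.
    by move=> t; exact: cos_norm_le1.
  apply: (rint_mul_bounded (M := 1) if_).
    apply: measurable_funM => //.
    exact: measurable_normal_pdf2.
  move=> w; rewrite ger0_norm.
    rewrite mulrC ler_pdivrMr ?mul1r ?normal_peak_gt0 ?gt_eqF//.
    by rewrite normal_pdf_ub// gt_eqF.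
  by rewrite mulr_ge0// ?invr_ge0 ?normal_peak_ge0 ?normal_pdf_ge0.
congr (_ * _).
rewrite (Rint_fubini (m1 := P) (m2 := normal_prob 0 e^-1) (h := fun z => f z.1 * cos (z.2 * (y - X z.1)))).
- apply: eq_Rintegral => t _; apply: eq_Rintegral => w _.
  by rewrite /= mulrBr mulNr.
- have := @rint_prod _ T _ _ R P (normal_prob 0 e^-1)
    (fun z : T * R => f z.1 * cos (z.2 * (y - X z.1))) f mc if_.
  apply => w.
  + apply: (@le_trans _ _ (\int[normal_prob 0 e^-1]_t (`|f w|)%:E)%E).
      apply: ge0_le_integral => //.
      * apply/measurable_EFinP; apply: measurable_norm.
        exact: (measurable_funM (@measurable_cst _ _ _ _ _ (f w)) (mcos' w)).
      * by move=> t _; rewrite /= lee_fin normrM ler_piMr// cos_norm_le1.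
    by rewrite integral_cst//= (@probability_setT _ _ _ (normal_prob 0 e^-1)) mule1.
- move=> w.
  have h : rintegrable (normal_prob 0 e^-1) (fun t : R => cos (t * (y - X w))).
    apply: (@rint_bounded _ _ _ _ _ 1); first exact: mcos'.
    by move=> t; exact: cos_norm_le1.
  exact: (rintZ (f w) h).
- by move=> t; apply: (rint_mul_bounded (M := 1) if_ (mcos t)) => w; exact: cos_norm_le1.
Qed.

Lemma smooth_rayE (e b : R) : 0 < e ->
  \int[P]_w (f w * normal_ray e b (X w)) =
  \int[mu]_y (\1_(ray b) y * \int[P]_w (f w * normal_pdf (X w) e y)).
Proof.
move=> e0; have en0 : e != 0 by rewrite gt_eqF.
have mi : measurable_fun setT (\1_(ray b) : R -> R) by exact: (indic_measurable (mray b)).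
have mpX : measurable_fun setT (fun z : T * R => normal_pdf (X z.1) e z.2).
  by apply: measurable_normal_pdf2 => //; exact: measurableT_comp.
have mc : measurable_fun setT (fun z : T * R => f z.1 * (\1_(ray b) z.2 * normal_pdf (X z.1) e z.2)).
  apply: measurable_funM; first exact: measurableT_comp.
  by apply: measurable_funM => //; exact: measurableT_comp.
have mcw (w : T) : measurable_fun setT (fun y : R => f w * (\1_(ray b) y * normal_pdf (X w) e y)).
  apply: measurable_funM; first exact: measurable_cst.
  by apply: measurable_funM => //; exact: measurable_normal_pdf.
have ipdf w : rintegrable mu (fun y => \1_(ray b) y * normal_pdf (X w) e y).
  have := rint_normalP (X w) e mi; move=> [h _]; apply: h.
  apply: (@rint_bounded _ _ _ _ _ 1); first exact: mi.
  by move=> y; exact: indic_norm_le1.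
have mpw y : measurable_fun setT (fun w => normal_pdf (X w) e y).
  exact: measurable_normal_pdf2.
have ipw y : rintegrable P (fun w => f w * normal_pdf (X w) e y).
  apply: (rint_mul_bounded (M := normal_peak e) if_) => // w.
  by rewrite ger0_norm ?normal_pdf_ge0// normal_pdf_ub.
transitivity (\int[P]_w \int[mu]_y (f w * (\1_(ray b) y * normal_pdf (X w) e y))).
  apply: eq_Rintegral => w _; rewrite normal_rayE//.
  by rewrite RintegralZl//; exact: ipdf.
rewrite (Rint_fubini (m1 := P) (m2 := mu) (h := fun z => f z.1 * (\1_(ray b) z.2 * normal_pdf (X z.1) e z.2))).
- apply: eq_Rintegral => y _; rewrite -RintZ; last exact: ipw.
  by apply: eq_Rintegral => w _; ring.
- have := @rint_prod _ T _ _ R P mu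
    (fun z : T * R => f z.1 * (\1_(ray b) z.2 * normal_pdf (X z.1) e z.2)) f mc if_.
  apply => w.
  + apply: (@le_trans _ _ (\int[mu]_y (`|f w|%:E * (normal_pdf (X w) e y)%:E))%E).
      apply: ge0_le_integral => //.
      * apply/measurable_EFinP; apply: measurable_norm.
        exact: (mcw w).
      * apply/measurable_EFinP; apply: measurable_funM; first exact: measurable_cst.
        exact: measurable_normal_pdf.
      * move=> y _; rewrite /= lee_fin normrM ler_wpM2l// normrM.
        rewrite (ger0_norm (normal_pdf_ge0 (X w) e y)) ler_piMl ?normal_pdf_ge0//.
        exact: indic_norm_le1.
    rewrite ge0_integralZl//.
    * by rewrite integral_normal_pdf mule1.
    * by apply/measurable_EFinP; exact: measurable_normal_pdf.
    * by move=> y _; rewrite lee_fin normal_pdf_ge0.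
- move=> w; exact: (integrableZl measurableT (f w) (ipdf w)).
- move=> y; have := rintZ (\1_(ray b) y) (ipw y).
  by congr (rintegrable _ _); apply/funext => w /=; ring.
Qed.

Lemma cvg_smooth_ray (b : R) :
  \int[P]_w (f w * normal_ray (n.+1%:R^-1 ^+ 2) (b + n.+1%:R^-1) (X w)) @[n --> \oo] -->
  \int[P]_w (f w * \1_(ray b) (X w)).
Proof.
have mr e c : 0 < e -> measurable_fun setT (normal_ray e c).
  move=> e0; rewrite (_ : normal_ray e c = fine \o
      (fun x => \int[mu]_y (\1_(ray c) y * normal_pdf x e y)%:E)%E); last first.
    by apply/funext => x /=; rewrite normal_rayE.
  apply: measurableT_comp => //.
  have := @measurable_fun_fubini_tonelli_F _ _ R (measurableTypeR R) R (@lebesgue_measure R)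
    (fun z : R * R => (\1_(ray c) z.2 * normal_pdf z.1 e z.2)%:E).
  apply; last by move=> z; rewrite lee_fin mulr_ge0 ?normal_pdf_ge0.
  apply/measurable_EFinP; apply: measurable_funM; last by apply: measurable_normal_pdf2.
  by apply: measurableT_comp => //; exact: (indic_measurable (mray c)).
apply: (Rint_dominated (g := fun t => `|f t|) _ _ _ _ _).2.
- move=> n; apply: measurable_funM => //.
  have en0 : 0 < n.+1%:R^-1 ^+ 2 :> R by rewrite exprn_gt0.
  exact: (measurableT_comp (mr _ _ en0) mX).
- apply: measurable_funM => //.
  exact: (measurableT_comp (indic_measurable (mray b)) mX).
- by apply/aeW => w; apply: cvgMr; exact: cvg_normal_ray.
- move=> n w; rewrite normrM ler_piMr//.
  by have /andP[h0 h1] := normal_ray_bound (n.+1%:R^-1 ^+ 2) (b + n.+1%:R^-1) (X w);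
    rewrite ger0_norm.
- exact: rint_norm.
Qed.

End one_space.

Context d1 (T1 : measurableType d1) d2 (T2 : measurableType d2)
  (P1 : probability T1 R) (P2 : probability T2 R).
Variables (X1 : T1 -> R) (X2 : T2 -> R) (f1 : T1 -> R) (f2 : T2 -> R).
Hypotheses (mX1 : measurable_fun setT X1) (mX2 : measurable_fun setT X2).
Hypotheses (if1 : rintegrable P1 f1) (if2 : rintegrable P2 f2).

(* Smoothing X by an independent Gaussian of small variance turns the
   distribution function into an average of the cosines in the hypothesis,
   because the Gaussian density is its own Fourier transform. *)
Lemma weighted_law_cos :
  (forall th t, \int[P1]_w (f1 w * cos (th + t * X1 w)) =
                \int[P2]_w (f2 w * cos (th + t * X2 w))) ->
  forall B, measurable B ->
  \int[P1]_w (f1 w * \1_B (X1 w)) = \int[P2]_w (f2 w * \1_B (X2 w)).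
Proof.
move=> H; apply: (weighted_law_pi mX1 mX2 if1 if2 (@measurable_ray_gen R) (@ray_setI R)).
- have := H 0 0.
  under eq_Rintegral do rewrite mul0r addr0 cos0.
  under [in RHS]eq_Rintegral do rewrite mul0r addr0 cos0.
  under [in X in _ -> X]eq_Rintegral do rewrite indicE in_setT.
  by under [in X in _ -> _ = X]eq_Rintegral do rewrite indicE in_setT.
- move=> _ [b ->].
  have l1 := cvg_smooth_ray mX1 if1 (b := b); have l2 := cvg_smooth_ray mX2 if2 (b := b).
  have E : (fun n : nat => \int[P1]_w (f1 w * normal_ray (n.+1%:R^-1 ^+ 2) (b + n.+1%:R^-1) (X1 w))) =
    (fun n : nat => \int[P2]_w (f2 w * normal_ray (n.+1%:R^-1 ^+ 2) (b + n.+1%:R^-1) (X2 w))).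
    apply/funext => n; have e0 : 0 < n.+1%:R^-1 ^+ 2 :> R by rewrite exprn_gt0.
    rewrite !smooth_rayE//; apply: eq_Rintegral => y _; congr (_ * _).
    by rewrite !smooth_cosE//; congr (_ * _); apply: eq_Rintegral => t _; exact: H.
  move: l1; rewrite E => l1.
  exact: (cvg_unique (@Rhausdorff R) l1 l2).
Qed.

End fourier_uniqueness.

Section nlaw.
Context (R : realType) (s : R).
Let mid : measurable_fun setT (fun x : measurableTypeR R => x : R).
Proof. exact: (@measurable_id _ R setT). Qed.
Let idm : {mfun (measurableTypeR R) >-> R} :=
  HB.pack (fun x : measurableTypeR R => x : R) (isMeasurableFun.Build _ _ _ _ _ mid).
(** Pushing [normal_prob] forward along the identity retypes it, so that it can share a type with
    the Dirac mass in [glaw]. *)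
Definition nlaw : probability R R := distribution (normal_prob 0 s) idm.
Lemma ge0_integral_nlaw (f : R -> \bar R) : measurable_fun setT f -> (forall x, (0 <= f x)%E) ->
  (\int[nlaw]_x f x = \int[normal_prob 0 s]_x f x)%E.
Proof. by move=> mf f0; rewrite ge0_integral_distribution. Qed.
Lemma rint_nlaw (f : R -> R) : rintegrable (normal_prob 0 s) f -> rintegrable nlaw f.
Proof.
move=> hf; have mf : measurable_fun setT f by exact: (rint_measurable hf).
apply/integrableP; split; first exact/measurable_EFinP.
rewrite ge0_integral_nlaw; first by have /integrableP[] := hf.
  by apply/measurable_EFinP; exact: measurable_norm.
by move=> x; exact: abse_ge0.
Qed.
Lemma Rint_nlaw (f : R -> R) : rintegrable (normal_prob 0 s) f -> \int[nlaw]_x f x = \int[normal_prob 0 s]_x f x.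
Proof.
move=> hf; have mf : measurable_fun setT f by exact: (rint_measurable hf).
congr fine; rewrite integral_distribution//; exact/measurable_EFinP.
Qed.
End nlaw.

(** * Integrating out an independent variable *)

Section decoupling.
Context d (T : measurableType d) d' (S : measurableType d') (R : realType)
  (P : probability T R) (gam : probability S R).
Variables (G : set (set T)) (X : T -> S).
Hypotheses (GI : setI_closed G) (GT : G setT)
  (Gm : forall E, G E -> measurable E) (mX : measurable_fun setT X).
Hypothesis indep : forall E B, G E -> measurable B ->
  P (E `&` X @^-1` B) = (P E * gam B)%E.

Local Notation TG := (g_sigma_algebraType G).

Definition to_gen (w : T) : TG := w.

Lemma measurable_to_gen : measurable_fun setT to_gen.
Proof.
move=> _ Y mY; rewrite setTI.
suff : <<s G >> `<=` [set A | measurable A] by move=> /(_ _ mY).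
apply: smallest_sub; last by move=> E /Gm.
split.
- exact: measurable0.
- by move=> A mA; rewrite setTD; apply: measurableC.
- by move=> F mF; apply: bigcup_measurable => k _; exact: mF.
Qed.

Definition with_gen (w : T) : TG * S := (to_gen w, X w).

Lemma measurable_with_gen : measurable_fun setT with_gen.
Proof. exact: (measurable_fun_pair measurable_to_gen mX). Qed.

Let gen_mfun : {mfun T >-> TG} :=
  HB.pack to_gen (isMeasurableFun.Build _ _ _ _ _ measurable_to_gen).

Definition gen_law : probability TG R := distribution P gen_mfun.

Let with_mfun : {mfun T >-> (TG * S)%type} :=
  HB.pack with_gen (isMeasurableFun.Build _ _ _ _ _ measurable_with_gen).

Let law_with A : measurable A ->
  (gen_law \x gam)%E A = distribution P with_mfun A.
Proof.
move=> mA; apply: (product_measure_unique _ mA) => {A mA} A1 B mA1 mB /=.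
rewrite /distribution /pushforward /=.
have -> : with_gen @^-1` (A1 `*` B) = A1 `&` X @^-1` B by [].
have fB : gam B \is a fin_num by exact: fin_num_measure.
have mXB : measurable (X @^-1` B) by rewrite -[X in measurable X]setTI; exact: mX.
have mGT A : <<s G >> A -> measurable A.
  by move=> GA; have := measurable_to_gen measurableT GA; rewrite setTI.
have := @weighted_law_pi _ T _ T _ TG R P P to_gen to_gen (\1_(X @^-1` B))
   (fun=> fine (gam B)) measurable_to_gen measurable_to_gen.
have i1 : rintegrable P (\1_(X @^-1` B) : T -> R).
  by apply: (@rint_bounded _ _ _ _ _ 1); [exact: indic_measurable|exact: indic_norm_le1].
move=> /(_ i1 (rint_cst _ _) G erefl GI) h.
have E A : measurable A -> \int[P]_t (\1_(X @^-1` B) t * \1_A t) = fine (P (A `&` X @^-1` B)).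
  move=> mA; rewrite -Rint_indic; last exact: measurableI.
  by apply: eq_Rintegral => t _; rewrite indicI mulrC.
have E' A : measurable A -> \int[P]_t (fine (gam B) * \1_A t) = fine (gam B) * fine (P A).
  move=> mA; rewrite RintZ ?Rint_indic//.
  by apply: (@rint_bounded _ _ _ _ _ 1); [exact: indic_measurable|exact: indic_norm_le1].
have key A : G A -> \int[P]_t (\1_(X @^-1` B) t * \1_A (to_gen t)) =
    \int[P]_t (fine (gam B) * \1_A (to_gen t)).
  move=> GA; have mA := Gm GA; rewrite E// E'// indep// fineM//; first by rewrite mulrC.
  exact: fin_num_measure.
have {h} := h (key _ GT) key A1 mA1.
have mA1T := mGT _ mA1.
rewrite E// E'// => h.
rewrite -[LHS]fineK; last by apply: fin_num_measure; exact: measurableI.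
by rewrite h EFinM fineK// fineK 1?muleC//; exact: fin_num_measure.
Qed.

(** The first coordinate of [with_gen] sees [w] only through the sigma-algebra of [G]. On rectangles
    the joint law is a product: this is [indep] for sets of [G], extended to the generated
    sigma-algebra by the pi-system lemma. The product law plays the role of conditioning on [G]. *)
Lemma ge0_integral_decouple (F : TG * S -> \bar R) : measurable_fun setT F ->
  (forall z, (0 <= F z)%E) ->
  (\int[P]_w F (w, X w) = \int[(gen_law \x gam)]_z F z)%E.
Proof.
move=> mF F0.
rewrite (eq_measure_integral (distribution P with_mfun)); last first.
  by move=> A mA _; exact: law_with.
by rewrite ge0_integral_distribution.
Qed.

Lemma rint_decouple (F : TG * S -> R) : measurable_fun setT F ->
  rintegrable P (fun w => F (w, X w)) <-> rintegrable (gen_law \x gam)%E F.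
Proof.
move=> mF.
have mE : measurable_fun setT (fun z => (`|F z|)%:E).
  by apply/measurable_EFinP; exact: measurable_norm.
have e := ge0_integral_decouple mE (fun z => normr_ge0 (F z)).
have mc : measurable_fun setT (fun w => F (w, X w)).
  exact: (measurableT_comp mF measurable_with_gen).
split => /integrableP[_ h]; apply/integrableP; split.
- exact/measurable_EFinP.
- by move: h; rewrite [X in (X < _)%E -> _](_ : _ = (\int[P]_w (`|F (w, X w)|)%:E)%E)// e.
- exact/measurable_EFinP.
- by move: h; rewrite [X in (X < _)%E -> _](_ : _ = (\int[(gen_law \x gam)%E]_z (`|F z|)%:E)%E)// -e.
Qed.

Lemma Rint_decouple (F : TG * S -> R) : measurable_fun setT F ->
  rintegrable P (fun w => F (w, X w)) ->
  \int[P]_w F (w, X w) = \int[(gen_law \x gam)%E]_z F z.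
Proof.
move=> mF iF; congr fine.
rewrite (eq_measure_integral (distribution P with_mfun)); last first.
  by move=> A mA _; exact: law_with.
rewrite integral_distribution//.
exact/measurable_EFinP.
Qed.

Lemma gen_lawE (F : TG -> \bar R) : measurable_fun setT F ->
  (forall z, (0 <= F z)%E) -> (\int[gen_law]_w F w = \int[P]_w F w)%E.
Proof. by move=> mF F0; rewrite ge0_integral_distribution. Qed.

End decoupling.

(** * Gibbs weights and their derivatives *)

Section softmax.
Context (R : realType) (I : finType).
Implicit Types (a : I -> R) (g : I -> R -> R).

Definition softmax (a v : I -> R) (k : I) : R :=
  a k * expR (v k) / \sum_i a i * expR (v i).

Lemma softmax_sum_gt0 (a v : I -> R) : (forall i, 0 <= a i) -> 0 < \sum_i a i ->
  0 < \sum_i a i * expR (v i).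
Proof.
move=> a0 s0; have t0 i : 0 <= a i * expR (v i) by rewrite mulr_ge0 ?expR_ge0.
rewrite lt_neqAle sumr_ge0// andbT eq_sym; apply: contraTneq s0 => s0.
have h i : a i = 0.
  have /eqP := psumr_eq0P (fun i _ => t0 i) s0 (erefl true : xpredT i).
  by rewrite mulf_eq0 (gt_eqF (expR_gt0 _)) orbF => /eqP.
by rewrite big1 ?ltxx// => i _; exact: h.
Qed.

Section with_weights.
Variable a : I -> R.
Hypotheses (a0 : forall i, 0 <= a i) (as0 : 0 < \sum_i a i).

Lemma softmax_ge0 v k : 0 <= softmax a v k.
Proof. by rewrite divr_ge0 ?mulr_ge0 ?expR_ge0// ltW// softmax_sum_gt0. Qed.

Lemma sum_softmax v : \sum_k softmax a v k = 1.
Proof. by rewrite -mulr_suml divff// gt_eqF// softmax_sum_gt0. Qed.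

Lemma softmax_le1 v k : softmax a v k <= 1.
Proof.
rewrite -(sum_softmax v) (bigD1 k)//= lerDl; apply: sumr_ge0 => i _.
exact: softmax_ge0.
Qed.

Lemma is_derive_bigsum (s : seq I) (f : I -> R -> R) (df : I -> R) (x : R) :
  (forall i, is_derive x (1 : R) (f i) (df i)) ->
  is_derive x (1 : R) (fun y => \sum_(i <- s) f i y) (\sum_(i <- s) df i).
Proof.
move=> h; elim: s => [|i s IH].
  rewrite big_nil (_ : (fun y => _) = cst 0).
    by apply: is_derive_eq.
  by apply/funext => y; rewrite big_nil.
rewrite big_cons (_ : (fun y => _) = (f i) + (fun y => \sum_(j <- s) f j y)).
  exact: is_deriveD.
by apply/funext => y; rewrite big_cons.
Qed.

Lemma is_derive_aexp i (f : R -> R) (df x : R) : is_derive x (1 : R) f df ->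
  is_derive x (1 : R) (fun y => a i * expR (f y)) (a i * (expR (f x) * df)).
Proof.
move=> h; have d := is_derive1_comp (is_derive_expR _) h.
rewrite (_ : (fun y => _) = a i *: (expR \o f))//.
exact: is_deriveZ.
Qed.

Lemma is_derive_logsum g (dg : I -> R) (x : R) :
  (forall i, is_derive x (1 : R) (g i) (dg i)) ->
  is_derive x (1 : R) (fun y => ln (\sum_i a i * expR (g i y)))
    (\sum_i softmax a (g ^~ x) i * dg i).
Proof.
move=> h; pose S y := \sum_i a i * expR (g i y).
have S0 : 0 < S x by exact: softmax_sum_gt0.
have dS : is_derive x (1 : R) S (\sum_i a i * (expR (g i x) * dg i)).
  exact: (is_derive_bigsum _ (fun i => is_derive_aexp i (h i))).
have := is_derive1_comp (is_derive1_ln S0) dS => d; apply: (is_derive_eq d).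
rewrite mulr_sumr; apply: eq_bigr => i _; rewrite /softmax -/(S x).
by field; rewrite gt_eqF.
Qed.

Lemma is_derive_softmax g (dg : I -> R) (x : R) k :
  (forall i, is_derive x (1 : R) (g i) (dg i)) ->
  is_derive x (1 : R) (fun y => softmax a (g ^~ y) k)
    (softmax a (g ^~ x) k * (dg k - \sum_i softmax a (g ^~ x) i * dg i)).
Proof.
move=> h; pose S y := \sum_i a i * expR (g i y).
have S0 y : 0 < S y by exact: softmax_sum_gt0.
have dS : is_derive x (1 : R) S (\sum_i a i * (expR (g i x) * dg i)).
  exact: (is_derive_bigsum _ (fun i => is_derive_aexp i (h i))).
have dk : is_derive x (1 : R) (fun y => a k * expR (g k y)) (a k * (expR (g k x) * dg k)).
  exact: is_derive_aexp.
have Sx : S x != 0 by rewrite gt_eqF.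
have dV := is_deriveV Sx dS.
have := is_deriveM dk dV => d; apply: (is_derive_eq d).
rewrite /GRing.scale/= /softmax -!/(S x).
have -> : \sum_i a i * expR (g i x) / S x * dg i = (S x)^-1 * \sum_i a i * (expR (g i x) * dg i).
  by rewrite mulr_sumr; apply: eq_bigr => i _; ring.
by field.
Qed.

End with_weights.

Lemma measurable_softmax d (T : measurableType d) (a v : I -> T -> R) k :
  (forall i, measurable_fun setT (a i)) -> (forall i, measurable_fun setT (v i)) ->
  (forall w, 0 < \sum_i a i w * expR (v i w)) ->
  measurable_fun setT (fun w => softmax (a ^~ w) (v ^~ w) k).
Proof.
move=> ma mv s0.
have mt i : measurable_fun setT (fun w => a i w * expR (v i w)).
  by apply: measurable_funM => //; exact: measurable_exp.
have ms : measurable_fun setT (fun w => \sum_i a i w * expR (v i w)).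
  exact: measurable_sum.
(* The quotient is written with the exponential of minus a logarithm, which reduces measurability to
   that of [expR] and [ln]. *)
rewrite (_ : (fun w => _) = (fun w => a k w * expR (v k w) *
    expR (- ln (\sum_i a i w * expR (v i w))))).
  apply: measurable_funM => //; apply: measurable_exp; apply: measurable_funN.
  exact: measurable_log.
by apply/funext => w; rewrite expRN lnK// posrE.
Qed.

End softmax.

(** * Independence of a Gaussian variable from a pi-system *)

Section gaussian_independence.
Context d (T : measurableType d) (R : realType) (P : probability T R).

(** Intersecting one event of [W] with one event of [f] keeps a pi-system, and it describes [W] and
    [f] jointly. *)
Definition absorb (W : set (set T)) (f : T -> R) : set (set T) :=
  [set A | exists E B, [/\ W E, measurable B & A = E `&` f @^-1` B]].

Fixpoint absorb_all (n : nat) (Y : nat -> T -> R) (W : set (set T)) :=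
  if n is m.+1 then absorb_all m Y (absorb W (Y m)) else W.

Lemma absorb_setI W f : setI_closed W -> setI_closed (absorb W f).
Proof.
move=> WI _ _ [E1 [B1 [W1 m1 ->]]] [E2 [B2 [W2 m2 ->]]].
exists (E1 `&` E2), (B1 `&` B2); split; [exact: WI|exact: measurableI|].
by rewrite preimage_setI setIACA.
Qed.

Lemma absorb_measurable W f : measurable_fun setT f ->
  (forall E, W E -> measurable E) -> forall E, absorb W f E -> measurable E.
Proof.
move=> mf Wm _ [E [B [WE mB ->]]]; apply: measurableI; first exact: Wm.
by rewrite -[X in measurable X]setTI; exact: mf.
Qed.

Lemma absorb_sub W f : W `<=` absorb W f.
Proof. by move=> E WE; exists E, setT; split => //; rewrite preimage_setT setIT. Qed.

Lemma absorb_pre (W : set (set T)) f B : W setT -> measurable B -> absorb W f (f @^-1` B).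
Proof. by move=> WT mB; exists setT, B; rewrite setTI. Qed.

Variables (Y : nat -> T -> R).
Hypothesis mY : forall i, measurable_fun setT (Y i).

Lemma absorb_all_setI n W : setI_closed W -> setI_closed (absorb_all n Y W).
Proof. by elim: n W => //= n IH W WI; apply: IH; exact: absorb_setI. Qed.

Lemma absorb_all_measurable n W :
  (forall E, W E -> measurable E) -> forall E, absorb_all n Y W E -> measurable E.
Proof. by elim: n W => //= n IH W WI; apply: IH; exact: absorb_measurable. Qed.

Lemma absorb_all_sub n W : W `<=` absorb_all n Y W.
Proof.
by elim: n W => [|n IH] W E WE //=; apply: IH; exact: absorb_sub.
Qed.

Lemma absorb_all_pre n (W : set (set T)) i B : W setT -> (i < n)%N -> measurable B ->
  absorb_all n Y W (Y i @^-1` B).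
Proof.
elim: n W => //= n IH W WT; rewrite ltnS leq_eqVlt => /orP[/eqP-> mB|iN mB].
  by apply: absorb_all_sub; exact: absorb_pre.
by apply: IH => //; exact: absorb_sub.
Qed.

Variables (X : T -> R) (e : R -> R).
Hypothesis mX : measurable_fun setT X.

(** The transform of [X] factors out, jointly with the events of [W] and the first [n] variables
    [Y]. At [n = 0] this is independence of [X] from [W] in Fourier form; the next lemmas trade the
    variables [Y] for events one by one. *)
Definition cos_factor n (W : set (set T)) : Prop := forall E (c : nat -> R) th t, W E ->
  \int[P]_w (\1_E w * cos (th + t * X w + \sum_(i < n) c i * Y i w)) =
  e t * \int[P]_w (\1_E w * cos (th + \sum_(i < n) c i * Y i w)).

Let cos_prod (a b : R) : cos a * cos b = 2^-1 * (cos (a + b) + cos (a - b)).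
Proof. by rewrite cosD cosB; field. Qed.

Let mlin n (c : nat -> R) : measurable_fun setT (fun w => \sum_(i < n) c i * Y i w).
Proof. by apply: measurable_sum => i; exact: measurable_funM. Qed.

Let icos E (g : T -> R) : measurable E -> measurable_fun setT g ->
  rintegrable P (fun w => \1_E w * cos (g w)).
Proof.
move=> mE mg; apply: (@rint_bounded _ _ _ _ _ 1).
  by apply: measurable_funM; [exact: indic_measurable|exact: measurable_cos].
by move=> t; rewrite normrM mulr_ile1// ?indic_norm_le1// cos_norm_le1.
Qed.

(** Multiplied by [cos (et + r * Y n)], the integrand becomes a half-sum of cosines covered by the
    hypothesis at [n.+1]. Cosine transforms determine the weighted law of [Y n], so the cosine of
    [Y n] may be replaced by the indicator of any of its events. *)
Lemma cos_factor_absorb n W : (forall E, W E -> measurable E) ->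
  cos_factor n.+1 W -> cos_factor n (absorb W (Y n)).
Proof.
move=> Wm H _ c th t [E [B [WE mB ->]]]; have mE := Wm _ WE.
pose f1 w := \1_E w * cos (th + t * X w + \sum_(i < n) c i * Y i w).
pose f2 w := e t * (\1_E w * cos (th + \sum_(i < n) c i * Y i w)).
have if1 : rintegrable P f1.
  by apply: icos => //; apply: measurable_funD => //; apply: measurable_funD => //; exact: measurable_funM.
have if2 : rintegrable P f2.
  by apply: rintZ; apply: icos => //; exact: measurable_funD.
have H' : forall et r, \int[P]_w (f1 w * cos (et + r * Y n w)) =
    \int[P]_w (f2 w * cos (et + r * Y n w)).
  move=> et r; pose c' (r : R) (i : nat) := if i == n then r else c i.
  have E1 r' w : \sum_(i < n.+1) c' r' i * Y i w = \sum_(i < n) c i * Y i w + r' * Y n w.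
    rewrite big_ord_recr/= /c' eqxx; congr (_ + _).
    by apply: eq_bigr => i _; rewrite ltn_eqF.
  have ms r' th' : measurable_fun setT (fun w => th' + t * X w + \sum_(i < n.+1) c' r' i * Y i w).
    by apply: measurable_funD => //; apply: measurable_funD => //; exact: measurable_funM.
  have ms' r' th' : measurable_fun setT (fun w => th' + \sum_(i < n.+1) c' r' i * Y i w).
    exact: measurable_funD.
  transitivity (\int[P]_w (2^-1 *
     (\1_E w * cos (th + et + t * X w + \sum_(i < n.+1) c' r i * Y i w) +
      \1_E w * cos (th - et + t * X w + \sum_(i < n.+1) c' (- r) i * Y i w)))).
    apply: eq_Rintegral => w _; rewrite /f1 -mulrA cos_prod mulrCA -mulrDr !E1.
    by congr (_ * (_ * (cos _ + cos _))); ring.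
  rewrite RintZ; last by apply: rintD; exact: icos.
  rewrite RintD; [|exact: icos..].
  rewrite !H// -mulrDr -RintD; [|exact: icos..].
  rewrite mulrCA -RintZ; last by apply: rintD; exact: icos.
  rewrite -RintZ; last by apply: rintZ; apply: rintD; exact: icos.
  apply: eq_Rintegral => w _; rewrite /f2 -!mulrA cos_prod -mulrDr !E1; congr (_ * _).
  by rewrite mulrCA; congr (_ * (_ * (cos _ + cos _))); ring.
have := weighted_law_cos (mY n) (mY n) if1 if2 H' mB.
rewrite /f1 /f2 => h.
transitivity (\int[P]_w (\1_E w * cos (th + t * X w + \sum_(i < n) c i * Y i w) * \1_B (Y n w))).
  by apply: eq_Rintegral => w _; rewrite indicI indic_comp /=; ring.
rewrite h -RintZ.
  by apply: eq_Rintegral => w _; rewrite indicI indic_comp /=; ring.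
apply: icos; last exact: measurable_funD.
by apply: measurableI => //; rewrite -[X in measurable X]setTI; exact: mY.
Qed.

Lemma cos_factor_absorb_all n W : (forall E, W E -> measurable E) ->
  cos_factor n W -> cos_factor 0 (absorb_all n Y W).
Proof.
elim: n W => //= n IH W Wm H; apply: IH; first exact: absorb_measurable.
exact: cos_factor_absorb.
Qed.

(** For fixed [E], the law of [X] weighted by the indicator of [E] and the multiple P(E) of [gam]
    have the same cosine transform, hence coincide. *)
Lemma cos_factor_law (gam : probability R R) W :
  (forall E, W E -> measurable E) -> cos_factor 0 W ->
  (forall th t, \int[gam]_x cos (th + t * x) = cos th * e t) ->
  forall E B, W E -> measurable B -> P (E `&` X @^-1` B) = (P E * gam B)%E.
Proof.
move=> Wm H hg E B WE mB; have mE := Wm _ WE.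
have mXB : measurable (X @^-1` B) by rewrite -[X in measurable X]setTI; exact: mX.
have i1 : rintegrable P (\1_E : T -> R).
  by apply: (@rint_bounded _ _ _ _ _ 1); [exact: indic_measurable|exact: indic_norm_le1].
have i2 : rintegrable gam (fun=> fine (P E)) by exact: rint_cst.
have mid : measurable_fun setT (id : R -> R) by exact: measurable_id.
have h := weighted_law_cos mX mid i1 i2 _ mB.
have {}h : \int[P]_w (\1_E w * \1_B (X w)) = \int[gam]_w (fine (P E) * \1_B w).
  apply: h => th t.
  transitivity (\int[P]_w (\1_E w * cos (th + t * X w + \sum_(i < 0) 0 * Y i w))).
    by apply: eq_Rintegral => w _; rewrite big_ord0 addr0.
  rewrite (H E (fun=> 0) th t WE).
  transitivity (e t * \int[P]_w (cos th * \1_E w)).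
    by congr (_ * _); apply: eq_Rintegral => w _; rewrite big_ord0 addr0 mulrC.
  rewrite RintZ// Rint_indic// [RHS]RintZ ?hg; first by ring.
  apply: (@rint_bounded _ _ _ _ _ 1); last by move=> x; exact: cos_norm_le1.
  by apply: measurable_cos; apply: measurable_funD => //; exact: measurable_funM.
rewrite -[LHS]fineK; last by apply: fin_num_measure; exact: measurableI.
rewrite -Rint_indic; last exact: measurableI.
transitivity ((\int[P]_w (\1_E w * \1_B (X w)))%:E).
  by congr EFin; apply: eq_Rintegral => w _; rewrite indicI indic_comp.
rewrite h RintZ ?Rint_indic// ?EFinM ?fineK//; try exact: fin_num_measure.
by apply: (@rint_bounded _ _ _ _ _ 1); [exact: indic_measurable|exact: indic_norm_le1].
Qed.

End gaussian_independence.

(** * Centered Gaussian laws, degenerate ones included *)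

Section gaussian_law.
Context (R : realType) (s : R).

Definition glaw : probability R R := 
  if s == 0 then (\d_(0 : R) : probability R R) else nlaw s.

Lemma glawE (B : set R) :
  glaw B = if s == 0 then \d_(0 : R) B else normal_prob 0 s B.
Proof. by rewrite /glaw; case: ifP. Qed.

Lemma rint_dirac (f : R -> R) : measurable_fun setT f ->
  rintegrable (\d_(0 : R)) f /\ \int[\d_(0 : R)]_x f x = f 0.
Proof.
move=> mf; have mE : measurable_fun setT (EFin \o f) by exact/measurable_EFinP.
split; last by rewrite /Rintegral integral_dirac//= indicT mul1r.
apply/integrableP; split => //; rewrite integral_dirac//.
  by rewrite diracT mul1e ltry.
exact: measurableT_comp.
Qed.

Lemma glaw_growth (f : R -> R) (C : R) : measurable_fun setT f ->
  (forall x, `|f x| <= C * expR `|x|) -> rintegrable glaw f.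
Proof.
move=> mf fC; rewrite /glaw; case: (eqVneq s 0) => [_|s0].
  by case: (rint_dirac mf).
apply: rint_nlaw; apply: (rint_growth_normal s0 (C := C)) => // x.
by rewrite subr0.
Qed.

Lemma glaw_cos (th t : R) :
  \int[glaw]_x cos (th + t * x) = cos th * expR (- (s ^+ 2 * t ^+ 2) / 2).
Proof.
have mf : measurable_fun setT (fun x : R => cos (th + t * x)).
  by apply: measurable_cos; apply: measurable_funD => //; exact: measurable_funM.
rewrite /glaw; case: (eqVneq s 0) => [->|s0].
  by rewrite (rint_dirac mf).2 mulr0 addr0 expr0n/= mul0r oppr0 mul0r expR0 mulr1.
rewrite Rint_nlaw; last first.
  by apply: (@rint_bounded _ _ _ _ _ 1) => // x; exact: cos_norm_le1.
by rewrite -(normal_cos 0 s0); apply: eq_Rintegral => x _; rewrite subr0.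
Qed.

Lemma glaw_stein (phi phi' : R -> R) (M : R) :
  (forall x, is_derive x (1 : R) phi (phi' x)) -> continuous phi' ->
  (forall x, `|phi x| <= M * (1 + `|x|)) -> (forall x, `|phi' x| <= M) ->
  \int[glaw]_x (x * phi x) = s ^+ 2 * \int[glaw]_x (phi' x).
Proof.
move=> dphi cphi' phiM phi'M.
have cphi : continuous phi by move=> x; exact: is_derive1_continuous (dphi x).
have mphi : measurable_fun setT phi by exact: continuous_measurable_fun.
have mphi' : measurable_fun setT phi' by exact: continuous_measurable_fun.
have mx : measurable_fun setT (fun x : R => x * phi x) by exact: measurable_funM.
rewrite /glaw; case: (eqVneq s 0) => [->|s0].
  by rewrite (rint_dirac mx).2 expr0n/= !mul0r.
have phiM' x : `|phi x| <= M * (1 + `|x - 0|) by rewrite subr0.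
have h := normal_stein s0 dphi cphi' phiM' phi'M.
rewrite !Rint_nlaw.
- by rewrite -h; apply: eq_Rintegral => x _; rewrite subr0.
- by apply: (@rint_bounded _ _ _ _ _ M); first exact: mphi'.
- apply: (@rint_growth_normal _ _ _ s0 _ (4 * `|M|)); first exact: mx.
  move=> x; rewrite normrM subr0.
  apply: (@le_trans _ _ (`|x| * (`|M| * (1 + `|x|)))).
    rewrite ler_wpM2l// (le_trans (phiM x))//.
    by apply: ler_wpM2r; [exact: addr_ge0|exact: ler_norm].
  set y := `|x|; have y0 : 0 <= y := normr_ge0 _.
  have -> : y * (`|M| * (1 + y)) = `|M| * (y * (1 + y)) by ring.
  have -> : 4 * `|M| * expR y = `|M| * (4 * expR y) by ring.
  apply: ler_wpM2l => //.
  have e1 := expR_ge1Dx (y / 2).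
  have -> : expR y = expR (y / 2) ^+ 2 by rewrite expr2 -expRD; congr expR; field.
  have : (1 + y / 2) ^+ 2 <= expR (y / 2) ^+ 2.
    by rewrite ler_pXn2r// ?nnegrE ?expR_ge0//; lra.
  by move: (expR (y/2) ^+ 2) => z; nra.
Qed.

Lemma glaw_sqr : rintegrable glaw (fun x => x ^+ 2) /\ \int[glaw]_x (x ^+ 2) = s ^+ 2.
Proof.
have mx : measurable_fun setT (fun x : R => x ^+ 2) by exact: measurable_funX.
rewrite /glaw; case: (eqVneq s 0) => [->|s0].
  by have [? ->] := rint_dirac mx; rewrite expr0n.
have [i e] := normal_variance 0 s0.
have i' : rintegrable (normal_prob 0 s) (fun x : R => x ^+ 2).
  by move: i; congr (rintegrable _ _); apply/funext => x; rewrite subr0.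
split; first exact: rint_nlaw.
by rewrite Rint_nlaw// -e; apply: eq_Rintegral => x _; rewrite subr0.
Qed.

Lemma glaw_exp (c : R) : rintegrable glaw (fun x => expR (c * x)) /\
  \int[glaw]_x expR (c * x) = expR (c ^+ 2 * s ^+ 2 / 2).
Proof.
have mx : measurable_fun setT (fun x : R => expR (c * x)).
  by apply: measurable_exp; exact: measurable_funM.
rewrite /glaw; case: (eqVneq s 0) => [->|s0].
  by have [? ->] := rint_dirac mx; rewrite expr0n/= !mulr0 mul0r.
have i : rintegrable (normal_prob 0 s) (fun x : R => expR (c * x)).
  have := rint_exp_normal 0 s0 c.
  by congr (rintegrable _ _); apply/funext => x; rewrite subr0.
split; first exact: rint_nlaw.
rewrite Rint_nlaw// Rint_normal//.
transitivity (\int[lebesgue_measure]_x (expR (c ^+ 2 * s ^+ 2 / 2) * normal_pdf (c * s ^+ 2) s x)).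
  apply: eq_Rintegral => x _.
  rewrite !pdfE// mulrCA -expRD mulrCA -expRD; congr (_ * expR _).
  by field.
rewrite RintegralZl//; last exact: integrable_normal_pdf.
by rewrite /Rintegral integral_normal_pdf mulr1.
Qed.

End gaussian_law.

Section law_transfer.
Context d (T : measurableType d) (R : realType) (P : probability T R)
  (gam : probability R R) (X : T -> R).
Hypotheses (mX : measurable_fun setT X)
  (XL : forall B, measurable B -> P (X @^-1` B) = gam B).

Let Xm : {mfun T >-> R} := HB.pack X (isMeasurableFun.Build _ _ _ _ _ mX).

Lemma ge0_law (f : R -> \bar R) : measurable_fun setT f -> (forall x, (0 <= f x)%E) ->
  (\int[P]_w f (X w) = \int[gam]_x f x)%E.
Proof.
move=> mf f0.
rewrite (eq_measure_integral (distribution P Xm)); last first.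
  by move=> A mA _; exact: (esym (XL mA)).
by rewrite ge0_integral_distribution.
Qed.

Lemma rint_law (f : R -> R) : rintegrable gam f -> rintegrable P (fun w => f (X w)).
Proof.
move=> hf; have mf := rint_measurable hf; have /integrableP[_ h] := hf.
apply/integrableP; split.
  by apply/measurable_EFinP; exact: (measurableT_comp mf mX).
have mn : measurable_fun setT (fun x => `|(f x)%:E|)%E.
  by apply/measurable_EFinP; exact: measurable_norm.
by have := ge0_law mn (fun x => abse_ge0 _) => /= ->.
Qed.

Lemma Rint_law (f : R -> R) : rintegrable gam f ->
  \int[P]_w f (X w) = \int[gam]_x f x.
Proof.
move=> hf; have mf := rint_measurable hf.
congr fine; rewrite [RHS](eq_measure_integral (distribution P Xm)); last first.
  by move=> A mA _; exact: (esym (XL mA)).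
rewrite integral_distribution//; first exact/measurable_EFinP.
exact: (rint_law hf).
Qed.

End law_transfer.

Lemma cos_law d (T : measurableType d) (R : realType) (P : probability T R)
    (X : T -> R) (s : R) : measurable_fun setT X ->
  (forall th t, \int[P]_w cos (th + t * X w) = cos th * expR (- (s ^+ 2 * t ^+ 2) / 2)) ->
  forall B, measurable B -> P (X @^-1` B) = glaw s B.
Proof.
move=> mX H B mB.
have mid : measurable_fun setT (id : R -> R) by exact: measurable_id.
have h := weighted_law_cos mX mid (rint_cst P 1) (rint_cst (glaw s) 1) _ mB.
have {}h : \int[P]_w (1 * \1_B (X w)) = \int[glaw s]_x (1 * \1_B x).
  apply: h => th t.
  transitivity (\int[P]_w cos (th + t * X w)); first by apply: eq_Rintegral => w _; rewrite mul1r.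
  by rewrite H -glaw_cos; apply: eq_Rintegral => w _; rewrite mul1r.
have mXB : measurable (X @^-1` B) by rewrite -[X in measurable X]setTI; exact: mX.
rewrite -[LHS]fineK; last exact: fin_num_measure.
rewrite -[RHS]fineK; last exact: fin_num_measure.
rewrite -!Rint_indic//; congr EFin.
transitivity (\int[P]_w (1 * \1_B (X w))).
  by apply: eq_Rintegral => w _; rewrite mul1r indic_comp.
by rewrite h; apply: eq_Rintegral => w _; rewrite mul1r.
Qed.

Lemma cvg_bigsum (R : realType) (T : Type) (F : set_system T) (FF : Filter F)
    (I : Type) (s : seq I) (f : I -> T -> R) (l : I -> R) :
  (forall i, f i x @[x --> F] --> l i) ->
  \sum_(i <- s) f i x @[x --> F] --> \sum_(i <- s) l i.
Proof.
move=> h; elim: s => [|i s IH].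
  rewrite big_nil (_ : (fun x => _) = cst 0); first exact: cvg_cst.
  by apply/funext => x; rewrite big_nil.
rewrite big_cons (_ : (fun x => _) = (fun x => f i x + \sum_(j <- s) f j x)).
  exact: cvgD.
by apply/funext => x; rewrite big_cons.
Qed.

(** * Gaussian interpolation *)

Section gibbs_ibp.
Context d (T : measurableType d) (R : realType) (P : probability T R)
  (I : finType).
Variables (W : set (set T)) (X : T -> R) (V c : I -> T -> R) (s : R) (kappa : I -> R).
Hypotheses (WI : setI_closed W) (WT : W setT) (Wm : forall E, W E -> measurable E).
Hypotheses (mX : measurable_fun setT X) (mV : forall i, measurable_fun setT (V i)).
Hypotheses (cW : forall i B, measurable B -> <<s W >> (c i @^-1` B))
  (c0 : forall i w, 0 <= c i w) (cs : forall w, 0 < \sum_i c i w).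
Hypothesis kappa0 : s = 0 -> forall i, kappa i = 0.
Hypothesis H : forall E (b : I -> R) th t, W E ->
  \int[P]_w (\1_E w * cos (th + t * X w + \sum_i b i * V i w)) =
  expR (- (s ^+ 2 * t ^+ 2 + 2 * t * \sum_i b i * kappa i) / 2) *
  \int[P]_w (\1_E w * cos (th + \sum_i b i * V i w)).

(** Regression coefficient of [V i] on [X]: the residual [U i] is uncorrelated with [X], hence
    independent of it. At [s = 0] the quotient is 0, and so is [kappa i]. *)
Let lam i := kappa i / s ^+ 2.

Let lamE i : s ^+ 2 * lam i = kappa i.
Proof.
rewrite /lam; have [s0|s0] := eqVneq s 0; last by rewrite mulrC divfK// expf_neq0.
by rewrite kappa0// mul0r mulr0.
Qed.

Let U i w := V i w - lam i * X w.

Let mU i : measurable_fun setT (U i).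
Proof. by apply: measurable_funB => //; exact: measurable_funM. Qed.

Variable k : I.

Let Y (m : nat) := U (nth k (enum I) m).

Let n := #|I|.

Let Ysum (b : nat -> R) w :
  \sum_(m < n) b m * Y m w = \sum_i b (enum_rank i) * U i w.
Proof.
rewrite (reindex (@enum_rank I)) /=; last first.
  by exists enum_val => i _; rewrite ?enum_rankK ?enum_valK.
by apply: eq_bigr => i _; rewrite /Y nth_enum_rank.
Qed.

(** With K the sum of the a_i lam_i, the combination of residuals leaves [t - K] in front of [X],
    and s^2 (t - K)^2 + 2 (t - K) s^2 K = s^2 t^2 - s^2 K^2: the dependence on [t] separates from
    that on K. *)
Let factor : cos_factor P Y X (fun t => expR (- (s ^+ 2 * t ^+ 2) / 2)) n W.
Proof.
move=> E b th t WE.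
pose a (i : I) := b (enum_rank i); pose K := \sum_i a i * lam i.
have E1 t' w : th + t' * X w + \sum_(m < n) b m * Y m w =
    th + (t' - K) * X w + \sum_i a i * V i w.
  rewrite Ysum mulrBl -!addrA; congr (_ + (_ + _)).
  rewrite /K mulr_suml -sumrN -big_split/=; apply: eq_bigr => i _.
  by rewrite /U /a; ring.
have EK : \sum_i a i * kappa i = s ^+ 2 * K.
  by rewrite /K mulr_sumr; apply: eq_bigr => i _; rewrite -lamE; ring.
transitivity (\int[P]_w (\1_E w * cos (th + (t - K) * X w + \sum_i a i * V i w))).
  by apply: eq_Rintegral => w _; rewrite E1.
rewrite H// EK.
have -> : \int[P]_w (\1_E w * cos (th + \sum_(m < n) b m * Y m w)) =
    \int[P]_w (\1_E w * cos (th + (0 - K) * X w + \sum_i a i * V i w)).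
  by apply: eq_Rintegral => w _; rewrite -E1 mul0r addr0.
rewrite H// EK [RHS]mulrA -expRD; congr (expR _ * _).
by field.
Qed.

Let G := absorb_all n Y W.

Let GI : setI_closed G. Proof. exact: absorb_all_setI. Qed.
Let GT : G setT. Proof. exact: absorb_all_sub. Qed.
Let Gm : forall E, G E -> measurable E.
Proof. by apply: absorb_all_measurable => // i; exact: mU. Qed.

Let indepG E B : G E -> measurable B -> P (E `&` X @^-1` B) = (P E * glaw s B)%E.
Proof.
have f0 := cos_factor_absorb_all (fun i => mU _) mX Wm factor.
exact: (cos_factor_law mX Gm f0 (glaw_cos s)).
Qed.

Local Notation TG := (g_sigma_algebraType G).
Local Notation sm := (fun z : TG * R => softmax (c ^~ z.1) (fun i => U i z.1 + lam i * z.2)).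

Let mcG i : measurable_fun (setT : set TG) (c i).
Proof.
move=> _ B mB; rewrite setTI.
suff h : <<s W >> `<=` <<s G >> by exact: (h _ (cW i mB)).
apply: smallest_sub; first exact: smallest_sigma_algebra.
by move=> E WE; apply: sub_gen_smallest; exact: absorb_all_sub.
Qed.

Let mUG i : measurable_fun (setT : set TG) (U i).
Proof.
move=> _ B mB; rewrite setTI; apply: sub_gen_smallest.
have -> : U i = Y (enum_rank i) by rewrite /Y nth_enum_rank.
apply: absorb_all_pre => //; exact: ltn_ord.
Qed.

Let smV w i : softmax (c ^~ w) (V ^~ w) i = sm (w, X w) i.
Proof.
rewrite /= (_ : (fun j => U j w + lam j * X w) = V ^~ w)//.
by apply/funext => j; rewrite /U subrK.
Qed.

Let msm i : measurable_fun setT (fun z : TG * R => sm z i).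
Proof.
apply: (@measurable_softmax _ _ _ (TG * R)%type (fun i z => c i z.1)
  (fun i z => U i z.1 + lam i * z.2)).
- by move=> j; exact: (measurableT_comp (mcG j) (@measurable_fst _ _ TG R)).
- move=> j; apply: measurable_funD.
    exact: (measurableT_comp (mUG j) (@measurable_fst _ _ TG R)).
  by apply: measurable_funM => //; exact: measurable_snd.
- by move=> z; apply: softmax_sum_gt0.
Qed.

Let sm01 z i : 0 <= sm z i <= 1.
Proof. by rewrite softmax_ge0 ?softmax_le1. Qed.

(** Gaussian integration by parts against a Gibbs weight. With the weights [c] and the residuals [U]
    frozen, the softmax is a smooth function of the single Gaussian variable [X], and its derivative
    involves the slopes [lam]. Stein's identity on the line brings a factor s^2, which turns [lam]
    into the covariances [kappa]. *)
Lemma gibbs_ibp :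
  rintegrable P X /\
  \int[P]_w (X w * softmax (c ^~ w) (V ^~ w) k) =
  \int[P]_w (softmax (c ^~ w) (V ^~ w) k *
     (kappa k - \sum_i softmax (c ^~ w) (V ^~ w) i * kappa i)).
Proof.
have mxx : measurable_fun setT (fun x : R => x) by exact: measurable_id.
have ix : rintegrable (glaw s) (fun x => x).
  apply: (@glaw_growth _ _ _ 1) => // x; rewrite mul1r; exact: expR_id_le.
have XL B : measurable B -> P (X @^-1` B) = glaw s B.
  move=> mB; have := indepG GT mB; rewrite setTI => ->.
  by rewrite (@probability_setT _ _ _ P) mul1e.
split; first exact: (rint_law mX XL ix).
pose M := \int[glaw s]_x `|x|.
pose dsm (z : TG * R) := sm z k * (lam k - \sum_i sm z i * lam i).
pose F1 (z : TG * R) := z.2 * sm z k.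
pose F2 (z : TG * R) := s ^+ 2 * dsm z.
pose L := \sum_i `|lam i|.
have dsmL z : `|dsm z| <= 1 * (L + L).
  have [a0 a1] := andP (sm01 z k).
  rewrite normrM; apply: ler_pM => //; first by rewrite ger0_norm.
  apply: (le_trans (ler_normB _ _)); apply: lerD.
    by rewrite /L (bigD1 k)//= lerDl; apply: sumr_ge0.
  apply: (le_trans (ler_norm_sum _ _ _)); apply: ler_sum => i _.
  have [b0 b1] := andP (sm01 z i).
  by rewrite normrM ler_piMl// ger0_norm.
have mF1 : measurable_fun setT F1.
  by apply: measurable_funM => //; exact: measurable_snd.
have mdsm : measurable_fun setT dsm.
  apply: measurable_funM => //; apply: measurable_funB => //.
  by apply: measurable_sum => i; exact: measurable_funM.
have mF2 : measurable_fun setT F2 by exact: measurable_funM.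
have mF1w w : measurable_fun setT (fun x : R => F1 (w, x)).
  exact: (measurableT_comp mF1 (@pair1_measurable _ _ TG R w)).
have mF2w w : measurable_fun setT (fun x : R => F2 (w, x)).
  exact: (measurableT_comp mF2 (@pair1_measurable _ _ TG R w)).
pose GL := gen_law P Gm.
have F1le z : `|F1 z| <= `|z.2|.
  have [a0 a1] := andP (sm01 z k).
  by rewrite normrM ler_piMr// ger0_norm.
have F2le z : `|F2 z| <= s ^+ 2 * (1 * (L + L)).
  by rewrite normrM (ger0_norm (sqr_ge0 s)) ler_wpM2l ?sqr_ge0.
have i1w w : rintegrable (glaw s) (fun x => F1 (w, x)).
  by apply: (rint_le (mF1w w) _ (rint_norm ix)) => x; exact: F1le.
have i2w w : rintegrable (glaw s) (fun x => F2 (w, x)).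
  by apply: (rint_bounded (glaw s) (mF2w w)) => x; exact: F2le.
have i1 : rintegrable (GL \x glaw s)%E F1.
  apply: (@rint_prod _ _ _ _ _ GL (glaw s) F1 (fun=> M) mF1); first exact: rint_cst.
  move=> w; apply: (@le_trans _ _ (\int[glaw s]_x (`|x|)%:E)%E).
    apply: ge0_le_integral => //.
    - by apply/measurable_EFinP; exact: measurable_norm.
    - by apply/measurable_EFinP; exact: measurable_norm.
    - by move=> x _; rewrite lee_fin F1le.
  rewrite -EFin_Rint; last exact: rint_norm.
  by rewrite lee_fin ler_norm.
have i2 : rintegrable (GL \x glaw s)%E F2.
  apply: (@rint_prod _ _ _ _ _ GL (glaw s) F2 (fun=> s ^+ 2 * (1 * (L + L))) mF2).
    exact: rint_cst.
  move=> w; apply: (@le_trans _ _ (\int[glaw s]_x (cst (s ^+ 2 * (1 * (L + L)))%:E x))%E).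
    apply: ge0_le_integral => //.
    - by apply/measurable_EFinP; exact: measurable_norm.
    - by move=> x _; rewrite lee_fin F2le.
  rewrite integral_cst//= (@probability_setT _ _ _ (glaw s)) mule1 lee_fin.
  exact: ler_norm.
transitivity (\int[P]_w F1 (w, X w)).
  by apply: eq_Rintegral => w _; rewrite smV.
have p1 : rintegrable P (fun w => F1 (w, X w)) by apply/(rint_decouple GI GT Gm mX indepG mF1).
have p2 : rintegrable P (fun w => F2 (w, X w)) by apply/(rint_decouple GI GT Gm mX indepG mF2).
rewrite (Rint_decouple GI GT Gm mX indepG mF1 p1).
transitivity (\int[P]_w F2 (w, X w)); last first.
  apply: eq_Rintegral => w _; rewrite /F2 /dsm !smV mulrCA; congr (_ * _).
  rewrite mulrBr lamE mulr_sumr; congr (_ - _); apply: eq_bigr => i _.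
  by rewrite smV -(lamE i); ring.
rewrite (Rint_decouple GI GT Gm mX indepG mF2 p2).
(* From here on [w] is fixed, and the claim is Stein's identity in the second coordinate. *)
rewrite !Rint_prod//; apply: eq_Rintegral => w _.
pose phi x := sm (w, x) k; pose phi' x := dsm (w, x).
have aff i (x : R) : is_derive x (1 : R) (fun y : R => U i w + lam i * y) (lam i).
  by apply: is_derive_eq; rewrite /GRing.scale/=; ring.
have cw0 i : 0 <= c i w by [].
have dphi i (x : R) : is_derive x (1 : R) (fun x => sm (w, x) i)
    (sm (w, x) i * (lam i - \sum_j sm (w, x) j * lam j)).
  by have := is_derive_softmax (g := fun i y => U i w + lam i * y) cw0 (cs w) i (aff^~ x).
have cphi i : continuous (fun x => sm (w, x) i).
  by move=> x; exact: is_derive1_continuous (dphi i x).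
have iphi' : rintegrable (glaw s) phi'.
  apply: (@rint_bounded _ _ _ (glaw s) phi' (1 * (L + L))) => [|x]; last exact: dsmL.
  exact: (measurableT_comp mdsm (@pair1_measurable _ _ TG R w)).
rewrite [RHS]RintZ//.
apply: (@glaw_stein R s phi phi' (1 + (L + L)) (dphi k)).
- move=> x; apply: cvgM; first exact: cphi.
  apply: cvgB; first exact: cvg_cst.
  apply: cvg_bigsum => j; apply: cvgM; [exact: cphi|exact: cvg_cst].
- move=> x; have [a0 a1] := andP (sm01 (w, x) k).
  rewrite /phi ger0_norm//; apply: (le_trans a1).
  have L0 : 0 <= L by exact: sumr_ge0.
  by have x0 := normr_ge0 x; nra.
- by move=> x; apply: (le_trans (dsmL _)); rewrite mul1r lerDr.
Qed.

End gibbs_ibp.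

(** * Quadratic forms of covariances *)

Section quadratic.
Context (R : realType) (I : finType).
Implicit Types (C : I -> I -> R) (b : I -> R).

Definition quad C b : R := \sum_i \sum_j b i * b j * C i j.

Lemma quad_shift C b (x y : R) k : (forall i j, C i j = C j i) ->
  quad C (fun i => x * b i + y * (i == k)%:R) =
  x ^+ 2 * quad C b + 2 * x * y * \sum_i b i * C i k + y ^+ 2 * C k k.
Proof.
move=> Cs; have dl (f : I -> R) : \sum_i (i == k)%:R * f i = f k.
  rewrite (bigD1 k)//= eqxx mul1r big1 ?addr0// => i /negbTE ->.
  by rewrite mul0r.
rewrite /quad.
transitivity (\sum_i (x ^+ 2 * (\sum_j b i * b j * C i j) +
    x * y * (b i * C i k) + (i == k)%:R * (x * y * (\sum_j b j * C i j) + y ^+ 2 * C i k))).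
  apply: eq_bigr => i _.
  have -> : C i k = \sum_j (j == k)%:R * C i j by rewrite dl.
  rewrite !mulr_sumr -!big_split/= mulr_sumr -!big_split/=.
  by apply: eq_bigr => j _; ring.
rewrite !big_split/= dl -!mulr_sumr.
have -> : \sum_j b j * C k j = \sum_j b j * C j k by apply: eq_bigr => j _; rewrite Cs.
by ring.
Qed.

Lemma quad_delta C k : quad C (fun i => (i == k)%:R) = C k k.
Proof.
rewrite /quad (bigD1 k)//= [X in _ + X]big1 => [|i /negbTE ik]; last first.
  by apply: big1 => j _; rewrite ik !mul0r.
rewrite addr0 (bigD1 k)//= big1 => [|j /negbTE jk]; last by rewrite jk mulr0 mul0r.
by rewrite eqxx !mul1r addr0.
Qed.

(** A nonnegative form that vanishes at e_k has e_k in its kernel: otherwise e_i plus a suitable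
    multiple of e_k has value -1. This handles degenerate variances in the interpolation. *)
Lemma quad_null C k i : (forall b, 0 <= quad C b) -> (forall i j, C i j = C j i) ->
  C k k = 0 -> C i k = 0.
Proof.
move=> C0 Cs Ck; apply/eqP; apply: contraT => Ci0.
have := C0 (fun j => 1 * (j == i)%:R + (- (C i i + 1) / (2 * C i k)) * (j == k)%:R).
rewrite quad_shift// quad_delta Ck mulr0 addr0.
have -> : \sum_j (j == i)%:R * C j k = C i k.
  by rewrite (bigD1 i)//= eqxx mul1r big1 ?addr0// => j /negbTE ->; rewrite mul0r.
have -> : 1 ^+ 2 * C i i + 2 * 1 * (- (C i i + 1) / (2 * C i k)) * C i k = -1.
  by field.
by rewrite ler0N1.
Qed.

End quadratic.

Section compare.
Context d (T : measurableType d) (R : realType) (P : probability T R)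
  (I : finType).
Variables (W : set (set T)) (X Y c : I -> T -> R) (C D : I -> I -> R)
  (lo hi e : R).
Hypotheses (WI : setI_closed W) (WT : W setT) (Wm : forall E, W E -> measurable E).
Hypotheses (mX : forall i, measurable_fun setT (X i))
  (mY : forall i, measurable_fun setT (Y i)).
Hypotheses (cW : forall i B, measurable B -> <<s W >> (c i @^-1` B))
  (c0 : forall i w, 0 <= c i w) (lo0 : 0 < lo)
  (cb : forall w, lo <= \sum_i c i w <= hi).
Hypotheses (Cs : forall i j, C i j = C j i) (Ds : forall i j, D i j = D j i).
Hypothesis HXY : forall E a b th, W E ->
  \int[P]_w (\1_E w * cos (th + \sum_i a i * X i w + \sum_i b i * Y i w)) =
  cos th * expR (- (quad C a + quad D b) / 2) * fine (P E).
Hypothesis CDe : forall k i j, (C k k - D k k) - (C i j - D i j) <= e.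

Let mc i : measurable_fun setT (c i).
Proof.
move=> _ B mB; rewrite setTI.
suff h : <<s W >> `<=` @measurable _ T by exact: (h _ (cW i mB)).
apply: smallest_sub; last by move=> E /Wm.
split.
- exact: measurable0.
- by move=> A mA; rewrite setTD; exact: measurableC.
- by move=> F mF; apply: bigcup_measurable => k _; exact: mF.
Qed.

Let cs w : 0 < \sum_i c i w.
Proof. by case/andP: (cb w) => h _; exact: lt_le_trans h. Qed.

Let quad_ge0 a b : 0 <= quad C a + quad D b.
Proof.
have := HXY a b 0 WT.
rewrite cos0 mul1r (@probability_setT _ _ _ P) mulr1 => h.
have : expR (- (quad C a + quad D b) / 2) <= 1.
  rewrite -h -(Rint_cst P 1); apply: Rint_le.
  - apply: (@rint_bounded _ _ _ _ _ 1).
      apply: measurable_funM; first exact: indic_measurable.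
      apply: measurable_cos; apply: measurable_funD; first apply: measurable_funD => //.
        by apply: measurable_sum => i; exact: measurable_funM.
      by apply: measurable_sum => i; exact: measurable_funM.
    by move=> w; rewrite normrM mulr_ile1// ?indic_norm_le1// cos_norm_le1.
  - exact: rint_cst.
  - by move=> w; rewrite indicT mul1r cos_le1.
by rewrite -[X in _ <= X -> _]expR0 ler_expR; lra.
Qed.

Let quad0 (M : I -> I -> R) : quad M (fun=> 0) = 0.
Proof. by rewrite /quad big1// => i _; rewrite big1// => j _; rewrite !mul0r. Qed.

Let C_ge0 a : 0 <= quad C a.
Proof. by have := quad_ge0 a (fun=> 0); rewrite quad0 addr0. Qed.
Let D_ge0 b : 0 <= quad D b.
Proof. by have := quad_ge0 (fun=> 0) b; rewrite quad0 add0r. Qed.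

Let delta_sum k (F : I -> T -> R) w t :
  \sum_i t * (i == k)%:R * F i w = t * F k w.
Proof.
rewrite (bigD1 k)//= eqxx mulr1 big1 ?addr0// => i /negbTE ->.
by rewrite mulr0 mul0r.
Qed.

Let rint_gauss (Z : T -> R) (s2 : R) : measurable_fun setT Z -> 0 <= s2 ->
  (forall th t, \int[P]_w cos (th + t * Z w) = cos th * expR (- (s2 * t ^+ 2) / 2)) ->
  rintegrable P Z.
Proof.
move=> mZ s20 HZ.
have h := @cos_law _ T R P Z (Num.sqrt s2) mZ.
apply: (rint_law mZ (h _) (f := fun x => x)) => [th t|]; first by rewrite sqr_sqrtr.
apply: (@glaw_growth _ _ _ 1) => // x; rewrite mul1r; exact: expR_id_le.
Qed.

Let zero_sum (F : I -> T -> R) w : \sum_i (fun=> 0) i * F i w = 0.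
Proof. by rewrite big1// => i _; rewrite mul0r. Qed.

Let iX k : rintegrable P (X k).
Proof.
apply: (rint_gauss (mX k) (s2 := C k k)); first by rewrite -quad_delta.
move=> th t; have := HXY (fun i => t * (i == k)%:R) (fun=> 0) th WT.
rewrite quad0 addr0 (@probability_setT _ _ _ P) mulr1 => h.
transitivity (\int[P]_w (\1_setT w * cos (th + \sum_i t * (i == k)%:R * X i w + \sum_i (fun=> 0) i * Y i w))).
  by apply: eq_Rintegral => w _; rewrite indicT mul1r delta_sum zero_sum addr0.
rewrite h; suff -> : quad C (fun i => t * (i == k)%:R) = C k k * t ^+ 2 by [].
have -> : (fun i => t * (i == k)%:R) = (fun i => 0 * (fun=> 0) i + t * (i == k)%:R) :> (I -> R).
  by apply/funext => i; rewrite mul0r add0r.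
by rewrite quad_shift//; ring.
Qed.

Let iY k : rintegrable P (Y k).
Proof.
apply: (rint_gauss (mY k) (s2 := D k k)); first by rewrite -quad_delta.
move=> th t; have := HXY (fun=> 0) (fun i => t * (i == k)%:R) th WT.
rewrite quad0 add0r (@probability_setT _ _ _ P) mulr1 => h.
transitivity (\int[P]_w (\1_setT w * cos (th + \sum_i (fun=> 0) i * X i w + \sum_i t * (i == k)%:R * Y i w))).
  by apply: eq_Rintegral => w _; rewrite indicT mul1r delta_sum zero_sum addr0.
rewrite h; suff -> : quad D (fun i => t * (i == k)%:R) = D k k * t ^+ 2 by [].
have -> : (fun i => t * (i == k)%:R) = (fun i => 0 * (fun=> 0) i + t * (i == k)%:R) :> (I -> R).
  by apply/funext => i; rewrite mul0r add0r.
by rewrite quad_shift//; ring.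
Qed.

Let V th i w := cos th * X i w + sin th * Y i w.
Let V' th i w := - sin th * X i w + cos th * Y i w.

Let mV th i : measurable_fun setT (V th i).
Proof. by apply: measurable_funD; exact: measurable_funM. Qed.
Let mV' th i : measurable_fun setT (V' th i).
Proof. by apply: measurable_funD; exact: measurable_funM. Qed.

Let sm th w := softmax (c ^~ w) (V th ^~ w).
Let Del i j := C i j - D i j.

(** [V'] is the derivative of [V] in [th]. Rotating by the angle [th] makes the covariance of
    [V' th k] with [V th i] equal to - sin cos (C i k - D i k), so only the difference of the two
    covariances enters. *)
Let ibp th k :
  rintegrable P (V' th k) /\
  \int[P]_w (V' th k w * sm th w k) =
  \int[P]_w (sm th w k * ((- (sin th * cos th)) * Del k k -
     \sum_i sm th w i * ((- (sin th * cos th)) * Del i k))).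
Proof.
pose s2 := sin th ^+ 2 * C k k + cos th ^+ 2 * D k k.
have Ck : 0 <= C k k by rewrite -quad_delta.
have Dk : 0 <= D k k by rewrite -quad_delta.
have s20 : 0 <= s2 by rewrite addr_ge0// mulr_ge0// sqr_ge0.
apply: (@gibbs_ibp _ T R P I W (V' th k) (V th) c (Num.sqrt s2)
   (fun i => - (sin th * cos th) * Del i k)) => //.
(* If [V' th k] has variance 0, either the sine or the cosine vanishes, or C k k = D k k = 0 and
   then [quad_null] gives C i k = D i k = 0. *)
- move=> /eqP; rewrite sqrtr_eq0 => s2le i.
  have s2E : s2 = 0 by apply/eqP; rewrite eq_le s2le.
  have h1 : sin th ^+ 2 * C k k = 0.
    have b : 0 <= cos th ^+ 2 * D k k by rewrite mulr_ge0// sqr_ge0.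
    apply/eqP; rewrite eq_le; apply/andP; split; last by rewrite mulr_ge0// sqr_ge0.
    by move: s2le; rewrite /s2; lra.
  have h2 : cos th ^+ 2 * D k k = 0 by move: s2E; rewrite /s2 h1 add0r.
  have [->|s0] := eqVneq (sin th) 0; first by rewrite mul0r oppr0 mul0r.
  have [->|co0] := eqVneq (cos th) 0; first by rewrite mulr0 oppr0 mul0r.
  have Ck0 : C k k = 0.
    by move/eqP: h1; rewrite mulf_eq0 expf_eq0/= (negbTE s0)/= => /eqP.
  have Dk0 : D k k = 0.
    by move/eqP: h2; rewrite mulf_eq0 expf_eq0/= (negbTE co0)/= => /eqP.
  by rewrite /Del (quad_null i C_ge0 Cs Ck0) (quad_null i D_ge0 Ds Dk0) subrr mulr0.
- move=> E b ph t WE.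
  have lin t' w : ph + t' * V' th k w + \sum_i b i * V th i w =
     ph + \sum_i (cos th * b i + (- (t' * sin th)) * (i == k)%:R) * X i w +
     \sum_i (sin th * b i + (t' * cos th) * (i == k)%:R) * Y i w.
    have spl x y (F : I -> T -> R) : \sum_i (x * b i + y * (i == k)%:R) * F i w =
        x * \sum_i b i * F i w + y * F k w.
      rewrite -(delta_sum k F w y) mulr_sumr -big_split/=.
      by apply: eq_bigr => i _; ring.
    have -> : \sum_i b i * V th i w = cos th * \sum_i b i * X i w + sin th * \sum_i b i * Y i w.
      by rewrite !mulr_sumr -big_split/=; apply: eq_bigr => i _; rewrite /V; ring.
    by rewrite !spl /V'; ring.
  transitivity (cos ph * expR (- (quad C (fun i => cos th * b i + (- (t * sin th)) * (i == k)%:R) +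
     quad D (fun i => sin th * b i + (t * cos th) * (i == k)%:R)) / 2) * fine (P E)).
    by rewrite -HXY//; apply: eq_Rintegral => w _; rewrite lin.
  have -> : \int[P]_w (\1_E w * cos (ph + \sum_i b i * V th i w)) =
     cos ph * expR (- (quad C (fun i => cos th * b i + (- (0 * sin th)) * (i == k)%:R) +
     quad D (fun i => sin th * b i + (0 * cos th) * (i == k)%:R)) / 2) * fine (P E).
    rewrite -HXY//; apply: eq_Rintegral => w _.
    by have := lin 0 w; rewrite mul0r addr0 => <-.
  rewrite !quad_shift// [RHS]mulrA; congr (_ * _).
  rewrite [RHS]mulrCA -expRD sqr_sqrtr//; congr (_ * expR _).
  have -> : \sum_i b i * (- (sin th * cos th) * Del i k) =
     - (sin th * cos th) * (\sum_i b i * C i k - \sum_i b i * D i k).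
    by rewrite -sumrB mulr_sumr; apply: eq_bigr => i _; rewrite /Del; ring.
  by rewrite /s2; field.
Qed.

Let L th := \int[P]_w ln (\sum_i c i w * expR (V th i w)).

Let sum_gt0 th w : 0 < \sum_i c i w * expR (V th i w).
Proof. exact: softmax_sum_gt0. Qed.

Let logsum_bound (v : I -> R) w :
  `|ln (\sum_i c i w * expR (v i))| <= \sum_i `|v i| + (`|ln lo| + `|ln hi|).
Proof.
have S0 : 0 < \sum_i c i w * expR (v i) by exact: softmax_sum_gt0.
have /andP[c1 c2] := cb w; have hi0 : 0 < hi by exact: lt_le_trans c2.
have vle i : `|v i| <= \sum_j `|v j|.
  by rewrite (bigD1 i)//= lerDl; apply: sumr_ge0.
rewrite ler_norml; apply/andP; split.
- apply: (@le_trans _ _ (ln (lo * expR (- \sum_j `|v j|)))).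
    rewrite lnM ?posrE ?expR_gt0// expRK.
    by have := ler_norm (- ln lo); rewrite normrN; have := normr_ge0 (ln hi); lra.
  rewrite ler_ln ?posrE ?mulr_gt0 ?expR_gt0//.
  apply: (@le_trans _ _ ((\sum_i c i w) * expR (- \sum_j `|v j|))).
    by rewrite ler_wpM2r ?expR_ge0.
  rewrite mulr_suml; apply: ler_sum => i _; rewrite ler_wpM2l// ler_expR.
  by rewrite lerNl (le_trans _ (vle i))// -normrN ler_norm.
- apply: (@le_trans _ _ (ln (hi * expR (\sum_j `|v j|)))).
    rewrite ler_ln ?posrE ?mulr_gt0 ?expR_gt0//.
    apply: (@le_trans _ _ ((\sum_i c i w) * expR (\sum_j `|v j|))).
      rewrite mulr_suml; apply: ler_sum => i _; rewrite ler_wpM2l// ler_expR.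
      by rewrite (le_trans _ (vle i))// ler_norm.
    by rewrite ler_wpM2r ?expR_ge0.
  rewrite lnM ?posrE ?expR_gt0// expRK.
  by have := ler_norm (ln hi); have := normr_ge0 (ln lo); lra.
Qed.

Let mlog (v : I -> T -> R) : (forall i, measurable_fun setT (v i)) ->
  measurable_fun setT (fun w => ln (\sum_i c i w * expR (v i w))).
Proof.
move=> mv; apply: measurable_log; apply: measurable_sum => i.
by apply: measurable_funM => //; exact: measurable_exp.
Qed.

(** Bounds on the total weight suffice, even if single weights vanish: the logarithm is then within
    the sum of the |v i| of a bounded quantity. *)
Lemma rint_logsum (v : I -> T -> R) : (forall i, rintegrable P (v i)) ->
  rintegrable P (fun w => ln (\sum_i c i w * expR (v i w))).
Proof.
move=> iv; apply: (@rint_le _ _ _ P _ (fun w => \sum_i `|v i w| + (`|ln lo| + `|ln hi|))).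
- by apply: mlog => i; exact: (rint_measurable (iv i)).
- by move=> w; exact: logsum_bound.
- by apply: rintD; [apply: rint_sum => i _; exact: rint_norm|exact: rint_cst].
Qed.

Let iV th i : rintegrable P (V th i).
Proof. by apply: rintD; exact: rintZ. Qed.

Let msm th k : measurable_fun setT (sm th ^~ k).
Proof. exact: measurable_softmax. Qed.

Let sm0 th w k : 0 <= sm th w k. Proof. exact: softmax_ge0. Qed.
Let sm1 th w : \sum_k sm th w k = 1. Proof. exact: sum_softmax. Qed.
Let smle1 th w k : sm th w k <= 1. Proof. exact: softmax_le1. Qed.

Let dL th : is_derive th (1 : R) L (\sum_k \int[P]_w (V' th k w * sm th w k)).
Proof.
pose f th w := ln (\sum_i c i w * expR (V th i w)).
have dV i w x : is_derive x (1 : R) (fun x => V x i w) (V' x i w).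
  have d1 := is_derive_cos x; have d2 := is_derive_sin x.
  rewrite (_ : (fun x => V x i w) = (fun x => X i w *: cos x) + (fun x => Y i w *: sin x)).
    by apply: is_derive_eq; rewrite /V' /GRing.scale/=; ring.
  by apply/funext => y; rewrite /V /GRing.scale/= !fctE /GRing.scale/=; ring.
have df w x : is_derive x (1 : R) (f ^~ w) (\sum_i sm x w i * V' x i w).
  by have := is_derive_logsum (a := c ^~ w) (g := fun i x => V x i w) (c0 ^~ w) (cs w)
    (dV^~ w ^~ x).
have Ia : (`]th - 1, th + 1[%classic : set R) th.
  by rewrite /= in_itv/=; apply/andP; split; lra.
have h1 : forall x, (`]th - 1, th + 1[%classic : set R) x ->
    P.-integrable setT (EFin \o f x).
  by move=> x _; exact: rint_logsum.
have h2 : forall x w, (`]th - 1, th + 1[%classic : set R) x -> setT w ->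
    derivable (f ^~ w) x 1 by move=> x w _ _; case: (df w x).
have p1 x w : partial1of2 f x w = \sum_i sm x w i * V' x i w.
  by rewrite /partial1of2; exact: is_derive1E.
pose g w := \sum_i (`|X i w| + `|Y i w|).
have g0 w : 0 <= g w by apply: sumr_ge0 => i _; exact: addr_ge0.
have ig : rintegrable P g.
  by apply: rint_sum => i _; apply: rintD; exact: rint_norm.
have h3 : forall x w, (`]th - 1, th + 1[%classic : set R) x -> setT w ->
    `|partial1of2 f x w| <= g w.
  move=> x w _ _; rewrite p1; apply: (le_trans (ler_norm_sum _ _ _)).
  apply: ler_sum => i _; rewrite normrM (ger0_norm (sm0 x w i)).
  apply: (@le_trans _ _ `|V' x i w|); first by rewrite ler_piMl.
  apply: (le_trans (ler_normD _ _)); apply: lerD; rewrite normrM ler_piMl//.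
    by rewrite normrN sin_norm_le1.
  exact: cos_norm_le1.
have DD := derivable_under_integral measurableT Ia h1 h2 g0 ig h3.
have EE := differentiation_under_integral measurableT Ia h1 h2 g0 ig h3.
apply: DeriveDef; first exact: DD.
rewrite -derive1E; rewrite EE.
rewrite -Rint_sum; last first.
  move=> k _; apply: (rint_mul_bounded (M := 1) (ibp th k).1 (msm th k)) => w.
  by rewrite ger0_norm.
by apply: eq_Rintegral => w _; rewrite p1; apply: eq_bigr => i _; rewrite mulrC.
Qed.

(** After integration by parts the derivative of [L] is sin cos times the mean of Del i k - Del k k
    over two independent samples [i], [k] of the Gibbs weights. The hypothesis [CDe] bounds this
    difference below by [- e]. *)
Let dL_ge th : 0 <= sin th * cos th ->
  - (e * (sin th * cos th)) <= \sum_k \int[P]_w (V' th k w * sm th w k).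
Proof.
move=> sc0.
under eq_bigr do rewrite (ibp th _).2.
pose h k w := sm th w k * ((- (sin th * cos th)) * Del k k -
     \sum_i sm th w i * ((- (sin th * cos th)) * Del i k)).
have mh k : measurable_fun setT (h k).
  apply: measurable_funM => //; apply: measurable_funB => //.
  by apply: measurable_sum => i; apply: measurable_funM.
have hE k w : h k w = (sin th * cos th) * \sum_i sm th w k * sm th w i * (Del i k - Del k k).
  rewrite /h.
  have -> : - (sin th * cos th) * Del k k = \sum_i sm th w i * (- (sin th * cos th) * Del k k).
    by rewrite -mulr_suml sm1 mul1r.
  by rewrite -sumrB !mulr_sumr; apply: eq_bigr => i _; ring.
have ih k : rintegrable P (h k).
  apply: (@rint_bounded _ _ _ _ _ (`|sin th * cos th| * \sum_i `|Del i k - Del k k|)) => //.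
  move=> w; rewrite hE normrM ler_wpM2l//.
  apply: (le_trans (ler_norm_sum _ _ _)); apply: ler_sum => i _.
  rewrite normrM ler_piMl// ger0_norm; first exact: mulr_ile1.
  exact: mulr_ge0.
rewrite -Rint_sum; last by move=> k _; exact: ih.
rewrite -(Rint_cst P (- (e * (sin th * cos th)))); apply: Rint_le.
- exact: rint_cst.
- by apply: rint_sum => k _; exact: ih.
- move=> w; rewrite [leRHS](_ : _ = \sum_k (sin th * cos th) *
      \sum_i sm th w k * sm th w i * (Del i k - Del k k)); last first.
    by apply: eq_bigr => k _; rewrite -hE.
  rewrite -mulr_sumr mulrC -mulrN; apply: ler_wpM2l => //.
  have -> : - e = \sum_k \sum_i sm th w k * sm th w i * - e.
    under eq_bigr do rewrite -mulr_suml -mulr_sumr sm1 mulr1.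
    by rewrite -mulr_suml sm1 mul1r.
  apply: ler_sum => k _; apply: ler_sum => i _.
  apply: ler_wpM2l; first exact: mulr_ge0.
  by have := CDe k i k; rewrite /Del; lra.
Qed.

(* Interpolation along cos(th) X + sin(th) Y. *)
Theorem gaussian_compare :
  \int[P]_w ln (\sum_i c i w * expR (X i w)) <=
  \int[P]_w ln (\sum_i c i w * expR (Y i w)) + e / 2.
Proof.
(* The added term has derivative e sin cos, which compensates the possible decrease of [L], and it
   is worth [e / 2] at the end point. *)
pose psi th := L th + e / 2 * sin th ^+ 2.
have dpsi th : is_derive th (1 : R) psi
    (\sum_k \int[P]_w (V' th k w * sm th w k) + e * (sin th * cos th)).
  have d1 := dL th; have d2 := is_derive_sin th.
  rewrite (_ : psi = L + (fun th => (e / 2) *: (sin th ^+ 2)))//.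
  by apply: is_derive_eq; rewrite /GRing.scale/=; field.
have cpsi : continuous psi by move=> x; exact: is_derive1_continuous (dpsi x).
have pi0 : 0 < pi :> R by exact: pi_gt0.
have := @ger0_derive1_ndecr R psi 0 (pi / 2).
move=> /(_ _ _ _ 0 (pi / 2) (lexx _) _ (lexx _)) h.
have : psi 0 <= psi (pi / 2).
  apply: h.
  - by move=> x _; case: (dpsi x).
  - move=> x; rewrite in_itv/= => /andP[x0 x1].
    rewrite (is_derive1E (dpsi x)).
    have s0 : 0 <= sin x by apply: ltW; apply: sin_gt0_pi; rewrite x0/=; lra.
    have c0' : 0 <= cos x by apply: ltW; apply: cos_gt0_pihalf; apply/andP; split; lra.
    by have := @dL_ge x (mulr_ge0 s0 c0'); lra.
  - exact: continuous_subspaceT.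
  - by rewrite divr_ge0// ltW.
have E0 : L 0 = \int[P]_w ln (\sum_i c i w * expR (X i w)).
  apply: eq_Rintegral => w _; congr ln; apply: eq_bigr => i _.
  by rewrite /V cos0 sin0 mul1r mul0r addr0.
have E1 : L (pi / 2) = \int[P]_w ln (\sum_i c i w * expR (Y i w)).
  apply: eq_Rintegral => w _; congr ln; apply: eq_bigr => i _.
  by rewrite /V cos_pihalf sin_pihalf mul1r mul0r add0r.
rewrite -E0 -E1 /psi sin0 sin_pihalf; move: (L 0) (L (pi / 2)); clear => x y.
by rewrite expr1n expr0n/= mulr0 mulr1 addr0.
Qed.

End compare.

(** * Transforms of independent variables *)

Section independent_cosines.
Context d (T : measurableType d) (R : realType) (P : probability T R).
Context (J : choiceType) (D : set J) (F : J -> set (set T)).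
Hypothesis Fm : forall j A, D j -> F j A -> measurable A.
Hypothesis indep : mutually_independent P D F.

Lemma indep_seq (r : seq J) (E : J -> set T) : uniq r ->
  (forall j, j \in r -> D j) -> (forall j, j \in r -> F j (E j)) ->
  \int[P]_w (\prod_(j <- r) \1_(E j) w) = \prod_(j <- r) fine (P (E j)).
Proof.
move=> ur rD rF; pose S := [fset x in r]%fset.
have Sr j : (j \in S) = (j \in r) by rewrite inE.
have h := @indep S E _ _.
have {}h : P (\bigcap_(j in [set` S]) E j) = (\prod_(j <- S) P (E j))%E.
  apply: h; first by move=> j /=; rewrite Sr; exact: rD.
  by move=> j; rewrite Sr; exact: rF.
have pS : perm_eq S r by apply: uniq_perm => //; exact: fset_uniq.
have mE j : j \in r -> measurable (E j) by move=> jr; apply: (Fm (rD _ jr)); exact: rF.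
have mS : measurable (\bigcap_(j in [set` S]) E j).
  by apply: fin_bigcap_measurable => // j /=; rewrite Sr; exact: mE.
transitivity (\int[P]_w \1_(\bigcap_(j in [set` S]) E j) w).
  apply: eq_Rintegral => w _; rewrite indicE.
  case: (boolP (w \in _)) => [|].
    rewrite inE => h'; rewrite big_seq big1// => j jr.
    by rewrite indicE mem_set//; apply: h'; rewrite /= Sr.
  rewrite notin_setE => nh; apply/eqP; rewrite prodf_seq_eq0; apply/hasP.
  apply: contrapT => nh'; apply: nh => j /=; rewrite Sr => jr.
  apply: contrapT => nE; apply: nh'; exists j => //.
  by rewrite /= indicE memNset.
rewrite Rint_indic// h (perm_big _ pS)/=.
have : forall j, j \in r -> P (E j) = (fine (P (E j)))%:E.
  by move=> j /mE mEj; rewrite fineK//; exact: fin_num_measure.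
elim: r {ur rD rF Sr pS mE mS h S} => [|j r IH] h; first by rewrite !big_nil.
rewrite !big_cons h ?mem_head// fineM//=.
  by rewrite IH// => i ir; apply: h; rewrite inE ir orbT.
apply/fin_numP; rewrite big_seq.
have : ((\prod_(i <- r | i \in r) P (E i))%E \is a fin_num).
  elim/big_rec: _ => // i x ir xf; rewrite fin_numM// h ?inE ?ir ?orbT//.
by move/fin_numP.
Qed.

Variables (U : J -> T -> R) (e : J -> R).
Hypothesis mU : forall j, measurable_fun setT (U j).

(** Independence is a statement about events, so the induction moves the head [j] from the cosines
    to the events. There the hypothesis for the shorter list gives the law of [U j] weighted by all
    the rest, and [cos (U j)] and [sin (U j)] can be integrated separately. The sine has mean 0, as
    the hypothesis at phase - pi / 2 shows. *)
Lemma indep_cos (s r : seq J) (E : J -> set T) (th : R) : uniq (s ++ r) ->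
  (forall j, j \in s ++ r -> D j) ->
  (forall j B, j \in s -> measurable B -> F j (U j @^-1` B)) ->
  (forall j th, j \in s -> \int[P]_w cos (th + U j w) = cos th * e j) ->
  (forall j, j \in r -> F j (E j)) ->
  \int[P]_w (\prod_(j <- r) \1_(E j) w * cos (th + \sum_(j <- s) U j w)) =
  cos th * \prod_(j <- s) e j * \prod_(j <- r) fine (P (E j)).
Proof.
elim: s r E th => [|j s IH] r E th us sD sF sU rF.
  rewrite big_nil mulr1.
  transitivity (\int[P]_w (cos th * \prod_(j <- r) \1_(E j) w)).
    by apply: eq_Rintegral => w _; rewrite big_nil addr0 mulrC.
  rewrite RintZ ?indep_seq//.
  apply: (@rint_bounded _ _ _ _ _ 1).
    apply: measurable_prod => i ir; apply: indic_measurable.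
    by apply: (@Fm i); [exact: sD|exact: rF].
  move=> w; elim/big_rec: _ => [|i x _ xM]; first by rewrite normr1.
  by rewrite normrM mulr_ile1// indic_norm_le1.
have jD : D j by apply: sD; rewrite mem_head.
have [jr us'] : j \notin r /\ uniq (s ++ j :: r).
  have : perm_eq (s ++ j :: r) ((j :: s) ++ r) by rewrite perm_catC/= perm_cons perm_catC.
  move=> /perm_uniq ->; split => //.
  by move: us => /= /andP[]; rewrite mem_cat negb_or => /andP[].
have sD' i : i \in s ++ j :: r -> D i.
  by rewrite mem_cat inE => H; apply: sD; rewrite /= inE mem_cat; move: H => /or3P[->|->|->]; rewrite ?orbT.
have mr : measurable_fun setT (fun w => \prod_(i <- r) \1_(E i) w : R).
  apply: measurable_prod => i ir; apply: indic_measurable.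
  by apply: (@Fm i); [apply: sD; rewrite mem_cat ir orbT|exact: rF].
have rb w : `|\prod_(i <- r) \1_(E i) w : R| <= 1.
  elim/big_rec: _ => [|i x _ xM]; first by rewrite normr1.
  by rewrite normrM mulr_ile1// indic_norm_le1.
pose psi ph w := \prod_(i <- r) \1_(E i) w * cos (ph + \sum_(i <- s) U i w).
pose kap ph := cos ph * \prod_(i <- s) e i * \prod_(i <- r) fine (P (E i)).
have ms : measurable_fun setT (fun w => \sum_(i <- s) U i w) by exact: measurable_sum.
have ipsi ph : rintegrable P (psi ph).
  apply: (@rint_bounded _ _ _ _ _ 1).
    by apply: measurable_funM => //; apply: measurable_cos; exact: measurable_funD.
  by move=> w; rewrite normrM mulr_ile1// cos_norm_le1.
have law ph B : measurable B ->
    \int[P]_w (psi ph w * \1_B (U j w)) = \int[P]_w (kap ph * \1_B (U j w)).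
  move=> mB; have FB : F j (U j @^-1` B) by apply: sF => //; rewrite mem_head.
  have mUB := Fm jD FB.
  pose E' i := if i == j then U j @^-1` B else E i.
  have E'r i : i \in r -> E' i = E i.
    by move=> ir; rewrite /E'; case: eqP => // ij; rewrite ij (negbTE jr) in ir.
  have E'j : E' j = U j @^-1` B by rewrite /E' eqxx.
  have h := IH (j :: r) E' ph us' sD'.
  transitivity (\int[P]_w (\prod_(i <- j :: r) \1_(E' i) w * cos (ph + \sum_(i <- s) U i w))).
    apply: eq_Rintegral => w _; rewrite /psi big_cons E'j -indic_comp.
    rewrite mulrC mulrA; congr (_ * _ * _).
    by apply: eq_big_seq => i ir; rewrite E'r.
  rewrite h.
  - rewrite RintZ; last first.
      apply: (@rint_bounded _ _ _ _ _ 1); last by move=> w; exact: indic_norm_le1.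
      exact: (measurableT_comp (indic_measurable mB) (mU j)).
    under [in RHS]eq_Rintegral do rewrite indic_comp.
    rewrite Rint_indic// big_cons E'j /kap.
    have -> : \prod_(i <- r) fine (P (E' i)) = \prod_(i <- r) fine (P (E i)).
      by apply: eq_big_seq => i ir; rewrite E'r.
    by ring.
  - by move=> i B' is_ mB'; apply: sF => //; rewrite inE is_ orbT.
  - by move=> i ph' is_; apply: sU; rewrite inE is_ orbT.
  - by move=> i; rewrite inE => /orP[/eqP->|ir]; rewrite ?E'j// E'r//; exact: rF.
have ext ph (phi : R -> R) : measurable_fun setT phi -> (forall x, `|phi x| <= 1) ->
    \int[P]_w (psi ph w * phi (U j w)) = kap ph * \int[P]_w phi (U j w).
  move=> mphi phi1.
  rewrite (weighted_law_ext (mU j) (mU j) (ipsi ph) (rint_cst P (kap ph)) (law ph) mphi phi1).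
  rewrite RintZ//; apply: (@rint_bounded _ _ _ _ _ 1) => //.
  exact: (measurableT_comp mphi (mU j)).
have mcos : measurable_fun setT (@cos R) by exact: (continuous_measurable_fun (@continuous_cos R)).
have msin : measurable_fun setT (@sin R) by exact: (continuous_measurable_fun (@continuous_sin R)).
have jU : forall th, \int[P]_w cos (th + U j w) = cos th * e j.
  by move=> ph; apply: sU; rewrite mem_head.
have ecos : \int[P]_w cos (U j w) = e j.
  have := jU 0; rewrite cos0 mul1r => <-.
  by apply: eq_Rintegral => w _; rewrite add0r.
have esin : \int[P]_w sin (U j w) = 0.
  have := jU (- (pi / 2)); rewrite cosN cos_pihalf mul0r => <-.
  by apply: eq_Rintegral => w _; rewrite addrC cosBpihalf.
(* A phase shift by pi / 2 turns a cosine into a sine, so both terms of the addition formula are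
   instances of [psi]. *)
transitivity (\int[P]_w (psi th w * cos (U j w) - psi (th - pi / 2) w * sin (U j w))).
  apply: eq_Rintegral => w _; rewrite /psi big_cons -!mulrA -mulrBr; congr (_ * _).
  set S := \sum_(i <- s) U i w.
  have -> : th - pi / 2 + S = th + S - pi / 2 by ring.
  by rewrite cosBpihalf -cosD; congr cos; ring.
rewrite RintB; last 2 first.
- by apply: (rint_mul_bounded (M := 1) (ipsi _) (measurableT_comp mcos (mU j))) => w; exact: cos_norm_le1.
- by apply: (rint_mul_bounded (M := 1) (ipsi _) (measurableT_comp msin (mU j))) => w; exact: sin_norm_le1.
rewrite !ext ?ecos ?esin//; [|exact: sin_norm_le1|exact: cos_norm_le1].
by rewrite mulr0 subr0 /kap big_cons; ring.
Qed.

End independent_cosines.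

Section standard_family.
Context d (T : measurableType d) (R : realType) (P : probability T R).

(** Independent standard Gaussian variables, described by their joint transform. The list has no
    repetition, so that the squares of the coefficients add up. *)
Definition std_family (J : eqType) (D : pred J) (X : J -> T -> R) : Prop :=
  forall (s : seq J) (c : J -> R) th, uniq s -> all D s ->
  \int[P]_w cos (th + \sum_(j <- s) c j * X j w) =
  cos th * expR (- (\sum_(j <- s) c j ^+ 2) / 2).

Lemma sigma_generated_measurable (I : Type) (X : I -> T -> R) :
  (forall i, measurable_fun setT (X i)) -> sigma_generated X `<=` measurable.
Proof.
move=> mX; apply: smallest_sub.
  split; [exact: measurable0|by move=> A mA; rewrite setTD; exact: measurableC|].
  by move=> F mF; apply: bigcup_measurable => k _; exact: mF.
by move=> A [i _ [B mB <-]]; exact: (mX i measurableT B mB).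
Qed.

Lemma sigma_generated_pre (I : Type) (X : I -> T -> R) i B :
  measurable B -> sigma_generated X (X i @^-1` B).
Proof.
move=> mB; apply: sub_gen_smallest; exists i => //; exists B => //.
by rewrite setTI.
Qed.

Lemma gaussian_disorder_std (g : seq nat -> {RV P >-> R}) :
  gaussian_disorder g -> std_family (fun s => s != [::]) (fun s => g s : T -> R).
Proof.
move=> [glaw1 gind] s c th us sD.
have Fm : forall j A, [set s | s != [::]] j ->
    sigma_generated (fun _ : unit => g j : T -> R) A -> measurable A.
  by move=> j A _; apply: sigma_generated_measurable => _.
have cosg j ph : j \in s -> \int[P]_w cos (ph + c j * g j w) =
    cos ph * expR (- (c j ^+ 2) / 2).
  move=> js; have jn : j != [::] by have /allP := sD; exact.
  have XL B : measurable B -> P (g j @^-1` B) = glaw 1 B.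
    by move=> mB; rewrite glaw1// glawE oner_eq0.
  have mg : measurable_fun setT (g j) by exact: measurable_funP.
  have mf : measurable_fun setT (fun x : R => cos (ph + c j * x)).
    by apply: measurable_cos; apply: measurable_funD => //; exact: measurable_funM.
  rewrite (Rint_law mg XL (f := fun x => cos (ph + c j * x))).
    by rewrite glaw_cos expr1n mul1r.
  by apply: (@rint_bounded _ _ _ _ _ 1) => // x; exact: cos_norm_le1.
have h := indep_cos Fm gind (U := fun j w => c j * g j w)
  (e := fun j => expR (- (c j ^+ 2) / 2)) _ (s := s) (r := [::]) (E := fun=> set0) th.
transitivity (\int[P]_w (\prod_(j <- [::] : seq (seq nat)) \1_(set0 : set T) w *
   cos (th + \sum_(j <- s) c j * g j w))).
  by apply: eq_Rintegral => w _; rewrite big_nil mul1r.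
rewrite h ?cats0//.
- rewrite big_nil mulr1 -expR_sum; congr (_ * expR _).
  by rewrite mulNr mulr_suml -sumrN; apply: eq_bigr => i _; rewrite mulNr.
- by move=> j; exact: measurable_funM.
- by move=> j js /=; have /allP := sD; exact.
- move=> j B js mB.
  have mc : measurable_fun setT (fun x : R => c j * x) by exact: measurable_funM.
  have := @sigma_generated_pre unit (fun _ => g j) tt _ (mc measurableT B mB).
  by rewrite setTI.
Qed.

End standard_family.

(** * Measurability of pointwise limits *)

Section limits.
Context (R : realType).

Lemma cvgn_cauchyP (u : nat -> R) :
  cvgn u <-> (forall j : nat, exists m : nat, forall n : nat, (m <= n)%N ->
    `|u n - u m| <= j.+1%:R^-1).
Proof.
split.
- move=> /cvg_ex[l ul] j.
  have j0 : 0 < j.+1%:R^-1 / 2 :> R by rewrite divr_gt0.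
  move/cvgrPdist_le : ul => /(_ _ j0)[m _ h]; exists m => n mn.
  have h1 := h n mn; have h2 := h m (leqnn m).
  have -> : u n - u m = (l - u m) - (l - u n) by ring.
  apply: (le_trans (ler_normB _ _)).
  by rewrite [leRHS]splitr; apply: lerD.
- move=> h; apply: cauchy_cvg; apply: cauchy_exP => e e0.
  have [j je] : exists j : nat, j.+1%:R^-1 < e.
    exists (Num.truncn e^-1).
    rewrite invf_plt ?posrE//; exact: truncnS_gt.
  have [m hm] := h j; exists (u m); exists m => // n /= mn.
  by rewrite /ball/= distrC; apply: le_lt_trans je; exact: hm.
Qed.

(** The set of convergence is measurable by the countable form of the Cauchy criterion. Off this set
    [limn] returns the default value [point], and the sequence is replaced there by that
    constant. *)
Lemma measurable_limn d (T : measurableType d) (f : nat -> T -> R) :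
  (forall n, measurable_fun setT (f n)) ->
  measurable_fun setT (fun w => limn (f ^~ w)).
Proof.
move=> mf; pose D := [set w | cvgn (f ^~ w)].
have mD : measurable D.
  rewrite (_ : D = \bigcap_j \bigcup_m \bigcap_(n in [set n | (m <= n)%N])
      [set w | `|f n w - f m w| <= j.+1%:R^-1]); last first.
    apply/seteqP; split => w /=.
      move=> /cvgn_cauchyP h j _; have [m hm] := h j.
      by exists m => // n /= mn; exact: hm.
    move=> h; apply/cvgn_cauchyP => j; have [m _ hm] := h j I.
    by exists m => n mn; exact: hm.
  apply: bigcap_measurable => [|j _]; first by exists 0%N.
  apply: bigcup_measurable => m _; apply: bigcap_measurable; first by exists m => /=.
  move=> n _; rewrite (_ : [set w | _] = (fun w => `|f n w - f m w|) @^-1` `]-oo, j.+1%:R^-1]); last first.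
    by apply/seteqP; split => w /=; rewrite in_itv/=.
  have mn : measurable_fun setT (fun w => `|f n w - f m w|).
    by apply: measurable_norm; exact: measurable_funB.
  by rewrite -[X in measurable X]setTI; exact: mn.
apply: (measurable_fun_cvg (h := fun n w => f n w * \1_D w + (point : R) * (1 - \1_D w))).
  move=> n; have mi : measurable_fun setT (\1_D : T -> R) by exact: indic_measurable.
  by apply: measurable_funD; apply: measurable_funM => //; exact: measurable_funB.
move=> w _; have [Dw|nD] := pselect (D w).
  rewrite indicE mem_set// subrr mulr0.
  under eq_fun do rewrite mulr1 addr0.
  exact: Dw.
rewrite indicE memNset// subr0 mulr1.
under eq_fun do rewrite mulr0 add0r.
rewrite dvgP//; exact: cvg_cst.
Qed.

End limits.

(** * Series of independent variables *)

Section orthogonality.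
Context d (T : measurableType d) (R : realType) (P : probability T R).
Variables (G : set (set T)) (X : T -> R) (s : R).
Hypotheses (GI : setI_closed G) (GT : G setT)
  (Gm : forall E, G E -> measurable E) (mX : measurable_fun setT X).
Hypothesis indep : forall E B, G E -> measurable B ->
  P (E `&` X @^-1` B) = (P E * glaw s B)%E.

Local Notation TG := (g_sigma_algebraType G).

Lemma rint_glaw_id : rintegrable (glaw s) (fun x => x).
Proof. apply: (@glaw_growth _ _ _ 1) => // x; rewrite mul1r; exact: expR_id_le. Qed.

Lemma glaw_mean : \int[glaw s]_x x = 0.
Proof.
have d1 (x : R) : is_derive x (1 : R) (fun=> 1 : R) ((fun=> 0) x) by exact: is_derive_cst.
have := @glaw_stein R s (fun=> 1) (fun=> 0) 1 d1.
under eq_Rintegral do rewrite mulr1.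
rewrite Rint_cst mulr0; apply.
- exact: cst_continuous.
- by move=> x; rewrite normr1 mul1r lerDl.
- by move=> x; rewrite normr0.
Qed.

(** In the product law of the past and [X], the inner integral of [f w * x] is [f w] times the mean
    of a centered Gaussian, which is 0. *)
Lemma gauss_orthogonal (f : T -> R) : measurable_fun (setT : set TG) f ->
  rintegrable P f ->
  rintegrable P (fun w => f w * X w) /\ \int[P]_w (f w * X w) = 0.
Proof.
move=> mf if_; pose F (z : TG * R) := f z.1 * z.2.
have mF : measurable_fun setT F.
  apply: measurable_funM; last exact: measurable_snd.
  exact: (measurableT_comp mf (@measurable_fst _ _ TG R)).
have iFw w : rintegrable (glaw s) (fun x => F (w, x)) by exact: (rintZ (f w) rint_glaw_id).
pose M := \int[glaw s]_x `|x|.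
have mfT : measurable_fun (setT : set T) f := rint_measurable if_.
have if' : rintegrable (gen_law P Gm) (fun w => f w * M).
  apply/integrableP; split.
    by apply/measurable_EFinP; exact: measurable_funM.
  rewrite gen_lawE//.
    have h : rintegrable P (fun w => f w * M).
      by have := rintZ M if_; congr (rintegrable _ _); apply/funext => w; rewrite mulrC.
    by have /integrableP[_] := h.
  by apply/measurable_EFinP; apply: measurable_norm; exact: measurable_funM.
have iF : rintegrable (gen_law P Gm \x glaw s)%E F.
  apply: (rint_prod mF if') => w.
  rewrite (_ : (\int[glaw s]_x _)%E = (\int[glaw s]_x (`|f w| * `|x|)%:E)%E); last first.
    by apply: eq_integral => x _; rewrite /F normrM.
  rewrite -EFin_Rint; last by apply: rintZ; apply: rint_norm; exact: rint_glaw_id.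
  rewrite RintZ ?lee_fin; last by apply: rint_norm; exact: rint_glaw_id.
  by rewrite normrM ler_wpM2l// ler_norm.
have p1 : rintegrable P (fun w => F (w, X w)) by apply/(rint_decouple GI GT Gm mX indep mF).
split; first exact: p1.
rewrite (Rint_decouple GI GT Gm mX indep mF p1) Rint_prod//.
rewrite -[RHS](Rint_cst (gen_law P Gm)); apply: eq_Rintegral => w _.
transitivity (\int[glaw s]_x (f w * x)); first by [].
by rewrite RintZ ?glaw_mean ?mulr0//; exact: rint_glaw_id.
Qed.

End orthogonality.

Section kolmogorov.
Context d (T : measurableType d) (R : realType) (P : probability T R).
Variables (xi : nat -> T -> R) (v : nat -> R).
Hypotheses (mxi : forall p, measurable_fun setT (xi p)) (v0 : forall p, 0 <= v p).
Hypothesis cos_xi : forall n (b : nat -> R) th,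
  \int[P]_w cos (th + \sum_(p < n) b p * xi p w) =
  cos th * expR (- (\sum_(p < n) b p ^+ 2 * v p) / 2).

Let S m k w := \sum_(m <= p < m + k) xi p w.
Let Sv m k := \sum_(m <= p < m + k) v p.

Let Sv_ge0 m k : 0 <= Sv m k. Proof. by apply: sumr_ge0. Qed.

Let mS m k : measurable_fun setT (S m k).
Proof. exact: measurable_sum. Qed.

Let block m k n : (m + k <= n)%N -> forall (b : nat -> R) th t,
  \int[P]_w cos (th + t * S m k w + \sum_(i < m) b i * xi i w) =
  expR (- (Sv m k * t ^+ 2) / 2) * \int[P]_w cos (th + \sum_(i < m) b i * xi i w).
Proof.
move=> mkn b th t; pose b' (p : nat) := if (p < m)%N then b p else if (p < m + k)%N then t else 0.
have spl (F : nat -> R) : \sum_(p < m + k) F p = \sum_(p < m) F p + \sum_(m <= p < m + k) F p.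
  by rewrite -!(big_mkord xpredT) (big_cat_nat (n := m))//= leq_addr.
have bl i : (i < m)%N -> b' i = b i by rewrite /b' => ->.
have br i : (m <= i < m + k)%N -> b' i = t.
  by move=> /andP[mi imk]; rewrite /b' ltnNge mi imk.
transitivity (\int[P]_w cos (th + \sum_(p < m + k) b' p * xi p w)).
  apply: eq_Rintegral => w _; rewrite (spl (fun p => b' p * xi p w)).
  have -> : \sum_(p < m) b' p * xi p w = \sum_(p < m) b p * xi p w.
    by apply: eq_bigr => i _; rewrite bl.
  have -> : \sum_(m <= p < m + k) b' p * xi p w = t * S m k w.
    by rewrite /S mulr_sumr !big_nat; apply: eq_bigr => i hi; rewrite br.
  by congr cos; ring.
rewrite !cos_xi (spl (fun p => b' p ^+ 2 * v p)) mulrCA -expRD; congr (_ * expR _).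
have -> : \sum_(p < m) b' p ^+ 2 * v p = \sum_(p < m) b p ^+ 2 * v p.
  by apply: eq_bigr => i _; rewrite bl.
have -> : \sum_(m <= p < m + k) b' p ^+ 2 * v p = t ^+ 2 * Sv m k.
  by rewrite /Sv mulr_sumr !big_nat; apply: eq_bigr => i hi; rewrite br.
by field.
Qed.

Let Sint m k : rintegrable P (fun w => S m k w ^+ 2) /\
  \int[P]_w (S m k w ^+ 2) = Sv m k.
Proof.
have SL B : measurable B -> P (S m k @^-1` B) = glaw (Num.sqrt (Sv m k)) B.
  apply: (cos_law (mS m k)) => th t.
  have := block (leqnn (m + k)) (fun=> 0) th t.
  have z w : \sum_(i < m) (fun=> 0) i * xi i w = 0 by rewrite big1// => i _; rewrite mul0r.
  transitivity (\int[P]_w cos (th + t * S m k w + \sum_(i < m) (fun=> 0) i * xi i w)).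
    by apply: eq_Rintegral => w _; rewrite z addr0.
  rewrite H.
  transitivity (expR (- (Sv m k * t ^+ 2) / 2) * \int[P]_w cos th).
    by congr (_ * _); apply: eq_Rintegral => w _; rewrite z addr0.
  by rewrite Rint_cst mulrC sqr_sqrtr.
have [i e] := glaw_sqr (Num.sqrt (Sv m k)).
split; first exact: (rint_law (mS m k) SL i).
by rewrite (Rint_law (mS m k) SL i) e sqr_sqrtr.
Qed.

Let first_exit (eps : R) m k w : bool :=
  (eps <= `|S m k w|) && [forall j : 'I_k, `|S m j w| < eps].

(** Whether [k] is the first exit is decided by the variables of index below [m + k], and the later
    block is independent of them and centered. *)
Let orth eps m k n : (k <= n)%N ->
  rintegrable P (fun w => (first_exit eps m k w)%:R * S m k w * S (m + k) (n - k) w) /\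
  \int[P]_w ((first_exit eps m k w)%:R * S m k w * S (m + k) (n - k) w) = 0.
Proof.
move=> kn; pose W := [set setT : set T]; pose G := absorb_all (m + k) xi W.
have WI : setI_closed W by move=> A B -> ->; rewrite /W/= setTI.
have Wm A : W A -> measurable A by move=> ->.
have GI : setI_closed G by exact: absorb_all_setI.
have GT : G setT by exact: absorb_all_sub.
have Gm : forall E, G E -> measurable E by exact: absorb_all_measurable.
have fac : cos_factor P xi (S (m + k) (n - k)) (fun t => expR (- (Num.sqrt (Sv (m + k) (n - k)) ^+ 2 * t ^+ 2) / 2)) (m + k) W.
  move=> E b th t ->; rewrite sqr_sqrtr//.
  have h := block (leqnn (m + k + (n - k))) b th t.
  transitivity (\int[P]_w cos (th + t * S (m + k) (n - k) w + \sum_(i < m + k) b i * xi i w)).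
    by apply: eq_Rintegral => w _; rewrite indicT mul1r.
  rewrite h; congr (_ * _).
  by apply: eq_Rintegral => w _; rewrite indicT mul1r.
have f0 := cos_factor_absorb_all mxi (mS _ _) Wm fac.
have ind := cos_factor_law (mS _ _) Gm f0 (glaw_cos _).
have mxiG p : (p < m + k)%N -> measurable_fun (setT : set (g_sigma_algebraType G)) (xi p).
  move=> pk _ B mB; rewrite setTI; apply: sub_gen_smallest.
  exact: absorb_all_pre.
have mSG j : (j <= k)%N -> measurable_fun (setT : set (g_sigma_algebraType G)) (S m j).
  move=> jk; rewrite (_ : S m j = fun w => \sum_(p < m + j - m) xi (p + m)%N w); last first.
    by apply/funext => w; rewrite /S -{1}[m]add0n big_addn big_mkord.
  apply: measurable_sum => p; apply: mxiG.
  by rewrite addnC ltn_add2l (leq_trans (ltn_ord p))// addKn.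
have mfe : measurable_fun (setT : set (g_sigma_algebraType G)) (fun w => (first_exit eps m k w)%:R : R).
  rewrite (_ : (fun w => _) = (fun w : g_sigma_algebraType G => \1_[set w | eps <= `|S m k w|] w *
     \prod_(j <- enum 'I_k) \1_[set w | `|S m j w| < eps] w)); last first.
    apply/funext => w; rewrite /first_exit.
    have -> : \1_[set w | eps <= `|S m k w|] w = (eps <= `|S m k w|)%R%:R :> R.
      by rewrite indicE; congr (nat_of_bool _)%:R; apply/idP/idP; rewrite inE.
    have -> : \prod_(j <- enum 'I_k) \1_[set w | `|S m j w| < eps] w =
        [forall j : 'I_k, (`|S m j w| < eps)%R]%:R :> R.
      rewrite big_enum/=; case: forallP => [h|h].
        by apply: big1 => j _; rewrite indicE mem_set//; exact: h.
      apply/eqP; rewrite prodf_seq_eq0; apply/hasP.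
      apply: contrapT => nh; apply: h => j; apply: contrapT => hj; apply: nh.
      by exists j; rewrite ?mem_index_enum//= indicE memNset.
    by case: (_ <= _); rewrite ?mul1r ?mul0r.
  have mabs j : (j <= k)%N -> measurable_fun (setT : set (g_sigma_algebraType G)) (fun w => `|S m j w|).
    by move=> jk; apply: measurable_norm; exact: mSG.
  apply: measurable_funM.
    apply: indic_measurable.
    rewrite (_ : [set w | _] = (fun w => `|S m k w|) @^-1` `[eps, +oo[); last first.
      by apply/seteqP; split => w /=; rewrite in_itv/= andbT.
    by rewrite -[X in measurable X]setTI; apply: mabs.
  apply: measurable_prod => j _; apply: indic_measurable.
  rewrite (_ : [set w | _] = (fun w => `|S m j w|) @^-1` `]-oo, eps[); last first.
    by apply/seteqP; split => w /=; rewrite in_itv/=.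
  by rewrite -[X in measurable X]setTI; apply: mabs => //; exact: ltnW.
have mf : measurable_fun (setT : set (g_sigma_algebraType G)) (fun w => (first_exit eps m k w)%:R * S m k w).
  by apply: measurable_funM => //; exact: mSG.
apply: (gauss_orthogonal GI GT Gm (mS _ _) ind mf).
have [i2 _] := Sint m k.
apply: (@rint_le _ _ _ P _ (fun w => 1 + S m k w ^+ 2)).
- have := measurableT_comp mf (measurable_to_gen Gm); exact.
- move=> w; rewrite normrM.
  apply: (@le_trans _ _ (1 * `|S m k w|)).
    by rewrite ler_wpM2r//; case: first_exit; rewrite ?normr1 ?normr0.
  rewrite mul1r -[S m k w ^+ 2]real_normK ?num_real//.
  by have := sqr_ge0 (`|S m k w| - 1); nra.
- by apply: rintD => //; exact: rint_cst.
Qed.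

Let exits (eps : R) m n : set T := [set w | exists k : 'I_n.+1, eps <= `|S m k w|].

Let mexits eps m n : measurable (exits eps m n).
Proof.
rewrite (_ : exits _ _ _ = \bigcup_(k in [set k | (k < n.+1)%N]) [set w | eps <= `|S m k w|]).
  apply: bigcup_measurable => k _.
  rewrite (_ : [set w | _] = (fun w => `|S m k w|) @^-1` `[eps, +oo[); last first.
    by apply/seteqP; split => w /=; rewrite in_itv/= andbT.
  have mabs : measurable_fun setT (fun w => `|S m k w|) by exact: measurable_norm.
  by rewrite -[X in measurable X]setTI; exact: mabs.
apply/seteqP; split => w /=.
  by move=> [k hk]; exists k => /=.
by move=> [k kn hk]; exists (Ordinal kn).
Qed.

(** Kolmogorov's inequality. If [k] is the first exit, S_n^2 = S_k^2 + 2 S_k (S_n - S_k) + (S_n -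
    S_k)^2 with S_k^2 >= eps^2, and the cross terms, one for each possible [k], have mean 0 by
    [orth]. *)
Lemma kolmogorov_maximal (eps : R) m n : 0 < eps ->
  eps ^+ 2 * fine (P (exits eps m n)) <= Sv m n.
Proof.
move=> eps0; have [in2 <-] := Sint m n.
pose o (k : 'I_n.+1) w := (first_exit eps m k w)%:R * S m k w * S (m + k) (n - k) w.
have ho (k : 'I_n.+1) := orth eps m (leq_ord k).
have Sspl (k : 'I_n.+1) w : S m n w = S m k w + S (m + k) (n - k) w.
  rewrite /S -addnA subnKC ?leq_ord// (big_cat_nat (n := m + k)) ?leq_addr//=.
  by rewrite leq_add2l leq_ord.
have key w : eps ^+ 2 * \1_(exits eps m n) w + 2 * \sum_(k < n.+1) o k w <= S m n w ^+ 2.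
  have [ex|nex] := pselect (exists k : nat, (k < n.+1)%N && (eps <= `|S m k w|)).
    have [k /andP[kn hk] kmin] := ex_minnP ex.
    have fe (j : 'I_n.+1) : first_exit eps m j w = (j == k :> nat).
      rewrite /first_exit; apply/idP/idP.
        move=> /andP[hj /forallP hlt]; rewrite eq_sym eqn_leq kmin ?hj ?ltn_ord//=.
        rewrite leqNgt; apply/negP => jk'; have kj := hlt (Ordinal jk').
        by move: hk; rewrite leNgt kj.
      move=> /eqP jk; rewrite jk hk/=; apply/forallP => i.
      rewrite ltNge; apply/negP => hi.
      have := kmin i; rewrite hi (ltn_trans (ltn_ord i) kn) => /(_ isT).
      by rewrite leqNgt ltn_ord.
    rewrite indicE mem_set/=; last by exists (Ordinal kn).
    rewrite (bigD1 (Ordinal kn))//= big1 => [|j jk]; last first.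
      rewrite /o fe (_ : (j == k :> nat) = false) ?mul0r//.
      by apply/negbTE; move: jk; apply: contra => /eqP jk; apply/eqP/val_inj.
    rewrite /o fe/= eqxx mul1r addr0 mulr1 (Sspl (Ordinal kn))/=.
    have : eps ^+ 2 <= S m k w ^+ 2.
      by rewrite -[leRHS]real_normK ?num_real// ler_pXn2r// nnegrE// ltW.
    by have := sqr_ge0 (S (m + k) (n - k) w); nra.
  rewrite indicE memNset/=; last first.
    by move=> [k hk]; apply: nex; exists k; rewrite hk ltn_ord.
  rewrite big1 => [|j _]; first by rewrite !mulr0 addr0 sqr_ge0.
  rewrite /o /first_exit; case: (boolP (eps <= _)) => [hj|]; last by rewrite !mul0r.
  by exfalso; apply: nex; exists j; rewrite hj ltn_ord.
have iexit : rintegrable P (\1_(exits eps m n) : T -> R).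
  by apply: (@rint_bounded _ _ _ _ _ 1); [exact: indic_measurable|exact: indic_norm_le1].
have io : rintegrable P (fun w => \sum_(k < n.+1) o k w).
  by apply: rint_sum => k _; exact: (ho k).1.
rewrite -Rint_indic// -RintZ//.
have -> : \int[P]_w (eps ^+ 2 * \1_(exits eps m n) w) =
   \int[P]_w (eps ^+ 2 * \1_(exits eps m n) w + 2 * \sum_(k < n.+1) o k w).
  rewrite [RHS]RintD; [|exact: rintZ..].
  rewrite [X in _ + X]RintZ// Rint_sum; last by move=> k _; exact: (ho k).1.
  rewrite [X in 2 * X]big1 ?mulr0 ?addr0// => k _; exact: (ho k).2.
apply: Rint_le => //.
by apply: rintD; exact: rintZ.
Qed.

(** [hamiltonian] is a pointwise [limn] of partial sums, so convergence in mean square would not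
    identify it: almost sure convergence is what is needed. The event [B j], that oscillations of a
    fixed size occur after every time [m], has probability at most the tail of the variances divided
    by eps^2, for each [m]. *)
Lemma kolmogorov_series : cvgn (fun n => \sum_(p < n) v p) ->
  {ae P, forall w, cvgn (fun n => \sum_(p < n) xi p w)}.
Proof.
move=> cv; have /cvg_ex[l cl] := cv.
have ndv : nondecreasing_seq (fun n => \sum_(p < n) v p).
  by apply/nondecreasing_seqP => n; rewrite big_ord_recr/= lerDl.
have lv n : \sum_(p < n) v p <= l.
  by rewrite -(cvg_lim (@Rhausdorff R) cl); exact: nondecreasing_cvgn_le.
have Sl m k : Sv m k <= l - \sum_(p < m) v p.
  have := lv (m + k)%N; rewrite -(big_mkord xpredT) (big_cat_nat (n := m)) ?leq_addr//=.
  by rewrite -/(Sv m k) big_mkord; lra.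
pose B (j : nat) : set T := \bigcap_m \bigcup_n exits (j.+1%:R^-1 / 2) m n.
have PB j : P (B j) = 0%E.
  have eps0 : 0 < j.+1%:R^-1 / 2 :> R by rewrite divr_gt0.
  set eps := (j.+1%:R^-1 / 2 : R) in eps0 *.
  have mU m : measurable (\bigcup_n exits eps m n) by apply: bigcup_measurable.
  have mB : measurable (B j) by apply: bigcapT_measurable => m; exact: mU.
  have bound m : (P (B j) <= ((l - \sum_(p < m) v p) / eps ^+ 2)%:E)%E.
    apply: (@le_trans _ _ (P (\bigcup_n exits eps m n))).
      by apply: le_measure; rewrite ?inE//; exact: bigcap_inf.
    have cvP := @nondecreasing_cvg_mu _ _ _ P (exits eps m) (mexits eps m) (mU m) _.
    have nd : nondecreasing_seq (exits eps m).
      apply/nondecreasing_seqP => n; apply/subsetPset => w [k hk].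
      by exists (widen_ord (leqnSn _) k).
    have {}cvP := cvP nd.
    apply: (cvge_le _ cvP); apply: nearW => n /=.
    rewrite -[X in (X <= _)%E]fineK; last by apply: fin_num_measure; exact: mexits.
    rewrite lee_fin ler_pdivlMr ?exprn_gt0// mulrC.
    by apply: (le_trans (kolmogorov_maximal m n eps0)); exact: Sl.
  have c0 : ((l - \sum_(p < m) v p) / eps ^+ 2)%:E @[m --> \oo] --> 0%E.
    apply: cvg_EFin; first exact: nearW.
    rewrite [X in _ --> X](_ : _ = (l - l) / eps ^+ 2); last by rewrite subrr mul0r.
    by apply: cvgM; [apply: cvgB; [exact: cvg_cst|exact: cl]|exact: cvg_cst].
  apply/eqP; rewrite eq_le measure_ge0 andbT.
  by apply: (cvge_ge _ c0); apply: nearW => m; exact: bound.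
have nB : P.-negligible (\bigcup_j B j).
  apply: negligible_bigcup => j; exists (B j); split => //; last exact: PB.
  by apply: bigcapT_measurable => m; apply: bigcup_measurable.
apply: negligibleS nB => w /= nc; apply: contrapT => nw; apply: nc.
apply/cvgn_cauchyP => j.
have : ~ B j w by move=> Bj; apply: nw; exists j.
move=> /existsNP[m /not_implyP[_ nm]]; exists m => n mn.
have -> : \sum_(p < n) xi p w - \sum_(p < m) xi p w = S m (n - m) w.
  rewrite /S subnKC// -(big_mkord xpredT (fun p => xi p w)) (big_cat_nat (n := m))//=.
  by rewrite big_mkord addrAC subrr add0r.
apply: contrapT => /negP; rewrite -ltNge => hlt; apply: nm.
exists (n - m)%N => //; exists ord_max => /=.
apply: ltW; apply: le_lt_trans hlt.
by rewrite ler_pdivrMr// ler_pMr// ler1n.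
Qed.

End kolmogorov.

Section series.
Context (R : realType).

Lemma sum_geqE (f : nat -> R) m0 n :
  \sum_(m0 <= p < n) f p = \sum_(p < n) (if (m0 <= p)%N then f p else 0).
Proof.
have [mn|nm] := leqP m0 n; last first.
  rewrite big_geq ?(ltnW nm)// big1// => i _.
  by rewrite leqNgt (ltn_trans (ltn_ord i) nm).
rewrite -(big_mkord xpredT (fun p => if (m0 <= p)%N then f p else 0)).
rewrite [RHS](big_cat_nat (n := m0))//= [X in _ = X + _]big_nat.
rewrite [X in _ = X + _]big1 ?add0r => [|i /= im]; last by rewrite leqNgt im.
by rewrite !big_nat; apply: eq_bigr => i /andP[-> _].
Qed.

Lemma cvg_bounded_sum (f : nat -> R) (B : R) : (forall p, 0 <= f p) ->
  (forall n, \sum_(p < n) f p <= B) -> cvgn (fun n => \sum_(p < n) f p).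
Proof.
move=> f0 fB; apply: nondecreasing_is_cvgn.
  by apply/nondecreasing_seqP => n; rewrite big_ord_recr/= lerDl.
by exists B => _ [n _ <-]; exact: fB.
Qed.

Lemma cvg_abs_sum (f : nat -> R) (B : R) m0 :
  (forall n, \sum_(p < n) `|f p| <= B) -> cvgn (fun n => \sum_(m0 <= p < n) f p).
Proof.
move=> fB; pose g p := if (m0 <= p)%N then f p else 0.
have : cvgn [normed series g].
  rewrite (_ : [normed series g] = (fun n => \sum_(p < n) `|g p|)); last first.
    by apply/funext => n; rewrite -(big_mkord xpredT (fun p => `|g p|)).
  apply: (@cvg_bounded_sum (fun p => `|g p|) B) => // n.
  apply: le_trans (fB n); apply: ler_sum => p _; rewrite /g.
  by case: ifP => // _; rewrite normr0.
move/normed_cvg; rewrite (_ : series g = (fun n => \sum_(m0 <= p < n) f p))//.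
by apply/funext => n; rewrite sum_geqE /series/= big_mkord.
Qed.

End series.

(** A centered Gaussian family with covariance [C], described by its joint transform. Finite
    subfamilies are given by maps [f], repetitions allowed, so indices that carry the same field
    need no separate treatment. *)
Definition gfam d (T : measurableType d) (R : realType) (P : probability T R)
    (J : Type) (X : J -> T -> R) (C : J -> J -> R) : Prop :=
  forall (K : finType) (f : K -> J) (c : K -> R) th,
  \int[P]_w cos (th + \sum_k c k * X (f k) w) =
  cos th * expR (- quad (fun k l => C (f k) (f l)) c / 2).

Definition ov (R : realType) (N : nat) (s t : config N) : R :=
  N%:R^-1 * \sum_(i < N) spin R s i * spin R t i.

Section overlaps.
Context (R : realType) (N : nat).
Implicit Types s t : config N.

Lemma spin_norm s i : `|spin R s i| = 1.
Proof. by rewrite /spin; case: (s i); rewrite ?expr1 ?normrN ?expr0 normr1. Qed.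

Lemma spin_sqr s i : spin R s i * spin R s i = 1.
Proof. by rewrite -expr2 -[_ ^+ 2]real_normK ?num_real// spin_norm expr1n. Qed.

Lemma ov_sym s t : ov R s t = ov R t s.
Proof. by rewrite /ov; congr (_ * _); apply: eq_bigr => i _; rewrite mulrC. Qed.

Lemma ov_self s : (0 < N)%N -> ov R s s = 1.
Proof.
move=> N0; rewrite /ov (eq_bigr (fun=> 1)); last by move=> i _; rewrite spin_sqr.
by rewrite sumr_const card_ord mulVf// pnatr_eq0 -lt0n.
Qed.

Lemma ov_le1 s t : `|ov R s t| <= 1.
Proof.
have [N0|N0] := posnP N.
  by rewrite /ov (_ : N%:R = 0 :> R) ?N0// invr0 mul0r normr0.
rewrite normrM ger0_norm ?invr_ge0// ler_pdivrMl ?ltr0n// mulr1.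
apply: (le_trans (ler_norm_sum _ _ _)).
rewrite (eq_bigr (fun=> 1)); last by move=> i _; rewrite normrM !spin_norm mulr1.
by rewrite sumr_const card_ord.
Qed.

Lemma sum_tuples (F : 'I_N -> R) p :
  \sum_(i : p.-tuple 'I_N) \prod_(j <- i) F j = (\sum_i F i) ^+ p.
Proof.
transitivity (\sum_(f : {ffun 'I_p -> 'I_N}) \prod_i F (f i)); last first.
  by rewrite -(bigA_distr_bigA (fun _ : 'I_p => F)) prodr_const card_ord.
rewrite (reindex (fun f : {ffun 'I_p -> 'I_N} => [tuple f i | i < p])); last first.
  exists (fun t : p.-tuple 'I_N => [ffun i => tnth t i]) => [f _|t _].
    by apply/ffunP => i; rewrite ffunE tnth_mktuple.
  by apply: eq_from_tnth => i; rewrite tnth_mktuple ffunE.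
apply: eq_bigr => f _.
transitivity (\prod_(i < p) F (tnth [tuple f i | i < p] i)); first exact: big_tuple.
by apply: eq_bigr => i _; rewrite tnth_mktuple.
Qed.

End overlaps.

(** * Mixed p-spin fields *)

Section mixed_field.
Context d (T : measurableType d) (R : realType) (P : probability T R).
Variables (gam : seq nat -> T -> R) (m0 M : nat).
Hypotheses (mgam : forall s, measurable_fun setT (gam s))
  (std : std_family P (fun s => (m0 <= size s)%N) gam) (M0 : (0 < M)%N).
Implicit Types (b : nat -> R) (s : config M).

(** The lowest level [m0] is 1 for the Hamiltonian; it is 0 for the fields with covariance [xi'],
    which has a constant term. *)
Definition field_term b s p w : R := b p / (M%:R `^ (p%:R / 2)) *
  \sum_(i : p.-tuple 'I_M) gam (map (@nat_of_ord M) i) w * \prod_(j <- i) spin R s j.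

Definition mixed b s w : R := limn (fun n => \sum_(m0 <= p < n) field_term b s p w).

Let words n : seq (seq nat) :=
  allpairs_dep (fun p (i : p.-tuple 'I_M) => map (@nat_of_ord M) i)
    (index_iota m0 n) (fun p => enum {: p.-tuple 'I_M}).

Let words_uniq n : uniq (words n).
Proof.
apply: allpairs_uniq_dep; first exact: iota_uniq.
  by move=> p _; exact: enum_uniq.
move=> [p i] [q j] _ _ /= e.
have pq : p = q by rewrite -(size_tuple i) -(size_map (@nat_of_ord M) i) e size_map size_tuple.
subst q; congr existT; apply: val_inj => /=.
exact: (inj_map val_inj e).
Qed.

Let words_size n : all (fun s : seq nat => (m0 <= size s)%N) (words n).
Proof.
apply/allP => s /allpairsPdep[p [i [hp _ ->]]].
by rewrite size_map size_tuple; move: hp; rewrite mem_index_iota => /andP[].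
Qed.

Let spinN s (x : nat) : R := if insub x is Some i then spin R s i else 0.

Let coef b s (u : seq nat) : R := b (size u) / (M%:R `^ ((size u)%:R / 2)) *
  \prod_(x <- u) spinN s x.

Let coefE b s p (i : p.-tuple 'I_M) : coef b s (map (@nat_of_ord M) i) =
  b p / (M%:R `^ (p%:R / 2)) * \prod_(j <- i) spin R s j.
Proof.
rewrite /coef size_map size_tuple big_map; congr (_ * _).
by apply: eq_bigr => j _; rewrite /spinN valK.
Qed.

Let sum_words n (F : seq nat -> R) : \sum_(u <- words n) F u =
  \sum_(m0 <= p < n) \sum_(i : p.-tuple 'I_M) F (map (@nat_of_ord M) i).
Proof.
by rewrite big_allpairs_dep; apply: eq_bigr => p _; rewrite big_enum.
Qed.

Let partialE b s n w : \sum_(m0 <= p < n) field_term b s p w =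
  \sum_(u <- words n) coef b s u * gam u w.
Proof.
rewrite sum_words; apply: eq_bigr => p _; rewrite /field_term mulr_sumr.
by apply: eq_bigr => i _; rewrite coefE; ring.
Qed.

(** Summed over the words of length p, the products of the spins of the two configurations give (M
    R)^p, where R is the overlap; the normalization M^p leaves b_p b'_p R^p. *)
Let covE b s b' s' n : \sum_(u <- words n) coef b s u * coef b' s' u =
  \sum_(m0 <= p < n) b p * b' p * ov R s s' ^+ p.
Proof.
rewrite sum_words; apply: eq_bigr => p _.
have Mp : (M%:R `^ (p%:R / 2)) * (M%:R `^ (p%:R / 2)) = M%:R ^+ p :> R.
  rewrite -powRD; last by rewrite pnatr_eq0 -lt0n M0 implybT.
  by rewrite -splitr powR_mulrn.
have Mp0 : (M%:R `^ (p%:R / 2)) != 0 :> R.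
  by rewrite gt_eqF// powR_gt0// ltr0n.
transitivity (\sum_(i : p.-tuple 'I_M) b p * b' p / (M%:R ^+ p) *
    \prod_(j <- i) (spin R s j * spin R s' j)).
  apply: eq_bigr => i _; rewrite !coefE -Mp big_split/=; field; exact: Mp0.
rewrite -mulr_sumr sum_tuples /ov exprMn exprVn.
by field; rewrite expf_neq0// pnatr_eq0 -lt0n.
Qed.

Definition partial_cov n b s b' s' := \sum_(m0 <= p < n) b p * b' p * ov R s s' ^+ p.

Lemma partial_cos (K : finType) (bk : K -> nat -> R) (sk : K -> config M) (c : K -> R) th n :
  \int[P]_w cos (th + \sum_k c k * \sum_(m0 <= p < n) field_term (bk k) (sk k) p w) =
  cos th * expR (- quad (fun k l => partial_cov n (bk k) (sk k) (bk l) (sk l)) c / 2).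
Proof.
pose co u := \sum_k c k * coef (bk k) (sk k) u.
have E w : \sum_k c k * \sum_(m0 <= p < n) field_term (bk k) (sk k) p w =
    \sum_(u <- words n) co u * gam u w.
  under eq_bigr do rewrite partialE mulr_sumr.
  rewrite exchange_big/=; apply: eq_bigr => u _; rewrite /co mulr_suml.
  by apply: eq_bigr => k _; rewrite mulrA.
transitivity (\int[P]_w cos (th + \sum_(u <- words n) co u * gam u w)).
  by apply: eq_Rintegral => w _; rewrite E.
transitivity (cos th * expR (- (\sum_(u <- words n) co u ^+ 2) / 2)).
  exact: std (words_uniq n) (words_size n).
suff -> : \sum_(u <- words n) co u ^+ 2 =
    quad (fun k l => partial_cov n (bk k) (sk k) (bk l) (sk l)) c by [].
rewrite /quad.
transitivity (\sum_(u <- words n) \sum_k \sum_l c k * c l *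
    (coef (bk k) (sk k) u * coef (bk l) (sk l) u)).
  apply: eq_bigr => u _; rewrite expr2 /co mulr_suml; apply: eq_bigr => k _.
  by rewrite mulr_sumr; apply: eq_bigr => l _; ring.
rewrite exchange_big/=; apply: eq_bigr => k _.
rewrite exchange_big/=; apply: eq_bigr => l _.
by rewrite -mulr_sumr covE.
Qed.

Lemma measurable_field_term b s p : measurable_fun setT (field_term b s p).
Proof.
apply: measurable_funM => //; apply: measurable_sum => i.
exact: measurable_funM.
Qed.

Lemma measurable_mixed b s : measurable_fun setT (mixed b s).
Proof.
apply: (measurable_limn (f := fun n w => \sum_(m0 <= p < n) field_term b s p w)) => n.
by apply: measurable_sum => p; exact: measurable_field_term.
Qed.

Definition sqsum_bounded b := exists B, forall n, \sum_(p < n) b p ^+ 2 <= B.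

(** A linear combination of the levels at one configuration is again a partial sum, with
    coefficients [c p * b p], so [partial_cos] gives their joint transform. The self-overlap is 1,
    hence the variances are the b_p^2. *)
Lemma mixed_cvg b s : sqsum_bounded b ->
  {ae P, forall w, cvgn (fun n => \sum_(m0 <= p < n) field_term b s p w)}.
Proof.
move=> [B hB].
have := @kolmogorov_series _ T R P (fun p w => if (m0 <= p)%N then field_term b s p w else 0)
  (fun p => if (m0 <= p)%N then b p ^+ 2 else 0).
have mx p : measurable_fun setT (fun w => if (m0 <= p)%N then field_term b s p w else 0).
  by case: (m0 <= p)%N; [exact: measurable_field_term|exact: measurable_cst].
have v0 p : 0 <= (if (m0 <= p)%N then b p ^+ 2 else 0).
  by case: ifP => // _; exact: sqr_ge0.
move=> /(_ mx v0) h.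
have {}h : {ae P, forall w, cvgn (fun n => \sum_(p < n) (if (m0 <= p)%N then field_term b s p w else 0))}.
  apply: h.
    move=> n c th.
    have := @partial_cos unit (fun=> fun p => c p * b p) (fun=> s) (fun=> 1) th n.
    have E (F : unit -> R) : \sum_(k : unit) F k = F tt.
      by rewrite (big_pred1 tt)// => -[].
    rewrite /quad !E /partial_cov !mul1r ov_self// => h.
    transitivity (\int[P]_w cos (th + \sum_(k : unit) 1 * \sum_(m0 <= p < n) field_term (fun p => c p * b p) s p w)).
      apply: eq_Rintegral => w _; rewrite E mul1r sum_geqE; congr (cos (_ + _)).
      apply: eq_bigr => p _; case: ifP => _; last by rewrite mulr0.
      by rewrite /field_term; ring.
    rewrite h sum_geqE.
    suff -> : \sum_(p < n) (if (m0 <= p)%N then c p * b p * (c p * b p) * 1 ^+ p else 0) =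
      \sum_(p < n) c p ^+ 2 * (if (m0 <= p)%N then b p ^+ 2 else 0) by [].
    apply: eq_bigr => p _; case: ifP => _; last by rewrite mulr0.
    by rewrite expr1n; ring.
  apply: (@cvg_bounded_sum _ (fun p => if (m0 <= p)%N then b p ^+ 2 else 0) B) => // n.
  apply: le_trans (hB n); apply: ler_sum => p _; case: ifP => // _; exact: sqr_ge0.
apply: filterS h => w hw.
suff -> : (fun n => \sum_(m0 <= p < n) field_term b s p w) =
  (fun n => \sum_(p < n) if (m0 <= p)%N then field_term b s p w else 0) by exact: hw.
by apply/funext => n; rewrite sum_geqE.
Qed.

Lemma cov_cvg b b' x : sqsum_bounded b -> sqsum_bounded b' -> `|x| <= 1 ->
  cvgn (fun n => \sum_(m0 <= p < n) b p * b' p * x ^+ p).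
Proof.
move=> [B hB] [B' hB'] x1; apply: (@cvg_abs_sum _ _ (B + B')) => n.
apply: le_trans (lerD (hB n) (hB' n)); rewrite -big_split/=; apply: ler_sum => p _.
rewrite normrM normrX; apply: (@le_trans _ _ `|b p * b' p|).
  by rewrite ler_piMr// exprn_ile1.
rewrite normrM -[b p ^+ 2]real_normK ?num_real// -[b' p ^+ 2]real_normK ?num_real//.
have := sqr_ge0 (`|b p| - `|b' p|); have := normr_ge0 (b p); have := normr_ge0 (b' p).
by nra.
Qed.

(** Cosines are bounded by 1, so almost sure convergence of the partial sums passes to the
    transform; on the other side the covariances converge term by term. *)
Lemma mixed_gfam (J : Type) (b : J -> nat -> R) :
  (forall j, sqsum_bounded (b j)) ->
  gfam P (fun j : J * config M => mixed (b j.1) j.2)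
    (fun j j' => limn (fun n => \sum_(m0 <= p < n) b j.1 p * b j'.1 p * ov R j.2 j'.2 ^+ p)).
Proof.
move=> hb K f c th.
pose F n w := cos (th + \sum_k c k * \sum_(m0 <= p < n) field_term (b (f k).1) (f k).2 p w).
have mpart n k : measurable_fun setT (fun w => \sum_(m0 <= p < n) field_term (b (f k).1) (f k).2 p w).
  by apply: measurable_sum => p; exact: measurable_field_term.
have l1 : \int[P]_w F n w @[n --> \oo] -->
    \int[P]_w cos (th + \sum_k c k * mixed (b (f k).1) (f k).2 w).
  apply: (Rint_dominated (g := fun=> 1) _ _ _ _ (rint_cst P 1)).2.
  - move=> n; apply: measurable_cos; apply: measurable_funD => //.
    by apply: measurable_sum => k; apply: measurable_funM.
  - apply: measurable_cos; apply: measurable_funD => //.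
    by apply: measurable_sum => k; apply: measurable_funM => //; exact: measurable_mixed.
  - have ae k : {ae P, forall w, cvgn (fun n => \sum_(m0 <= p < n) field_term (b (f k).1) (f k).2 p w)}.
      exact: mixed_cvg.
    have : {ae P, forall w, forall k, cvgn (fun n => \sum_(m0 <= p < n) field_term (b (f k).1) (f k).2 p w)}.
      exact: filter_forall ae.
    apply: filterS => w cw; apply: continuous_cvg; first exact: continuous_cos.
    apply: cvgD; first exact: cvg_cst.
    apply: cvg_bigsum => k; apply: cvgM; first exact: cvg_cst.
    exact: (cw k).
  - by move=> n w; exact: cos_norm_le1.
have l2 : \int[P]_w F n w @[n --> \oo] --> cos th * expR (- quad (fun k l =>
    limn (fun n => \sum_(m0 <= p < n) b (f k).1 p * b (f l).1 p * ov R (f k).2 (f l).2 ^+ p)) c / 2).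
  rewrite (_ : (fun n => _) = (fun n => cos th * expR (- quad (fun k l =>
      partial_cov n (b (f k).1) (f k).2 (b (f l).1) (f l).2) c / 2))); last first.
    by apply/funext => n; exact: partial_cos.
  apply: cvgM; first exact: cvg_cst.
  apply: continuous_cvg; first exact: continuous_expR.
  apply: cvgM; last exact: cvg_cst.
  apply: cvgN; apply: cvg_bigsum => k; apply: cvg_bigsum => l.
  apply: cvgM; first exact: cvg_cst.
  by apply: cov_cvg => //; exact: ov_le1.
exact: (cvg_unique (@Rhausdorff R) l1 l2).
Qed.

End mixed_field.

Lemma cvg_norm_le (R : realType) (f : nat -> R) (l M : R) : f @ \oo --> l ->
  (\forall n \near \oo, `|f n| <= M) -> `|l| <= M.
Proof.
move=> fl fM; have h : (fun n => `|f n|) @ \oo --> `|l| by exact: cvg_norm.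
rewrite -(cvg_lim (@Rhausdorff R) h); apply: limr_le => //.
by apply/cvg_ex; exists `|l|.
Qed.

(** * Power series on the closed unit interval *)

Section power_series.
Context (R : realType).

Lemma power_lip (x y : R) p : `|x| <= 1 -> `|y| <= 1 ->
  `|y ^+ p - x ^+ p| <= p%:R * `|y - x|.
Proof.
move=> x1 y1; elim: p => [|p IH]; first by rewrite !expr0 subrr normr0 mul0r.
rewrite !exprS (_ : _ - _ = y * (y ^+ p - x ^+ p) + x ^+ p * (y - x)); last by ring.
apply: (le_trans (ler_normD _ _)); rewrite !normrM -natr1 mulrDl mul1r; apply: lerD.
  apply: le_trans IH; rewrite -[leRHS]mul1r; exact: ler_wpM2r.
rewrite -[leRHS]mul1r normrX; apply: ler_wpM2r => //; exact: exprn_ile1.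
Qed.

Lemma power_taylor (x y : R) p : `|x| <= 1 -> `|y| <= 1 ->
  `|y ^+ p - x ^+ p - (y - x) * (p%:R * x ^+ p.-1)| <= p%:R ^+ 2 * `|y - x| ^+ 2.
Proof.
move=> x1 y1; elim: p => [|p IH].
  by rewrite !expr0 subrr mul0r mulr0 subrr normr0 expr0n mul0r.
have -> : y ^+ p.+1 - x ^+ p.+1 - (y - x) * (p.+1%:R * x ^+ p) =
    x * (y ^+ p - x ^+ p - (y - x) * (p%:R * x ^+ p.-1)) + (y - x) * (y ^+ p - x ^+ p).
  have e : p%:R * x ^+ p = x * (p%:R * x ^+ p.-1).
    by case: p {IH} => [|p]; rewrite ?mul0r ?mulr0//= exprS; ring.
  have -> : p.+1%:R * x ^+ p = x * (p%:R * x ^+ p.-1) + x ^+ p.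
    by rewrite -e -natr1; ring.
  by rewrite !exprS; ring.
apply: (le_trans (ler_normD _ _)); rewrite !normrM.
have h1 : `|x| * `|y ^+ p - x ^+ p - (y - x) * (p%:R * x ^+ p.-1)| <= p%:R ^+ 2 * `|y - x| ^+ 2.
  by apply: le_trans IH; rewrite -[leRHS]mul1r; exact: ler_wpM2r.
have h2 : `|y - x| * `|y ^+ p - x ^+ p| <= `|y - x| * (p%:R * `|y - x|).
  by apply: ler_wpM2l => //; exact: power_lip.
apply: (le_trans (lerD h1 h2)); rewrite -natr1.
have p0 : 0 <= p%:R :> R by [].
have := sqr_ge0 `|y - x|; move: p0; move: (p%:R) (`|y - x|) => P A P0 A0; nra.
Qed.

Variables (c : nat -> R) (B : R).
Hypothesis cB : forall n, \sum_(1 <= p < n) p%:R * `|c p| <= B.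

Definition pser x := limn (fun n => \sum_(1 <= p < n) c p * x ^+ p).
Definition dpser x := limn (fun n => \sum_(1 <= p < n) c p * (p%:R * x ^+ p.-1)).

Lemma cvg_abs_sum1 (f : nat -> R) : (forall n, \sum_(1 <= p < n) `|f p| <= B) ->
  cvgn (fun n => \sum_(1 <= p < n) f p).
Proof.
move=> fB; pose g p := if (1 <= p)%N then f p else 0.
have h : cvgn (fun n => \sum_(1 <= p < n) g p).
  apply: (@cvg_abs_sum _ _ B) => n; apply: le_trans (fB n); rewrite sum_geqE.
  by apply: ler_sum => p _; rewrite /g; case: ifP => //; rewrite normr0.
rewrite (_ : (fun n => _) = (fun n => \sum_(1 <= p < n) g p))//.
by apply/funext => n; rewrite !sum_geqE; apply: eq_bigr => p _; rewrite /g; case: ifP.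
Qed.

Lemma pser_cvg x : `|x| <= 1 -> (fun n => \sum_(1 <= p < n) c p * x ^+ p) @ \oo --> pser x.
Proof.
move=> x1; apply: cvg_abs_sum1 => n; apply: le_trans (cB n).
rewrite big_nat [leRHS]big_nat; apply: ler_sum => p /andP[p1 _].
rewrite normrM normrX mulrC; apply: ler_wpM2r => //.
apply: (@le_trans _ _ 1); first exact: exprn_ile1.
by rewrite ler1n.
Qed.

Lemma dpser_cvg x : `|x| <= 1 ->
  (fun n => \sum_(1 <= p < n) c p * (p%:R * x ^+ p.-1)) @ \oo --> dpser x.
Proof.
move=> x1; apply: cvg_abs_sum1 => n; apply: le_trans (cB n).
apply: ler_sum => p _; rewrite !normrM normr_nat normrX mulrCA.
rewrite ler_wpM2l// -[leRHS]mulr1; apply: ler_wpM2l => //; exact: exprn_ile1.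
Qed.

Lemma dpser_bound x : `|x| <= 1 -> `|dpser x| <= B.
Proof.
move=> x1; apply: (cvg_norm_le (dpser_cvg x1)).
apply: nearW => n; apply: le_trans (cB n); apply: (le_trans (ler_norm_sum _ _ _)).
apply: ler_sum => p _; rewrite !normrM normr_nat normrX mulrCA.
rewrite ler_wpM2l// -[leRHS]mulr1; apply: ler_wpM2l => //; exact: exprn_ile1.
Qed.

Lemma pser_lip x y : `|x| <= 1 -> `|y| <= 1 -> `|pser y - pser x| <= B * `|y - x|.
Proof.
move=> x1 y1; apply: (cvg_norm_le (cvgB (pser_cvg y1) (pser_cvg x1))).
apply: nearW => n; rewrite !fctE -sumrB; apply: (le_trans (ler_norm_sum _ _ _)).
apply: (@le_trans _ _ ((\sum_(1 <= p < n) p%:R * `|c p|) * `|y - x|)).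
  rewrite mulr_suml; apply: ler_sum => p _; rewrite -mulrBr normrM mulrC.
  by rewrite mulrAC; apply: ler_wpM2r => //; exact: power_lip.
by apply: ler_wpM2r.
Qed.

Let B0 : 0 <= B. Proof. by have := cB 0; rewrite big_geq. Qed.

Let tail (e : R) : 0 < e -> exists n, (0 < n)%N /\
  forall m, (n <= m)%N -> \sum_(n <= p < m) p%:R * `|c p| <= e.
Proof.
move=> e0; pose s n := \sum_(1 <= p < n) p%:R * `|c p|.
have sm : {homo s : n m / (n <= m)%N >-> n <= m}.
  move=> n m nm; rewrite /s !sum_geqE -(subnKC nm) big_split_ord/= lerDl.
  by apply: sumr_ge0 => i _; case: ifP => // _; exact: mulr_ge0.
have sc : cvgn s.
  apply: nondecreasing_is_cvgn => //; exists B => _ [n _ <-]; exact: cB.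
have /cvgrPdist_le/(_ _ e0)[n0 _ h] := sc.
exists n0.+1; split => // m nm.
have := h n0.+1 (leqnSn _) => /=; have := nondecreasing_cvgn_le sm sc m.
have -> : s m = s n0.+1 + \sum_(n0.+1 <= p < m) p%:R * `|c p|.
  by rewrite /s -big_cat_nat.
by rewrite ler_norml => a /andP[_ b]; lra.
Qed.

(** The error of the power p grows like p^2 |y - x|^2, while only the sum of the p |c_p| is bounded,
    so no quadratic estimate holds for the whole series. Cut it at [n]: the tail costs 2 (e / 4) |y
    - x| by the Lipschitz bound on powers, and the head n B |y - x|^2, which is at most (e / 2) |y -
    x| for the chosen [del]. *)
Lemma pser_taylor (e : R) : 0 < e -> exists2 del, 0 < del &
  forall x y, `|x| <= 1 -> `|y| <= 1 -> `|y - x| <= del ->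
  `|pser y - pser x - (y - x) * dpser x| <= e * `|y - x|.
Proof.
move=> e0; have e4 : 0 < e / 4 by rewrite divr_gt0.
have [n [n0 tn]] := tail e4.
have nB : 0 < 2 * (n%:R * B + 1) by have := mulr_ge0 (ler0n R n) B0; lra.
exists (e / (2 * (n%:R * B + 1))); first by rewrite divr_gt0.
move=> x y x1 y1 xy.
apply: (cvg_norm_le (cvgB (cvgB (pser_cvg y1) (pser_cvg x1))
  (cvgM (cvg_cst (y - x)) (dpser_cvg x1)))).
exists n => // m /= nm; set t := fun p => y ^+ p - x ^+ p - (y - x) * (p%:R * x ^+ p.-1).
rewrite !fctE.
have -> : \sum_(1 <= p < m) c p * y ^+ p - \sum_(1 <= p < m) c p * x ^+ p -
    (y - x) * (\sum_(1 <= p < m) c p * (p%:R * x ^+ p.-1)) = \sum_(1 <= p < m) c p * t p.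
  by rewrite mulr_sumr -!sumrB; apply: eq_bigr => p _; rewrite /t; ring.
rewrite (big_cat_nat (n := n))//=.
apply: (le_trans (ler_normD _ _)).
have t2 p : `|t p| <= 2 * (p%:R * `|y - x|).
  apply: (le_trans (ler_normB _ _)); rewrite [leRHS]mulr_natl [leRHS]mulr2n; apply: lerD.
    exact: power_lip.
  rewrite !normrM normr_nat mulrC -mulrA ler_wpM2l// -[leRHS]mul1r normrX.
  by apply: ler_wpM2r => //; exact: exprn_ile1.
have h2 : `|\sum_(n <= p < m) c p * t p| <= e / 2 * `|y - x|.
  apply: (@le_trans _ _ ((\sum_(n <= p < m) p%:R * `|c p|) * (2 * `|y - x|))); last first.
    have := ler_wpM2r (mulr_ge0 (ler0n R 2) (normr_ge0 (y - x))) (tn m nm).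
    by move/le_trans; apply; rewrite le_eqVlt; apply/orP; left; apply/eqP; field.
  apply: (le_trans (ler_norm_sum _ _ _)); rewrite mulr_suml; apply: ler_sum => p _.
  rewrite normrM; apply: (le_trans (ler_wpM2l (normr_ge0 (c p)) (t2 p))).
  by rewrite le_eqVlt; apply/orP; left; apply/eqP; ring.
have h1 : `|\sum_(1 <= p < n) c p * t p| <= e / 2 * `|y - x|.
  apply: (@le_trans _ _ ((\sum_(1 <= p < n) p%:R * `|c p|) * (n%:R * `|y - x| ^+ 2))).
    apply: (le_trans (ler_norm_sum _ _ _)); rewrite mulr_suml.
    rewrite big_nat [leRHS]big_nat; apply: ler_sum => p /andP[_ pn].
    rewrite normrM; apply: (le_trans (ler_wpM2l (normr_ge0 (c p)) (power_taylor p x1 y1))).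
    rewrite [leRHS](_ : _ = `|c p| * (p%:R * n%:R * `|y - x| ^+ 2)); last by ring.
    rewrite ler_wpM2l// ler_wpM2r ?sqr_ge0// expr2 ler_wpM2l//.
    by rewrite ler_nat ltnW.
  apply: (@le_trans _ _ (B * (n%:R * `|y - x| ^+ 2))).
    by apply: ler_wpM2r => //; apply: mulr_ge0 => //; exact: sqr_ge0.
  rewrite expr2 !mulrA; apply: ler_wpM2r => //.
  move: xy; rewrite ler_pdivlMr// => xy.
  have := normr_ge0 (y - x); move: xy; set D := `|y - x| => xy D0.
  have -> : B * n%:R * D = (n%:R * B) * D by ring.
  by move: xy; set k := n%:R * B; nra.
have := lerD h1 h2; lra.
Qed.

(** One-sided derivatives at the end points are limits along this filter, and properness makes them
    unique. A point of the punctured neighbourhood is found by moving towards the farther end. *)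
Lemma proper_unit (x : R) : `|x| <= 1 -> ProperFilter (within `[-1, 1]%classic x^').
Proof.
move=> x1; split; last exact: within_filter.
rewrite /within/= /dnbhs/= => -[e /= e0 h].
move: x1; rewrite ler_norml => /andP[xa xb].
have [x0|x0] := lerP x 0.
- have m0 : 0 < Num.min (e / 2) 1 by rewrite lt_min divr_gt0//=.
  have m1 : Num.min (e / 2) 1 <= e / 2 by rewrite ge_min lexx.
  have m2 : Num.min (e / 2) 1 <= 1 by rewrite ge_min lexx orbT.
  apply: (h (x + Num.min (e / 2) 1)).
  + by rewrite /ball_/= opprD addNKr normrN gtr0_norm//; lra.
  + by rewrite -subr_eq0 addrC addKr gt_eqF.
  + by rewrite /= in_itv/=; apply/andP; split; lra.
- have m0 : 0 < Num.min (e / 2) 1 by rewrite lt_min divr_gt0//=.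
  have m1 : Num.min (e / 2) 1 <= e / 2 by rewrite ge_min lexx.
  have m2 : Num.min (e / 2) 1 <= 1 by rewrite ge_min lexx orbT.
  apply: (h (x - Num.min (e / 2) 1)).
  + by rewrite /ball_/= opprB addrC subrK gtr0_norm//; lra.
  + by rewrite -subr_eq0 addrC addKr oppr_eq0 gt_eqF.
  + by rewrite /= in_itv/=; apply/andP; split; lra.
Qed.

Lemma unit_deriveE x : `|x| <= 1 -> unit_derive pser x = dpser x.
Proof.
move=> x1; apply: cvg_lim; [exact: Rhausdorff|exact: proper_unit|].
apply/cvgrPdist_le => e e0; have [del d0 h] := pser_taylor e0.
rewrite /within/= /dnbhs/=; exists del => //= y xy yx yI.
have y1 : `|y| <= 1 by move: yI; rewrite /= in_itv/= ler_norml.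
have yx0 : `|y - x| > 0 by rewrite normr_gt0 subr_eq0.
have := h x y x1 y1; rewrite distrC ltW// => /(_ isT) hh.
rewrite distrC /slope -(ler_pM2r yx0) -normrM mulrBl divfK ?subr_eq0//.
by rewrite [in leRHS]distrC (mulrC (dpser x)).
Qed.

(** A convex function lies above its tangents. If the gap [m] at [y] were negative, convexity would
    make the gap at x + t (y - x) at most t m, whereas the Taylor estimate for small t allows only t
    m / 2. *)
Lemma pser_tangent x y : convex_function (`[-1, 1] : set R) pser ->
  `|x| <= 1 -> `|y| <= 1 -> 0 <= pser y - pser x - (y - x) * dpser x.
Proof.
move=> cvx x1 y1; rewrite leNgt; apply/negP => neg.
set m := pser y - _ - _ in neg.
have d0 : 0 < `|y - x| + 1 by have := normr_ge0 (y - x); lra.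
(* Adding 1 to |y - x| avoids a division by 0 when the points coincide. *)
have e0 : 0 < - m / 2 / (`|y - x| + 1) by rewrite !divr_gt0// oppr_gt0.
have [del del0 h] := pser_taylor e0.
pose t := Num.min 1 (del / (`|y - x| + 1)).
have t0 : 0 < t by rewrite lt_min ltr01 divr_gt0.
have t1 : t <= 1 by rewrite ge_min lexx.
have td : t * `|y - x| <= del.
  apply: (@le_trans _ _ (t * (`|y - x| + 1))).
    by rewrite ler_wpM2l// ?lerDl// ltW.
  by rewrite -ler_pdivlMr// ge_min lexx orbT.
have zE : x + t * (y - x) = (1 - t) * x + t * y by ring.
have z1 : `|x + t * (y - x)| <= 1.
  rewrite zE; apply: (le_trans (ler_normD _ _)); rewrite !normrM.
  rewrite (ger0_norm (ltW t0)) ger0_norm ?subr_ge0//.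
  have t1' : 0 <= 1 - t by rewrite subr_ge0.
  by have := ler_wpM2l t1' x1; have := ler_wpM2l (ltW t0) y1; lra.
have := h x _ x1 z1; rewrite addrC addKr normrM (gtr0_norm t0) => /(_ td).
rewrite ler_norml => /andP[h1 _].
have cv : pser (x + t * (y - x)) <= (1 - t) * pser x + t * pser y.
  have t01 : (0 <= 1 - t <= 1)%R by apply/andP; split; lra.
  have := cvx (Itv01 (proj1 (andP t01)) (proj2 (andP t01))) x y _ _.
  rewrite !inE /= !in_itv /= -!ler_norml => /(_ x1 y1).
  rewrite !convRE /= zE => hh.
  have oE : unstable.onem (1 - t) = t by rewrite /unstable.onem; ring.
  have e : (1 - t) * x + t * y = (1 - t) * x + unstable.onem (1 - t) * y by rewrite oE.
  apply: (@le_trans _ _ ((1 - t) * pser x + unstable.onem (1 - t) * pser y)).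
    by rewrite e; exact: hh.
  by rewrite oE.
have e1 : - m / 2 / (`|y - x| + 1) * (t * `|y - x|) <= t * (- m / 2).
  rewrite mulrCA; apply: ler_wpM2l; first exact: ltW.
  rewrite -[leLHS]mulrA ler_piMr//; first by rewrite divr_ge0// ltW// oppr_gt0.
  by rewrite mulrC ler_pdivrMr// mul1r lerDl.
have : t * m >= t * (m / 2).
  by rewrite /m; move: h1 e1 cv; rewrite /m; lra.
by rewrite ler_pM2l//; lra.
Qed.

End power_series.

Lemma sqsum_bounded1 (R : realType) (b : nat -> R) (B : R) :
  (forall n, \sum_(1 <= p < n) b p ^+ 2 <= B) -> sqsum_bounded b.
Proof.
move=> bB; exists (b 0 ^+ 2 + B) => -[|n].
  rewrite big_ord0 addr_ge0 ?sqr_ge0//.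
  by have := bB 0; rewrite big_geq.
by rewrite -(big_mkord xpredT (fun p => b p ^+ 2)) big_ltn// lerD2l.
Qed.

(** * The functions xi and theta *)

Section xi_facts.
Context (R : realType) (a : 'I_2 -> nat -> R).
Hypotheses (a_l2 : forall l, cvg (\sum_(1 <= p < n) a l p ^+ 2 @[n --> \oo]))
  (xi_derivable : forall l l', derivable_on_unit (xi a l l')).

Definition aa l l' p := a l p * a l' p.

Lemma a_sqsum l : sqsum_bounded (a l).
Proof.
have sm : {homo (fun n => \sum_(1 <= p < n) a l p ^+ 2) : n m / (n <= m)%N >-> n <= m}.
  move=> n m nm; rewrite !sum_geqE -(subnKC nm) big_split_ord/= lerDl.
  by apply: sumr_ge0 => i _; case: ifP => // _; exact: sqr_ge0.
apply: (@sqsum_bounded1 _ _ (limn (fun n => \sum_(1 <= p < n) a l p ^+ 2))) => n.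
exact: (nondecreasing_cvgn_le sm (@a_l2 l)).
Qed.

Lemma xi_cvg l l' x : `|x| <= 1 ->
  (fun n => \sum_(1 <= p < n) a l p * a l' p * x ^+ p) @ \oo --> xi a l l' x.
Proof. by move=> x1; apply: cov_cvg => //; exact: a_sqsum. Qed.

(** Differentiability at the end point 1 enters here. For 0 < y < 1 the difference quotient is a
    series with nonnegative terms that dominates each partial sum of a_p^2 (1 + y + ... + y^(p-1));
    letting y tend to 1 bounds the partial sums of p a_p^2 by the derivative. *)
Let weighted_sqsum l : exists D, forall n, \sum_(1 <= p < n) p%:R * a l p ^+ 2 <= D.
Proof.
have p1 : ProperFilter (within `[-1, 1]%classic (1 : R)^').
  by apply: proper_unit; rewrite normr1.
pose f := xi a l l; have n11 : -1 <= 1 :> R by apply: (@le_trans _ _ 0); rewrite ?lerN10.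
have fd := @xi_derivable l l 1; rewrite n11 lexx in fd; have {}fd := fd isT.
exists (unit_derive f 1) => n.
pose g (y : R) := \sum_(1 <= p < n) a l p ^+ 2 * \sum_(k < p) y ^+ k.
have g1 : g 1 = \sum_(1 <= p < n) p%:R * a l p ^+ 2.
  apply: eq_bigr => p _; rewrite (eq_bigr (fun=> 1)); last by move=> k _; rewrite expr1n.
  by rewrite sumr_const card_ord mulrC.
rewrite -g1.
have gc : g y @[y --> within `[-1, 1]%classic (1 : R)^'] --> g 1.
  have h : g y @[y --> (1 : R)] --> g 1.
    apply: cvg_bigsum => p; apply: cvgM; first exact: cvg_cst.
    apply: cvg_bigsum => k; exact: exprn_continuous.
  apply: cvg_trans h; apply: cvg_app.
  apply: (@cvg_trans _ (1 : R)^'); first exact: cvg_within.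
  exact: cvg_within.
apply: (ler_cvg_to gc fd).
rewrite /within/= /dnbhs/=; exists 1 => //= y y1 yn yI.
have y0 : 0 < y by move: y1; rewrite /ball_/= ltr_norml => /andP[_]; lra.
have yl : y < 1 by rewrite lt_neqAle yn; move: yI; rewrite in_itv/= => /andP[].
have d0 : 0 < 1 - y by rewrite subr_gt0.
rewrite /slope -[(_ - f 1)]opprB -[y - 1]opprB invrN mulrNN ler_pdivlMr//.
have c1 := @xi_cvg l l 1; rewrite normr1 in c1; have {}c1 := c1 (lexx _).
have c2 := @xi_cvg l l y; rewrite gtr0_norm// in c2; have {}c2 := c2 (ltW yl).
have h : (fun m => \sum_(1 <= p < m) a l p ^+ 2 * (1 - y ^+ p)) @ \oo --> f 1 - f y.
  rewrite (_ : (fun m => _) = (fun m => \sum_(1 <= p < m) a l p * a l p * 1 ^+ p -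
      \sum_(1 <= p < m) a l p * a l p * y ^+ p)); first exact: cvgB.
  apply/funext => m; rewrite -sumrB; apply: eq_bigr => p _.
  by rewrite expr1n expr2; ring.
rewrite -(cvg_lim (@Rhausdorff R) h); apply: limr_ge.
  by apply/cvg_ex; exists (f 1 - f y).
exists n => // m /= nm.
have -> : g y * (1 - y) = \sum_(1 <= p < n) a l p ^+ 2 * (1 - y ^+ p).
  rewrite /g mulr_suml; apply: eq_bigr => p _; rewrite -mulrA; congr (_ * _).
  by rewrite -[1 - y ^+ p]opprB subrX1; ring.
rewrite !sum_geqE -(subnKC nm) big_split_ord/= lerDl.
apply: sumr_ge0 => i _; case: ifP => // _; rewrite mulr_ge0 ?sqr_ge0// subr_ge0.
by apply: exprn_ile1; exact: ltW.
Qed.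

(** Mixed products are handled by 2 |a b| <= a^2 + b^2, so a single [B] serves all pairs of
    indices. *)
Lemma xi_weight : exists2 B, 0 <= B &
  forall l l' n, \sum_(1 <= p < n) p%:R * `|aa l l' p| <= B.
Proof.
have [D0 h0] := weighted_sqsum ord0; have [D1 h1] := weighted_sqsum ord_max.
have D00 : 0 <= D0 by have := h0 0; rewrite big_geq.
have D10 : 0 <= D1 by have := h1 0; rewrite big_geq.
exists (D0 + D1) => [|l l' n]; first exact: addr_ge0.
have hl l0 : \sum_(1 <= p < n) p%:R * a l0 p ^+ 2 <= D0 + D1.
  have [->|->] : l0 = ord0 \/ l0 = ord_max.
    by case: l0 => -[|[|//]] i; [left|right]; exact: val_inj.
  - by apply: (le_trans (h0 n)); rewrite lerDl.
  - by apply: (le_trans (h1 n)); rewrite lerDr.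
have := lerD (hl l) (hl l'); rewrite -big_split/=.
have : 2 * \sum_(1 <= p < n) p%:R * `|aa l l' p| <=
    \sum_(1 <= p < n) (p%:R * a l p ^+ 2 + p%:R * a l' p ^+ 2).
  rewrite mulr_sumr; apply: ler_sum => p _; rewrite -mulrDr mulrCA ler_wpM2l//.
  rewrite /aa normrM -[a l p ^+ 2]real_normK ?num_real// -[a l' p ^+ 2]real_normK ?num_real//.
  have := sqr_ge0 (`|a l p| - `|a l' p|); move: (`|a l p|) (`|a l' p|) => x y; nra.
by move=> /le_trans h /h; lra.
Qed.

End xi_facts.

Section xi_bounds.
Context (R : realType) (a : 'I_2 -> nat -> R) (B : R).
Hypotheses (B0 : 0 <= B) (aB : forall l l' n, \sum_(1 <= p < n) p%:R * `|aa a l l' p| <= B).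
Hypothesis xi_convex : forall l l', convex_function (`[-1, 1] : set R) (xi a l l').

Lemma xiC l l' x : xi a l l' x = xi a l' l x.
Proof.
rewrite /xi (_ : (fun n => _) = (fun n => \sum_(1 <= p < n) a l' p * a l p * x ^+ p))//.
by apply/funext => n; apply: eq_bigr => p _; rewrite (mulrC (a l p)).
Qed.

Lemma xi'E l l' x : `|x| <= 1 -> xi' a l l' x = dpser (aa a l l') x.
Proof. by move=> x1; apply: unit_deriveE x1; exact: aB. Qed.

Lemma xi'C l l' x : xi' a l l' x = xi' a l' l x.
Proof.
rewrite /xi'; congr (unit_derive _ x); apply/funext => y; exact: xiC.
Qed.

Lemma thetaC l l' x : theta a l l' x = theta a l' l x.
Proof. by rewrite /theta xi'C xiC. Qed.

Lemma xi'_bound l l' x : `|x| <= 1 -> `|xi' a l l' x| <= B.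
Proof. by move=> x1; rewrite xi'E//; apply: dpser_bound x1; exact: aB. Qed.

Lemma xi_lip l l' x y : `|x| <= 1 -> `|y| <= 1 ->
  `|xi a l l' y - xi a l l' x| <= B * `|y - x|.
Proof. by move=> x1 y1; apply: pser_lip x1 y1; exact: aB. Qed.

Lemma xi0 l l' : xi a l l' 0 = 0.
Proof.
rewrite /xi (_ : (fun n => _) = fun=> 0) ?lim_cst//; apply/funext => n.
rewrite big_nat big1// => p /andP[p1 _].
by rewrite expr0n; case: p p1 => //= p _; rewrite mulr0.
Qed.

Lemma xi_bound l l' x : `|x| <= 1 -> `|xi a l l' x| <= B.
Proof.
move=> x1; have := @xi_lip l l' 0 x; rewrite normr0 ler01 xi0 !subr0 => /(_ isT x1).
by move/le_trans; apply; rewrite ler_piMr.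
Qed.

Lemma theta_bound l l' x : `|x| <= 1 -> `|theta a l l' x| <= 2 * B.
Proof.
move=> x1; rewrite /theta mulr_natl mulr2n; apply: (le_trans (ler_normB _ _)).
apply: lerD; last exact: xi_bound.
rewrite normrM -[leRHS]mul1r; apply: ler_pM => //; exact: xi'_bound.
Qed.

Lemma xi_taylor (e : R) : 0 < e -> exists2 del, 0 < del &
  forall l l' x y, `|x| <= 1 -> `|y| <= 1 -> `|y - x| <= del ->
  `|xi a l l' y - xi a l l' x - (y - x) * xi' a l l' x| <= e * `|y - x|.
Proof.
move=> e0.
pose Q (ll : 'I_2 * 'I_2) del := 0 < del /\
  forall x y, `|x| <= 1 -> `|y| <= 1 -> `|y - x| <= del ->
  `|xi a ll.1 ll.2 y - xi a ll.1 ll.2 x - (y - x) * xi' a ll.1 ll.2 x| <= e * `|y - x|.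
have hQ ll : exists del, Q ll del.
  have [del d0 h] := pser_taylor (aB ll.1 ll.2) e0; exists del; split => // x y x1 y1 xy.
  by rewrite xi'E//; exact: h.
have [D hD] := choice hQ.
exists (\big[Num.min/1]_ll D ll).
  by elim/big_rec: _ => // ll x _ x0; rewrite lt_min x0 (hD ll).1.
move=> l l' x y x1 y1 xy; apply: (hD (l, l')).2 => //; apply: (le_trans xy).
by rewrite (bigD1 (l, l'))//= ge_min lexx.
Qed.

Lemma xi_tangent l l' x y : `|x| <= 1 -> `|y| <= 1 ->
  0 <= xi a l l' y - xi a l l' x - (y - x) * xi' a l l' x.
Proof. by move=> x1 y1; rewrite xi'E//; apply: (pser_tangent (aB l l') _ x1 y1); exact: xi_convex. Qed.

Lemma xi_tangent_le l l' x y : `|x| <= 1 -> `|y| <= 1 ->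
  xi a l l' y - xi a l l' x - (y - x) * xi' a l l' x <= 2 * B * `|y - x|.
Proof.
move=> x1 y1; apply: (le_trans (ler_norm _)); apply: (le_trans (ler_normB _ _)).
rewrite -mulrA [leRHS]mulr_natl [leRHS]mulr2n; apply: lerD; first exact: xi_lip.
rewrite normrM mulrC; apply: ler_wpM2r => //; exact: xi'_bound.
Qed.

End xi_bounds.

(** * Integrals of functions equal almost everywhere *)

Section almost_everywhere.
Context d (T : measurableType d) (R : realType) (P : probability T R).
Local Open Scope ereal_scope.

(** No measurability is assumed: the integral is a supremum over simple functions below [f], and
    each of them, set to 0 on the exceptional set, lies below [g] and keeps its integral. The
    integrands of [G] are treated this way. *)
Let ge0_integral_ae_le (f g : T -> \bar R) : (forall t, 0 <= f t) -> (forall t, 0 <= g t) ->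
  {ae P, forall t, f t = g t} -> \int[P]_t f t <= \int[P]_t g t.
Proof.
move=> f0 g0 [N [mN N0 sN]].
rewrite [leLHS]ge0_integralTE//; apply: ge_ereal_sup => _ [k /= kf <-].
have mNc : measurable (~` N) by exact: measurableC.
pose k' : {nnsfun T >-> R} := mul_nnsfun k (indic_nnsfun R mNc).
have k'E t : k' t = (k t * \1_(~` N) t)%R by [].
rewrite -integralT_nnsfun.
have -> : \int[P]_t (k t)%:E = \int[P]_t (k' t)%:E.
  apply: ge0_ae_eq_integral => //.
  - by apply/measurable_EFinP.
  - by apply/measurable_EFinP.
  - by move=> t _; rewrite lee_fin.
  - by move=> t _; rewrite lee_fin.
  exists N; split => // t /= h; apply: contrapT => tN; apply: h => _.
  have e : k' t = k t by rewrite k'E indicE mem_set// mulr1.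
  exact: (congr1 EFin (esym e)).
rewrite integralT_nnsfun [leRHS]ge0_integralTE//; apply: ereal_sup_ubound.
exists k' => // t; rewrite k'E indicE; case: (boolP (t \in _)) => [|_].
  rewrite inE /= => tN; rewrite mulr1; apply: le_trans (kf t) _.
  suff -> : f t = g t by [].
  by apply: contrapT => h; apply: tN; exact: sN.
by rewrite mulr0.
Qed.

Lemma eq_integral_ae (f g : T -> \bar R) : {ae P, forall t, f t = g t} ->
  \int[P]_t f t = \int[P]_t g t.
Proof.
move=> fg; have gf : {ae P, forall t, g t = f t} by apply: filterS fg => t ->.
rewrite integralE [RHS]integralE; congr (_ - _); apply/eqP; rewrite eq_le; apply/andP; split;
  apply: ge0_integral_ae_le => //.
- by apply: filterS fg => t h; rewrite !funeposE h.
- by apply: filterS gf => t h; rewrite !funeposE h.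
- by apply: filterS fg => t h; rewrite !funenegE h.
- by apply: filterS gf => t h; rewrite !funenegE h.
Qed.

End almost_everywhere.

(** * Truncation of random weights *)

Section random_mixture.
Context d (T : measurableType d) (R : realType) (P : probability T R).

Lemma Rint_dominated_ae (F : nat -> T -> R) (f g : T -> R) :
  (forall n, measurable_fun setT (F n)) -> measurable_fun setT f ->
  {ae P, forall t, F n t @[n --> \oo] --> f t} ->
  {ae P, forall t, forall n, `|F n t| <= g t} -> rintegrable P g ->
  rintegrable P f /\ \int[P]_t F n t @[n --> \oo] --> \int[P]_t f t.
Proof.
move=> mF mf Ff Fg ig.
have [] := @dominated_convergence _ _ _ P setT measurableT
  (fun n => EFin \o F n) (EFin \o f) (EFin \o g).
- by move=> n; exact/measurable_EFinP.
- exact/measurable_EFinP.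
- apply: filterS Ff => t Ft _.
  by apply: cvg_comp; first exact: Ft.
- exact: ig.
- by apply: filterS Fg => t Ft n _; rewrite lee_fin.
move=> hf _ h; split => //.
apply: fine_cvg; rewrite fineK//; exact: integrable_fin_num.
Qed.

Lemma rint_series (f : nat -> T -> R) (K : R) : (forall i t, 0 <= f i t) ->
  (forall i, rintegrable P (f i)) -> (forall n, \int[P]_t (\sum_(i < n) f i t) <= K) ->
  exists r : T -> R, [/\ rintegrable P r,
    {ae P, forall t, \sum_(i < n) f i t @[n --> \oo] --> r t},
    {ae P, forall t, forall n, \sum_(i < n) f i t <= r t} &
    {ae P, forall t, (\sum_(i <oo) (f i t)%:E)%E = (r t)%:E}].
Proof.
move=> f0 fi fK; pose F t := (\sum_(i <oo) (f i t)%:E)%E.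
have mfi i : measurable_fun setT (fun t => (f i t)%:E).
  by apply/measurable_EFinP; exact: rint_measurable (fi i).
have mF : measurable_fun setT F.
  by apply: ge0_emeasurable_sum => // i t _ _; rewrite lee_fin.
have F0 t : (0 <= F t)%E by apply: nneseries_ge0 => i _ _; rewrite lee_fin.
have iF : P.-integrable setT F.
  apply/integrableP; split => //.
  rewrite (eq_integral F); last by move=> t _; rewrite gee0_abs.
  rewrite integral_nneseries//; last by move=> i t _; rewrite lee_fin.
  apply: (@le_lt_trans _ _ K%:E); last exact: ltry.
  apply: lime_le; first by apply: is_cvg_nneseries => i _ _; apply: integral_ge0 => t _; rewrite lee_fin.
  apply: nearW => n; rewrite big_mkord.
  rewrite (eq_bigr (fun i : 'I_n => (\int[P]_t f i t)%:E)); last first.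
    by move=> i _; rewrite -EFin_Rint.
  by rewrite sumEFin lee_fin; have := fK n; rewrite Rint_sum.
pose r t := fine (F t).
have Ff : {ae P, forall t, F t = (r t)%:E}.
  by have := integrable_ae measurableT iF; apply: filterS => t /(_ I) h; rewrite /r fineK.
have partial t n : ((\sum_(i < n) f i t)%:E <= F t)%E.
  rewrite -sumEFin -(big_mkord xpredT (fun i => (f i t)%:E)).
  by apply: nneseries_lim_ge => i _ _; rewrite lee_fin.
exists r; split.
- apply/integrableP; split.
    by apply/measurable_EFinP; exact: (measurableT_comp (fine_measurable _)).
  have /integrableP[_] := iF; rewrite [X in (X < _)%E -> _](_ : _ = (\int[P]_t `|(EFin \o r) t|)%E)//.
  by apply: eq_integral_ae; apply: filterS Ff => t ->.
- apply: filterS Ff => t tr.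
  have c : (fun n => (\sum_(0 <= i < n) (f i t)%:E)%E) @ \oo --> (r t)%:E.
    by rewrite -tr; apply: is_cvg_nneseries => i _ _; rewrite lee_fin.
  have h := fine_cvg c.
  suff <- : fine \o (fun n => (\sum_(0 <= i < n) (f i t)%:E)%E) =
    (fun n => \sum_(i < n) f i t) by exact: h.
  by apply/funext => n /=; rewrite sumEFin big_mkord.
- by apply: filterS Ff => t tr n; have := partial t n; rewrite tr lee_fin.
- exact: Ff.
Qed.

(** Jensen's inequality for the inverse, obtained from its tangent at the mean [s]: 1/b >= 2/s -
    b/s^2. *)
Lemma inv_convex (n : nat) (p b : 'I_n -> R) : (forall i, 0 <= p i) -> (forall i, 0 < b i) ->
  \sum_i p i = 1 -> (\sum_i p i * b i)^-1 <= \sum_i p i * (b i)^-1.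
Proof.
move=> p0 b0 p1; set s := \sum_i p i * b i.
have s0 : 0 < s.
  rewrite lt_neqAle sumr_ge0 ?andbT; last by move=> i _; rewrite mulr_ge0// ltW.
  apply/negP => /eqP/esym/eqP; rewrite psumr_eq0; last by move=> i _; rewrite mulr_ge0// ltW.
  move=> /allP h; have : \sum_i p i = 0.
    apply: big1 => i _; have := h i (mem_index_enum i); rewrite implyTb mulf_eq0.
    by rewrite (gt_eqF (b0 i)) orbF => /eqP.
  by rewrite p1 => /eqP; rewrite oner_eq0.
have h i : 2 / s - b i / s ^+ 2 <= (b i)^-1.
  rewrite -subr_ge0 (_ : _ - _ = (b i)^-1 * (1 - b i / s) ^+ 2); last first.
    by field; rewrite !gt_eqF.
  by rewrite mulr_ge0 ?sqr_ge0// invr_ge0 ltW.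
apply: (@le_trans _ _ (\sum_i p i * (2 / s - b i / s ^+ 2))); last first.
  by apply: ler_sum => i _; rewrite ler_wpM2l.
have -> : \sum_i p i * (2 / s - b i / s ^+ 2) =
    2 / s * (\sum_i p i) - (\sum_i p i * b i) / s ^+ 2.
  by rewrite mulr_sumr mulr_suml -sumrB; apply: eq_bigr => i _; ring.
rewrite p1 -/s le_eqVlt; apply/orP; left; apply/eqP.
by field; rewrite gt_eqF.
Qed.

Lemma ln_abs_le (x : R) : 0 < x -> `|ln x| <= x + x^-1.
Proof.
move=> x0; have xi0 : 0 < x^-1 by rewrite invr_gt0.
have h1 := ltW (ln_sublinear x0); have h2 := ltW (ln_sublinear xi0).
rewrite lnV ?posrE// in h2; rewrite ler_norml; apply/andP; split; lra.
Qed.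

Variables (W B B' : nat -> T -> R) (K : R).
Hypotheses (mW : forall i, measurable_fun setT (W i)) (mB : forall i, measurable_fun setT (B i))
  (W0 : forall i t, 0 <= W i t) (W1 : forall n t, \sum_(i < n) W i t <= 1)
  (Wae : {ae P, forall t, \sum_(i < n) W i t @[n --> \oo] --> (1 : R)})
  (B0 : forall i t, 0 < B i t) (BB : forall i t, B i t + (B i t)^-1 <= B' i t)
  (iB0 : rintegrable P (B' 0))
  (iWB : forall i, rintegrable P (fun t => W i t * B' i t))
  (WBK : forall i, \int[P]_t (W i t * B' i t) <= K * \int[P]_t W i t).
Hypothesis K0 : 0 <= K.

Definition trunc_mix n t := \sum_(i < n) W i t * B i t + (1 - \sum_(i < n) W i t) * B 0 t.

(* The mass missing from the first n weights is put on index 0. *)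
Definition trunc_weight n (i : 'I_n.+1) t : R :=
  (if (i < n)%N then W i t else 0) + (i == ord0)%:R * (1 - \sum_(j < n) W j t).

Lemma trunc_weight_sum n t (f : nat -> R) : \sum_(i < n.+1) trunc_weight i t * f i =
  \sum_(i < n) W i t * f i + (1 - \sum_(i < n) W i t) * f 0.
Proof.
under eq_bigr do rewrite mulrDl; rewrite big_split/= big_ord_recr/= ltnn mul0r addr0.
congr (_ + _); first by apply: eq_bigr => i _; rewrite ltn_ord.
rewrite (bigD1 ord0)//= ?eqxx mul1r -[RHS]addr0; congr (_ + _).
by apply: big1 => i /negbTE ->; rewrite !mul0r.
Qed.

Lemma trunc_weight_ge0 n (i : 'I_n.+1) t : 0 <= trunc_weight i t.
Proof.
apply: addr_ge0; first by case: ifP.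
by rewrite mulr_ge0// subr_ge0.
Qed.

Lemma trunc_weight1 n t : \sum_(i < n.+1) trunc_weight i t = 1.
Proof.
have := trunc_weight_sum n t (fun=> 1).
by under eq_bigr do rewrite mulr1; move=> ->; under eq_bigr do rewrite mulr1; ring.
Qed.

Lemma trunc_mix_gt0 n t : 0 < trunc_mix n t.
Proof.
rewrite /trunc_mix -(trunc_weight_sum n t (B ^~ t)).
have h i : 0 <= @trunc_weight n i t * B i t.
  by rewrite mulr_ge0 ?trunc_weight_ge0// ltW.
rewrite lt_neqAle sumr_ge0// andbT; apply/negP => /eqP/esym/eqP.
rewrite psumr_eq0// => /allP h'.
have : \sum_(i < n.+1) trunc_weight i t = 0.
  apply: big1 => i _; have := h' i (mem_index_enum i); rewrite implyTb mulf_eq0.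
  by rewrite (gt_eqF (B0 i t)) orbF => /eqP.
by rewrite trunc_weight1 => /eqP; rewrite oner_eq0.
Qed.

Let B'0 i t : 0 <= B' i t.
Proof. by apply: le_trans (BB i t); rewrite addr_ge0 ?invr_ge0 ?ltW. Qed.

Let S_gt0 := trunc_mix_gt0.

Let S_bound n t : trunc_mix n t + (trunc_mix n t)^-1 <= \sum_(i < n) W i t * B' i t + B' 0 t.
Proof.
rewrite /trunc_mix -(trunc_weight_sum n t (B ^~ t)).
have h := @inv_convex n.+1 (fun i => trunc_weight i t) (fun i => B i t)
  (fun i => trunc_weight_ge0 i t) (fun i => B0 i t) (trunc_weight1 n t).
apply: (le_trans (lerD (lexx _) h)); rewrite -big_split/=.
apply: (@le_trans _ _ (\sum_(i < n.+1) trunc_weight i t * B' i t)).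
  apply: ler_sum => i _; rewrite -mulrDr ler_wpM2l ?trunc_weight_ge0//.
rewrite (trunc_weight_sum n t (B' ^~ t)) lerD2l ler_piMl// gerBl.
exact: sumr_ge0.
Qed.

Let mS n : measurable_fun setT (trunc_mix n).
Proof.
apply: measurable_funD.
  by apply: measurable_sum => i; exact: measurable_funM.
apply: measurable_funM => //; apply: measurable_funB => //.
by apply: measurable_sum.
Qed.

Let iW i : rintegrable P (W i).
Proof.
apply: (@rint_bounded _ _ _ _ _ 1) => // t; rewrite ger0_norm//.
apply: le_trans (W1 i.+1 t); rewrite big_ord_recr/= lerDr; exact: sumr_ge0.
Qed.

Lemma rint_ln_trunc n : rintegrable P (fun t => ln (trunc_mix n t)).
Proof.
apply: (@rint_le _ _ _ P _ (fun t => \sum_(i < n) W i t * B' i t + B' 0 t)).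
- exact: measurable_log.
- by move=> t; apply: le_trans (S_bound n t); exact: ln_abs_le.
- by apply: rintD => //; exact: rint_sum.
Qed.

(** By |ln x| <= x + 1/x and Jensen for the inverse, every truncated logarithm is bounded by one
    function, the series of the [W i * B' i] plus [B' 0]. That series is integrable because its
    terms integrate to at most K times the mean weights, whose total is at most 1. *)
Lemma trunc_mix_limit : exists S : T -> R, [/\ rintegrable P (fun t => ln (S t)),
  {ae P, forall t, 0 < S t},
  {ae P, forall t, (\sum_(i <oo) (W i t * B i t)%:E)%E = (S t)%:E} &
  \int[P]_t ln (trunc_mix n t) @[n --> \oo] --> \int[P]_t ln (S t)].
Proof.
have bnd n : \int[P]_t (\sum_(i < n) W i t * B' i t) <= K.
  rewrite Rint_sum//; apply: (@le_trans _ _ (\sum_(i < n) K * \int[P]_t W i t)).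
    exact: ler_sum.
  rewrite -mulr_sumr -Rint_sum// ler_piMr//.
  by rewrite -[leRHS](Rint_cst P 1); apply: Rint_le => //; [exact: rint_sum|exact: rint_cst].
have BB' i t : B i t <= B' i t.
  by apply: le_trans (BB i t); rewrite lerDl invr_ge0 ltW.
have iWB1 i : rintegrable P (fun t => W i t * B i t).
  apply: rint_le (iWB i); first exact: measurable_funM.
  by move=> t; rewrite ger0_norm ?mulr_ge0 ?ler_wpM2l// ltW.
have [r [ir rc rle _]] := @rint_series (fun i t => W i t * B' i t) K
  (fun i t => mulr_ge0 (W0 i t) (B'0 i t)) iWB bnd.
have bnd1 n : \int[P]_t (\sum_(i < n) W i t * B i t) <= K.
  apply: le_trans (bnd n); apply: Rint_le; [exact: rint_sum|exact: rint_sum|].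
  by move=> t; apply: ler_sum => i _; exact: ler_wpM2l.
have [S [iS Sc Sle SE]] := @rint_series (fun i t => W i t * B i t) K
  (fun i t => mulr_ge0 (W0 i t) (ltW (B0 i t))) iWB1 bnd1.
have lim : {ae P, forall t, trunc_mix n t @[n --> \oo] --> S t}.
  move: Wae Sc; apply: filterS2 => t wt st.
  rewrite -[S t]addr0 -[X in _ + X](mul0r (B 0 t)) -[X in _ + X * _](subrr 1).
  apply: cvgD; first exact: st.
  by apply: cvgM; [apply: cvgB; [exact: cvg_cst|exact: wt]|exact: cvg_cst].
have dom : {ae P, forall t, forall n, trunc_mix n t + (trunc_mix n t)^-1 <= r t + B' 0 t}.
  apply: filterS rle => t rt n; apply: (le_trans (S_bound n t)).
  by rewrite lerD2r.
(* The bound on the inverses is uniform in [n] and keeps the limit away from 0. *)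
have S0 : {ae P, forall t, 0 < S t}.
  move: lim dom; apply: filterS2 => t lt dt.
  have g0 : 0 < r t + B' 0 t.
    by apply: lt_le_trans (dt 0); rewrite addr_gt0 ?invr_gt0.
  apply: (@lt_le_trans _ _ (r t + B' 0 t)^-1); first by rewrite invr_gt0.
  rewrite -(cvg_lim (@Rhausdorff R) lt); apply: limr_ge; first by apply/cvg_ex; exists (S t).
  apply: nearW => n; rewrite -[leRHS]invrK lef_pV2 ?posrE ?invr_gt0//.
  by apply: le_trans (dt n); rewrite lerDr ltW.
exists S.
have [i1 l1] : rintegrable P (fun t => ln (S t)) /\
    \int[P]_t ln (trunc_mix n t) @[n --> \oo] --> \int[P]_t ln (S t).
  apply: (@Rint_dominated_ae _ _ (fun t => r t + B' 0 t)).
  - by move=> n; exact: measurable_log.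
  - by apply: measurable_log; exact: rint_measurable iS.
  - move: lim S0; apply: filterS2 => t lt st.
    by apply: continuous_cvg => //; exact: continuous_ln.
  - apply: filterS dom => t dt n; apply: le_trans (dt n); exact: ln_abs_le.
  - exact: rintD.
by split.
Qed.

End random_mixture.

(** * Gaussian families: combinations, covariances, transforms *)

Section gaussian_families.
Context d (T : measurableType d) (R : realType) (P : probability T R).

Lemma rint_product (X Y : T -> R) : measurable_fun setT X -> measurable_fun setT Y ->
  rintegrable P (fun w => X w ^+ 2) -> rintegrable P (fun w => Y w ^+ 2) ->
  rintegrable P (fun w => X w * Y w).
Proof.
move=> mX mY iX iY; apply: (rint_le _ _ (rintD iX iY)); first exact: measurable_funM.
move=> w; rewrite normrM -[X w ^+ 2]real_normK ?num_real// -[Y w ^+ 2]real_normK ?num_real//.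
have := sqr_ge0 (`|X w| - `|Y w|); have := normr_ge0 (X w); have := normr_ge0 (Y w).
by move: (`|X w|) (`|Y w|) => x y; nra.
Qed.

Lemma Rint_quad (K : finType) (X : K -> T -> R) (C : K -> K -> R) (c : K -> R) :
  (forall k, measurable_fun setT (X k)) ->
  (forall k, rintegrable P (fun w => X k w ^+ 2)) ->
  (forall k l, \int[P]_w (X k w * X l w) = C k l) ->
  \int[P]_w ((\sum_k c k * X k w) ^+ 2) = quad C c.
Proof.
move=> mX iX XC.
have ip k l : rintegrable P (fun w => X k w * X l w) by exact: rint_product.
transitivity (\int[P]_w (\sum_k \sum_l c k * c l * (X k w * X l w))).
  apply: eq_Rintegral => w _; rewrite expr2 mulr_suml; apply: eq_bigr => k _.
  by rewrite mulr_sumr; apply: eq_bigr => l _; ring.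
rewrite Rint_sum; last by move=> k _; apply: rint_sum => l _; exact: rintZ.
apply: eq_bigr => k _; rewrite Rint_sum; last by move=> l _; exact: rintZ.
by apply: eq_bigr => l _; rewrite RintZ// XC.
Qed.

Lemma centered_gaussianP (X : T -> R) : centered_gaussian P X ->
  exists s : R, forall B, measurable B -> P (X @^-1` B) = glaw s B.
Proof. by move=> [s s0 h]; exists s => B mB; rewrite h// glawE. Qed.

Lemma law_sqr (X : T -> R) (s : R) : measurable_fun setT X ->
  (forall B, measurable B -> P (X @^-1` B) = glaw s B) ->
  rintegrable P (fun w => X w ^+ 2) /\ \int[P]_w (X w ^+ 2) = s ^+ 2.
Proof.
move=> mX h; have [i e] := glaw_sqr s.
by split; [exact: (rint_law mX h i)|rewrite (Rint_law mX h i)].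
Qed.

Lemma law_cos (X : T -> R) (s : R) th : measurable_fun setT X ->
  (forall B, measurable B -> P (X @^-1` B) = glaw s B) ->
  \int[P]_w cos (th + X w) = cos th * expR (- s ^+ 2 / 2).
Proof.
move=> mX h.
have mc : measurable_fun setT (fun x : R => cos (th + 1 * x)).
  by apply: measurable_cos; apply: measurable_funD => //; exact: measurable_funM.
have ic : rintegrable (glaw s) (fun x : R => cos (th + 1 * x)).
  by apply: (@rint_bounded _ _ _ _ _ 1) => // x; exact: cos_norm_le1.
have := glaw_cos s th 1; rewrite -(Rint_law mX h ic) expr1n mulr1 => <-.
by apply: eq_Rintegral => w _; rewrite mul1r.
Qed.

(** [gaussian_family] leaves the variances of the linear combinations free; the prescribed second
    moments determine them. *)
Lemma gaussian_family_gfam (I : eqType) (X : I -> T -> R) (C : I -> I -> R) :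
  (forall i, measurable_fun setT (X i)) -> gaussian_family P X ->
  (forall i j, ('E_P[fun w => (X i w * X j w)%R] = (C i j)%:E)%E) -> gfam P X C.
Proof.
move=> mX gX XC K f c th.
have sq i : rintegrable P (fun w => X i w ^+ 2).
  have [s hs] := centered_gaussianP (gX [:: i] (fun=> 1)).
  have [] := @law_sqr (X i) s (mX i) _ => // B mB.
  rewrite -hs//; congr (P _); apply/seteqP; split => w /=;
  by rewrite big_cons big_nil mul1r addr0.
have XC' i j : \int[P]_w (X i w * X j w) = C i j.
  by rewrite /Rintegral -[RHS](congr1 fine (XC i j)) expectation.unlock.
(* In [gaussian_family] the coefficient is a function of the index, so the coefficients of all [k]
   with the same [f k] are merged. *)
pose s := undup [seq f k | k <- index_enum K].
pose c' i := \sum_(k | f k == i) c k.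
have E w : \sum_(i <- s) c' i * X i w = \sum_k c k * X (f k) w.
  under eq_bigr do rewrite /c' mulr_suml.
  rewrite (exchange_big_dep xpredT)//=; apply: eq_bigr => k _.
  rewrite (eq_bigl (pred1 (f k))); last by move=> i; rewrite /= eq_sym.
  rewrite -big_filter filter_pred1_uniq ?undup_uniq ?big_seq1//.
  by rewrite mem_undup; apply/mapP; exists k; rewrite // mem_index_enum.
have [sg hs] := centered_gaussianP (gX s c').
pose Y w := \sum_k c k * X (f k) w.
have mY : measurable_fun setT Y by apply: measurable_sum => k; exact: measurable_funM.
have hY B : measurable B -> P (Y @^-1` B) = glaw sg B.
  by move=> mB; rewrite -hs//; congr (P _); apply/seteqP; split => w /=; rewrite /Y E.
suff eq : sg ^+ 2 = quad (fun k l => C (f k) (f l)) c.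
  by have := law_cos th mY hY; rewrite eq.
rewrite -(law_sqr mY hY).2.
exact: (@Rint_quad _ (fun k => X (f k)) (fun k l => C (f k) (f l))).
Qed.

Lemma gfam_law (J : Type) (X : J -> T -> R) (C : J -> J -> R) (K : finType) (f : K -> J)
    (c : K -> R) : (forall j, measurable_fun setT (X j)) -> gfam P X C ->
  0 <= quad (fun k l => C (f k) (f l)) c ->
  forall B, measurable B -> P ((fun w => \sum_k c k * X (f k) w) @^-1` B) =
    glaw (Num.sqrt (quad (fun k l => C (f k) (f l)) c)) B.
Proof.
move=> mX gX q0; apply: cos_law; first by apply: measurable_sum => k; exact: measurable_funM.
move=> th t; rewrite sqr_sqrtr//.
transitivity (\int[P]_w cos (th + \sum_k (t * c k) * X (f k) w)).
  apply: eq_Rintegral => w _; congr (cos (_ + _)); rewrite mulr_sumr.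
  by apply: eq_bigr => k _; rewrite mulrA.
rewrite gX; suff -> : quad (fun k l => C (f k) (f l)) (fun k => t * c k) =
  quad (fun k l => C (f k) (f l)) c * t ^+ 2 by [].
rewrite /quad mulr_suml; apply: eq_bigr => k _; rewrite mulr_suml.
by apply: eq_bigr => l _; ring.
Qed.

(** A mean of cosines is at most 1, which forces the exponent to have the right sign. *)
Lemma gfam_quad_ge0 (J : Type) (X : J -> T -> R) (C : J -> J -> R) (K : finType) (f : K -> J)
    (c : K -> R) : (forall j, measurable_fun setT (X j)) -> gfam P X C ->
  0 <= quad (fun k l => C (f k) (f l)) c.
Proof.
move=> mX gX; have := gX K f c 0; rewrite cos0 mul1r => h.
have : expR (- quad (fun k l => C (f k) (f l)) c / 2) <= 1.
  rewrite -h -[leRHS](Rint_cst P 1); apply: Rint_le.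
  - apply: (@rint_bounded _ _ _ _ _ 1); last by move=> w; exact: cos_norm_le1.
    apply: measurable_cos; apply: measurable_funD => //.
    by apply: measurable_sum => k; exact: measurable_funM.
  - exact: rint_cst.
  - by move=> w; apply: (le_trans (ler_norm _)); exact: cos_norm_le1.
rewrite -[X in _ <= X]expR0 ler_expR; lra.
Qed.

Lemma gfam_sqr (J : Type) (X : J -> T -> R) (C : J -> J -> R) j :
  (forall j, measurable_fun setT (X j)) -> gfam P X C -> 0 <= C j j ->
  rintegrable P (fun w => X j w ^+ 2) /\ \int[P]_w (X j w ^+ 2) = C j j.
Proof.
move=> mX gX C0.
have e1 : quad (fun k l : unit => C j j) (fun=> 1) = C j j.
  by rewrite /quad !(big_pred1 tt) ?mul1r//; case.
have := @gfam_law _ X C unit (fun=> j) (fun=> 1) mX gX; rewrite e1 => /(_ C0) h.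
have hX B : measurable B -> P (X j @^-1` B) = glaw (Num.sqrt (C j j)) B.
  move=> mB; rewrite -h//; congr (P _); apply/seteqP; split => w /=;
  by rewrite (big_pred1 tt) ?mul1r//; case.
have [i e] := law_sqr (mX j) hX; split => //; rewrite e sqr_sqrtr//.
Qed.

Lemma gfam_rint (J : Type) (X : J -> T -> R) (C : J -> J -> R) j :
  (forall j, measurable_fun setT (X j)) -> gfam P X C -> 0 <= C j j ->
  rintegrable P (X j).
Proof.
move=> mX gX C0; have [i _] := gfam_sqr mX gX C0.
apply: (rint_le (mX j) _ (rintD (rint_cst P 1) i)) => w.
rewrite -[X j w ^+ 2]real_normK ?num_real//; have := sqr_ge0 (`|X j w| - 1).
by have := normr_ge0 (X j w); move: (`|X j w|) => x; nra.
Qed.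

End gaussian_families.

Section exponential_moments.
Context d (T : measurableType d) (R : realType) (P : probability T R).
Variables (G : set (set T)) (X : T -> R) (v : R).
Hypotheses (GI : setI_closed G) (GT : G setT)
  (Gm : forall E, G E -> measurable E) (mX : measurable_fun setT X) (v0 : 0 <= v).
Hypothesis Xcos : forall E th t, G E ->
  \int[P]_w (\1_E w * cos (th + t * X w)) = cos th * expR (- (v * t ^+ 2) / 2) * fine (P E).

Let s := Num.sqrt v.
Local Notation TG := (g_sigma_algebraType G).

Let indep : forall E B, G E -> measurable B -> P (E `&` X @^-1` B) = (P E * glaw s B)%E.
Proof.
move=> E B GE mB.
have fac : cos_factor P (fun=> fun=> 0) X (fun t => expR (- (s ^+ 2 * t ^+ 2) / 2)) 0 G.
  move=> E' b th t GE'; rewrite sqr_sqrtr//.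
  transitivity (\int[P]_w (\1_E' w * cos (th + t * X w))).
    by apply: eq_Rintegral => w _; rewrite big_ord0 addr0.
  rewrite Xcos//; transitivity (expR (- (v * t ^+ 2) / 2) * \int[P]_w (cos th * \1_E' w)).
    rewrite RintZ ?Rint_indic//; [by ring|exact: Gm|].
    apply: (@rint_bounded _ _ _ _ _ 1); last by move=> w; exact: indic_norm_le1.
    by apply: indic_measurable; exact: Gm.
  by congr (_ * _); apply: eq_Rintegral => w _; rewrite big_ord0 addr0 mulrC.
exact: (cos_factor_law mX Gm fac (glaw_cos _)).
Qed.

(** The inner integral of the product law is the Laplace transform of a Gaussian. Applied with
    random weights as [f], this gives the moment bounds required for mixtures of exponentials. *)
Lemma gauss_exp (f : T -> R) (c : R) : measurable_fun (setT : set TG) f ->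
  (forall w, 0 <= f w <= 1) ->
  rintegrable P (fun w => f w * expR (c * X w)) /\
  \int[P]_w (f w * expR (c * X w)) = expR (c ^+ 2 * v / 2) * \int[P]_w f w.
Proof.
move=> mf f01; pose F (z : TG * R) := f z.1 * expR (c * z.2).
have [ie ee] := glaw_exp s c; rewrite sqr_sqrtr// in ee.
have mF : measurable_fun setT F.
  apply: measurable_funM.
    exact: (measurableT_comp mf (@measurable_fst _ _ TG R)).
  apply: measurable_exp; apply: measurable_funM => //; exact: measurable_snd.
have iFw w : rintegrable (glaw s) (fun x => F (w, x)) by exact: (rintZ (f w) ie).
pose M := expR (c ^+ 2 * v / 2).
have mfT : measurable_fun (setT : set T) f.
  by have := measurableT_comp mf (measurable_to_gen Gm); exact.
have ifT : rintegrable P f.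
  apply: (@rint_bounded _ _ _ _ _ 1) => // w.
  by have /andP[a b] := f01 w; rewrite ger0_norm.
have if' : rintegrable (gen_law P Gm) (fun w => f w * M).
  apply: (@rint_bounded _ _ _ _ _ M); first exact: measurable_funM.
  move=> w; have /andP[a b] := f01 w.
  by rewrite ger0_norm ?mulr_ge0 ?expR_ge0// ler_piMl// expR_ge0.
have iF : rintegrable (gen_law P Gm \x glaw s)%E F.
  apply: (rint_prod mF if') => w.
  rewrite (_ : (\int[glaw s]_x _)%E = (\int[glaw s]_x (f w * expR (c * x))%:E)%E); last first.
    apply: eq_integral => x _; rewrite /F ger0_norm// mulr_ge0 ?expR_ge0//.
    by have /andP[] := f01 w.
  rewrite -EFin_Rint; last exact: rintZ.
  by rewrite RintZ// ee lee_fin ler_norm.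
have p1 : rintegrable P (fun w => F (w, X w)) by apply/(rint_decouple GI GT Gm mX indep mF).
split; first exact: p1.
rewrite (Rint_decouple GI GT Gm mX indep mF p1) Rint_prod//.
transitivity (\int[gen_law P Gm]_w (M * f w)).
  by apply: eq_Rintegral => w _; rewrite /F /= (RintZ (f w) ie) ee mulrC.
have -> : \int[gen_law P Gm]_w (M * f w) = \int[P]_w (M * f w).
  rewrite /Rintegral; congr fine.
  rewrite gen_lawE//; first by apply/measurable_EFinP; exact: measurable_funM.
  by move=> z; rewrite lee_fin mulr_ge0 ?expR_ge0//; have /andP[] := f01 z.
by rewrite RintZ.
Qed.

End exponential_moments.

Section independent_families.
Context d (T : measurableType d) (R : realType) (P : probability T R).
Context (J : choiceType) (D : set J) (F : J -> set (set T)).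
Hypothesis Fm : forall j A, D j -> F j A -> measurable A.
Hypothesis indep : mutually_independent P D F.
Variables (K : finType) (V : J -> K -> T -> R) (C : J -> K -> K -> R).
Hypothesis mV : forall j k, measurable_fun setT (V j k).

Lemma indep_gfam (s r : seq J) (E : J -> set T) (a : J -> K -> R) (th : R) : uniq (s ++ r) ->
  (forall j, j \in s ++ r -> D j) ->
  (forall j (b : K -> R) B, j \in s -> measurable B ->
    F j ((fun w => \sum_k b k * V j k w) @^-1` B)) ->
  (forall j (b : K -> R) th, j \in s ->
    \int[P]_w cos (th + \sum_k b k * V j k w) = cos th * expR (- quad (C j) b / 2)) ->
  (forall j, j \in r -> F j (E j)) ->
  \int[P]_w (\prod_(j <- r) \1_(E j) w * cos (th + \sum_(j <- s) \sum_k a j k * V j k w)) =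
  cos th * expR (- (\sum_(j <- s) quad (C j) (a j)) / 2) * \prod_(j <- r) fine (P (E j)).
Proof.
move=> us sD sF sV rF.
have mU j : measurable_fun setT (fun w => \sum_k a j k * V j k w).
  by apply: measurable_sum => k; exact: measurable_funM.
rewrite (indep_cos Fm indep (e := fun j => expR (- quad (C j) (a j) / 2)) mU th us sD).
- congr (_ * _ * _); elim: s {us sD sF sV} => [|j s IH].
    by rewrite !big_nil oppr0 mul0r expR0.
  by rewrite !big_cons IH -expRD; congr expR; ring.
- by move=> j B js; exact: sF.
- by move=> j th' js; exact: sV.
- exact: rF.
Qed.

End independent_families.

Lemma sigma_generated_fun d (T : measurableType d) (R : realType) (I : Type) (X : I -> T -> R)
    (U : T -> R) (B : set R) :
  measurable_fun (setT : set (g_sigma_algebraType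
    (\bigcup_(i in [set: I]) preimage_set_system setT (X i) measurable))) U ->
  measurable B -> sigma_generated X (U @^-1` B).
Proof. by move=> mU mB; have := mU measurableT B mB; rewrite setTI. Qed.

Lemma sigma_generated_meas d (T : measurableType d) (R : realType) (I : Type) (X : I -> T -> R) i :
  measurable_fun (setT : set (g_sigma_algebraType
    (\bigcup_(i in [set: I]) preimage_set_system setT (X i) measurable))) (X i).
Proof. by move=> _ B mB; rewrite setTI; exact: sigma_generated_pre. Qed.

Lemma sigma_generated_setI d (T : measurableType d) (R : realType) (I : Type) (X : I -> T -> R) :
  setI_closed (sigma_generated X).
Proof.
move=> A B hA hB; exact: (@measurableI _ (g_sigma_algebraType
  (\bigcup_(i in [set: I]) preimage_set_system setT (X i) measurable))).
Qed.

Lemma sigma_generated_setT d (T : measurableType d) (R : realType) (I : Type) (X : I -> T -> R) :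
  sigma_generated X setT.
Proof.
exact: (@measurableT _ (g_sigma_algebraType
  (\bigcup_(i in [set: I]) preimage_set_system setT (X i) measurable))).
Qed.

(** Finite combinations of the members of a family form a family, with the covariance given by
    bilinearity; this is how fields at two configurations are assembled from single ones. *)
Lemma gfam_comb d (T : measurableType d) (R : realType) (P : probability T R) (J : Type)
    (X : J -> T -> R) (C : J -> J -> R) (K L : finType) (m : K -> L -> R) (f : K -> L -> J)
    (b : K -> R) th : gfam P X C ->
  \int[P]_w cos (th + \sum_k b k * \sum_l m k l * X (f k l) w) = cos th *
  expR (- quad (fun k k' => \sum_l \sum_l' m k l * m k' l' * C (f k l) (f k' l')) b / 2).
Proof.
move=> gX.
transitivity (\int[P]_w cos (th + \sum_(kl : K * L) (b kl.1 * m kl.1 kl.2) * X (f kl.1 kl.2) w)).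
  apply: eq_Rintegral => w _; congr (cos (_ + _)).
  rewrite -(pair_bigA _ (fun k l => b k * m k l * X (f k l) w))/=.
  by apply: eq_bigr => k _; rewrite mulr_sumr; apply: eq_bigr => l _; rewrite mulrA.
rewrite (gX _ (fun kl => f kl.1 kl.2)).
suff -> : quad (fun k l : K * L => C (f k.1 k.2) (f l.1 l.2)) (fun kl => b kl.1 * m kl.1 kl.2) =
  quad (fun k k' => \sum_l \sum_l' m k l * m k' l' * C (f k l) (f k' l')) b by [].
rewrite /quad -(pair_bigA _ (fun k l => \sum_(kl' : K * L) b k * m k l * (b kl'.1 * m kl'.1 kl'.2) *
  C (f k l) (f kl'.1 kl'.2)))/=.
apply: eq_bigr => k _.
transitivity (\sum_l \sum_k' \sum_l' b k * m k l * (b k' * m k' l') * C (f k l) (f k' l')).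
  apply: eq_bigr => l _.
  by rewrite -(pair_bigA _ (fun k' l' => b k * m k l * (b k' * m k' l') * C (f k l) (f k' l'))).
rewrite exchange_big/=; apply: eq_bigr => k' _; rewrite mulr_sumr; apply: eq_bigr => l _.
by rewrite mulr_sumr; apply: eq_bigr => l' _; ring.
Qed.

Lemma esum_pickle (R : realType) (A : countType) (F : A -> \bar R) : (forall x, (0 <= F x)%E) ->
  (\esum_(x in [set: A]) F x =
   \sum_(i <oo) (if @pickle_inv A i is Some x then F x else 0))%E.
Proof.
move=> F0; rewrite nneseries_esumT; last by move=> i; case: pickle_inv.
pose D := [set i | @pickle_inv A i != None].
rewrite [RHS](_ : _ = \esum_(i in [set: nat])
    (if i \in D then (if @pickle_inv A i is Some x then F x else 0) else 0))%E; last first.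
  apply: eq_esum => i _; rewrite /D; case: ifP => //.
  by move/negbT; rewrite notin_setE/= => /negP; rewrite negbK => /eqP ->.
rewrite -esum_mkcond (reindex_esum [set: A] D (@choice.pickle A)) => [|].
  by apply: eq_esum => x _; rewrite pickleK_inv.
split.
- by move=> x _; rewrite /D/= pickleK_inv.
- move=> x y _ _ /(congr1 (@pickle_inv A)); rewrite !pickleK_inv; by case.
- move=> i; rewrite /D/= => hi; case e : (@pickle_inv A i) hi => [x|]// _.
  exists x => //; have := @pickle_invK A i; rewrite /ocancel e/=; exact.
Qed.

(** * Random weights of an overlap structure *)

Section weights.
Context (R : realType) (a : 'I_2 -> nat -> R) (u delta : R)
  (Om : overlap_structure a u delta).

Local Notation Q := (os_P Om).
Local Notation A := (os_A Om).
Local Notation wgen := (\bigcup_(x in [set: A]) preimage_set_system setT (os_w (o := Om) x : _ -> R) measurable).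
Local Notation TG := (g_sigma_algebraType wgen).

Definition pos_weight i (t : os_T Om) : R :=
  if @pickle_inv A i is Some x then Num.max (os_w x t) 0 else 0.

(* Almost surely equal to pos_weight; the indicator forces the total mass to
   be at most 1 everywhere. *)
Definition weight i t : R :=
  pos_weight i t * \1_(`]-oo, 1]%classic : set R) (\sum_(j < i.+1) pos_weight j t).

Lemma pos_weight_ge0 i t : 0 <= pos_weight i t.
Proof. by rewrite /pos_weight; case: pickle_inv => // x; rewrite le_max lexx orbT. Qed.

Lemma weight_ge0 i t : 0 <= weight i t.
Proof. by rewrite mulr_ge0// pos_weight_ge0. Qed.

Lemma weight_le i t : weight i t <= pos_weight i t.
Proof. by rewrite ler_piMr ?pos_weight_ge0// (le_trans (ler_norm _))// indic_norm_le1. Qed.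

Lemma weight_sum_le n t : \sum_(i < n) weight i t <= 1.
Proof.
elim: n => [|n IH]; first by rewrite big_ord0.
have [h|h] := lerP (\sum_(j < n.+1) pos_weight j t) 1.
  by apply: le_trans h; apply: ler_sum => i _; exact: weight_le.
rewrite big_ord_recr/= [X in _ + X](_ : _ = 0) ?addr0//.
by rewrite /weight indicE memNset ?mulr0//= in_itv/=; apply/negP; rewrite -ltNge.
Qed.

Lemma measurable_weight_gen i : measurable_fun (setT : set TG) (weight i).
Proof.
have mp j : measurable_fun (setT : set TG) (pos_weight j).
  rewrite /pos_weight; case: pickle_inv => [x|]; last exact: measurable_cst.
  by apply: measurable_maxr => //; exact: sigma_generated_meas.
apply: measurable_funM; first exact: mp.
apply: (measurableT_comp (indic_measurable _)); first exact: measurable_itv.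
by apply: measurable_sum => j; exact: mp.
Qed.

Lemma sigma_w_measurable : sigma_generated (fun x : A => os_w x : os_T Om -> R) `<=` measurable.
Proof. by apply: sigma_generated_measurable => x; exact: measurable_funP. Qed.

Lemma measurable_gen_w (f : os_T Om -> R) : measurable_fun (setT : set TG) f ->
  measurable_fun (setT : set (os_T Om)) f.
Proof.
move=> mf _ C mC; rewrite setTI; apply: sigma_w_measurable.
by have := mf measurableT C mC; rewrite setTI.
Qed.

Lemma weight_ae : {ae Q, forall t, (forall i, weight i t = pos_weight i t) /\
  (forall x, os_w x t = Num.max (os_w x t) 0) /\ \sum_(i < n) weight i t @[n --> \oo] --> (1 : R)}.
Proof.
have := os_w_proba Om; apply: filterS => t [w0 w1].
have wm x : os_w x t = Num.max (os_w x t) 0 by apply/esym/max_idPl.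
have e1 : (\sum_(i <oo) (pos_weight i t)%:E = 1)%E.
  rewrite -w1 esum_pickle; last by move=> x; rewrite lee_fin.
  apply: eq_eseriesr => i _; rewrite /pos_weight; case: pickle_inv => // x.
  by rewrite -wm.
have part n : \sum_(i < n) pos_weight i t <= 1.
  rewrite -lee_fin -e1 -sumEFin -(big_mkord xpredT (fun i => (pos_weight i t)%:E)).
  by apply: nneseries_lim_ge => i _ _; rewrite lee_fin pos_weight_ge0.
have wE i : weight i t = pos_weight i t.
  by rewrite /weight indicE mem_set ?mulr1//= in_itv/=; exact: part.
split; [exact: wE|split => //].
have c : (fun n => (\sum_(0 <= i < n) (pos_weight i t)%:E)%E) @ \oo --> (1 : R)%:E.
  by rewrite -e1; apply: is_cvg_nneseries => i _ _; rewrite lee_fin pos_weight_ge0.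
have h := fine_cvg c.
suff <- : fine \o (fun n => (\sum_(0 <= i < n) (pos_weight i t)%:E)%E) =
    (fun n => \sum_(i < n) weight i t) by exact: h.
apply/funext => n /=; rewrite sumEFin big_mkord/=.
by apply: eq_bigr => i _; rewrite wE.
Qed.

(** The weights sum to 1 almost surely and the space has mass 1, so at some sample point the sum is
    not empty. *)
Lemma os_A_inhabited : A.
Proof.
suff : exists x : A, True by move=> /cid[].
apply: contrapT => noA.
have [t [_ [_ wt]]] : exists t, (forall i, weight i t = pos_weight i t) /\
  (forall x, os_w x t = Num.max (os_w x t) 0) /\ \sum_(i < n) weight i t @[n --> \oo] --> (1 : R).
  have pf : ProperFilter (almost_everywhere Q).
    have q0 : (0 < Q [set: os_T Om])%E by rewrite (@probability_setT _ _ _ Q) lte01.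
    exact: ae_properfilter_algebraOfSetsType.
  exact: (filter_ex weight_ae).
move: wt; rewrite (_ : (fun n => \sum_(i < n) weight i t) = fun=> 0).
  move=> /(cvg_lim (@Rhausdorff R)); rewrite lim_cst; last exact: Rhausdorff.
  by move=> /eqP; rewrite eq_sym oner_eq0.
apply/funext => n; apply: big1 => i _; rewrite /weight /pos_weight.
by case: pickle_inv => [x|]; [case: noA; exists x|rewrite mul0r].
Qed.

(** Natural numbers that code no index receive a default one; their weight is 0. *)
Definition os_al (i : nat) : A := odflt os_A_inhabited (@pickle_inv A i).

Variables (Bx B'x : A -> os_T Om -> R) (K : R).
Hypotheses (mB : forall x, measurable_fun setT (Bx x)) (B0 : forall x t, 0 < Bx x t)
  (BB : forall x t, Bx x t + (Bx x t)^-1 <= B'x x t) (K0 : 0 <= K).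
Hypothesis WB : forall x (f : os_T Om -> R), measurable_fun (setT : set TG) f -> (forall t, 0 <= f t <= 1) ->
  rintegrable Q (fun t => f t * B'x x t) /\ \int[Q]_t (f t * B'x x t) <= K * \int[Q]_t f t.

Let mix n := trunc_mix weight (fun i => Bx (os_al i)) n.

(** The countable sums in [G] are reached from the finite mixtures in the mean of the logarithm.
    Hypothesis [WB] reflects that the fields are independent of the weights, and the null set where
    the weights misbehave is removed by [eq_integral_ae]. *)
Lemma os_mix : (forall n, rintegrable Q (fun t => ln (mix n t))) /\ exists L : R,
  (\int[Q]_t lne (\esum_(x in [set: A]) (os_w x t * Bx x t)%:E) = L%:E)%E /\
  \int[Q]_t ln (mix n t) @[n --> \oo] --> L.
Proof.
have mw i : measurable_fun setT (weight i).
  by apply: measurable_gen_w; exact: measurable_weight_gen.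
have w1 i t : 0 <= weight i t <= 1.
  rewrite weight_ge0 (le_trans _ (weight_sum_le i.+1 t))// big_ord_recr/= lerDr.
  by apply: sumr_ge0 => j _; exact: weight_ge0.
have iB0 : rintegrable Q (B'x (os_al 0)).
  have [+ _] := @WB (os_al 0) (fun=> 1) (@measurable_cst _ _ _ _ _ _) (fun=> (introT andP (conj ler01 (lexx _)))).
  by congr (rintegrable _ _); apply/funext => t; rewrite mul1r.
have iWB i : rintegrable Q (fun t => weight i t * B'x (os_al i) t).
  exact: (WB _ (measurable_weight_gen i) (w1 i)).1.
have WBK i : \int[Q]_t (weight i t * B'x (os_al i) t) <= K * \int[Q]_t weight i t.
  exact: (WB _ (measurable_weight_gen i) (w1 i)).2.
have wae : {ae Q, forall t, \sum_(i < n) weight i t @[n --> \oo] --> (1 : R)}.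
  by apply: filterS weight_ae => t [_ []].
split=> [n|].
  by apply: (rint_ln_trunc (B' := fun i => B'x (os_al i))) => //; [exact: weight_ge0|exact: weight_sum_le].
have [S [iS S0 SE Sl]] := trunc_mix_limit mw (fun i => mB (os_al i)) weight_ge0 weight_sum_le wae
  (fun i => B0 (os_al i)) (fun i => BB (os_al i)) iB0 iWB WBK K0.
exists (\int[Q]_t ln (S t)); split => //.
rewrite EFin_Rint//.
apply: eq_integral_ae.
have hS : {ae Q, forall t, 0 < S t /\ (\sum_(i <oo) (weight i t * Bx (os_al i) t)%:E)%E = (S t)%:E}.
  by move: S0 SE; apply: filterS2.
move: hS weight_ae; apply: filterS2 => t [St St'] [wE [wm _]].
have -> : (\esum_(x in [set: A]) (os_w x t * Bx x t)%:E)%E = (S t)%:E.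
  rewrite -St' esum_pickle; last first.
    by move=> x; rewrite lee_fin; apply: mulr_ge0; [rewrite wm le_max lexx orbT|exact: ltW].
  apply: eq_eseriesr => i _; rewrite wE /pos_weight /os_al.
  by case: pickle_inv => [x|]; [rewrite -wm|rewrite mul0r].
by rewrite lne_EFin.
Qed.

End weights.

(** * Joint transform of the fields of an overlap structure *)

Section os_cosines.
Context (R : realType) (a : 'I_2 -> nat -> R) (u delta : R)
  (Om : overlap_structure a u delta) (N : nat).

Local Notation Q := (os_P Om).
Local Notation A := (os_A Om).
Local Notation pairs := {ffun 'I_2 -> config N}.

Definition yfield (x : A) (t : os_T Om) : R :=
  Num.sqrt N%:R * \sum_(l < 2) os_y l x t.

Definition zfield (s : pairs) (x : A) (t : os_T Om) : R :=
  \sum_(l < 2) \sum_(i < N) spin R (s l) i * os_z i l x t.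

Definition ycov (x x' : A) : R :=
  N%:R * \sum_(l < 2) \sum_(l' < 2) theta a l l' (os_q l l' x x').

Definition zcov (p p' : pairs * A) : R := N%:R * \sum_(l < 2) \sum_(l' < 2)
  ov R (p.1 l) (p'.1 l') * xi' a l l' (os_q l l' p.2 p'.2).

(** Contribution of the site [i], extended by 0 from [N] on, so that it is indexed by [nat] like the
    independent copies [os_z]. *)
Let zpart i (p : pairs * A) (t : os_T Om) : R :=
  if insub i is Some i' then \sum_(l < 2) spin R (p.1 l) (i' : 'I_N) * os_z i l p.2 t else 0.

Let zc i (p p' : pairs * A) : R :=
  if insub i is Some i' then \sum_(l < 2) \sum_(l' < 2)
    spin R (p.1 l) (i' : 'I_N) * spin R (p'.1 l') i' * xi' a l l' (os_q l l' p.2 p'.2) else 0.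

Let F (j : option (option nat)) := match j with
  | None => sigma_generated (fun x : A => os_w x : os_T Om -> R)
  | Some None => sigma_generated (fun lx : 'I_2 * A => os_y lx.1 lx.2 : os_T Om -> R)
  | Some (Some i) => sigma_generated (fun lx : 'I_2 * A => os_z i lx.1 lx.2 : os_T Om -> R)
  end.

Let Fm j E : setT j -> F j E -> measurable E.
Proof.
by case: j => [[i|]|] _; apply: sigma_generated_measurable => x; exact: measurable_funP.
Qed.

Lemma measurable_yfield x : measurable_fun setT (yfield x).
Proof. by apply: measurable_funM => //; exact: measurable_sum. Qed.

Lemma measurable_zfield s x : measurable_fun setT (zfield s x).
Proof.
by apply: measurable_sum => l; apply: measurable_sum => i; exact: measurable_funM.
Qed.

Let mzpart i p : measurable_fun setT (zpart i p).
Proof.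
rewrite /zpart; case: insub => [i'|]; last exact: measurable_cst.
by apply: measurable_sum => l; exact: measurable_funM.
Qed.

Let zfieldE s x t : zfield s x t = \sum_(i < N) zpart i (s, x) t.
Proof.
rewrite /zfield exchange_big/=; apply: eq_bigr => i _.
by rewrite /zpart valK.
Qed.

Let zcovE p p' : zcov p p' = \sum_(i < N) zc i p p'.
Proof.
case: (posnP N) => [N0|N0].
  rewrite /zcov (_ : N%:R = 0 :> R) ?N0// mul0r big1// => i.
  by have := ltn_ord i; rewrite {2}N0.
rewrite /zcov mulr_sumr.
have -> : \sum_(i < N) zc i p p' = \sum_(i < N) \sum_(l < 2) \sum_(l' < 2)
    spin R (p.1 l) i * spin R (p'.1 l') i * xi' a l l' (os_q l l' p.2 p'.2).
  by apply: eq_bigr => i _; rewrite /zc valK.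
rewrite exchange_big/=; apply: eq_bigr => l _; rewrite mulr_sumr exchange_big/=.
apply: eq_bigr => l' _; rewrite /ov -mulr_suml; field.
by rewrite pnatr_eq0 -lt0n.
Qed.

(** The event belongs to the group of the weights, [y] is a second group and each site [i] has its
    own group z_i. Independence of the groups makes the exponents add and factors out the
    probability of the event. *)
Lemma os_cos (K : finType) (f : K -> pairs * A) (E : set (os_T Om)) (b c : K -> R) th :
  sigma_generated (fun x : A => os_w x : os_T Om -> R) E ->
  \int[Q]_t (\1_E t * cos (th + \sum_k b k * yfield (f k).2 t +
    \sum_k c k * zfield (f k).1 (f k).2 t)) =
  cos th * expR (- (quad (fun k l => ycov (f k).2 (f l).2) b +
    quad (fun k l => zcov (f k) (f l)) c) / 2) * fine (Q E).
Proof.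
move=> hE.
pose V (j : option (option nat)) k : os_T Om -> R := match j with
  | None => fun=> 0 | Some None => yfield (f k).2 | Some (Some i) => zpart i (f k) end.
pose C (j : option (option nat)) (k k' : K) : R := match j with
  | None => 0 | Some None => ycov (f k).2 (f k').2 | Some (Some i) => zc i (f k) (f k') end.
pose s : seq (option (option nat)) := Some None :: [seq Some (Some i) | i <- index_iota 0 N].
pose aa (j : option (option nat)) := match j with Some None => b | _ => c end.
have mV j k : measurable_fun setT (V j k).
  by case: j => [[i|]|]; [exact: mzpart|exact: measurable_yfield|exact: measurable_cst].
have us : uniq (s ++ [:: None]).
  have sn : Some None \notin [seq Some (Some i) | i <- index_iota 0 N] by apply/negP => /mapP[].
  have nn : None \notin s by rewrite inE /=; apply/negP => /mapP[].
  rewrite cats1 rcons_uniq nn/= sn /= map_inj_uniq ?iota_uniq// => i j.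
  by case.
have sF j (b' : K -> R) B : j \in s -> measurable B ->
    F j ((fun w => \sum_k b' k * V j k w) @^-1` B).
  rewrite inE => /orP[/eqP -> mB|/mapP[i _ ->] mB].
    apply: sigma_generated_fun => //; apply: measurable_sum => k.
    apply: measurable_funM => //; apply: measurable_funM => //.
    apply: measurable_sum => l.
    exact: (@sigma_generated_meas _ _ _ _ (fun lx : 'I_2 * A => os_y lx.1 lx.2 : os_T Om -> R) (l, (f k).2)).
  apply: sigma_generated_fun => //; apply: measurable_sum => k.
  apply: measurable_funM => //; rewrite /V /zpart; case: insub => [i'|]; last exact: measurable_cst.
  apply: measurable_sum => l; apply: measurable_funM => //.
  exact: (@sigma_generated_meas _ _ _ _ (fun lx : 'I_2 * A => os_z i lx.1 lx.2 : os_T Om -> R) (l, (f k).2)).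
have gy : gfam Q (fun lx : 'I_2 * A => os_y lx.1 lx.2 : os_T Om -> R)
    (fun p p' => theta a p.1 p'.1 (os_q p.1 p'.1 p.2 p'.2)).
  apply: gaussian_family_gfam; [by move=> p; exact: measurable_funP|exact: os_y_gaussian|].
  by move=> p p'; exact: os_y_cov.
have gz i : gfam Q (fun lx : 'I_2 * A => os_z i lx.1 lx.2 : os_T Om -> R)
    (fun p p' => xi' a p.1 p'.1 (os_q p.1 p'.1 p.2 p'.2)).
  apply: gaussian_family_gfam; [by move=> p; exact: measurable_funP|exact: os_z_gaussian|].
  by move=> p p'; exact: os_z_cov.
have sV j (b' : K -> R) th' : j \in s ->
    \int[Q]_w cos (th' + \sum_k b' k * V j k w) = cos th' * expR (- quad (C j) b' / 2).
  rewrite inE => /orP[/eqP ->|/mapP[i _ ->]].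
    have h := @gfam_comb _ _ _ _ _ _ _ K 'I_2 (fun=> fun=> Num.sqrt N%:R)
      (fun k l => (l, (f k).2)) b' th' gy.
    transitivity (\int[Q]_w cos (th' + \sum_k b' k *
      \sum_(l < 2) Num.sqrt N%:R * os_y l (f k).2 w)).
      by apply: eq_Rintegral => w _; under eq_bigr do rewrite /V /yfield mulr_sumr.
    rewrite h; suff -> : (fun k k' => \sum_(l < 2) \sum_(l' < 2) Num.sqrt N%:R * Num.sqrt N%:R *
        theta a l l' (os_q l l' (f k).2 (f k').2)) = C (Some None) by [].
    apply/funext => k; apply/funext => k'; rewrite /C /ycov mulr_sumr; apply: eq_bigr => l _.
    by rewrite mulr_sumr; apply: eq_bigr => l' _; rewrite -expr2 sqr_sqrtr.
  rewrite /V /C /zpart /zc; case: insub => [i'|].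
    exact: (@gfam_comb _ _ _ _ _ _ _ K 'I_2 (fun k l => spin R ((f k).1 l) i')
      (fun k l => (l, (f k).2)) b' th' (gz i)).
  transitivity (\int[Q]_w cos th').
    by apply: eq_Rintegral => w _; rewrite big1 ?addr0// => k _; rewrite mulr0.
  rewrite Rint_cst /quad big1 ?oppr0 ?mul0r ?expR0 ?mulr1// => k _.
  by rewrite big1// => l _; rewrite mulr0.
have h0 j : j \in [:: None : option (option nat)] -> F j E by rewrite inE => /eqP ->.
have := @indep_gfam _ _ R Q _ setT F Fm (@os_independent _ _ _ _ Om) K V C mV s [:: None]
  (fun=> E) aa th us (fun _ _ => I) sF sV h0.
rewrite /s big_cons big_map !big_seq1 big_mkord.
have -> : quad (C (Some None)) (aa (Some None)) + \sum_(i < N) quad (C (Some (Some (i : nat)))) (aa (Some (Some (i : nat)))) =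
   quad (fun k l => ycov (f k).2 (f l).2) b + quad (fun k l => zcov (f k) (f l)) c.
  congr (_ + _); rewrite /quad exchange_big/=; apply: eq_bigr => k _.
  rewrite exchange_big/=; apply: eq_bigr => l _; rewrite zcovE mulr_sumr.
  by apply: eq_bigr => i _.
move=> <-; apply: eq_Rintegral => t _; rewrite big_seq1; congr (_ * cos _).
rewrite -addrA big_cons big_map big_mkord; congr (_ + (_ + _)).
rewrite exchange_big/=; apply: eq_bigr => k _; rewrite -mulr_sumr zfieldE.
by congr (_ * _); apply: eq_bigr => i _; case: (f k).
Qed.

End os_cosines.

Section product_space.
Context d1 (T1 : measurableType d1) d2 (T2 : measurableType d2) (R : realType)
  (P1 : probability T1 R) (P2 : probability T2 R).

Lemma Rint_fst (f : T1 -> R) : rintegrable P1 f ->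
  rintegrable (P1 \x P2)%E (fun z => f z.1) /\
  \int[(P1 \x P2)%E]_z f z.1 = \int[P1]_x f x.
Proof.
move=> fi.
have mf : measurable_fun setT (fun z : T1 * T2 => f z.1).
  exact: (measurableT_comp (rint_measurable fi)).
have i : rintegrable (P1 \x P2)%E (fun z => f z.1).
  apply: (rint_prod mf fi) => x /=.
  by rewrite -(EFin_Rint (rint_cst P2 `|f x|)) Rint_cst.
split => //; rewrite Rint_prod//; last by move=> x; exact: (rint_cst P2 (f x)).
by apply: eq_Rintegral => x _; exact: (Rint_cst P2 (f x)).
Qed.

Lemma Rint_snd (f : T2 -> R) : rintegrable P2 f ->
  rintegrable (P1 \x P2)%E (fun z => f z.2) /\
  \int[(P1 \x P2)%E]_z f z.2 = \int[P2]_x f x.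
Proof.
move=> fi.
have mf : measurable_fun setT (fun z : T1 * T2 => f z.2).
  exact: (measurableT_comp (rint_measurable fi)).
have i : rintegrable (P1 \x P2)%E (fun z => f z.2).
  apply: (rint_prod mf (rint_cst P1 (\int[P2]_y `|f y|))) => x /=.
  rewrite -(EFin_Rint (rint_norm fi)) lee_fin; exact: ler_norm.
split => //; rewrite Rint_prod//.
exact: (Rint_cst P1 (\int[P2]_y f y)).
Qed.

Lemma prod_snd_preimage (E : set T2) : measurable E ->
  (P1 \x P2)%E [set z : T1 * T2 | E z.2] = P2 E.
Proof.
move=> mE; rewrite (_ : [set z | _] = setT `*` E); last first.
  by apply/seteqP; split => z /= => [|[]].
by rewrite product_measure1E//= (@probability_setT _ _ _ P1) mul1e.
Qed.

End product_space.

Lemma gen_cst (T : pointedType) (R : realType) (W : set (set T)) (c : R) (B : set R) :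
  measurable B -> <<s W >> ((fun=> c) @^-1` B).
Proof.
move=> mB; have := @measurable_cst _ _ (g_sigma_algebraType W) R setT c measurableT B mB.
by rewrite setTI.
Qed.

Lemma quadD (R : realType) (I : finType) (C D : I -> I -> R) b :
  quad (fun i j => C i j + D i j) b = quad C b + quad D b.
Proof.
rewrite /quad -big_split/=; apply: eq_bigr => i _; rewrite -big_split/=.
by apply: eq_bigr => j _; rewrite mulrDr.
Qed.

Lemma sum_ord2 (R : realType) (F : 'I_2 -> R) : \sum_(l < 2) F l = F ord0 + F ord_max.
Proof.
rewrite big_ord_recl big_ord_recl big_ord0 addr0; congr (_ + F _).
exact: val_inj.
Qed.

(** * Energies and the constrained partition function *)

Section hamiltonian.
Context (R : realType) d (T : measurableType d) (P : probability T R)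
  (g : seq nat -> {RV P >-> R}) (a : 'I_2 -> nat -> R) (h : 'I_2 -> R).
Hypotheses (g_gauss : gaussian_disorder g) (a_sq : forall l, sqsum_bounded (a l)).
Variable N : nat.
Hypothesis N0 : (0 < N)%N.
Local Notation pairs := {ffun 'I_2 -> config N}.

Definition pair_energy (s : pairs) t : R := \sum_(l < 2) hamiltonian g a l (s l) t.
Definition pair_field (s : pairs) : R := \sum_(l < 2) h l * \sum_(i < N) spin R (s l) i.
Definition energy_cov (s s' : pairs) : R :=
  N%:R * \sum_(l < 2) \sum_(l' < 2) xi a l l' (ov R (s l) (s' l')).
Definition psi v := \int[P]_t ln (partition_function g a h N v t).

Lemma disorder_std1 : std_family P (fun s : seq nat => (1 <= size s)%N) (fun s => g s : T -> R).
Proof.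
move=> s c th us /allP hs; apply: (gaussian_disorder_std g_gauss) => //.
by apply/allP => x /hs; case: x.
Qed.

Lemma measurable_pair_energy s : measurable_fun setT (pair_energy s).
Proof.
apply: measurable_sum => l; apply: measurable_funM => //.
apply: (measurable_mixed (gam := fun s => g s : T -> R)) => w; exact: measurable_funP.
Qed.

Lemma energy_gfam : gfam P pair_energy energy_cov.
Proof.
move=> K f b th.
have gm := @mixed_gfam _ T R P (fun s => g s : T -> R) 1 N
  (fun s => measurable_funP (g s)) disorder_std1 N0 'I_2 a a_sq.
have := @gfam_comb _ _ _ _ _ _ _ K 'I_2 (fun=> fun=> Num.sqrt N%:R) (fun k l => (l, f k l)) b th gm.
have -> : (fun k k' => \sum_(l < 2) \sum_(l' < 2) Num.sqrt N%:R * Num.sqrt N%:R *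
    limn (fun n => \sum_(1 <= p < n) a l p * a l' p * ov R (f k l) (f k' l') ^+ p)) =
    (fun k l => energy_cov (f k) (f l)).
  apply/funext => k; apply/funext => k'; rewrite /energy_cov mulr_sumr; apply: eq_bigr => l _.
  by rewrite mulr_sumr; apply: eq_bigr => l' _; rewrite -expr2 sqr_sqrtr.
by move=> <-.
Qed.

Lemma energy_covC s s' : energy_cov s s' = energy_cov s' s.
Proof.
rewrite /energy_cov exchange_big/=; congr (_ * _); apply: eq_bigr => l _; apply: eq_bigr => l' _.
by rewrite xiC ov_sym.
Qed.

Lemma energy_cov_ge0 s : 0 <= energy_cov s s.
Proof.
have := @gfam_quad_ge0 _ _ _ _ _ _ _ unit (fun=> s) (fun=> 1) measurable_pair_energy energy_gfam.
by rewrite /quad !(big_pred1 tt) ?mul1r//; case.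
Qed.

Lemma partition_functionE v t : partition_function g a h N v t =
  \sum_(s : pairs | overlap R s == v) expR (pair_energy s t + pair_field s).
Proof. by []. Qed.

Lemma rint_pair_energy s : rintegrable P (pair_energy s).
Proof. exact: (gfam_rint measurable_pair_energy energy_gfam (energy_cov_ge0 s)). Qed.

End hamiltonian.

Lemma cos_var_ge0 d (T : measurableType d) (R : realType) (P : probability T R)
    (X : T -> R) (v : R) : measurable_fun setT X ->
  \int[P]_w cos (X w) = expR (- v / 2) -> 0 <= v.
Proof.
move=> mX hX; have : expR (- v / 2) <= 1.
  rewrite -hX -[leRHS](Rint_cst P 1); apply: Rint_le.
  - apply: (@rint_bounded _ _ _ _ _ 1); last by move=> w; exact: cos_norm_le1.
    exact: measurable_cos.
  - exact: rint_cst.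
  - by move=> w; apply: (le_trans (ler_norm _)); exact: cos_norm_le1.
rewrite -[X in _ <= X]expR0 ler_expR; lra.
Qed.

Section constrained_sum.
Context (R : realType) (N : nat) (h : 'I_2 -> R) (v : R).
Local Notation pairs := {ffun 'I_2 -> config N}.
Variable s0 : pairs.
Hypothesis s0v : overlap R s0 = v.

(* Excluded configurations get weight 0, but carry the field of an admissible
   one, so that the diagonal overlaps are right for every index. *)
Definition fallback (s : pairs) := if overlap R s == v then s else s0.
Definition cweight (s : pairs) : R := if overlap R s == v then expR (pair_field h s) else 0.

Lemma fallback_overlap s : overlap R (fallback s) = v.
Proof. by rewrite /fallback; case: eqP. Qed.

Lemma cweight_ge0 s : 0 <= cweight s.
Proof. by rewrite /cweight; case: ifP => // _; exact: expR_ge0. Qed.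

Lemma cweight_sum_gt0 : 0 < \sum_s cweight s.
Proof.
rewrite (bigD1 s0)//= ltr_pwDl//; first by rewrite /cweight s0v eqxx expR_gt0.
by apply: sumr_ge0 => s _; exact: cweight_ge0.
Qed.

Lemma cweight_sumE (X : pairs -> R) : \sum_s cweight s * expR (X (fallback s)) =
  \sum_(s : pairs | overlap R s == v) expR (X s + pair_field h s).
Proof.
rewrite [RHS]big_mkcond/=; apply: eq_bigr => s _; rewrite /cweight /fallback.
by case: ifP => _; rewrite ?mul0r// expRD mulrC.
Qed.

End constrained_sum.

Section log_partition.
Context (R : realType) d (T : measurableType d) (P : probability T R)
  (g : seq nat -> {RV P >-> R}) (a : 'I_2 -> nat -> R) (h : 'I_2 -> R).
Hypotheses (g_gauss : gaussian_disorder g) (a_sq : forall l, sqsum_bounded (a l)).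
Variable N : nat.
Hypothesis N0 : (0 < N)%N.
Variables (v : R) (s0 : {ffun 'I_2 -> config N}).
Hypothesis s0v : overlap R s0 = v.

Lemma partition_fallback t : partition_function g a h N v t =
  \sum_s cweight h v s * expR (pair_energy g a (fallback v s0 s) t).
Proof. by rewrite (cweight_sumE h v s0 (fun s => pair_energy g a s t)). Qed.

Lemma partition_gt0 t : 0 < partition_function g a h N v t.
Proof.
rewrite partition_functionE (bigD1 s0) ?s0v//= ltr_pwDl ?expR_gt0//.
by apply: sumr_ge0 => s _; exact: expR_ge0.
Qed.

Lemma rint_ln_partition : rintegrable P (fun t => ln (partition_function g a h N v t)).
Proof.
(* The weights are deterministic, so the trivial pi-system is enough. *)
have cg (s : {ffun 'I_2 -> config N}) (B : set R) : measurable B ->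
    <<s [set (setT : set T)] >> ((fun=> cweight h v s) @^-1` B) by move=> mB; exact: gen_cst.
have Wm (E : set T) : [set setT] E -> measurable E by move=> ->.
have := @rint_logsum _ T R P _ [set setT] (fun s _ => cweight h v s)
  (\sum_s cweight h v s) (\sum_s cweight h v s) Wm cg (fun s _ => cweight_ge0 h v s)
  (cweight_sum_gt0 h s0v) (fun=> introT andP (conj (lexx _) (lexx _))) _
  (fun s => rint_pair_energy g_gauss a_sq N0 (fallback v s0 s)).
by congr (rintegrable _ _); apply/funext => t; rewrite partition_fallback.
Qed.

End log_partition.

(** * Upper bound by interpolation *)

Section guerra.
Context (R : realType) d (T : measurableType d) (P : probability T R)
  (g : seq nat -> {RV P >-> R}) (a : 'I_2 -> nat -> R) (h : 'I_2 -> R) (B : R).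
Hypotheses (g_gauss : gaussian_disorder g) (a_sq : forall l, sqsum_bounded (a l)).
Hypotheses (B0 : 0 <= B) (aB : forall l l' n, \sum_(1 <= p < n) p%:R * `|aa a l l' p| <= B)
  (xi_convex : forall l l', convex_function (`[-1, 1] : set R) (xi a l l')).
Variables (u delta : R) (Om : overlap_structure a u delta) (N : nat).
Hypothesis N0 : (0 < N)%N.
Local Notation pairs := {ffun 'I_2 -> config N}.
Variables (v : R) (s0 : pairs).
Hypothesis s0v : overlap R s0 = v.

Local Notation Q := (os_P Om).
Local Notation A := (os_A Om).
Local Notation sigw := (sigma_generated (fun x : A => os_w x : os_T Om -> R)).
Local Notation fb := (fallback v s0).
Local Notation al := (os_al Om).

Lemma os_theta_sym l l' (x x' : A) :
  theta a l l' (os_q l l' x x') = theta a l' l (os_q l' l x' x).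
Proof.
apply: EFin_inj; rewrite -!os_y_cov; congr expectation; apply/funext => t; exact: mulrC.
Qed.

Lemma os_xi'_sym l l' (x x' : A) : xi' a l l' (os_q l l' x x') = xi' a l' l (os_q l' l x' x).
Proof.
apply: EFin_inj; rewrite -!(os_z_cov 0); congr expectation; apply/funext => t; exact: mulrC.
Qed.

Let ycovC (x x' : A) : ycov N x x' = ycov N x' x.
Proof.
rewrite /ycov exchange_big/=; congr (_ * _); apply: eq_bigr => l _; apply: eq_bigr => l' _.
exact: os_theta_sym.
Qed.

Let zcovC (p p' : pairs * A) : zcov p p' = zcov p' p.
Proof.
rewrite /zcov exchange_big/=; congr (_ * _); apply: eq_bigr => l _; apply: eq_bigr => l' _.
by rewrite ov_sym os_xi'_sym.
Qed.

(** Excess of [xi] at the overlap r over its tangent at q. Since theta(q) = q xi'(q) - xi(q), the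
    covariance of H + sqrt N y minus that of z is N times a sum of such excesses. *)
Let gap (s s' : pairs) (x x' : A) l l' := let r := ov R (s l) (s' l') in let q := os_q l l' x x' in
  xi a l l' r - xi a l l' q - (r - q) * xi' a l l' q.

Let gapE s s' x x' : energy_cov a s s' + ycov N x x' - zcov (s, x) (s', x') =
  N%:R * \sum_(l < 2) \sum_(l' < 2) gap s s' x x' l l'.
Proof.
rewrite /energy_cov /ycov /zcov -mulrDr -mulrBr; congr (_ * _).
rewrite -big_split/= -sumrB; apply: eq_bigr => l _; rewrite -big_split/= -sumrB.
by apply: eq_bigr => l' _; rewrite /gap /theta /=; ring.
Qed.

Let gap_ge0 s s' x x' l l' : 0 <= gap s s' x x' l l'.
Proof. by apply: (xi_tangent aB xi_convex); [exact: os_q_le1|exact: ov_le1]. Qed.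

(** For l = l' both overlaps are 1 and the gap vanishes. For l <> l' the constraint gives r = v,
    while q is within [delta] of [u]: the bound 2 B (|v - u| + delta) occurs twice. *)
Let gap_diag (s : pairs) (x : A) : overlap R s = v -> \sum_(l < 2) \sum_(l' < 2) gap s s x x l l' <=
  4 * B * (`|v - u| + delta).
Proof.
move=> sv; rewrite !sum_ord2.
have g0 l : gap s s x x l l = 0 by rewrite /gap/= os_q_diag ov_self// !subrr mul0r subr0.
have g01 : gap s s x x ord0 ord_max <= 2 * B * (`|v - u| + delta).
  rewrite /gap/= -[ov _ _ _]/(overlap R s) sv.
  have v1 : `|v| <= 1 by rewrite -sv; exact: ov_le1.
  have q1 := os_q_le1 ord0 ord_max x x.
  apply: (le_trans (xi_tangent_le aB ord0 ord_max q1 v1)).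
  apply: ler_wpM2l; first by rewrite mulr_ge0.
  apply: (@le_trans _ _ (`|v - u| + `|u - os_q ord0 ord_max x x|)); first exact: ler_distD.
  by rewrite lerD2l distrC; exact: os_q_near.
(* Only q^{1,2} is required to be near u, and q^{2,1} could be another number. Symmetry of the
   covariances gives [xi'] and [theta] the same values at both, and the gap at q equals xi(r) +
   theta(q) - r xi'(q). *)
have g10 : gap s s x x ord_max ord0 = gap s s x x ord0 ord_max.
  rewrite /gap/= [ov R (s ord_max) _]ov_sym [xi a ord_max ord0 (ov _ _ _)]xiC.
  have e1 := os_xi'_sym ord_max ord0 x x; have e2 := os_theta_sym ord_max ord0 x x.
  move: e2; rewrite /theta e1 => e2.
  by move: e2; move: (xi' a ord0 ord_max _) (xi a ord_max ord0 _) => X Y e2; lra.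
by rewrite !g0 g10; lra.
Qed.

Let ycov_le (x : A) : ycov N x x <= 8 * B * N%:R.
Proof.
rewrite /ycov mulrC ler_wpM2r// !sum_ord2.
have t l l' : theta a l l' (os_q l l' x x) <= 2 * B.
  by apply: (le_trans (ler_norm _)); apply: (theta_bound B0 aB); exact: os_q_le1.
have := t ord0 ord0; have := t ord0 ord_max; have := t ord_max ord0; have := t ord_max ord_max.
lra.
Qed.

Let zcov_le (s : pairs) (x : A) : zcov (s, x) (s, x) <= 4 * B * N%:R.
Proof.
rewrite /zcov mulrC ler_wpM2r// !sum_ord2/=.
have t l l' : ov R (s l) (s l') * xi' a l l' (os_q l l' x x) <= B.
  apply: (le_trans (ler_norm _)); rewrite normrM -[leRHS]mul1r.
  by apply: ler_pM => //; [exact: ov_le1|apply: (xi'_bound aB); exact: os_q_le1].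
have := t ord0 ord0; have := t ord0 ord_max; have := t ord_max ord0; have := t ord_max ord_max.
lra.
Qed.

Let sum_unit (F : unit -> R) : \sum_(k : unit) F k = F tt.
Proof. by rewrite (big_pred1 tt)//; case. Qed.

Let ycos (x : A) E th t : sigw E -> \int[Q]_w (\1_E w * cos (th + t * yfield N x w)) =
  cos th * expR (- (ycov N x x * t ^+ 2) / 2) * fine (Q E).
Proof.
move=> hE; have := @os_cos _ _ _ _ Om N unit (fun=> (s0, x)) E (fun=> t) (fun=> 0) th hE.
rewrite /quad !sum_unit mul0r mul0r addr0 => hc.
rewrite [X in expR (- X / 2)](_ : _ = t * t * ycov N x x); last by ring.
rewrite -hc; apply: eq_Rintegral => w _; congr (_ * cos _).
by rewrite !sum_unit mul0r addr0.
Qed.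

Let zcos (s : pairs) (x : A) E th t : sigw E -> \int[Q]_w (\1_E w * cos (th + t * zfield s x w)) =
  cos th * expR (- (zcov (s, x) (s, x) * t ^+ 2) / 2) * fine (Q E).
Proof.
move=> hE; have := @os_cos _ _ _ _ Om N unit (fun=> (s, x)) E (fun=> 0) (fun=> t) th hE.
rewrite /quad !sum_unit mul0r mul0r add0r => hc.
rewrite [X in expR (- X / 2)](_ : _ = t * t * zcov (s, x) (s, x)); last by ring.
rewrite -hc; apply: eq_Rintegral => w _; congr (_ * cos _).
by rewrite !sum_unit mul0r addr0.
Qed.

Let var_ge0 (X : os_T Om -> R) c : measurable_fun setT X ->
  (forall E th t, sigw E -> \int[Q]_w (\1_E w * cos (th + t * X w)) =
    cos th * expR (- (c * t ^+ 2) / 2) * fine (Q E)) -> 0 <= c.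
Proof.
move=> mX hX; apply: (cos_var_ge0 (P := Q) mX).
have hT : sigw setT by exact: sigma_generated_setT.
have := hX setT 0 1 hT.
rewrite (@probability_setT _ _ _ Q) cos0 expr1n !mulr1 mul1r => <-.
by apply: eq_Rintegral => w _; rewrite indicT mul1r add0r mul1r.
Qed.

(** The sign [e] is 1 or -1: both exponentials are needed, because mixtures are controlled together
    with their inverses. *)
Let os_exp (X : os_T Om -> R) c b : measurable_fun setT X ->
  (forall E th t, sigw E -> \int[Q]_w (\1_E w * cos (th + t * X w)) =
    cos th * expR (- (c * t ^+ 2) / 2) * fine (Q E)) -> c <= b ->
  forall (f : os_T Om -> R) e, measurable_fun (setT : set (g_sigma_algebraType sigw)) f ->
  (forall t, 0 <= f t <= 1) -> e ^+ 2 = 1 ->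
  rintegrable Q (fun w => f w * expR (e * X w)) /\
  \int[Q]_w (f w * expR (e * X w)) <= expR (b / 2) * \int[Q]_w f w.
Proof.
move=> mX hX cb f e mf f01 e1.
have hI : setI_closed sigw by exact: sigma_generated_setI.
have hT : sigw setT by exact: sigma_generated_setT.
have [i ->] := gauss_exp hI hT (@sigma_w_measurable _ _ _ _ Om) mX (var_ge0 mX hX) hX e mf f01.
split => //; rewrite e1 mul1r; apply: ler_wpM2r; last by rewrite ler_expR; lra.
by apply: Rintegral_ge0 => t _; have /andP[] := f01 t.
Qed.

Let gen_gen (f : os_T Om -> R) : measurable_fun (setT : set (g_sigma_algebraType
    (\bigcup_(x in [set: A]) preimage_set_system setT (os_w x : os_T Om -> R) measurable))) f ->
  measurable_fun (setT : set (g_sigma_algebraType sigw)) f.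
Proof.
move=> mf _ C mC; rewrite setTI; apply: sub_gen_smallest.
by have := mf measurableT C mC; rewrite setTI.
Qed.

Let By (x : A) (t : os_T Om) : R := expR (yfield N x t).
Let By' (x : A) (t : os_T Om) : R := expR (1 * yfield N x t) + expR (-1 * yfield N x t).
Let Bz (x : A) (t : os_T Om) : R := \sum_(s : pairs | overlap R s == v) expR (\sum_(l < 2) \sum_(i < N)
  spin R (s l) i * (os_z i l x t + h l)).
Let Bz' (x : A) (t : os_T Om) : R := \sum_(s : pairs) (expR (pair_field h s) + expR (- pair_field h s)) *
  (expR (1 * zfield s x t) + expR (-1 * zfield s x t)).

Let BzE (x : A) t : Bz x t = \sum_(s : pairs | overlap R s == v) expR (zfield s x t + pair_field h s).
Proof.
apply: eq_bigr => s _; congr expR; rewrite /zfield /pair_field -big_split/=.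
apply: eq_bigr => l _; rewrite mulr_sumr -big_split/=; apply: eq_bigr => i _.
by rewrite mulrDr (mulrC (h l)).
Qed.

Let mixy : (forall n, rintegrable Q (fun t => ln (trunc_mix (@weight _ _ _ _ Om) (fun i => By (al i)) n t))) /\
  exists L : R, (\int[Q]_t lne (\esum_(x in [set: A]) (os_w x t * By x t)%:E) = L%:E)%E /\
  \int[Q]_t ln (trunc_mix (@weight _ _ _ _ Om) (fun i => By (al i)) n t) @[n --> \oo] --> L.
Proof.
apply: (@os_mix _ _ _ _ Om By By' (expR (8 * B * N%:R / 2) * 2)).
- by move=> x; apply: measurable_exp; exact: measurable_yfield.
- by move=> x t; exact: expR_gt0.
- by move=> x t; rewrite /By /By' mul1r mulN1r expRN.
- by rewrite mulr_ge0// expR_ge0.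
move=> x f /gen_gen mf f01.
have e1 : (1 : R) ^+ 2 = 1 by rewrite expr1n.
have e2 : (-1 : R) ^+ 2 = 1 by rewrite sqrrN expr1n.
have my := measurable_yfield N x.
have [i1 b1] := os_exp my (ycos x) (ycov_le x) mf f01 e1.
have [i2 b2] := os_exp my (ycos x) (ycov_le x) mf f01 e2.
rewrite /By'; under eq_fun do rewrite mulrDr.
split; first exact: rintD.
by rewrite RintD//; lra.
Qed.

Let mixz : (forall n, rintegrable Q (fun t => ln (trunc_mix (@weight _ _ _ _ Om) (fun i => Bz (al i)) n t))) /\
  exists L : R, (\int[Q]_t lne (\esum_(x in [set: A]) (os_w x t * Bz x t)%:E) = L%:E)%E /\
  \int[Q]_t ln (trunc_mix (@weight _ _ _ _ Om) (fun i => Bz (al i)) n t) @[n --> \oo] --> L.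
Proof.
pose k (s : pairs) := expR (pair_field h s) + expR (- pair_field h s).
have k0 s : 0 <= k s by rewrite addr_ge0 ?expR_ge0.
apply: (@os_mix _ _ _ _ Om Bz Bz' (\sum_s k s * (expR (4 * B * N%:R / 2) * 2))).
- move=> x; rewrite (_ : Bz x = fun t => \sum_(s : pairs | overlap R s == v) expR (zfield s x t + pair_field h s)).
    rewrite [X in measurable_fun _ X](_ : _ = fun t => \sum_(s : pairs)
      (if overlap R s == v then expR (zfield s x t + pair_field h s) else 0)).
      apply: measurable_sum => s; case: (overlap R s == v); last exact: measurable_cst.
      by apply: measurable_exp; apply: measurable_funD => //; exact: measurable_zfield.
    by apply/funext => t; rewrite big_mkcond.
  by apply/funext => t; rewrite BzE.
- move=> x t; rewrite BzE (bigD1 s0) ?s0v//= ltr_pwDl ?expR_gt0//.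
  by apply: sumr_ge0 => s _; exact: expR_ge0.
- move=> x t; rewrite /Bz' -/k.
  have -> : \sum_s k s * (expR (1 * zfield s x t) + expR (-1 * zfield s x t)) =
    \sum_s k s * expR (zfield s x t) + \sum_s k s * expR (- zfield s x t).
    by rewrite -big_split/=; apply: eq_bigr => s _; rewrite mul1r mulN1r mulrDr.
  rewrite BzE; apply: lerD.
    rewrite big_mkcond/=; apply: ler_sum => s _; case: ifP => _.
      by rewrite expRD mulrC ler_wpM2r ?expR_ge0// lerDl expR_ge0.
    by rewrite mulr_ge0// expR_ge0.
  (* The inverse of the sum is at most the inverse of its term at the admissible configuration
     [s0]. *)
  apply: (@le_trans _ _ (expR (zfield s0 x t + pair_field h s0))^-1).
    rewrite lef_pV2 ?posrE ?expR_gt0//; last first.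
      rewrite (bigD1 s0) ?s0v//= ltr_pwDl ?expR_gt0//.
      by apply: sumr_ge0 => s _; exact: expR_ge0.
    by rewrite (bigD1 s0) ?s0v//= lerDl; apply: sumr_ge0 => s _; exact: expR_ge0.
  rewrite -expRN opprD expRD (bigD1 s0)//= mulrC.
  apply: (@le_trans _ _ (k s0 * expR (- zfield s0 x t))).
    by rewrite ler_wpM2r ?expR_ge0// lerDr expR_ge0.
  by rewrite lerDl; apply: sumr_ge0 => s _; rewrite mulr_ge0// expR_ge0.
- by apply: sumr_ge0 => s _; rewrite !mulr_ge0// expR_ge0.
move=> x f /gen_gen mf f01.
have e1 : (1 : R) ^+ 2 = 1 by rewrite expr1n.
have e2 : (-1 : R) ^+ 2 = 1 by rewrite sqrrN expr1n.
have hs (s : pairs) : rintegrable Q (fun t => f t * expR (1 * zfield s x t) + f t * expR (-1 * zfield s x t)) /\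
    \int[Q]_t (f t * expR (1 * zfield s x t) + f t * expR (-1 * zfield s x t)) <=
    (expR (4 * B * N%:R / 2) * 2) * \int[Q]_t f t.
  have mz := measurable_zfield s x.
  have [i1 b1] := os_exp mz (zcos s x) (zcov_le s x) mf f01 e1.
  have [i2 b2] := os_exp mz (zcos s x) (zcov_le s x) mf f01 e2.
  by split; [exact: rintD|rewrite RintD//; lra].
have E t : f t * Bz' x t = \sum_s k s * (f t * expR (1 * zfield s x t) + f t * expR (-1 * zfield s x t)).
  by rewrite /Bz' mulr_sumr; apply: eq_bigr => s _; rewrite /k; ring.
rewrite (_ : (fun t => f t * Bz' x t) = fun t => \sum_s k s * (f t * expR (1 * zfield s x t) + f t * expR (-1 * zfield s x t))); last first.
  by apply/funext => t; exact: E.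
split; first by apply: rint_sum => s _; apply: rintZ; exact: (hs s).1.
rewrite Rint_sum; last by move=> s _; apply: rintZ; exact: (hs s).1.
rewrite mulr_suml; apply: ler_sum => s _; rewrite RintZ; last exact: (hs s).1.
by rewrite -mulrA; apply: ler_wpM2l => //; exact: (hs s).2.
Qed.

Let Wt := @weight _ _ _ _ Om.
Let PQ : probability (T * os_T Om)%type R := (P \x Q)%E.

(** For fixed [n] the pairs of an index and a configuration form a finite set. The interpolation
    runs on the product of the two probability spaces, with the weights frozen by the pi-system [W].
    On the side of H + sqrt N y the sum factors into the partition function and the mixture of the
    [y], and its logarithm splits. *)
Let guerra_trunc n : psi g a h N v + \int[Q]_t ln (trunc_mix Wt (fun i => By (al i)) n t) <=
  \int[Q]_t ln (trunc_mix Wt (fun i => Bz (al i)) n t) + N%:R * (4 * B * (`|v - u| + delta)) / 2.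
Proof.
pose I := ('I_n.+1 * pairs)%type.
pose X (k : I) (z : T * os_T Om) := pair_energy g a (fb k.2) z.1 + yfield N (al k.1) z.2.
pose Y (k : I) (z : T * os_T Om) := zfield (fb k.2) (al k.1) z.2.
pose c (k : I) (z : T * os_T Om) := trunc_weight Wt k.1 z.2 * cweight h v k.2.
pose W : set (set (T * os_T Om)) := [set E | exists2 E2, sigw E2 & E = [set z | E2 z.2]].
pose C (k k' : I) := energy_cov a (fb k.2) (fb k'.2) + ycov N (al k.1) (al k'.1).
pose D (k k' : I) := zcov (fb k.2, al k.1) (fb k'.2, al k'.1).
have WI : setI_closed W.
  move=> E1 E2 [F1 h1 ->] [F2 h2 ->]; exists (F1 `&` F2) => //.
  exact: sigma_generated_setI.
have WT : W setT by exists setT => //; exact: sigma_generated_setT.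
have msw (E : set (os_T Om)) : sigw E -> measurable E by exact: sigma_w_measurable.
have Wm E : W E -> measurable E.
  move=> [F hF ->]; have := @measurable_snd _ _ T (os_T Om) measurableT F (msw _ hF).
  by rewrite setTI.
have mX k : measurable_fun setT (X k).
  apply: measurable_funD.
    exact: (measurableT_comp (measurable_pair_energy g a (fb k.2)) (@measurable_fst _ _ T (os_T Om))).
  exact: (measurableT_comp (measurable_yfield N (al k.1)) (@measurable_snd _ _ T (os_T Om))).
have mY k : measurable_fun setT (Y k).
  exact: (measurableT_comp (measurable_zfield (fb k.2) (al k.1)) (@measurable_snd _ _ T (os_T Om))).
have mtw (i : 'I_n.+1) : measurable_fun (setT : set (g_sigma_algebraType
    (\bigcup_(x in [set: A]) preimage_set_system setT (os_w x : os_T Om -> R) measurable)))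
    (trunc_weight Wt i).
  apply: measurable_funD.
    case: (i < n)%N; [exact: measurable_weight_gen|exact: measurable_cst].
  apply: measurable_funM => //; apply: measurable_funB => //.
  by apply: measurable_sum => j; exact: measurable_weight_gen.
have cW k C' : measurable C' -> <<s W >> (c k @^-1` C').
  move=> mC'; apply: sub_gen_smallest.
  exists ((fun t => trunc_weight Wt k.1 t * cweight h v k.2) @^-1` C') => //.
  apply: sigma_generated_fun => //; exact: measurable_funM.
have tw0 (i : 'I_n.+1) t : 0 <= trunc_weight Wt i t.
  by apply: trunc_weight_ge0; [exact: weight_ge0|exact: weight_sum_le].
have c0 k z : 0 <= c k z by rewrite mulr_ge0 ?cweight_ge0.
have sumE (f : 'I_n.+1 -> R) (F : 'I_n.+1 -> pairs -> R) :
    \sum_(k : I) f k.1 * cweight h v k.2 * F k.1 k.2 = \sum_i f i * \sum_s cweight h v s * F i s.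
  rewrite -(pair_bigA _ (fun i s => f i * cweight h v s * F i s))/=.
  by apply: eq_bigr => i _; rewrite mulr_sumr; apply: eq_bigr => s _; rewrite mulrA.
have csum z : \sum_k c k z = \sum_(s : pairs) cweight h v s.
  have := sumE (fun i => trunc_weight Wt i z.2) (fun _ _ => 1).
  rewrite (eq_bigr (fun k => c k z)); last by move=> k _; rewrite mulr1.
  move=> ->; under eq_bigr => i _ do under eq_bigr do rewrite mulr1.
  by rewrite -mulr_suml trunc_weight1 mul1r.
have cb z : \sum_(s : pairs) cweight h v s <= \sum_k c k z <= \sum_(s : pairs) cweight h v s.
  by rewrite csum lexx.
have Cs k k' : C k k' = C k' k by rewrite /C energy_covC ycovC.
have Ds k k' : D k k' = D k' k by rewrite /D zcovC.
have mE s : measurable_fun setT (pair_energy g a s) by exact: measurable_pair_energy.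
have HXY E b e th : W E -> \int[PQ]_w (\1_E w * cos (th + \sum_k b k * X k w + \sum_k e k * Y k w)) =
    cos th * expR (- (quad C b + quad D e) / 2) * fine (PQ E).
  move=> [F hF ->]; have mF := msw _ hF.
  have -> : fine (PQ [set z | F z.2]) = fine (Q F).
    by congr fine; exact: prod_snd_preimage.
  pose U t1 := \sum_k b k * pair_energy g a (fb k.2) t1.
  pose V t2 := \sum_k b k * yfield N (al k.1) t2 + \sum_k e k * zfield (fb k.2) (al k.1) t2.
  have mU : measurable_fun setT U.
    by apply: measurable_sum => k; exact: measurable_funM.
  have mV : measurable_fun setT V.
    apply: measurable_funD; apply: measurable_sum => k; apply: measurable_funM => //.
      exact: measurable_yfield.
    exact: measurable_zfield.
  have E1 z : th + \sum_k b k * X k z + \sum_k e k * Y k z = th + U z.1 + V z.2.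
    rewrite /U /V /X /Y addrA; congr (_ + _); rewrite -!addrA; congr (_ + _).
    by rewrite -big_split/=; apply: eq_bigr => k _; rewrite mulrDr.
  transitivity (\int[(P \x Q)%E]_z (\1_F z.2 * cos (th + U z.1 + V z.2))).
    apply: eq_Rintegral => z _; by rewrite E1.
  rewrite Rint_prod.
  - transitivity (\int[P]_t (expR (- (quad (fun k l : I => ycov N (al k.1) (al l.1)) b + quad D e) / 2) *
        fine (Q F) * cos (th + U t))).
      apply: eq_Rintegral => t _ /=.
      (* For a fixed sample of the disorder the energy is part of the phase. *)
      have := @os_cos _ _ _ _ Om N I (fun k => (fb k.2, al k.1)) F b e (th + U t) hF.
      rewrite /= => hc; rewrite [RHS](_ : _ = cos (th + U t) * expR (- (quad (fun k l : I => ycov N (al k.1) (al l.1)) b + quad D e) / 2) * fine (Q F)); last by ring.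
      rewrite -hc; apply: eq_Rintegral => t2 _; congr (_ * cos _).
      by rewrite /V addrA.
    rewrite RintZ; last first.
      apply: (@rint_bounded _ _ _ _ _ 1); last by move=> t; exact: cos_norm_le1.
      by apply: measurable_cos; exact: measurable_funD.
    have -> : \int[P]_t cos (th + U t) = cos th * expR (- quad (fun k l : I => energy_cov a (fb k.2) (fb l.2)) b / 2).
      exact: (energy_gfam g_gauss a_sq N0 (fun k : I => fb k.2)).
    rewrite (quadD (fun k l : I => energy_cov a (fb k.2) (fb l.2))).
    move: (quad (fun k l : I => ycov N _ _) b) (quad D e) (quad (fun k l : I => energy_cov a _ _) b).
    move=> q1 q2 q3; have -> : expR (- (q3 + q1 + q2) / 2) = expR (- (q1 + q2) / 2) * expR (- q3 / 2).
      by rewrite -expRD; congr expR; ring.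
    by ring.
  - apply: (@rint_bounded _ _ _ _ _ 1); last first.
      by move=> z; rewrite normrM mulr_ile1 ?indic_norm_le1 ?cos_norm_le1.
    apply: measurable_funM.
      exact: (measurableT_comp (indic_measurable mF) (@measurable_snd _ _ T (os_T Om))).
    apply: measurable_cos; apply: measurable_funD.
      apply: measurable_funD => //.
      exact: (measurableT_comp mU (@measurable_fst _ _ T (os_T Om))).
    exact: (measurableT_comp mV (@measurable_snd _ _ T (os_T Om))).
  - move=> t; apply: (@rint_bounded _ _ _ _ _ 1); last first.
      by move=> z; rewrite normrM mulr_ile1 ?indic_norm_le1 ?cos_norm_le1.
    apply: measurable_funM; first exact: indic_measurable.
    apply: measurable_cos; exact: (measurable_funD (measurable_cst (th + U t)) mV).
have CDe k i j : (C k k - D k k) - (C i j - D i j) <= N%:R * (4 * B * (`|v - u| + delta)).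
  rewrite /C /D !gapE.
  have g1 := gap_diag (al k.1) (fallback_overlap s0v k.2).
  have g2 : 0 <= \sum_(l < 2) \sum_(l' < 2) gap (fb i.2) (fb j.2) (al i.1) (al j.1) l l'.
    by apply: sumr_ge0 => l _; apply: sumr_ge0 => l' _; exact: gap_ge0.
  have := ler_wpM2l (ler0n R N) g1; have := mulr_ge0 (ler0n R N) g2; lra.
have := gaussian_compare WI WT Wm mX mY cW c0 (cweight_sum_gt0 h s0v) cb Cs Ds HXY CDe.
have EX z : \sum_i c i z * expR (X i z) =
    partition_function g a h N v z.1 * trunc_mix Wt (fun i => By (al i)) n z.2.
  have := sumE (fun i => trunc_weight Wt i z.2)
    (fun i s => expR (pair_energy g a (fb s) z.1) * expR (yfield N (al i) z.2)).
  rewrite (eq_bigr (fun i => c i z * expR (X i z))); last by move=> k _; rewrite /X expRD.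
  move=> ->; rewrite /trunc_mix -(trunc_weight_sum Wt n z.2 (fun i => By (al i) z.2)) mulr_sumr.
  apply: eq_bigr => i _; rewrite (partition_fallback g a h v s0) mulrCA; congr (_ * _).
  by rewrite mulr_suml; apply: eq_bigr => s _; rewrite mulrA.
have EY z : \sum_i c i z * expR (Y i z) = trunc_mix Wt (fun i => Bz (al i)) n z.2.
  have := sumE (fun i => trunc_weight Wt i z.2) (fun i s => expR (zfield (fb s) (al i) z.2)).
  rewrite (eq_bigr (fun i => c i z * expR (Y i z)))// => ->.
  rewrite /trunc_mix -(trunc_weight_sum Wt n z.2 (fun i => Bz (al i) z.2)).
  apply: eq_bigr => i _; congr (_ * _).
  by rewrite (cweight_sumE h v s0 (fun s => zfield s (al i) z.2)) BzE.
have iZ := rint_ln_partition h g_gauss a_sq N0 s0v.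
have [iZ1 eZ1] := Rint_fst Q iZ; have [iy1 ey1] := Rint_snd P (mixy.1 n).
have [iz1 ez1] := Rint_snd P (mixz.1 n).
have By0 t : 0 < trunc_mix Wt (fun i => By (al i)) n t.
  apply: trunc_mix_gt0 => //; [exact: weight_ge0|exact: weight_sum_le|].
  by move=> i t'; exact: expR_gt0.
have -> : \int[PQ]_w ln (\sum_i c i w * expR (X i w)) =
    psi g a h N v + \int[Q]_t ln (trunc_mix Wt (fun i => By (al i)) n t).
  rewrite -ey1 /psi -eZ1 -RintD//; apply: eq_Rintegral => z _.
  by rewrite EX lnM// posrE ?By0//; exact: (partition_gt0 g a h s0v).
have -> // : \int[PQ]_w ln (\sum_i c i w * expR (Y i w)) =
    \int[Q]_t ln (trunc_mix Wt (fun i => Bz (al i)) n t).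
rewrite -ez1; apply: eq_Rintegral => z _; by rewrite EY.
Qed.

Theorem guerra_bound : exists gv : R, G h N v Om = gv%:E /\
  N%:R^-1 * psi g a h N v <= gv + 2 * B * (`|v - u| + delta).
Proof.
have [_ [Ly [Ey ly]]] := mixy; have [_ [Lz [Ez lz]]] := mixz.
exists (N%:R^-1 * Lz - N%:R^-1 * Ly); split.
  rewrite EFinB !EFinM -Ez -Ey; congr (_ * _ - _ * _)%E.
have Nr : 0 < N%:R :> R by rewrite ltr0n.
suff : psi g a h N v + Ly <= Lz + N%:R * (4 * B * (`|v - u| + delta)) / 2.
  move=> hl; rewrite -(ler_pM2l Nr) mulrA divff ?gt_eqF// mul1r mulrDr mulrBr !mulrA.
  rewrite divff ?gt_eqF// !mul1r; move: hl.
  have -> : N%:R * (4 * B * (`|v - u| + delta)) / 2 = N%:R * 2 * B * (`|v - u| + delta) by field.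
  lra.
apply: (ler_cvg_to (cvgD (cvg_cst (psi g a h N v)) ly) (cvgD lz (cvg_cst (N%:R * (4 * B * (`|v - u| + delta)) / 2)))).
by apply: nearW => n; exact: guerra_trunc.
Qed.

End guerra.

(** * The structure built from a large system *)

Section grouping.
Context d (T : measurableType d) (R : realType) (P : probability T R).

Lemma pi_indep (G : set (set T)) (H : set T) : setI_closed G -> G setT ->
  (forall E, G E -> measurable E) -> measurable H ->
  (forall E, G E -> P (E `&` H) = (P E * P H)%E) ->
  forall E, <<s G >> E -> P (E `&` H) = (P E * P H)%E.
Proof.
move=> GI GT Gm mH indep E hE.
have mGT A : <<s G >> A -> measurable A.
  by move=> GA; have := measurable_to_gen Gm measurableT GA; rewrite setTI.
have := @weighted_law_pi _ T _ T _ (g_sigma_algebraType G) R P P (@to_gen _ T G) (@to_gen _ T G) (\1_H)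
   (fun=> fine (P H)) (measurable_to_gen Gm) (measurable_to_gen Gm).
have i1 : rintegrable P (\1_H : T -> R).
  by apply: (@rint_bounded _ _ _ _ _ 1); [exact: indic_measurable|exact: indic_norm_le1].
move=> /(_ i1 (rint_cst _ _) G erefl GI) h.
have E1 A : measurable A -> \int[P]_t (\1_H t * \1_A t) = fine (P (A `&` H)).
  move=> mA; rewrite -Rint_indic; last exact: measurableI.
  by apply: eq_Rintegral => t _; rewrite indicI mulrC.
have E2 A : measurable A -> \int[P]_t (fine (P H) * \1_A t) = fine (P H) * fine (P A).
  move=> mA; rewrite RintZ ?Rint_indic//.
  by apply: (@rint_bounded _ _ _ _ _ 1); [exact: indic_measurable|exact: indic_norm_le1].
have key A : G A -> \int[P]_t (\1_H t * \1_A (@to_gen _ T G t)) =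
    \int[P]_t (fine (P H) * \1_A (@to_gen _ T G t)).
  move=> GA; have mA := Gm _ GA; rewrite E1// E2// indep// fineM//; [by rewrite mulrC| |];
  exact: fin_num_measure.
have {h} := h (key _ GT) key E hE.
have mE := mGT _ hE; rewrite E1// E2// => h.
rewrite -[LHS]fineK; last by apply: fin_num_measure; exact: measurableI.
by rewrite h EFinM !fineK 1?muleC//; exact: fin_num_measure.
Qed.

Lemma indep_list (J : choiceType) (D : set J) (F : J -> set (set T)) :
  mutually_independent P D F <->
  forall (r : seq J) (E : J -> set T), uniq r -> (forall j, j \in r -> D j) ->
    (forall j, j \in r -> F j (E j)) ->
    P (\big[setI/setT]_(j <- r) E j) = (\prod_(j <- r) P (E j))%E.
Proof.
split=> [h r E ur rD rF|h S E SD SF]; last first.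
  by rewrite bigcap_fset h// => j; exact: SD.
have Sr j : (j \in [fset x in r]%fset) = (j \in r) by rewrite inE.
have pS : perm_eq [fset x in r]%fset r by apply: uniq_perm => //; exact: fset_uniq.
rewrite -(perm_big _ pS) -(perm_big _ pS) -bigcap_fset; apply: h.
  by move=> j /=; rewrite Sr; exact: rD.
by move=> j; rewrite Sr; exact: rF.
Qed.

Lemma indep_sub (J J' : choiceType) (F : J -> set (set T)) (F' : J' -> set (set T))
    (f : J' -> J) (f' : J -> J') : cancel f f' -> (forall j, F' j `<=` F (f j)) ->
  mutually_independent P setT F -> mutually_independent P setT F'.
Proof.
move=> fK FF /indep_list h; apply/indep_list => r E ur _ rF.
have := h (map f r) (E \o f') _ (fun _ _ => I) _; rewrite !big_map.
under eq_bigr do rewrite /= fK.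
under [X in _ -> _ -> _ = X]eq_bigr do rewrite /= fK.
apply; first by rewrite map_inj_uniq//; exact: can_inj fK.
by move=> j /mapP[i ir ->] /=; rewrite fK; apply: FF; exact: rF.
Qed.

Variable g : seq nat -> {RV P >-> R}.
Hypothesis g_gauss : gaussian_disorder g.

Definition prefix_gen (k : nat) : set (set T) :=
  sigma_generated (fun s : seq nat => g (k :: s) : T -> R).

Let sg s : set (set T) := sigma_generated (fun _ : unit => g s : T -> R).

(** Finite intersections of events of single variables: a pi-system large enough to generate
    [prefix_gen k], on which independence reduces to that of the variables. *)
Let cyl k : set (set T) := [set E | exists (r : seq (seq nat)) (A : seq nat -> set T),
  (forall s, sg (k :: s) (A s)) /\ E = \bigcap_(s in [set` r]) A s].

Let sgT s : sg s setT. Proof. exact: sigma_generated_setT. Qed.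

Let cylT k : cyl k setT.
Proof.
exists [::], (fun=> setT); split; first by move=> s; exact: sgT.
by apply/seteqP; split.
Qed.

Let cylI k : setI_closed (cyl k).
Proof.
move=> _ _ [r1 [A1 [h1 ->]]] [r2 [A2 [h2 ->]]].
exists (r1 ++ r2), (fun s => (if s \in r1 then A1 s else setT) `&` (if s \in r2 then A2 s else setT)).
split=> [s|]; first by apply: sigma_generated_setI; case: ifP => _; first [exact: h1|exact: h2|exact: sgT].
apply/seteqP; split=> [t [t1 t2] s /= sr|t h].
  by split; case: ifP => // ?; [exact: t1|exact: t2].
split=> s /= sr.
  by have := h s; rewrite /= mem_cat sr => /(_ isT)[].
by have := h s; rewrite /= mem_cat sr orbT => /(_ isT)[_].
Qed.

Let sgm s E : sg s E -> measurable E.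
Proof. by apply: sigma_generated_measurable => _; exact: measurable_funP. Qed.

Let cylm k E : cyl k E -> measurable E.
Proof.
move=> [r [A [h ->]]]; apply: fin_bigcap_measurable => // s _; exact: (sgm (h s)).
Qed.

Let prefix_sub k : prefix_gen k `<=` <<s cyl k >>.
Proof.
apply: smallest_sub; first exact: smallest_sigma_algebra.
move=> E [s _ [C mC <-]]; apply: sub_gen_smallest.
exists [:: s], (fun s' => if s' == s then g (k :: s) @^-1` C else setT); split.
  move=> s'; case: eqP => [->|_]; last exact: sgT.
  exact: (@sigma_generated_pre _ T R unit (fun=> g (k :: s) : T -> R) tt).
rewrite setTI; apply/seteqP; split => t /= ht.
  by move=> s'; rewrite /= inE => /eqP ->; rewrite eqxx.
by have := ht s; rewrite /= inE eqxx => /(_ isT).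
Qed.

Let prefixm k E : prefix_gen k E -> measurable E.
Proof. by apply: sigma_generated_measurable => s; exact: measurable_funP. Qed.

Let cyl_indep (r : seq nat) (E : nat -> set T) : uniq r -> (forall k, k \in r -> cyl k (E k)) ->
  P (\big[setI/setT]_(k <- r) E k) = (\prod_(k <- r) P (E k))%E.
Proof.
move=> ur hE; have gi := (indep_list _ _).1 g_gauss.2.
have : forall k, exists q : seq (seq nat) * (seq nat -> set T), k \in r ->
    (forall s, sg (k :: s) (q.2 s)) /\ E k = \big[setI/setT]_(s <- undup q.1) q.2 s.
  move=> k; case: (boolP (k \in r)) => [kr|_]; last by exists ([::], fun=> setT).
  have [q [A [h ->]]] := hE k kr; exists (q, A) => _; split => //=.
  rewrite -bigcap_seq; apply/seteqP; split => t ht s /=.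
    by rewrite mem_undup => sq; exact: ht.
  by move=> sq; apply: ht; rewrite /= mem_undup.
move=> /choice[q hq].
pose A w := if w is k :: s then (q k).2 s else setT.
pose wd k := [seq k :: s | s <- undup (q k).1].
have eE k : k \in r -> E k = \big[setI/setT]_(w <- wd k) A w.
  by move=> kr; rewrite (hq k kr).2 big_map.
have wdF k w : k \in r -> w \in wd k -> w != [::] /\ sg w (A w).
  by move=> kr /mapP[s _ ->]; split => //; exact: (hq k kr).1.
have uwd k : uniq (wd k) by rewrite map_inj_uniq ?undup_uniq// => s s' [].
have e1 : \big[setI/setT]_(k <- r) E k = \big[setI/setT]_(w <- flatten (map wd r)) A w.
  by rewrite big_flatten big_map; apply: eq_big_seq => k; exact: eE.
have e2 : (\prod_(k <- r) P (E k) = \prod_(w <- flatten (map wd r)) P (A w))%E.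
  rewrite big_flatten big_map; apply: eq_big_seq => k kr; rewrite eE//; apply: gi => // w ww.
    exact: (wdF k w kr ww).1.
  exact: (wdF k w kr ww).2.
rewrite e1 e2; apply: gi.
- apply: (@map_uniq _ _ id); rewrite map_id.
  have : uniq (allpairs_dep (fun (k : nat) (s : seq nat) => k :: s) r (fun k => undup (q k).1)).
    apply: allpairs_uniq_dep => // [k _|]; first exact: undup_uniq.
    by move=> [k s] [k' s'] _ _ /= [-> ->].
  by [].
- by move=> w /flattenP[_ /mapP[k kr ->] ww]; exact: (wdF k w kr ww).1.
- by move=> w /flattenP[_ /mapP[k kr ->] ww]; exact: (wdF k w kr ww).2.
Qed.

(** Independence of disjoint groups of independent variables. Groups pass one at a time from
    cylinders, listed in [r2], to the full sigma-algebra, listed in [r1]; each passage is the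
    pi-system argument [pi_indep] with the other groups fixed. *)
Lemma prefix_indep : mutually_independent P setT prefix_gen.
Proof.
apply/indep_list => r E ur _ hE.
suff H (r1 r2 : seq nat) (F : nat -> set T) : uniq (r1 ++ r2) ->
    (forall k, k \in r1 -> prefix_gen k (F k)) -> (forall k, k \in r2 -> cyl k (F k)) ->
    P (\big[setI/setT]_(k <- r1 ++ r2) F k) = (\prod_(k <- r1 ++ r2) P (F k))%E.
  by have := H r [::] E; rewrite cats0; apply.
elim: r1 r2 F {r E ur hE} => [|k r1 IH] r2 F ur h1 h2; first exact: cyl_indep.
have pk : perm_eq ((k :: r1) ++ r2) (r1 ++ k :: r2) by rewrite perm_sym; apply/permPl; exact: (perm_catCA r1 [:: k] r2).
have ukr : uniq (r1 ++ k :: r2) by rewrite -(perm_uniq pk).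
have [kn ur'] : k \notin r1 ++ r2 /\ uniq (r1 ++ r2) by move: ur => /= /andP[].
have hr : P (\big[setI/setT]_(i <- r1 ++ r2) F i) = (\prod_(i <- r1 ++ r2) P (F i))%E.
  by apply: IH => // i ir; apply: h1; rewrite inE ir orbT.
have mF i : i \in r1 ++ r2 -> measurable (F i).
  rewrite mem_cat => /orP[ir|ir]; last exact: (cylm (h2 i ir)).
  by apply: (@prefixm i); apply: h1; rewrite inE ir orbT.
rewrite /= !big_cons -hr; apply: (pi_indep (@cylI k) (@cylT k) (@cylm k)).
- rewrite -bigcap_seq; apply: fin_bigcap_measurable => // i /= ir; exact: mF.
- move=> A cA; pose F' i := if i == k then A else F i.
  have F'r i : i \in r1 ++ r2 -> F' i = F i.
    by rewrite /F' => ir; case: eqP => // ik; rewrite -ik ir in kn.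
  have := IH (k :: r2) F' ukr; rewrite -!(perm_big _ pk)/= !big_cons.
  rewrite (_ : F' k = A); last by rewrite /F' eqxx.
  rewrite (eq_big_seq _ F'r) (eq_big_seq (fun i => P (F i))); last by move=> i /F'r ->.
  rewrite hr; apply.
    move=> i ir; rewrite F'r ?mem_cat ?ir//; apply: h1; by rewrite inE ir orbT.
  move=> i; rewrite inE => /orP[/eqP ->|ir]; first by rewrite /F' eqxx.
  by rewrite F'r ?mem_cat ?ir ?orbT//; exact: h2.
- by apply: prefix_sub; apply: h1; rewrite mem_head.
Qed.

(** A prefixed word is never empty, so [s] ranges over all words; the empty one serves the constant
    term of [xi']. *)
Lemma prefix_std k (D : pred (seq nat)) : std_family P D (fun s => g (k :: s) : T -> R).
Proof.
move=> s c th us _.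
have := gaussian_disorder_std g_gauss (s := map (cons k) s) (fun w => c (behead w)) th.
rewrite !big_map /= map_inj_uniq; last by move=> x y [].
move=> /(_ us) <-; last by apply/allP => w /mapP[x _ ->].
by apply: eq_Rintegral => w _; rewrite big_map.
Qed.

End grouping.

Section gfam_moments.
Context d (T : measurableType d) (R : realType) (P : probability T R) (J : Type)
  (X : J -> T -> R) (C : J -> J -> R).
Hypotheses (mX : forall j, measurable_fun setT (X j)) (gX : gfam P X C)
  (Cs : forall j j', C j j' = C j' j).

Lemma gfam_diag_ge0 j : 0 <= C j j.
Proof.
have := @gfam_quad_ge0 _ _ _ _ _ _ _ unit (fun=> j) (fun=> 1) mX gX.
by rewrite /quad !(big_pred1 tt) ?mul1r//; case.
Qed.

Lemma gfam_gaussian_family : gaussian_family P X.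
Proof.
move=> s c.
have q0 := @gfam_quad_ge0 _ _ _ _ _ _ _ 'I_(size s) (tnth (in_tuple s)) (fun k => c (tnth (in_tuple s) k)) mX gX.
exists (Num.sqrt (quad (fun k l => C (tnth (in_tuple s) k) (tnth (in_tuple s) l)) (fun k => c (tnth (in_tuple s) k)))).
  exact: sqrtr_ge0.
move=> B mB; rewrite -glawE -(@gfam_law _ _ _ _ _ _ _ _ (tnth (in_tuple s)) (fun k => c (tnth (in_tuple s) k)) mX gX q0 B mB).
congr (P (_ @^-1` B)); apply/funext => t.
exact: (big_tnth _ _ s xpredT (fun i => c i * X i t)).
Qed.

(** Polarization: the variances of [X j], [X j'] and of their sum are read off the transform. *)
Lemma gfam_product j j' : \int[P]_t (X j t * X j' t) = C j j'.
Proof.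
have sb (F : bool -> R) : \sum_b F b = F true + F false.
  by rewrite (bigD1 true)//= (big_pred1 false)//; case.
pose f (b : bool) := if b then j else j'.
have q0 := @gfam_quad_ge0 _ _ _ _ _ _ _ bool f (fun=> 1) mX gX.
have hl := @gfam_law _ _ _ _ _ _ _ _ f (fun=> 1) mX gX q0.
have mZ : measurable_fun setT (fun w => \sum_(b : bool) 1 * X (f b) w).
  by apply: measurable_sum => b; exact: measurable_funM.
have [iZ eZ] := law_sqr mZ hl; rewrite sqr_sqrtr// in eZ.
have [i1 e1] := gfam_sqr mX gX (gfam_diag_ge0 j).
have [i2 e2] := gfam_sqr mX gX (gfam_diag_ge0 j').
have i12 : rintegrable P (fun t => X j t * X j' t) by exact: rint_product.
move: eZ; rewrite /quad !sb /f !mul1r (Cs j' j).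
have -> : \int[P]_w ((\sum_(b : bool) 1 * X (if b then j else j') w) ^+ 2) =
    \int[P]_w (X j w ^+ 2 + (X j' w ^+ 2 + 2 * (X j w * X j' w))).
  by apply: eq_Rintegral => w _; rewrite sb; ring.
rewrite RintD//; last by apply: rintD => //; exact: rintZ.
rewrite RintD//; last exact: rintZ.
rewrite RintZ// e1 e2; lra.
Qed.

Lemma gfam_expectation j j' : ('E_P[fun t => (X j t * X j' t)%R] = (C j j')%:E)%E.
Proof.
have [i1 _] := gfam_sqr mX gX (gfam_diag_ge0 j).
have [i2 _] := gfam_sqr mX gX (gfam_diag_ge0 j').
have i12 : rintegrable P (fun t => X j t * X j' t) by exact: rint_product.
by rewrite expectation.unlock -EFin_Rint// gfam_product.
Qed.

End gfam_moments.

Lemma gfam_sub d (T : measurableType d) (R : realType) (P : probability T R) (J J' : Type)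
    (X : J -> T -> R) (C : J -> J -> R) (f : J' -> J) :
  gfam P X C -> gfam P (fun j => X (f j)) (fun j j' => C (f j) (f j')).
Proof. by move=> gX K f' c th; exact: (gX K (fun k => f (f' k)) c th). Qed.

Lemma gfam_ext d (T : measurableType d) (R : realType) (P : probability T R) (J : Type)
    (X : J -> T -> R) (C C' : J -> J -> R) : (forall j j', C j j' = C' j j') ->
  gfam P X C -> gfam P X C'.
Proof. by move=> CC; rewrite (_ : C = C')//; apply/funext => j; apply/funext => j'. Qed.

Definition mkRV d (T : measurableType d) (R : realType) (P : probability T R) (X : T -> R)
  (mX : measurable_fun setT X) : {RV P >-> R} :=
  HB.pack X (isMeasurableFun.Build _ _ _ _ _ mX).

Lemma esum_finType (R : realType) (I : finType) (F : I -> \bar R) : (forall x, (0 <= F x)%E) ->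
  (\esum_(x in [set: I]) F x = \sum_x F x)%E.
Proof.
move=> F0; rewrite esum_fset//; last exact: finite_finset.
rewrite [RHS]fsbig_seq ?index_enum_uniq// (_ : [set` index_enum I] = setT)//.
by apply/seteqP; split => x _ //=; exact: mem_index_enum.
Qed.

(** * Gibbs weights and cavity fields over a system of size M *)

Section rost.
Context (R : realType) d (T : measurableType d) (P : probability T R)
  (g : seq nat -> {RV P >-> R}) (a : 'I_2 -> nat -> R) (h : 'I_2 -> R) (B : R).
Hypotheses (g_gauss : gaussian_disorder g) (a_sq : forall l, sqsum_bounded (a l)).
Hypotheses (B0 : 0 <= B) (aB : forall l l' n, \sum_(1 <= p < n) p%:R * `|aa a l l' p| <= B).
Variables (u delta : R) (M : nat) (M0 : (0 < M)%N) (vM : R) (kap : R).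
Hypotheses (vMu : `|vM - u| <= delta) (kap0 : 0 < kap) (kap1 : M%:R <= kap).
Variable s0 : {ffun 'I_2 -> config M}.
Hypothesis s0v : overlap R s0 = vM.
Local Notation pairsM := {ffun 'I_2 -> config M}.

Let gk k : seq nat -> T -> R := fun s => g (k :: s).
Let mgk k s : measurable_fun setT (gk k s). Proof. exact: measurable_funP. Qed.

Let gk_std k m0 : std_family P (fun s : seq nat => (m0 <= size s)%N) (gk k).
Proof. exact: prefix_std. Qed.

(** The square roots split a factor between the two fields of a covariance: p + 1 is the factor of
    x^p in [xi'], which explains the shifted index, and p - 1 in [ycoef] is its factor in x xi' -
    xi. *)
Definition zcoef l p := a l p.+1 * Num.sqrt p.+1%:R.
Definition ycoef l p := a l p * Num.sqrt p.-1%:R.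
(* For kap = M + N, the field with these coefficients has the covariance
   kap xi (M q / kap) of the Hamiltonian of the system of size M + N restricted
   to its first M sites. *)
Definition xcoef l p := Num.sqrt kap * a l p * Num.sqrt (M%:R / kap) ^+ p.

Lemma zcoef_sq l : sqsum_bounded (zcoef l).
Proof.
exists B => n; apply: le_trans (aB l l n.+1).
rewrite big_add1/= big_mkord; apply: ler_sum => p _.
by rewrite /zcoef /aa exprMn sqr_sqrtr// normrM -expr2 real_normK ?num_real// mulrC.
Qed.

Lemma ycoef_sq l : sqsum_bounded (ycoef l).
Proof.
apply: (@sqsum_bounded1 _ _ B) => n; apply: le_trans (aB l l n).
apply: ler_sum => p _; rewrite /ycoef /aa exprMn sqr_sqrtr// normrM -expr2 real_normK ?num_real//.
by rewrite mulrC ler_wpM2r ?sqr_ge0// ler_nat leq_pred.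
Qed.

Let ratio0 : 0 <= M%:R / kap. Proof. by rewrite divr_ge0// ltW. Qed.
Let ratio1 : M%:R / kap <= 1. Proof. by rewrite ler_pdivrMr// mul1r. Qed.

Lemma xcoef_sq l : sqsum_bounded (xcoef l).
Proof.
have [D hD] := a_sq l; exists (kap * D) => n.
apply: (@le_trans _ _ (kap * \sum_(p < n) a l p ^+ 2)); last by rewrite ler_wpM2l// ltW.
rewrite mulr_sumr; apply: ler_sum => p _.
rewrite /xcoef !exprMn (sqr_sqrtr (ltW kap0)) -exprM mulnC exprM (sqr_sqrtr ratio0).
rewrite -[leRHS]mulr1 ler_wpM2l//; first by apply: mulr_ge0; [exact: ltW|exact: sqr_ge0].
by rewrite exprn_ile1.
Qed.

Lemma zcoef_cov l l' x : `|x| <= 1 ->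
  limn (fun n => \sum_(0 <= p < n) zcoef l p * zcoef l' p * x ^+ p) = xi' a l l' x.
Proof.
move=> x1; rewrite (xi'E aB)//; apply/cvg_lim; first exact: Rhausdorff.
have := dpser_cvg (aB l l') x1; move=> /(cvg_comp _ _ (cvg_addnr 1))/=.
move=> hc; rewrite [X in X @ _ --> _](_ : _ = (fun n =>
   \sum_(1 <= p < n + 1) aa a l l' p * (p%:R * x ^+ p.-1)))//.
apply/funext => n; rewrite addn1 big_add1/=; apply: eq_bigr => p _.
rewrite /zcoef /aa -[in RHS](@sqr_sqrtr _ p.+1%:R)//; ring.
Qed.

Lemma ycoef_cov l l' x : `|x| <= 1 ->
  limn (fun n => \sum_(1 <= p < n) ycoef l p * ycoef l' p * x ^+ p) = theta a l l' x.
Proof.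
move=> x1; rewrite /theta (xi'E aB)//; apply/cvg_lim; first exact: Rhausdorff.
have c1 : (fun n => x * \sum_(1 <= p < n) aa a l l' p * (p%:R * x ^+ p.-1)) @ \oo -->
    x * dpser (aa a l l') x.
  by apply: cvgM; [exact: cvg_cst|exact: (dpser_cvg (aB l l') x1)].
have c2 := cvgB c1 (pser_cvg (aB l l') x1).
rewrite [X in X @ _ --> _](_ : _ = (fun n => x * \sum_(1 <= p < n) aa a l l' p * (p%:R * x ^+ p.-1) -
  \sum_(1 <= p < n) aa a l l' p * x ^+ p))//; last first.
  apply/funext => n; rewrite mulr_sumr -sumrB big_nat [RHS]big_nat.
  apply: eq_bigr => -[//|p] _; rewrite /ycoef /aa /=.
  have -> : x * (a l p.+1 * a l' p.+1 * (p.+1%:R * x ^+ p)) =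
      a l p.+1 * a l' p.+1 * x ^+ p.+1 * (Num.sqrt p%:R ^+ 2 + 1).
    by rewrite sqr_sqrtr// natr1 exprS; ring.
  ring.
exact: c2.
Qed.

Lemma xcoef_cov l l' x : `|x| <= 1 ->
  limn (fun n => \sum_(1 <= p < n) xcoef l p * xcoef l' p * x ^+ p) = kap * xi a l l' (M%:R / kap * x).
Proof.
move=> x1; apply/cvg_lim; first exact: Rhausdorff.
have y1 : `|M%:R / kap * x| <= 1 by rewrite normrM mulr_ile1// ger0_norm.
have c1 : (fun n => kap * \sum_(1 <= p < n) aa a l l' p * (M%:R / kap * x) ^+ p) @ \oo -->
    kap * xi a l l' (M%:R / kap * x).
  by apply: cvgM; [exact: cvg_cst|exact: (pser_cvg (aB l l') y1)].
rewrite [X in X @ _ --> _](_ : _ = (fun n => kap * \sum_(1 <= p < n) aa a l l' p * (M%:R / kap * x) ^+ p)); first exact: c1.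
apply/funext => n; rewrite mulr_sumr; apply: eq_bigr => p _.
rewrite /xcoef /aa; transitivity (Num.sqrt kap ^+ 2 * (a l p * a l' p *
    (Num.sqrt (M%:R / kap) ^+ p * Num.sqrt (M%:R / kap) ^+ p * x ^+ p))); first by ring.
by rewrite (sqr_sqrtr (ltW kap0)) -exprMn -expr2 (sqr_sqrtr ratio0) -exprMn.
Qed.

(* Prefixing the words that index the disorder by 0, by 1 and by i.+2 yields
   independent copies of it, for x, for y and for z_i. *)
Definition rz i l (x : config M) : T -> R := mixed (gk i.+2) 0 (zcoef l) x.
Definition ry l (x : config M) : T -> R := mixed (gk 1) 1 (ycoef l) x.
Definition rx l (x : config M) : T -> R := mixed (gk 0) 1 (xcoef l) x.

Lemma measurable_rz i l x : measurable_fun setT (rz i l x).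
Proof. by apply: measurable_mixed => s; exact: mgk. Qed.
Lemma measurable_ry l x : measurable_fun setT (ry l x).
Proof. by apply: measurable_mixed => s; exact: mgk. Qed.
Lemma measurable_rx l x : measurable_fun setT (rx l x).
Proof. by apply: measurable_mixed => s; exact: mgk. Qed.

Lemma rz_gfam i : gfam P (fun p : 'I_2 * config M => rz i p.1 p.2)
  (fun p p' => xi' a p.1 p'.1 (ov R p.2 p'.2)).
Proof.
apply: (gfam_ext _ (mixed_gfam (@mgk i.+2) (@gk_std i.+2 _) M0 zcoef_sq)).
by move=> p p'; rewrite zcoef_cov// ov_le1.
Qed.

Lemma ry_gfam : gfam P (fun p : 'I_2 * config M => ry p.1 p.2)
  (fun p p' => theta a p.1 p'.1 (ov R p.2 p'.2)).
Proof.
apply: (gfam_ext _ (mixed_gfam (@mgk 1) (@gk_std 1 _) M0 ycoef_sq)).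
by move=> p p'; rewrite ycoef_cov// ov_le1.
Qed.

Lemma rx_gfam : gfam P (fun p : 'I_2 * config M => rx p.1 p.2)
  (fun p p' => kap * xi a p.1 p'.1 (M%:R / kap * ov R p.2 p'.2)).
Proof.
apply: (gfam_ext _ (mixed_gfam (@mgk 0) (@gk_std 0 _) M0 xcoef_sq)).
by move=> p p'; rewrite xcoef_cov// ov_le1.
Qed.

Definition rA : finType := {x : pairsM | overlap R x == vM}.

Definition rnum (x : pairsM) t := expR (\sum_(l < 2) rx l (x l) t + pair_field h x).
Definition rZ t := \sum_(y : rA) rnum (val y) t.
(** Gibbs weights for the field [rx] in place of the Hamiltonian of size M: this common part is
    compared later both with size M + N and with size M. *)
Definition rw (x : rA) t := rnum (val x) t / rZ t.

Let PG k := \bigcup_(s in [set: seq nat]) preimage_set_system setT (g (k :: s) : T -> R) measurable.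

Let mgkP k s : measurable_fun (setT : set (g_sigma_algebraType (PG k))) (gk k s).
Proof. exact: (@sigma_generated_meas _ T R _ (fun s : seq nat => g (k :: s) : T -> R) s). Qed.

Let mrnumP x : measurable_fun (setT : set (g_sigma_algebraType (PG 0))) (rnum x).
Proof.
apply: measurable_exp; apply: measurable_funD => //; apply: measurable_sum => l.
exact: (@measurable_mixed _ (g_sigma_algebraType (PG 0)) R (gk 0) 1 M (@mgkP 0)).
Qed.

Lemma rnum_gt0 x t : 0 < rnum x t. Proof. exact: expR_gt0. Qed.

Lemma rZ_gt0 (x : rA) t : 0 < rZ t.
Proof.
rewrite /rZ (bigD1 x)//= ltr_pwDl ?rnum_gt0//.
by apply: sumr_ge0 => y _; exact: ltW (rnum_gt0 _ _).
Qed.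

Let mrwP x : measurable_fun (setT : set (g_sigma_algebraType (PG 0))) (rw x).
Proof.
rewrite (_ : rw x = fun t => expR (ln (rnum (val x) t) - ln (rZ t))); last first.
  apply/funext => t; rewrite expRD expRN !lnK ?posrE ?rnum_gt0//.
  exact: (rZ_gt0 x).
apply: measurable_exp; apply: measurable_funB; apply: measurable_log => //.
refine (measurable_sum _ _) => y; exact: mrnumP.
Qed.

Let prefix_meas k (f : T -> R) : measurable_fun (setT : set (g_sigma_algebraType (PG k))) f ->
  measurable_fun setT f.
Proof.
move=> mf _ C mC; rewrite setTI.
apply: (@sigma_generated_measurable _ T R _ (fun s : seq nat => g (k :: s) : T -> R)).
  by move=> s; exact: measurable_funP.
by have := mf measurableT C mC; rewrite setTI.
Qed.

Lemma measurable_rw x : measurable_fun setT (rw x). Proof. exact: prefix_meas (mrwP x). Qed.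

Let gen_sub k (I : Type) (X : I -> T -> R) :
  (forall i, measurable_fun (setT : set (g_sigma_algebraType (PG k))) (X i)) ->
  sigma_generated X `<=` prefix_gen g k.
Proof.
move=> mX; apply: smallest_sub; first exact: smallest_sigma_algebra.
by move=> E [i _ [C mC <-]]; exact: mX.
Qed.

Let rq (l l' : 'I_2) (x y : rA) : R := ov R (val x l) (val y l').

(** The index set is the finite set of constrained configurations, and the numbers q are their true
    overlaps, so the diagonal ones equal [vM]. The term is transparent because [G] is evaluated on
    it by conversion. *)
Definition rost : overlap_structure a u delta.
Proof.
refine (@OverlapStructure R a u delta d T P rA rq
  (fun x => mkRV P (measurable_rw x))
  (fun i l x => mkRV P (measurable_rz i l (val x l)))
  (fun l x => mkRV P (measurable_ry l (val x l))) _ _ _ _ _ _ _ _ _).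
- by move=> l l' x y; exact: ov_le1.
- by move=> l x; exact: ov_self.
- move=> x; rewrite /rq -[ov _ _ _]/(overlap R (val x)) (eqP (valP x)); exact: vMu.
- apply: aeW => t; split=> [x|].
    by rewrite /= /rw divr_ge0 ?(ltW (rnum_gt0 _ _))// ltW//; exact: (rZ_gt0 x).
  rewrite esum_finType; last first.
    by move=> x; rewrite lee_fin /= /rw divr_ge0 ?(ltW (rnum_gt0 _ _))// ltW//; exact: (rZ_gt0 x).
  rewrite sumEFin /= /rw -mulr_suml -/(rZ t) divff// gt_eqF//.
  exact: (rZ_gt0 (exist _ s0 (introT eqP s0v))).
- move=> i; apply: (gfam_gaussian_family (X := fun lx : 'I_2 * rA => rz i lx.1 (val lx.2 lx.1))).
    by move=> lx; exact: measurable_rz.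
  exact: (gfam_sub (fun lx : 'I_2 * rA => (lx.1, val lx.2 lx.1)) (rz_gfam i)).
- move=> i l l' x y.
  have := @gfam_expectation _ _ _ _ _ _ _ _ (rz_gfam i) _ (l, val x l) (l', val y l').
  apply; first by move=> p; exact: measurable_rz.
  by move=> p p'; rewrite xi'C ov_sym.
- apply: (gfam_gaussian_family (X := fun lx : 'I_2 * rA => ry lx.1 (val lx.2 lx.1))).
    by move=> lx; exact: measurable_ry.
  exact: (gfam_sub (fun lx : 'I_2 * rA => (lx.1, val lx.2 lx.1)) ry_gfam).
- move=> l l' x y.
  have := @gfam_expectation _ _ _ _ _ _ _ _ ry_gfam _ (l, val x l) (l', val y l').
  apply; first by move=> p; exact: measurable_ry.
  by move=> p p'; rewrite thetaC ov_sym.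
- pose f (j : option (option nat)) := if j is Some (Some i) then i.+2 else
    if j is Some None then 1%N else 0%N.
  pose f' n : option (option nat) := if n is k.+1 then (if k is i.+1 then Some (Some i) else Some None) else None.
  have fK : cancel f f' by case=> [[i|]|].
  apply: (indep_sub fK) (prefix_indep g_gauss).
  case=> [[i|]|] /=; apply: gen_sub.
  + move=> lx; exact: (@measurable_mixed _ (g_sigma_algebraType (PG i.+2)) R (gk i.+2) 0 M (@mgkP i.+2)).
  + move=> lx; exact: (@measurable_mixed _ (g_sigma_algebraType (PG 1)) R (gk 1) 1 M (@mgkP 1)).
  + by move=> x; exact: mrwP.
Defined.

End rost.

(** * Free energies of families with close covariances *)

Section compare_families.
Context d1 (T1 : measurableType d1) d2 (T2 : measurableType d2) (R : realType)
  (P1 : probability T1 R) (P2 : probability T2 R) (I : finType)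
  (X1 : I -> T1 -> R) (X2 : I -> T2 -> R) (C1 C2 : I -> I -> R) (c : I -> R) (e : R).
Hypotheses (mX1 : forall i, measurable_fun setT (X1 i)) (mX2 : forall i, measurable_fun setT (X2 i))
  (gX1 : gfam P1 X1 C1) (gX2 : gfam P2 X2 C2)
  (C1s : forall i j, C1 i j = C1 j i) (C2s : forall i j, C2 i j = C2 j i)
  (c0 : forall i, 0 <= c i) (csum : 0 < \sum_i c i).

Lemma rint_ln_gfam : rintegrable P1 (fun t => ln (\sum_i c i * expR (X1 i t))).
Proof.
have cg i (B : set R) : measurable B -> <<s [set (setT : set T1)] >> ((fun=> c i) @^-1` B).
  by move=> mB; exact: gen_cst.
have Wm (E : set T1) : [set setT] E -> measurable E by move=> ->.
apply: (rint_logsum Wm cg (fun i _ => c0 i) csum (fun=> introT andP (conj (lexx _) (lexx _)))).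
by move=> i; apply: (gfam_rint mX1 gX1); exact: gfam_diag_ge0 mX1 gX1 i.
Qed.

(** The two families may be dependent, so they are first made independent on a product space.
    Entrywise closeness [e] gives the constant [2 * e] in [CDe], of which the interpolation keeps
    half. *)
Lemma gfam_compare : (forall i j, `|C1 i j - C2 i j| <= e) ->
  \int[P1]_t ln (\sum_i c i * expR (X1 i t)) <= \int[P2]_t ln (\sum_i c i * expR (X2 i t)) + e.
Proof.
move=> Ce; pose PQ : probability (T1 * T2)%type R := (P1 \x P2)%E.
pose Y1 i (z : T1 * T2) := X1 i z.1; pose Y2 i (z : T1 * T2) := X2 i z.2.
pose W := [set setT : set (T1 * T2)].
have WI : setI_closed W by move=> A B -> ->; rewrite /W/= setTI.
have Wm E : W E -> measurable E by move=> ->.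
have mY1 i : measurable_fun setT (Y1 i) by exact: (measurableT_comp (mX1 i) (@measurable_fst _ _ T1 T2)).
have mY2 i : measurable_fun setT (Y2 i) by exact: (measurableT_comp (mX2 i) (@measurable_snd _ _ T1 T2)).
have cg i (B : set R) : measurable B -> <<s W >> ((fun=> c i) @^-1` B).
  by move=> mB; exact: gen_cst.
have HXY E (a b : I -> R) th : W E ->
    \int[PQ]_w (\1_E w * cos (th + \sum_i a i * Y1 i w + \sum_i b i * Y2 i w)) =
    cos th * expR (- (quad C1 a + quad C2 b) / 2) * fine (PQ E).
  move=> ->; have -> : fine (PQ setT) = 1 by rewrite (@probability_setT _ _ _ PQ).
  have mS1 : measurable_fun setT (fun t => \sum_i a i * X1 i t).
    by apply: measurable_sum => i; exact: measurable_funM.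
  have mS2 : measurable_fun setT (fun t => \sum_i b i * X2 i t).
    by apply: measurable_sum => i; exact: measurable_funM.
  transitivity (\int[(P1 \x P2)%E]_z cos (th + \sum_i a i * X1 i z.1 + \sum_i b i * X2 i z.2)).
    by apply: eq_Rintegral => z _; rewrite indicT mul1r.
  rewrite Rint_prod.
  - transitivity (\int[P1]_t (expR (- quad C2 b / 2) * cos (th + \sum_i a i * X1 i t))).
      apply: eq_Rintegral => t _ /=; rewrite mulrC.
      exact: (gX2 (fun i => i) b (th + \sum_i a i * X1 i t)).
    rewrite RintZ; last first.
      apply: (@rint_bounded _ _ _ _ _ 1); last by move=> t; exact: cos_norm_le1.
      by apply: measurable_cos; exact: measurable_funD.
    rewrite (gX1 (fun i => i) a th) mulr1.
    have -> : expR (- (quad C1 a + quad C2 b) / 2) = expR (- quad C2 b / 2) * expR (- quad C1 a / 2).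
      by rewrite -expRD; congr expR; ring.
    by rewrite mulrCA.
  - apply: (@rint_bounded _ _ _ _ _ 1); last by move=> z; exact: cos_norm_le1.
    apply: measurable_cos; apply: measurable_funD.
      apply: measurable_funD => //.
      exact: (measurableT_comp mS1 (@measurable_fst _ _ T1 T2)).
    exact: (measurableT_comp mS2 (@measurable_snd _ _ T1 T2)).
  - move=> t; apply: (@rint_bounded _ _ _ _ _ 1); last by move=> z; exact: cos_norm_le1.
    apply: measurable_cos.
    exact: (measurable_funD (measurable_cst (th + \sum_i a i * X1 i t)) mS2).
have CDe k i j : (C1 k k - C2 k k) - (C1 i j - C2 i j) <= 2 * e.
  have := Ce k k; have := Ce i j; rewrite !ler_norml => /andP[h1 h2] /andP[h3 h4]; lra.
have := gaussian_compare WI erefl Wm mY1 mY2 cg (fun i _ => c0 i) csum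
  (fun=> introT andP (conj (lexx _) (lexx _))) C1s C2s HXY CDe.
have m1 : measurable_fun setT (fun t => ln (\sum_i c i * expR (X1 i t))).
  apply: measurable_log; apply: measurable_sum => i; apply: measurable_funM => //.
  exact: measurable_exp.
have -> : \int[PQ]_z ln (\sum_i c i * expR (Y1 i z)) = \int[P1]_t ln (\sum_i c i * expR (X1 i t)).
  exact: (Rint_fst P2 rint_ln_gfam).2.
have i2 : rintegrable P2 (fun t => ln (\sum_i c i * expR (X2 i t))).
  have cg2 i (B : set R) : measurable B -> <<s [set (setT : set T2)] >> ((fun=> c i) @^-1` B).
    by move=> mB; exact: gen_cst.
  have Wm2 (E : set T2) : [set setT] E -> measurable E by move=> ->.
  apply: (rint_logsum Wm2 cg2 (fun i _ => c0 i) csum (fun=> introT andP (conj (lexx _) (lexx _)))).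
  by move=> i; apply: (gfam_rint mX2 gX2); exact: gfam_diag_ge0 mX2 gX2 i.
have -> : \int[PQ]_z ln (\sum_i c i * expR (Y2 i z)) = \int[P2]_t ln (\sum_i c i * expR (X2 i t)).
  exact: (Rint_snd P1 i2).2.
by have -> : 2 * e / 2 = e by field.
Qed.

End compare_families.

Lemma big_sig (R : realType) (I : finType) (p : pred I) (F : I -> R) :
  \sum_(x : {x | p x}) F (val x) = \sum_(x | p x) F x.
Proof.
rewrite [RHS](reindex_omap val (insub : I -> option {x | p x}))/=; last by move=> i pi; rewrite insubT.
by apply: eq_bigl => x; rewrite valK (valP x) eqxx.
Qed.

Lemma sum_inj_le (R : realType) (I J : finType) (p : pred I) (q : pred J) (f : I -> J) (F : J -> R) :
  injective f -> (forall i, p i -> q (f i)) -> (forall j, 0 <= F j) ->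
  \sum_(i | p i) F (f i) <= \sum_(j | q j) F j.
Proof.
move=> fi pq F0.
have -> : \sum_(i | p i) F (f i) = \sum_(j in f @: [set i | p i]%SET) F j.
  rewrite big_imset/=; last by move=> x y _ _; exact: fi.
  by apply: eq_bigl => i; rewrite inE.
rewrite big_mkcond [leRHS]big_mkcond/=; apply: ler_sum => j _.
case: ifP => [/imsetP[i]|_]; last by case: ifP.
by rewrite inE => /pq qi ->; rewrite qi.
Qed.

(** * The functional G of the constructed structure *)

Section rost_functional.
Context (R : realType) d (T : measurableType d) (P : probability T R)
  (g : seq nat -> {RV P >-> R}) (a : 'I_2 -> nat -> R) (h : 'I_2 -> R) (B : R).
Hypotheses (g_gauss : gaussian_disorder g) (a_sq : forall l, sqsum_bounded (a l)).
Hypotheses (B0 : 0 <= B) (aB : forall l l' n, \sum_(1 <= p < n) p%:R * `|aa a l l' p| <= B).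
Variables (u delta : R) (M : nat) (M0 : (0 < M)%N) (vM : R) (kap : R).
Hypotheses (vMu : `|vM - u| <= delta) (kap0 : 0 < kap) (kap1 : M%:R <= kap).
Variable sM : {ffun 'I_2 -> config M}.
Hypothesis sMv : overlap R sM = vM.
Variables (N : nat) (N0 : (0 < N)%N) (v : R) (sN : {ffun 'I_2 -> config N}).
Hypothesis sNv : overlap R sN = v.
Local Notation pairsN := {ffun 'I_2 -> config N}.
Local Notation pairsM := {ffun 'I_2 -> config M}.

Let rz := @rz R d T P g a M.
Let ry := @ry R d T P g a M.
Let rx := @rx R d T P g a M kap.

Definition xfield (x : pairsM) t := \sum_(l < 2) rx l (x l) t.
Definition rzfield (s : pairsN) (x : pairsM) t :=
  \sum_(l < 2) \sum_(i < N) spin R (s l) i * rz i l (x l) t.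
Definition ryfield (x : pairsM) t := Num.sqrt N%:R * \sum_(l < 2) ry l (x l) t.

Definition xcov (x x' : pairsM) :=
  kap * \sum_(l < 2) \sum_(l' < 2) xi a l l' (M%:R / kap * ov R (x l) (x' l')).
Definition rzcov (p p' : pairsM * pairsN) := N%:R * \sum_(l < 2) \sum_(l' < 2)
  ov R (p.2 l) (p'.2 l') * xi' a l l' (ov R (p.1 l) (p'.1 l')).
Definition rycov (x x' : pairsM) :=
  N%:R * \sum_(l < 2) \sum_(l' < 2) theta a l l' (ov R (x l) (x' l')).

Let mx x : measurable_fun setT (xfield x).
Proof. by apply: measurable_sum => l; exact: measurable_rx. Qed.
Let my x : measurable_fun setT (ryfield x).
Proof. by apply: measurable_funM => //; apply: measurable_sum => l; exact: measurable_ry. Qed.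

Let zpart i (p : pairsM * pairsN) t :=
  if insub i is Some i' then \sum_(l < 2) spin R (p.2 l) (i' : 'I_N) * rz i l (p.1 l) t else 0.
Let zc i (p p' : pairsM * pairsN) : R :=
  if insub i is Some i' then \sum_(l < 2) \sum_(l' < 2)
    spin R (p.2 l) (i' : 'I_N) * spin R (p'.2 l') i' * xi' a l l' (ov R (p.1 l) (p'.1 l')) else 0.

Let mz i p : measurable_fun setT (zpart i p).
Proof.
rewrite /zpart; case: insub => [i'|]; last exact: measurable_cst.
by apply: measurable_sum => l; apply: measurable_funM => //; exact: measurable_rz.
Qed.

Let zfieldE s x t : rzfield s x t = \sum_(i < N) zpart i (x, s) t.
Proof.
by rewrite /rzfield exchange_big/=; apply: eq_bigr => i _; rewrite /zpart valK.
Qed.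

Let zcovE p p' : rzcov p p' = \sum_(i < N) zc i p p'.
Proof.
rewrite /rzcov mulr_sumr.
have -> : \sum_(i < N) zc i p p' = \sum_(i < N) \sum_(l < 2) \sum_(l' < 2)
    spin R (p.2 l) i * spin R (p'.2 l') i * xi' a l l' (ov R (p.1 l) (p'.1 l')).
  by apply: eq_bigr => i _; rewrite /zc valK.
rewrite exchange_big/=; apply: eq_bigr => l _; rewrite mulr_sumr exchange_big/=.
apply: eq_bigr => l' _; rewrite /ov -mulr_suml; field.
by rewrite pnatr_eq0 -lt0n.
Qed.

Let PG k := \bigcup_(s in [set: seq nat]) preimage_set_system setT (g (k :: s) : T -> R) measurable.

Let Fm (k : nat) E : setT k -> prefix_gen g k E -> measurable E.
Proof. by move=> _; apply: sigma_generated_measurable => s; exact: measurable_funP. Qed.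

Let mmix k m0 b (x : config M) : measurable_fun (setT : set (g_sigma_algebraType (PG k)))
  (mixed (fun s => g (k :: s) : T -> R) m0 b x).
Proof.
apply: (@measurable_mixed _ (g_sigma_algebraType (PG k)) R (fun s => g (k :: s) : T -> R) m0 M).
by move=> s; exact: (@sigma_generated_meas _ T R _ (fun s : seq nat => g (k :: s) : T -> R) s).
Qed.

Let xcos (K : finType) (f : K -> pairsM) b th :
  \int[P]_w cos (th + \sum_k b k * xfield (f k) w) =
  cos th * expR (- quad (fun k k' => xcov (f k) (f k')) b / 2).
Proof.
have := @gfam_comb _ _ _ _ _ _ _ K 'I_2 (fun=> fun=> 1) (fun k l => (l, f k l)) b th
  (rx_gfam g_gauss a_sq aB M0 kap0 kap1).
have -> : (fun k k' => \sum_(l < 2) \sum_(l' < 2) 1 * 1 *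
    (kap * xi a l l' (M%:R / kap * ov R (f k l) (f k' l')))) = (fun k k' => xcov (f k) (f k')).
  apply/funext => k; apply/funext => k'; rewrite /xcov mulr_sumr; apply: eq_bigr => l _.
  by rewrite mulr_sumr; apply: eq_bigr => l' _; rewrite !mul1r.
move=> <-; apply: eq_Rintegral => w _; congr (cos (_ + _)); apply: eq_bigr => k _.
by congr (_ * _); apply: eq_bigr => l _; rewrite mul1r.
Qed.

(** The fields use disjoint groups of the disorder, prefix 0 for [x] and prefix i + 2 for the site
    i, so their covariances add. *)
Lemma xz_gfam : gfam P (fun p : pairsM * pairsN => fun t => xfield p.1 t + rzfield p.2 p.1 t)
  (fun p p' => xcov p.1 p'.1 + rzcov p p').
Proof.
move=> K f b th.
pose V (j : nat) k : T -> R := match j with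
  | 0%N => xfield (f k).1 | 1%N => fun=> 0 | i.+2 => zpart i (f k) end.
pose C (j : nat) (k k' : K) : R := match j with
  | 0%N => xcov (f k).1 (f k').1 | 1%N => 0 | i.+2 => zc i (f k) (f k') end.
pose s : seq nat := 0%N :: [seq i.+2 | i <- index_iota 0 N].
have mV j k : measurable_fun setT (V j k).
  by case: j => [|[|i]]; [exact: mx|exact: measurable_cst|exact: mz].
have us : uniq (s ++ [::]).
  rewrite cats0 /= map_inj_uniq ?iota_uniq ?andbT; last by move=> i j [].
  by apply/negP => /mapP[].
have sF j (b' : K -> R) E : j \in s -> measurable E ->
    prefix_gen g j ((fun w => \sum_k b' k * V j k w) @^-1` E).
  rewrite inE => /orP[/eqP -> mE|/mapP[i _ ->] mE].
    apply: sigma_generated_fun => //; apply: measurable_sum => k.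
    by apply: measurable_funM => //; apply: measurable_sum => l; exact: mmix.
  apply: sigma_generated_fun => //; apply: measurable_sum => k.
  apply: measurable_funM => //; rewrite /V /zpart; case: insub => [i'|]; last exact: measurable_cst.
  by apply: measurable_sum => l; apply: measurable_funM => //; exact: mmix.
have sV j (b' : K -> R) th' : j \in s ->
    \int[P]_w cos (th' + \sum_k b' k * V j k w) = cos th' * expR (- quad (C j) b' / 2).
  rewrite inE => /orP[/eqP ->|/mapP[i _ ->]]; first exact: xcos.
  rewrite /V /C /zpart /zc; case: insub => [i'|].
    exact: (@gfam_comb _ _ _ _ _ _ _ K 'I_2 (fun k l => spin R ((f k).2 l) i')
      (fun k l => (l, (f k).1 l)) b' th' (rz_gfam g_gauss aB M0 i)).
  transitivity (\int[P]_w cos th').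
    by apply: eq_Rintegral => w _; rewrite big1 ?addr0// => k _; rewrite mulr0.
  rewrite Rint_cst /quad big1 ?oppr0 ?mul0r ?expR0 ?mulr1// => k _.
  by rewrite big1// => l _; rewrite mulr0.
have hT (j : nat) : j \in ([::] : seq nat) -> prefix_gen g j setT by [].
have := @indep_gfam _ _ R P _ setT (prefix_gen g) Fm (prefix_indep g_gauss) K V C mV s [::]
  (fun=> setT) (fun=> b) th us (fun _ _ => I) sF sV hT.
rewrite /s big_cons big_map big_nil mulr1 big_mkord.
have -> : quad (C 0%N) b + \sum_(i < N) quad (C i.+2) b =
   quad (fun k l => xcov (f k).1 (f l).1 + rzcov (f k) (f l)) b.
  rewrite quadD; congr (_ + _); rewrite /quad exchange_big/=; apply: eq_bigr => k _.
  by rewrite exchange_big/=; apply: eq_bigr => l _; rewrite zcovE mulr_sumr.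
move=> <-; apply: eq_Rintegral => t _; rewrite big_nil mul1r big_cons big_map big_mkord.
congr (cos (_ + _)); rewrite exchange_big/= -big_split/=; apply: eq_bigr => k _.
rewrite -mulr_sumr -mulrDr zfieldE; congr (_ * (_ + _)).
Qed.

Lemma xy_gfam : gfam P (fun x : pairsM => fun t => xfield x t + ryfield x t)
  (fun x x' => xcov x x' + rycov x x').
Proof.
move=> K f b th.
pose V (j : nat) k : T -> R := if j is 0%N then xfield (f k) else ryfield (f k).
pose C (j : nat) (k k' : K) : R := if j is 0%N then xcov (f k) (f k') else rycov (f k) (f k').
have mV j k : measurable_fun setT (V j k) by case: j => [|i]; [exact: mx|exact: my].
have sF j (b' : K -> R) E : j \in [:: 0%N; 1%N] -> measurable E ->
    prefix_gen g j ((fun w => \sum_k b' k * V j k w) @^-1` E).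
  rewrite !inE => /orP[/eqP -> mE|/eqP -> mE].
    apply: sigma_generated_fun => //; apply: measurable_sum => k.
    by apply: measurable_funM => //; apply: measurable_sum => l; exact: mmix.
  apply: sigma_generated_fun => //; apply: measurable_sum => k.
  apply: measurable_funM => //; apply: measurable_funM => //.
  by apply: measurable_sum => l; exact: mmix.
have sV j (b' : K -> R) th' : j \in [:: 0%N; 1%N] ->
    \int[P]_w cos (th' + \sum_k b' k * V j k w) = cos th' * expR (- quad (C j) b' / 2).
  rewrite !inE => /orP[/eqP ->|/eqP ->]; first exact: xcos.
  have hc := @gfam_comb _ _ _ _ _ _ _ K 'I_2 (fun=> fun=> Num.sqrt N%:R)
    (fun k l => (l, f k l)) b' th' (ry_gfam g_gauss aB M0).
  transitivity (\int[P]_w cos (th' + \sum_k b' k * \sum_(l < 2) Num.sqrt N%:R * ry l (f k l) w)).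
    by apply: eq_Rintegral => w _; under eq_bigr do rewrite /V /ryfield mulr_sumr.
  rewrite hc; suff -> : (fun k k' => \sum_(l < 2) \sum_(l' < 2) Num.sqrt N%:R * Num.sqrt N%:R *
      theta a l l' (ov R (f k l) (f k' l'))) = C 1%N by [].
  apply/funext => k; apply/funext => k'; rewrite /C /rycov mulr_sumr; apply: eq_bigr => l _.
  by rewrite mulr_sumr; apply: eq_bigr => l' _; rewrite -expr2 sqr_sqrtr.
have hT (j : nat) : j \in ([::] : seq nat) -> prefix_gen g j setT by [].
have := @indep_gfam _ _ R P _ setT (prefix_gen g) Fm (prefix_indep g_gauss) K V C mV [:: 0%N; 1%N] [::]
  (fun=> setT) (fun=> b) th erefl (fun _ _ => I) sF sV hT.
rewrite !big_cons !big_nil !addr0 mulr1 => hc.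
rewrite (quadD (fun k k' => xcov (f k) (f k'))) -hc.
apply: eq_Rintegral => t _; rewrite !big_nil mul1r !big_cons big_nil addr0.
congr (cos (_ + _)); rewrite -big_split/=; apply: eq_bigr => k _; by rewrite mulrDr.
Qed.

Lemma xcovC x x' : xcov x x' = xcov x' x.
Proof.
rewrite /xcov exchange_big/=; congr (_ * _); apply: eq_bigr => l _; apply: eq_bigr => l' _.
by rewrite xiC ov_sym.
Qed.

Lemma rzcovC p p' : rzcov p p' = rzcov p' p.
Proof.
rewrite /rzcov exchange_big/=; congr (_ * _); apply: eq_bigr => l _; apply: eq_bigr => l' _.
by rewrite xi'C ov_sym; congr (_ * xi' _ _ _ _); exact: ov_sym.
Qed.

Lemma rycovC x x' : rycov x x' = rycov x' x.
Proof.
rewrite /rycov exchange_big/=; congr (_ * _); apply: eq_bigr => l _; apply: eq_bigr => l' _.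
by rewrite thetaC ov_sym.
Qed.

Lemma measurable_rzfield s x : measurable_fun setT (rzfield s x).
Proof.
apply: measurable_sum => l; apply: measurable_sum => i; apply: measurable_funM => //.
exact: measurable_rz.
Qed.

Local Notation rA := (rA M vM).
Local Notation rZ := (@rZ R d T P g a h M vM kap).
Let Om := @rost R d T P g a h B g_gauss aB u delta M M0 vM kap vMu sM sMv.

Let x0 : rA := exist _ sM (introT eqP sMv).

Let field_sum (x : rA) t : rnum g a h kap (val x) t = expR (pair_field h (val x)) * expR (xfield (val x) t).
Proof. by rewrite /rnum expRD mulrC. Qed.

Let c0 (x : rA) : 0 <= expR (pair_field h (val x)). Proof. exact: expR_ge0. Qed.
Let csum : 0 < \sum_(x : rA) expR (pair_field h (val x)).
Proof. by rewrite (bigD1 x0)//= ltr_pwDl ?expR_gt0//; apply: sumr_ge0 => x _; exact: c0. Qed.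

Let xgfam : gfam P (fun x : rA => xfield (val x)) (fun x x' => xcov (val x) (val x')).
Proof. by move=> K f c th; exact: (xcos (fun k => val (f k))). Qed.

Let iZ : rintegrable P (fun t => ln (rZ t)).
Proof.
have := rint_ln_gfam (fun x : rA => mx (val x)) xgfam c0 csum.
by congr (rintegrable _ _); apply/funext => t; congr ln; apply: eq_bigr => x _; rewrite field_sum.
Qed.

Let half (Bx : rA -> T -> R) : (forall x t, 0 < Bx x t) ->
  rintegrable P (fun t => ln (\sum_(x : rA) rnum g a h kap (val x) t * Bx x t)) ->
  (\int[P]_t lne (\esum_(x in [set: rA]) (rw g a h kap x t * Bx x t)%:E) =
  (\int[P]_t ln (\sum_(x : rA) rnum g a h kap (val x) t * Bx x t)%R - \int[P]_t ln (rZ t))%:E)%E.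
Proof.
move=> B1 iS; rewrite -RintB// EFin_Rint; last exact: rintB.
apply: eq_integral => t _.
have n0 (x : rA) : 0 < rnum g a h kap (val x) t by exact: rnum_gt0.
have Z0 : 0 < rZ t by exact: (rZ_gt0 g a h kap x0).
have S0 : 0 < \sum_(x : rA) rnum g a h kap (val x) t * Bx x t.
  rewrite (bigD1 x0)//=; apply: ltr_pwDl; first exact: (mulr_gt0 (n0 x0) (B1 x0 t)).
  by apply: sumr_ge0 => x _; exact: (mulr_ge0 (ltW (n0 x)) (ltW (B1 x t))).
rewrite esum_finType; last by move=> x; rewrite lee_fin !mulr_ge0 ?invr_ge0 ?(ltW (n0 x)) ?(ltW (B1 x t)) ?(ltW Z0).
rewrite sumEFin.
have -> : \sum_(x : rA) rw g a h kap x t * Bx x t = (\sum_(x : rA) rnum g a h kap (val x) t * Bx x t) / rZ t.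
  by rewrite mulr_suml; apply: eq_bigr => x _; rewrite /rw mulrAC.
by rewrite lne_EFin ?divr_gt0// ln_div.
Qed.

Let fb := fallback v sN.
Let S1 t := \sum_(p : rA * pairsN) expR (pair_field h (val p.1)) * cweight h v p.2 *
  expR (xfield (val p.1) t + rzfield (fb p.2) (val p.1) t).
Let S2 t := \sum_(x : rA) expR (pair_field h (val x)) * expR (xfield (val x) t + ryfield (val x) t).

Let d0 (p : rA * pairsN) : 0 <= expR (pair_field h (val p.1)) * cweight h v p.2.
Proof. by rewrite mulr_ge0 ?expR_ge0 ?cweight_ge0. Qed.

Let dsum : 0 < \sum_(p : rA * pairsN) expR (pair_field h (val p.1)) * cweight h v p.2.
Proof.
rewrite -(pair_bigA _ (fun (x : rA) s => expR (pair_field h (val x)) * cweight h v s))/=.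
under eq_bigr do rewrite -mulr_sumr.
rewrite -mulr_suml mulr_gt0//; exact: (cweight_sum_gt0 h sNv).
Qed.

Let g1 := gfam_sub (fun p : rA * pairsN => (val p.1, fb p.2)) xz_gfam.
Let g2 := gfam_sub (fun x : rA => val x) xy_gfam.

Let m1 (p : rA * pairsN) : measurable_fun setT (fun t => xfield (val p.1) t + rzfield (fb p.2) (val p.1) t).
Proof. by apply: measurable_funD; [exact: mx|exact: measurable_rzfield]. Qed.
Let m2 (x : rA) : measurable_fun setT (fun t => xfield (val x) t + ryfield (val x) t).
Proof. by apply: measurable_funD; [exact: mx|exact: my]. Qed.

Let iS1 : rintegrable P (fun t => ln (S1 t)).
Proof. exact: (rint_ln_gfam m1 g1 d0 dsum). Qed.
Let iS2 : rintegrable P (fun t => ln (S2 t)).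
Proof. exact: (rint_ln_gfam m2 g2 c0 csum). Qed.

(** Each half of [G] is the mean logarithm of an unnormalized sum minus that of [rZ], and the
    normalization cancels. What remains is a difference of free energies for the fields x + z and x
    + sqrt N y. *)
Lemma G_rost : G h N v Om = (N%:R^-1 * (\int[P]_t ln (S1 t) - \int[P]_t ln (S2 t)))%:E.
Proof.
pose Bz (x : rA) t := \sum_(s : pairsN | overlap R s == v) expR (\sum_(l < 2) \sum_(i < N)
  spin R (s l) i * (rz i l (val x l) t + h l)).
pose By (x : rA) t := expR (Num.sqrt N%:R * \sum_(l < 2) ry l (val x l) t).
have BzE x t : Bz x t = \sum_(s : pairsN | overlap R s == v) expR (rzfield s (val x) t + pair_field h s).
  apply: eq_bigr => s _; congr expR; rewrite /rzfield /pair_field -big_split/=.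
  apply: eq_bigr => l _; rewrite mulr_sumr -big_split/=; apply: eq_bigr => i _.
  by rewrite mulrDr (mulrC (h l)).
have Bz0 x t : 0 < Bz x t.
  rewrite BzE (bigD1 sN) ?sNv//= ltr_pwDl ?expR_gt0//.
  by apply: sumr_ge0 => s _; exact: expR_ge0.
have E1 t : \sum_(x : rA) rnum g a h kap (val x) t * Bz x t = S1 t.
  rewrite /S1 -(pair_bigA _ (fun (x : rA) s => expR (pair_field h (val x)) * cweight h v s *
    expR (xfield (val x) t + rzfield (fb s) (val x) t)))/=.
  apply: eq_bigr => x _; rewrite BzE -(cweight_sumE h v sN (fun s => rzfield s (val x) t)).
  rewrite field_sum mulr_sumr; apply: eq_bigr => s _; rewrite expRD; ring.
have E2 t : \sum_(x : rA) rnum g a h kap (val x) t * By x t = S2 t.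
  by apply: eq_bigr => x _; rewrite field_sum /By -mulrA -expRD.
have h1 := half Bz0; have h2 := half (Bx := By) (fun x t => expR_gt0 _).
have f1 : (fun t => ln (\sum_(x : rA) rnum g a h kap (val x) t * Bz x t)) = (fun t => ln (S1 t)).
  by apply/funext => t; rewrite E1.
have f2 : (fun t => ln (\sum_(x : rA) rnum g a h kap (val x) t * By x t)) = (fun t => ln (S2 t)).
  by apply/funext => t; rewrite E2.
rewrite f1 in h1; rewrite f2 in h2; have {}h1 := h1 iS1; have {}h2 := h2 iS2.
rewrite /G; transitivity ((N%:R^-1)%:E * (\int[P]_t ln (S1 t) - \int[P]_t ln (rZ t))%:E -
   (N%:R^-1)%:E * (\int[P]_t ln (S2 t) - \int[P]_t ln (rZ t))%:E)%E.
  by rewrite -h1 -h2.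
by rewrite -!EFinM -EFinB; congr EFin; ring.
Qed.

End rost_functional.

(** * Joining configurations of sizes M and N *)

Section joining.
Context (R : realType) (M N : nat).
Hypotheses (M0 : (0 < M)%N) (N0 : (0 < N)%N).

Definition cjoin (x : config M) (s : config N) : config (M + N) :=
  [ffun i : 'I_(M + N) => match fintype.split i with inl j => x j | inr j => s j end].

Definition pjoin (x : {ffun 'I_2 -> config M}) (s : {ffun 'I_2 -> config N}) :
  {ffun 'I_2 -> config (M + N)} := [ffun l => cjoin (x l) (s l)].

Lemma cjoin_l x s j : cjoin x s (lshift N j) = x j.
Proof. by rewrite ffunE (unsplitK (inl j)). Qed.

Lemma cjoin_r x s j : cjoin x s (rshift M j) = s j.
Proof. by rewrite ffunE (unsplitK (inr j)). Qed.

Lemma pjoin_inj x s x' s' : pjoin x s = pjoin x' s' -> x = x' /\ s = s'.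
Proof.
move=> e; have el l : cjoin (x l) (s l) = cjoin (x' l) (s' l).
  by have := congr1 (fun f : {ffun 'I_2 -> config (M + N)} => f l) e; rewrite /pjoin !ffunE.
split; apply/ffunP => l; apply/ffunP => j.
  by rewrite -(cjoin_l (x l) (s l)) el cjoin_l.
by rewrite -(cjoin_r (x l) (s l)) el cjoin_r.
Qed.

Lemma sum_cjoin (F : 'I_(M + N) -> R) :
  \sum_i F i = \sum_(j < M) F (lshift N j) + \sum_(j < N) F (rshift M j).
Proof. exact: big_split_ord. Qed.

Lemma ov_cjoin x s x' s' : ov R (cjoin x s) (cjoin x' s') =
  (M%:R * ov R x x' + N%:R * ov R s s') / (M + N)%:R.
Proof.
have nz n : (0 < n)%N -> n%:R != 0 :> R by move=> n0; rewrite pnatr_eq0 -lt0n.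
rewrite /ov sum_cjoin !mulVKf ?nz// mulrC; congr (_ / _); congr (_ + _);
by apply: eq_bigr => j _; rewrite /spin ?cjoin_l ?cjoin_r.
Qed.

Lemma overlap_pjoin x s : overlap R (pjoin x s) =
  (M%:R * overlap R x + N%:R * overlap R s) / (M + N)%:R.
Proof. by rewrite -[LHS]/(ov R _ _) !ffunE ov_cjoin. Qed.

Lemma pair_field_pjoin h x s : pair_field h (pjoin x s) = pair_field h x + pair_field h s :> R.
Proof.
rewrite /pair_field -big_split/=; apply: eq_bigr => l _; rewrite -mulrDr sum_cjoin !ffunE.
by congr (_ * (_ + _)); apply: eq_bigr => j _; rewrite /spin ?cjoin_l ?cjoin_r.
Qed.

End joining.

(** * Covariances at sizes M and M + N *)

Section covariance_estimates.
Context (R : realType) (a : 'I_2 -> nat -> R) (eta dl m n K : R).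
Hypotheses (eta0 : 0 < eta) (m0 : 0 <= m) (n0 : 0 <= n) (K0 : 0 < K) (KE : K = m + n)
  (taylor : forall l l' x y, `|x| <= 1 -> `|y| <= 1 -> `|y - x| <= dl ->
  `|xi a l l' y - xi a l l' x - (y - x) * xi' a l l' x| <= eta * `|y - x|)
  (small : n / K <= dl).

Let Kn0 : K != 0. Proof. by rewrite gt_eqF. Qed.

Let step (r : R) : `|r| <= 1 -> `|n * r / K| <= n / K.
Proof.
move=> r1; rewrite normrM normrM (ger0_norm n0) (gtr0_norm (_ : 0 < K^-1)) ?invr_gt0//.
apply: ler_wpM2r; first by rewrite invr_ge0 ltW.
by rewrite ler_piMr.
Qed.

Let ratio (r : R) : `|r| <= 1 -> `|m / K * r| <= 1.
Proof.
move=> r1; rewrite normrM mulr_ile1// ger0_norm; first by rewrite ler_pdivrMr// mul1r KE lerDl.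
by rewrite divr_ge0// ltW.
Qed.

(** The sum of the Taylor estimates at [x] and at [y] bounds the variation of [xi']. *)
Let dxi l l' x y : `|x| <= 1 -> `|y| <= 1 -> `|y - x| <= dl -> `|xi' a l l' x - xi' a l l' y| <= 2 * eta.
Proof.
move=> x1 y1 xy; have [->|nxy] := eqVneq x y; first by rewrite subrr normr0 mulr_ge0// ltW.
have p : 0 < `|y - x| by rewrite normr_gt0 subr_eq0 eq_sym.
have t1 := taylor l l' x1 y1 xy; have := taylor l l' y1 x1; rewrite distrC => /(_ xy) t2.
rewrite -(ler_pM2r p) -normrM.
have -> : (xi' a l l' x - xi' a l l' y) * (y - x) =
  - (xi a l l' y - xi a l l' x - (y - x) * xi' a l l' x) +
  - (xi a l l' x - xi a l l' y - (x - y) * xi' a l l' y) by ring.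
apply: (le_trans (ler_normD _ _)); rewrite !normrN; lra.
Qed.

Let scaled (z w : R) : `|z| <= eta * w -> w <= n / K -> `|K * z| <= eta * n.
Proof.
move=> hz hw; rewrite normrM (gtr0_norm K0).
apply: (@le_trans _ _ (K * (eta * (n / K)))).
  by rewrite ler_pM2l//; apply: (le_trans hz); rewrite ler_pM2l.
by rewrite le_eqVlt; apply/orP; left; apply/eqP; field.
Qed.

(** Expand at x = m q / K, the joined overlap being x + n r / K. The Taylor error costs eta n, and
    replacing xi'(x) by xi'(q) costs 2 eta n, as |q - x| <= n / K. *)
Lemma cov_join_close l l' (q r : R) : `|q| <= 1 -> `|r| <= 1 -> `|(m * q + n * r) / K| <= 1 ->
  `|(K * xi a l l' (m / K * q) + n * (r * xi' a l l' q)) -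
    K * xi a l l' ((m * q + n * r) / K)| <= 3 * eta * n.
Proof.
move=> q1 r1; have x1 := ratio q1; set x := m / K * q in x1 *; set y := (_ + _) / K => y1.
have yx : y - x = n * r / K by rewrite /y /x; field.
have hyx : `|y - x| <= n / K by rewrite yx; exact: step.
have xq : q - x = n * q / K.
  by rewrite /x (_ : n = K - m); [field|rewrite KE addrC addKr].
have hxq : `|q - x| <= n / K by rewrite xq; exact: step.
have t := taylor l l' x1 y1 (le_trans hyx small).
have dx := dxi l l' x1 q1 (le_trans hxq small).
have -> : K * xi a l l' x + n * (r * xi' a l l' q) - K * xi a l l' y =
  - (K * (xi a l l' y - xi a l l' x - (y - x) * xi' a l l' x)) +
  - (n * r * (xi' a l l' x - xi' a l l' q)).
  by rewrite yx; field.
apply: (le_trans (ler_normD _ _)); rewrite !normrN.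
have b1 := scaled t hyx.
have b2 : `|n * r * (xi' a l l' x - xi' a l l' q)| <= 2 * eta * n.
  rewrite !normrM (ger0_norm n0) -mulrA [leRHS]mulrC ler_wpM2l//.
  rewrite -[leRHS]mul1r; exact: ler_pM.
lra.
Qed.

(** Expand at q: K xi(m q / K) is close to K xi(q) - n q xi'(q), and this is m xi(q) - n
    theta(q). *)
Lemma cov_scale_close l l' (q : R) : `|q| <= 1 ->
  `|m * xi a l l' q - (K * xi a l l' (m / K * q) + n * theta a l l' q)| <= eta * n.
Proof.
move=> q1; have x1 := ratio q1; set x := m / K * q in x1 *.
have xq : x - q = - (n * q / K).
  by rewrite /x (_ : n = K - m); [field|rewrite KE addrC addKr].
have hxq : `|x - q| <= n / K by rewrite xq normrN; exact: step.
have t := taylor l l' q1 x1 (le_trans hxq small).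
have -> : m * xi a l l' q - (K * xi a l l' x + n * theta a l l' q) =
    - (K * (xi a l l' x - xi a l l' q - (x - q) * xi' a l l' q)).
  by rewrite /theta xq {2}KE (_ : m = K - n); [field|rewrite KE addrK].
by rewrite normrN; exact: scaled t hxq.
Qed.

End covariance_estimates.

(** * The cavity bound *)

Section cavity.
Context (R : realType) d (T : measurableType d) (P : probability T R)
  (g : seq nat -> {RV P >-> R}) (a : 'I_2 -> nat -> R) (h : 'I_2 -> R) (B : R).
Hypotheses (g_gauss : gaussian_disorder g) (a_sq : forall l, sqsum_bounded (a l)).
Hypotheses (aB : forall l l' n, \sum_(1 <= p < n) p%:R * `|aa a l l' p| <= B).
Variables (u delta : R) (M : nat) (M0 : (0 < M)%N) (vM : R).
Hypotheses (vMu : `|vM - u| <= delta).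
Variable sM : {ffun 'I_2 -> config M}.
Hypothesis sMv : overlap R sM = vM.
Variables (N : nat) (N0 : (0 < N)%N) (v : R) (sN : {ffun 'I_2 -> config N}).
Hypothesis sNv : overlap R sN = v.
Variables (eta dl : R).
Hypotheses (eta0 : 0 < eta)
  (taylor : forall l l' x y, `|x| <= 1 -> `|y| <= 1 -> `|y - x| <= dl ->
  `|xi a l l' y - xi a l l' x - (y - x) * xi' a l l' x| <= eta * `|y - x|)
  (small : N%:R / (M + N)%:R <= dl).
Local Notation pairsN := {ffun 'I_2 -> config N}.
Local Notation pairsM := {ffun 'I_2 -> config M}.
Local Notation K := ((M + N)%:R : R).

Let K0 : 0 < K. Proof. by rewrite ltr0n addn_gt0 M0. Qed.
Let K1 : M%:R <= K. Proof. by rewrite ler_nat leq_addr. Qed.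
Let KE : K = M%:R + N%:R. Proof. by rewrite natrD. Qed.
Let KN0 : (0 < M + N)%N. Proof. by rewrite addn_gt0 M0. Qed.
Let w : R := (M%:R * vM + N%:R * v) / K.

Let sum4 (F : 'I_2 -> 'I_2 -> R) (b : R) : (forall l l', `|F l l'| <= b) ->
  `|\sum_(l < 2) \sum_(l' < 2) F l l'| <= 4 * b.
Proof.
move=> hF; rewrite !sum_ord2; apply: (le_trans (ler_normD _ _)).
have h1 := ler_normD (F ord0 ord0) (F ord0 ord_max).
have h2 := ler_normD (F ord_max ord0) (F ord_max ord_max).
have := hF ord0 ord0; have := hF ord0 ord_max; have := hF ord_max ord0; have := hF ord_max ord_max.
lra.
Qed.

Let cov1 (p p' : pairsM * pairsN) : `|xcov a K p.1 p'.1 + rzcov a p p' -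
  energy_cov a (pjoin p.1 p.2) (pjoin p'.1 p'.2)| <= 4 * (3 * eta * N%:R).
Proof.
rewrite /xcov /rzcov /energy_cov !mulr_sumr -big_split/= -sumrB.
under eq_bigr do rewrite !mulr_sumr -big_split/= -sumrB.
apply: sum4 => l l'; rewrite !ffunE ov_cjoin//.
apply: (cov_join_close eta0 (ler0n R M) (ler0n R N) K0 KE taylor small); try exact: ov_le1.
by rewrite -ov_cjoin//; exact: ov_le1.
Qed.

Let cov2 (x x' : pairsM) : `|energy_cov a x x' - (xcov a K x x' + rycov a N x x')| <= 4 * (eta * N%:R).
Proof.
rewrite /xcov /rycov /energy_cov !mulr_sumr -big_split/= -sumrB.
under eq_bigr do rewrite !mulr_sumr -big_split/= -sumrB.
apply: sum4 => l l'.
apply: (cov_scale_close eta0 (ler0n R M) (ler0n R N) K0 KE taylor small); exact: ov_le1.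
Qed.

Let fb := fallback v sN.

(** The field x + sqrt N y imitates the Hamiltonian of size M. The factor 4 counts the pairs (l,
    l'). *)
Let psi_lower : psi g a h M vM <= \int[P]_t ln (\sum_(x : rA M vM) expR (pair_field h (val x)) *
  expR (xfield g a K (val x) t + ryfield g a N (val x) t)) + 4 * (eta * N%:R).
Proof.
have -> : psi g a h M vM = \int[P]_t ln (\sum_(x : rA M vM) expR (pair_field h (val x)) *
    expR (pair_energy g a (val x) t)).
  apply: eq_Rintegral => t _; rewrite partition_functionE.
  rewrite -(big_sig (fun x : pairsM => overlap R x == vM) (fun x => expR (pair_energy g a x t + pair_field h x))).
  by congr ln; apply: eq_bigr => x _; rewrite expRD mulrC.
have ge := gfam_sub (fun x : rA M vM => val x) (energy_gfam g_gauss a_sq M0).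
have gy := gfam_sub (fun x : rA M vM => val x) (xy_gfam g_gauss a_sq aB M0 K0 K1 N).
apply: (gfam_compare _ _ ge gy).
- by move=> x; exact: measurable_pair_energy.
- move=> x; apply: measurable_funD.
    by apply: measurable_sum => l; exact: measurable_rx.
  by apply: measurable_funM => //; apply: measurable_sum => l; exact: measurable_ry.
- by move=> x x'; exact: energy_covC.
- by move=> x x'; rewrite xcovC rycovC.
- by move=> x; exact: expR_ge0.
- rewrite (bigD1 (exist _ sM (introT eqP sMv) : rA M vM))//= ltr_pwDl ?expR_gt0//.
  by apply: sumr_ge0 => x _; exact: expR_ge0.
- by move=> x x'; exact: cov2.
Qed.

(** The field x + z imitates the Hamiltonian of size M + N at joined configurations. These are only
    some of the configurations with overlap [w]; the omitted terms are positive, which gives the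
    direction of the inequality. *)
Let psi_upper : \int[P]_t ln (\sum_(p : rA M vM * pairsN) expR (pair_field h (val p.1)) * cweight h v p.2 *
  expR (xfield g a K (val p.1) t + rzfield g a (fb p.2) (val p.1) t)) <=
  psi g a h (M + N) w + 4 * (3 * eta * N%:R).
Proof.
have x0 : rA M vM := exist _ sM (introT eqP sMv).
pose J (p : rA M vM * pairsN) := pjoin (val p.1) (fb p.2).
have gz := gfam_sub (fun p : rA M vM * pairsN => (val p.1, fb p.2)) (xz_gfam g_gauss a_sq aB M0 K0 K1 N0).
have ge := gfam_sub J (energy_gfam g_gauss a_sq KN0).
have c0 (p : rA M vM * pairsN) : 0 <= expR (pair_field h (val p.1)) * cweight h v p.2.
  by rewrite mulr_ge0 ?expR_ge0 ?cweight_ge0.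
have cs : 0 < \sum_(p : rA M vM * pairsN) expR (pair_field h (val p.1)) * cweight h v p.2.
  rewrite -(pair_bigA _ (fun (x : rA M vM) s => expR (pair_field h (val x)) * cweight h v s))/=.
  under eq_bigr do rewrite -mulr_sumr.
  rewrite -mulr_suml mulr_gt0//; last exact: (cweight_sum_gt0 h sNv).
  by rewrite (bigD1 x0)//= ltr_pwDl ?expR_gt0//; apply: sumr_ge0 => x _; exact: expR_ge0.
have mJ p : measurable_fun setT (pair_energy g a (J p)) by exact: measurable_pair_energy.
have mz (p : rA M vM * pairsN) : measurable_fun setT
    (fun t => xfield g a K (val p.1) t + rzfield g a (fb p.2) (val p.1) t).
  apply: measurable_funD; last exact: measurable_rzfield.
  by apply: measurable_sum => l; exact: measurable_rx.
have cC p p' : energy_cov a (J p) (J p') = energy_cov a (J p') (J p) by exact: energy_covC.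
apply: (@le_trans _ _ (\int[P]_t ln (\sum_(p : rA M vM * pairsN) expR (pair_field h (val p.1)) *
    cweight h v p.2 * expR (pair_energy g a (J p) t)) + 4 * (3 * eta * N%:R))).
  apply: (gfam_compare mz mJ gz ge _ cC c0 cs).
  - by move=> p p'; rewrite xcovC rzcovC.
  - by move=> p p'; exact: (cov1 (val p.1, fb p.2) (val p'.1, fb p'.2)).
rewrite lerD2r; apply: Rint_le.
- exact: (rint_ln_gfam mJ ge c0 cs).
- apply: (rint_ln_partition h g_gauss a_sq KN0 (s0 := pjoin sM sN)).
  by rewrite overlap_pjoin// sMv sNv.
move=> t.
have S0 : 0 < \sum_(p : rA M vM * pairsN) expR (pair_field h (val p.1)) *
    cweight h v p.2 * expR (pair_energy g a (J p) t).
  apply: (softmax_sum_gt0 (a := fun p : rA M vM * pairsN => expR (pair_field h (val p.1)) * cweight h v p.2)) => //.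
rewrite ler_ln ?posrE//; last first.
  apply: (partition_gt0 g a h (s0 := pjoin sM sN)).
  by rewrite overlap_pjoin// sMv sNv.
rewrite partition_functionE.
have -> : \sum_(p : rA M vM * pairsN) expR (pair_field h (val p.1)) *
    cweight h v p.2 * expR (pair_energy g a (J p) t) =
    \sum_(p : rA M vM * pairsN | overlap R p.2 == v)
      expR (pair_energy g a (pjoin (val p.1) p.2) t + pair_field h (pjoin (val p.1) p.2)).
  rewrite [RHS]big_mkcond/=; apply: eq_bigr => p _; rewrite /cweight /J /fb /fallback.
  case: ifP => _; last by rewrite mulr0 mul0r.
  by rewrite pair_field_pjoin -!expRD; congr expR; ring.
apply: (sum_inj_le (f := fun p : rA M vM * pairsN => pjoin (val p.1) p.2)
  (F := fun s => expR (pair_energy g a s t + pair_field h s))).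
- move=> [x s] [x' s'] /= /pjoin_inj[e ->]; congr pair; exact: val_inj.
- move=> [x s] /= /eqP sv; rewrite overlap_pjoin// sv (eqP (valP x)); exact: eqxx.
- by move=> s; exact: expR_ge0.
Qed.

(** The constant 16 is 4 * 3 from [psi_upper] plus 4 from [psi_lower]. *)
Theorem cavity_bound :
  (inf_G a h N v u delta <=
    (N%:R^-1 * (psi g a h (M + N) w - psi g a h M vM) + 16 * eta)%:E)%E.
Proof.
have hG := G_rost h g_gauss a_sq aB M0 vMu K0 K1 sMv N0 sNv.
apply: (@le_trans _ _ (G h N v (rost h g_gauss aB M0 K vMu sMv))).
  by apply: ereal_inf_lbound; exists (rost h g_gauss aB M0 K vMu sMv).
rewrite hG lee_fin.
have Nr : 0 < N%:R :> R by rewrite ltr0n.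
have e (z : R) : N%:R * (N%:R^-1 * z) = z by rewrite mulrA divff ?gt_eqF// mul1r.
rewrite -(ler_pM2l Nr) [leRHS]mulrDr !e.
have := psi_lower; have := psi_upper; rewrite /fb; lra.
Qed.

End cavity.

(** * Choice of the overlap sequence *)

Section overlap_values.
Context (R : realType).

(* The overlap of two configurations of size M that agree at exactly j sites. *)
Definition vval (M j : nat) : R := (2 * j%:R - M%:R) / M%:R.

Definition vconf (M j : nat) : {ffun 'I_2 -> config M} :=
  [ffun l => [ffun i : 'I_M => (l == ord_max) && (j <= i)%N]].

Lemma vconf_overlap M j : (j <= M)%N -> overlap R (vconf M j) = vval M j.
Proof.
move=> jM; rewrite /overlap /vval mulrC; congr (_ / _).
rewrite (eq_bigr (fun i : 'I_M => if (i < j)%N then 1 else -1)); last first.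
  by move=> i _; rewrite /spin !ffunE/= expr0 mul1r ltnNge; case: (j <= i)%N.
rewrite -(big_mkord xpredT (fun i => if (i < j)%N then 1 else -1)).
rewrite (big_cat_nat (n := j))//= [X in X + _]big_nat [X in _ + X]big_nat.
rewrite (eq_bigr (fun=> 1)); last by move=> i /andP[_ ->].
rewrite [X in _ + X](eq_bigr (fun=> -1)); last by move=> i /andP[ji _]; rewrite ltnNge ji.
rewrite -!big_nat !big_const_nat !iter_addr addr0 addr0 subn0 -[_ *+ j]/(j%:R) mulNrn natrB//.
ring.
Qed.

Lemma vval_admissible (J : nat -> nat) : (forall M, (J M <= M)%N) -> admissible (fun M => vval M (J M)).
Proof.
move=> JM M M0; split; last by exists (vconf M (J M)); exact: vconf_overlap.
exists (2 * (J M)%:Z - M%:Z); first by have := JM M; lia.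
by rewrite /vval rmorphB rmorphM /=.
Qed.

Lemma admissible_witness (v : nat -> R) M : admissible v -> (0 < M)%N ->
  exists s : {ffun 'I_2 -> config M}, overlap R s = v M.
Proof. by move=> va M0; have [_] := va M M0. Qed.

End overlap_values.

(** If every increment from [n] on exceeded c + e, then s t would stay above a line of slope c + e
    and s t / t could not tend to c. *)
Lemma small_increments (R : realType) (s : nat -> R) (c e : R) : 0 < e ->
  (fun t => s t / t%:R) @ \oo --> c ->
  forall n, exists2 t, (n <= t)%N & s t.+1 - s t <= c + e.
Proof.
move=> e0 sc n; apply: contrapT => no.
have inc t : (n <= t)%N -> c + e < s t.+1 - s t.
  by move=> nt; rewrite ltNge; apply/negP => h; apply: no; exists t.
have low k : s n + k%:R * (c + e) <= s (n + k)%N.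
  elim: k => [|k IH]; first by rewrite mul0r addr0 addn0.
  have := inc (n + k)%N (leq_addr _ _); rewrite addnS -natr1; lra.
have e2 : 0 < e / 2 by rewrite divr_gt0.
have /cvgrPdist_le/(_ _ e2)[m0 _ hm] := sc.
pose A := s n - n%:R * (c + e).
(* Large enough for the ratio to be within e / 2 of c and for the offset [A] of the line to be below
   (n + k) e / 2. *)
pose k := (m0 + (Num.truncn (`|A| / (e / 2))).+1)%N.
have hk := hm (n + k)%N; have : (m0 <= n + k)%N by rewrite /k; lia.
move=> /hk /=; rewrite ler_norml => /andP[+ _].
have m1 : 0 < (n + k)%:R :> R by rewrite ltr0n /k; lia.
have sE : s (n + k)%N = s (n + k)%N / (n + k)%:R * (n + k)%:R by rewrite divfK// gt_eqF.
have A1 : `|A| < (n + k)%:R * (e / 2).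
  rewrite -ltr_pdivrMr//; apply: (lt_le_trans (truncnS_gt _)).
  by rewrite ler_nat /k addnA leq_addl.
have := low k; have := ler_norm (- A); rewrite normrN {1}/A.
move: sE; move: (s (n + k)%N / _) => q ->.
have -> : k%:R = (n + k)%:R - n%:R :> R by rewrite natrD addrC addKr.
move: A1 m1; move: (n + k)%:R (n%:R) => m r A1 m1 h1 h2 h3.
have : (c + e / 2) * m >= q * m by rewrite ler_pM2r//; lra.
nra.
Qed.

(** * Increments along a chain of sizes *)

Section chain.
Context (R : realType) d (T : measurableType d) (P : probability T R)
  (g : seq nat -> {RV P >-> R}) (a : 'I_2 -> nat -> R) (h : 'I_2 -> R) (B : R) (u Pu : R).
Hypotheses (g_gauss : gaussian_disorder g) (a_sq : forall l, sqsum_bounded (a l)).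
Hypotheses (B0 : 0 <= B) (aB : forall l l' n, \sum_(1 <= p < n) p%:R * `|aa a l l' p| <= B).
Hypotheses (u1 : -1 <= u <= 1) (Pu_lim : is_limiting_free_energy g a h u Pu).

Lemma free_energyE M (v : R) (s : {ffun 'I_2 -> config M}) : (0 < M)%N -> overlap R s = v ->
  free_energy g a h M v = (M%:R^-1 * psi g a h M v)%:E.
Proof.
move=> M0 sv; rewrite /free_energy expectation.unlock EFinM; congr (_ * _)%E.
by rewrite /psi EFin_Rint//; exact: (rint_ln_partition h g_gauss a_sq M0 sv).
Qed.

(** The fraction of agreeing sites that produces the overlap [u]. *)
Let tau := (1 + u) / 2.
Let tau0 : 0 <= tau. Proof. by rewrite /tau; move: u1 => /andP[]; lra. Qed.
Let tau1 : tau <= 1. Proof. by rewrite /tau; move: u1 => /andP[]; lra. Qed.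

Let vval_near M j c : (0 < M)%N -> `|j%:R - tau * M%:R| <= c -> `|vval R M j - u| <= 2 * c / M%:R.
Proof.
move=> M0 hj; have Mr : 0 < M%:R :> R by rewrite ltr0n.
rewrite (_ : vval R M j - u = 2 * (j%:R - tau * M%:R) / M%:R); last first.
  by rewrite /vval /tau; field; rewrite gt_eqF.
rewrite normrM (gtr0_norm (_ : 0 < M%:R^-1)) ?invr_gt0// ler_pM2r ?invr_gt0//.
by rewrite normrM ger0_norm// ler_pM2l.
Qed.

Variable N : nat.
Hypothesis N0 : (0 < N)%N.
Let Nr : 0 < N%:R :> R. Proof. by rewrite ltr0n. Qed.

Let ja := Num.truncn (tau * N%:R).
(** The minimum matters at [u = 1], where already [ja = N]. *)
Let jb := minn ja.+1 N.

Let ja_itv : ja%:R <= tau * N%:R < ja%:R + 1.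
Proof.
have h0 : 0 <= tau * N%:R by rewrite mulr_ge0.
by have := truncn_itv h0; rewrite natr1.
Qed.

Let jaN : (ja <= N)%N.
Proof.
rewrite -(ler_nat R); have /andP[h1 _] := ja_itv; apply: (le_trans h1).
by rewrite ler_piMl.
Qed.

Let jbN : (jb <= N)%N. Proof. exact: geq_minr. Qed.

Let jb_itv : tau * N%:R <= jb%:R <= tau * N%:R + 1.
Proof.
have /andP[h1 h2] := ja_itv; rewrite /jb /minn; case: ltnP => hN.
  by rewrite -natr1; apply/andP; split; lra.
have hN' : N%:R <= ja.+1%:R :> R by rewrite ler_nat.
have tN : tau * N%:R <= N%:R by rewrite ler_piMl.
by rewrite -natr1 in hN'; apply/andP; split; lra.
Qed.

(* Number of agreeing sites at size t * N: steps ja and jb are chosen greedily to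
   stay close to the line of slope tau. *)
Fixpoint chain_pos t : nat :=
  if t is t'.+1 then
    (chain_pos t' + (if ((chain_pos t')%:R <= tau * (t' * N)%:R)%R then jb else ja))%N
  else 0%N.

(** The step [jb] is at least tau N and exceeds it by at most 1; [ja] is at most tau N and misses it
    by less than 1. Correcting towards the line therefore never leaves the band of half-width 1. *)
Let chain_near t : `|(chain_pos t)%:R - tau * (t * N)%:R| <= 1.
Proof.
have /andP[a1 a2] := ja_itv; have /andP[b1 b2] := jb_itv.
elim: t => [|t IH]; first by rewrite mul0n mulr0 subrr normr0.
move: IH; rewrite /= mulSn natrD natrD mulrDr !ler_norml => /andP[h1 h2].
case: (lerP (chain_pos t)%:R (tau * (t * N)%:R)) => hc; apply/andP; split; lra.
Qed.

Let chain_le t : (chain_pos t <= t * N)%N.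
Proof.
elim: t => //= t IH; rewrite mulSn addnC leq_add//; by case: ifP.
Qed.

(** Convergence of the free energy is assumed along sequences defined at every size, so the chain is
    completed at the sizes that [N] does not divide. *)
Let J M := if (N %| M)%N then chain_pos (M %/ N) else Num.truncn (tau * M%:R).

Let JM M : (J M <= M)%N.
Proof.
rewrite /J; case: ifP => [/divnK {2}<-|_]; first exact: chain_le.
rewrite -(ler_nat R); have h0 : 0 <= tau * M%:R by rewrite mulr_ge0.
by have /andP[h1 _] := truncn_itv h0; apply: (le_trans h1); rewrite ler_piMl.
Qed.

Let J_near M : `|(J M)%:R - tau * M%:R| <= 1.
Proof.
rewrite /J; case: ifP => [dN|_]; first by rewrite -{2}(divnK dN); exact: chain_near.
have h0 : 0 <= tau * M%:R by rewrite mulr_ge0.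
have /andP[h1 h2] := truncn_itv h0; rewrite -natr1 in h2.
by rewrite ler_norml; apply/andP; split; lra.
Qed.

Lemma near_cvg (J' : nat -> nat) (c : R) : (forall M, `|(J' M)%:R - tau * M%:R| <= c) ->
  vval R M (J' M) @[M --> \oo] --> u.
Proof.
move=> hJ; have c0 : 0 <= c by exact: le_trans (hJ 0%N).
apply/cvgrPdist_le => e e0.
exists (Num.truncn (2 * c / e)).+1 => // M /= hM.
have M0 : (0 < M)%N by exact: leq_trans hM.
have Mr : 0 < M%:R :> R by rewrite ltr0n.
rewrite distrC; apply: (le_trans (vval_near M0 (hJ M))).
rewrite ler_pdivrMr// -ler_pdivrMl// mulrC.
by apply: (le_trans (ltW (truncnS_gt _))); rewrite ler_nat.
Qed.

Let S t := psi g a h (t * N) (vval R (t * N) (chain_pos t)).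

Let S_lim : (fun t => S t / t%:R) @ \oo --> N%:R * Pu.
Proof.
have va : admissible (fun M => vval R M (J M)) by exact: vval_admissible.
have h1 := Pu_lim va (near_cvg J_near).
have sub : (fun t => (t * N)%N) @ \oo --> \oo.
  move=> A [n _ hA]; exists n => // t /= nt; apply: hA => /=.
  by apply: (leq_trans nt); rewrite leq_pmulr.
have h2 := cvg_comp _ _ sub h1.
have h3 : (fun t => N%:R * (fine (free_energy g a h (t * N) (vval R (t * N) (J (t * N)))))) @ \oo --> N%:R * Pu.
  by apply: cvgM; [exact: cvg_cst|exact: (fine_cvg h2)].
apply: cvg_trans h3; apply: near_eq_cvg; exists 1%N => // t /= t0.
have tN : (0 < t * N)%N by rewrite muln_gt0 t0.
rewrite (free_energyE tN (vconf_overlap R (JM (t * N)))) /= /S.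
have -> : J (t * N) = chain_pos t by rewrite /J dvdn_mull// mulnK.
rewrite natrM; field; rewrite !gt_eqF//=; by rewrite ?ltr0n ?t0.
Qed.

(** The number [j] is chosen before [delta]: it is a step size used by infinitely many good
    increments, and each [delta] is then met by a large enough t. In 17 / N, one part comes from the
    increment and 16 from [cavity_bound] with eta = 1 / N. *)
Lemma cavity_chain : exists j, [/\ (j <= N)%N, `|vval R N j - u| <= 2 / N%:R &
  forall delta, 0 < delta -> (inf_G a h N (vval R N j) u delta <= (Pu + 17 / N%:R)%:E)%E].
Proof.
pose stp t := if (chain_pos t)%:R <= tau * (t * N)%:R then jb else ja.
have inc := small_increments (ltr01 : 0 < (1 : R)) S_lim.
(* Pigeonhole: the truth value of the comparison decides between [jb] and [ja]. If both values
   occurred only finitely often among good increments, none would exist beyond [maxn n1 n2]. *)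
have [b hb] : exists b : bool, forall n, exists t, [/\ (n <= t)%N, S t.+1 - S t <= N%:R * Pu + 1 &
    ((chain_pos t)%:R <= tau * (t * N)%:R) = b].
  apply: contrapT => nb.
  have hn b : exists n, forall t, (n <= t)%N -> S t.+1 - S t <= N%:R * Pu + 1 ->
      ((chain_pos t)%:R <= tau * (t * N)%:R) != b.
    apply: contrapT => h'; apply: nb; exists b => n; apply: contrapT => h2; apply: h'.
    by exists n => t nt st; apply/negP => /eqP eb; apply: h2; exists t.
  have [n1 h1] := hn true; have [n2 h2] := hn false.
  have [t nt st] := inc (maxn n1 n2).
  have := h1 t (leq_trans (leq_maxl _ _) nt) st; have := h2 t (leq_trans (leq_maxr _ _) nt) st.
  by case: (_ <= _).
pose j := if b then jb else ja.
have jN : (j <= N)%N by rewrite /j; case: b {hb j}.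
exists j; split => //.
  have := @vval_near N j 1 N0; rewrite mulr1; apply.
  have /andP[a1 a2] := ja_itv; have /andP[b1 b2] := jb_itv.
  by rewrite /j ler_norml; case: b {hb j jN}; apply/andP; split; lra.
move=> delta d0.
have eta0 : 0 < N%:R^-1 :> R by rewrite invr_gt0.
have [dl dl0 taylor] := xi_taylor aB eta0.
(* The first summand ensures N / (t N + N) = 1 / (t + 1) <= dl, the second 2 / (t N) <= delta. *)
pose n := ((Num.truncn (dl^-1)).+1 + (Num.truncn (2 / delta)).+1)%N.
have [t [nt st et]] := hb n.
have t0 : (0 < t)%N by apply: leq_trans nt; rewrite /n addSn.
have tN0 : (0 < t * N)%N by rewrite muln_gt0 t0.
have tr : 0 < t%:R :> R by rewrite ltr0n.
have tNr : t%:R <= (t * N)%:R :> R by rewrite ler_nat leq_pmulr.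
have dv : `|vval R (t * N) (chain_pos t) - u| <= delta.
  have := vval_near tN0 (chain_near t); rewrite mulr1 => /le_trans; apply.
  rewrite ler_pdivrMr ?ltr0n// mulrC -ler_pdivrMr//.
  apply: (le_trans (ltW (truncnS_gt _))); apply: le_trans tNr; rewrite ler_nat.
  by apply: leq_trans nt; rewrite /n leq_addl.
have small : N%:R / (t * N + N)%:R <= dl.
  have KE : (t * N + N)%:R = (t%:R + 1) * N%:R :> R by rewrite natrD natrM; ring.
  have t1 : 0 < t%:R + 1 :> R by lra.
  rewrite KE (_ : N%:R / ((t%:R + 1) * N%:R) = (t%:R + 1)^-1); last first.
    by field; rewrite !gt_eqF.
  rewrite -[leRHS]invrK lef_pV2 ?posrE ?invr_gt0//.
  apply: (le_trans (ltW (truncnS_gt _))).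
  apply: (@le_trans _ _ t%:R); last by rewrite lerDl.
  by rewrite ler_nat; apply: leq_trans nt; rewrite /n leq_addr.
have := cavity_bound h g_gauss a_sq aB tN0 dv (vconf_overlap R (chain_le t)) N0
  (vconf_overlap R jN) eta0 taylor small.
have -> : ((t * N)%:R * vval R (t * N) (chain_pos t) + N%:R * vval R N j) / (t * N + N)%:R =
    vval R (t * N + N) (chain_pos t + j).
  have h1 : (t * N)%:R != 0 :> R by rewrite gt_eqF// ltr0n.
  rewrite /vval; congr (_ / _); rewrite !natrD; move: h1; move: ((t * N)%:R) => X X0; field.
  by rewrite X0 gt_eqF.
have -> : psi g a h (t * N + N) (vval R (t * N + N) (chain_pos t + j)) = S t.+1.
  by rewrite /S mulSn addnC /= et.
move=> /le_trans; apply; rewrite lee_fin.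
have e1 : N%:R^-1 * (S t.+1 - S t) <= N%:R^-1 * (N%:R * Pu + 1) by rewrite ler_pM2l.
apply: (le_trans (lerD e1 (lexx _))); rewrite le_eqVlt; apply/orP; left; apply/eqP.
by field; rewrite gt_eqF.
Qed.

End chain.

(** * Passage to the limit in delta and in N *)

Definition os_weaken (R : realType) (a : 'I_2 -> nat -> R) (u delta delta' : R)
    (dd : delta <= delta') (Om : overlap_structure a u delta) : overlap_structure a u delta' :=
  @OverlapStructure R a u delta' (os_disp Om) (os_T Om) (os_P Om) (os_A Om) (@os_q _ _ _ _ Om)
    (@os_w _ _ _ _ Om) (@os_z _ _ _ _ Om) (@os_y _ _ _ _ Om) (@os_q_le1 _ _ _ _ Om)
    (@os_q_diag _ _ _ _ Om) (fun x => le_trans (os_q_near x) dd) (@os_w_proba _ _ _ _ Om)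
    (@os_z_gaussian _ _ _ _ Om) (@os_z_cov _ _ _ _ Om) (@os_y_gaussian _ _ _ _ Om)
    (@os_y_cov _ _ _ _ Om) (@os_independent _ _ _ _ Om).

Lemma inf_G_mono (R : realType) (a : 'I_2 -> nat -> R) (h : 'I_2 -> R) N (v u delta delta' : R) :
  delta <= delta' -> (inf_G a h N v u delta' <= inf_G a h N v u delta)%E.
Proof.
move=> dd; apply: ereal_inf_le_tmp => e [Om ->]; exists (os_weaken dd Om).
by [].
Qed.

Theorem theorem2 (R : realType) (d : measure_display) (T : measurableType d)
    (P : probability T R) (g : seq nat -> {RV P >-> R})
    (a : 'I_2 -> nat -> R) (h : 'I_2 -> R) (u Pu : R)
    (g_gauss : gaussian_disorder g)
    (a_l2 : forall l, cvg (\sum_(1 <= p < n) a l p ^+ 2 @[n --> \oo]))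
    (xi_derivable : forall l l', derivable_on_unit (xi a l l'))
    (xi_convex : forall l l', convex_function (`[-1, 1] : set R) (xi a l l'))
    (u_le1 : -1 <= u <= 1)
    (Pu_lim : is_limiting_free_energy g a h u Pu) :
  exists (u' : nat -> R) (L : nat -> \bar R),
    [/\ admissible u',
        u' N @[N --> \oo] --> u,
        forall N, (0 < N)%N ->
          inf_G a h N (u' N) u delta @[delta --> 0^'+] --> L N
      & L N @[N --> \oo] --> Pu%:E].
Proof.
have a_sq := a_sqsum a_l2; have [B B0 aB] := xi_weight a_l2 xi_derivable.
have /choice[J hJ] : forall N, exists j, (j <= N)%N /\ ((0 < N)%N ->
    `|vval R N j - u| <= 2 / N%:R /\ forall delta, 0 < delta ->
      (inf_G a h N (vval R N j) u delta <= (Pu + 17 / N%:R)%:E)%E).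
  (* At size 0 only the bound on [j] is asked. *)
  case=> [|N]; first by exists 0%N.
  have [j [jN ju jd]] := cavity_chain g_gauss a_sq aB u_le1 Pu_lim (ltn0Sn N).
  by exists j; split.
pose u' N := vval R N (J N).
have ua : admissible u' by apply: vval_admissible => N; exact: (hJ N).1.
have inv_small (c : R) : 0 <= c -> (fun N => c / N%:R) @ \oo --> (0 : R).
  move=> c0; apply/cvgrPdist_le => e e0; exists (Num.truncn (c / e)).+1 => // N /= hN.
  have Nr : 0 < N%:R :> R by rewrite ltr0n; exact: leq_trans hN.
  rewrite sub0r normrN ger0_norm ?divr_ge0// ler_pdivrMr// mulrC -ler_pdivrMr//.
  by apply: (le_trans (ltW (truncnS_gt _))); rewrite ler_nat.
have u'u : u' N @[N --> \oo] --> u.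
  apply/cvgrPdist_le => e e0.
  have /cvgrPdist_le/(_ _ e0)[n0 _ h0] := inv_small 2 (ler0n R 2).
  exists n0.+1 => // N /= hN; rewrite distrC.
  have N0 : (0 < N)%N by exact: leq_trans hN.
  apply: (le_trans ((hJ N).2 N0).1); have := h0 N (ltnW hN).
  by rewrite /= sub0r normrN; apply: le_trans; exact: ler_norm.
pose f N delta := inf_G a h N (u' N) u delta.
(* [inf_G] decreases when [delta] grows, so its limit at 0 from the right is a supremum over small
   [delta]. *)
pose L N := ereal_sup (f N @` `]0, 1[%classic).
exists u', L; split => //.
  move=> N _; apply: nonincreasing_at_right_cvge; first by rewrite bnd_simp.
  by move=> x y _ _ xy; exact: inf_G_mono.
have half0 : 0 < 2^-1 :> R by rewrite invr_gt0.
have half1 : 2^-1 < 1 :> R by rewrite invf_lt1 ?ltr1n.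
(* The interpolation bound is used at delta = 1 / (2 N), which lies in ]0, 1[ and makes the error
   term tend to 0. *)
pose lo N := N%:R^-1 * psi g a h N (u' N) - 2 * B * (`|u' N - u| + 2^-1 / N%:R).
have hup N : (0 < N)%N -> (L N <= (Pu + 17 / N%:R)%:E)%E.
  move=> N0; apply: ge_ereal_sup => _ [x xI <-]; apply: ((hJ N).2 N0).2.
  by move: xI; rewrite /= in_itv/= => /andP[].
have hlo N : (0 < N)%N -> ((lo N)%:E <= L N)%E.
  move=> N0; have Nr : 1 <= N%:R :> R by rewrite ler1n.
  have Nr0 : 0 < N%:R :> R by exact: lt_le_trans Nr.
  have dl0 : 0 < 2^-1 / N%:R :> R by rewrite divr_gt0.
  have dl1 : 2^-1 / N%:R < 1 :> R by rewrite ltr_pdivrMr// mul1r; exact: lt_le_trans Nr.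
  apply: (@le_trans _ _ (f N (2^-1 / N%:R))); last first.
    by apply: ereal_sup_ubound; exists (2^-1 / N%:R) => //=; rewrite in_itv/= dl0 dl1.
  apply: le_ereal_inf_tmp => _ [Om ->].
  have [s sv] := admissible_witness ua N0.
  have [gv [-> hg]] := guerra_bound h g_gauss a_sq B0 aB xi_convex Om N0 sv.
  by rewrite lee_fin /lo; lra.
apply: (@squeeze_cvge _ _ _ _ (fun N => (lo N)%:E) L (fun N => (Pu + 17 / N%:R)%:E)).
- by exists 1%N => // N /= N0; rewrite hlo// hup.
- apply: cvg_EFin; first exact: nearW.
  rewrite -[Pu]subr0 -[X in _ - X](mulr0 (2 * B)) -[X in _ * X](addr0 0).
  apply: cvgB.
    have h3 : (fun N => fine (free_energy g a h N (u' N))) @ \oo --> Pu.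
      exact: (fine_cvg (Pu_lim _ ua u'u)).
    apply: cvg_trans h3; apply: near_eq_cvg.
    exists 1%N => // N /= N0; have [s sv] := admissible_witness ua N0.
    by rewrite (free_energyE h g_gauss a_sq N0 sv).
  apply: cvgM; first exact: cvg_cst.
  apply: cvgD; last by apply: inv_small; exact: ltW.
  by rewrite -(normr0 R); apply: cvg_norm; rewrite -[X in _ --> X](subrr u); apply: cvgB => //; exact: cvg_cst.
- apply: cvg_EFin; first exact: nearW.
  rewrite -[X in _ --> X]addr0; apply: cvgD; first exact: cvg_cst.
  by apply: inv_small.
Qed.
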